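(* There exists a constant $\widetilde C>0$ depending only on $\Omega$ such that the following holds. Suppose that $$\sigma_{\min}\ge \frac{9\|\nabla\nu\|_{\infty}^2}{\nu_0},\qquad \widetilde C\,\|\nabla\cdot\boldsymbol{\beta}\|_0<\min\Big\{\sigma_{\min}-\frac{9\|\nabla\nu\|_\infty^2}{\nu_0},\ \frac{\nu_0}{12}\Big\},\qquad \rho_1=\tfrac23\nu_0,\qquad \rho_2>\tfrac{\nu_0}{3}.$$ For $\mathbf u\in[L^2(\Omega)]^d$ let $(\mathcal S_{\mathbf y}(\mathbf u),\mathcal S_{\boldsymbol\kappa}(\mathbf u))\in\boldsymbol V_0\times\boldsymbol W$ be the unique pair $(\mathbf y,\boldsymbol\kappa)$ with $$\mathcal A((\mathbf y,\boldsymbol\kappa),(\mathbf v,\boldsymbol\theta))=(\mathbf f+\mathbf u,\mathbf v)\qquad\forall(\mathbf v,\boldsymbol\theta)\in\boldsymbol V_0\times\boldsymbol W .$$ Then the problem of minimizing $$\mathcal F(\mathbf u)=\tfrac12\|\mathcal S_{\mathbf y}(\mathbf u)-\mathbf y_d\|_0^2+\tfrac12\|\mathcal S_{\boldsymbol\kappa}(\mathbf u)-\boldsymbol\kappa_d\|_0^2+\tfrac\gamma2\|\mathbf u\|_0^2$$ over $\mathbf u\in\mathcal A_d$ has a unique solution $\bar{\mathbf u}$, and, with $(\bar{\mathbf y},\bar{\boldsymbol\kappa})=(\mathcal S_{\mathbf y}(\bar{\mathbf u}),\mathcal S_{\boldsymbol\kappa}(\bar{\mathbf u}))$, there exists $\bar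 p\in Q$ such that $$\mathcal A((\bar{\mathbf y},\bar{\boldsymbol\kappa}),(\mathbf v,\boldsymbol\theta))+\mathcal B((\mathbf v,\boldsymbol\theta),\bar p)=(\mathbf f+\bar{\mathbf u},\mathbf v)\quad\forall(\mathbf v,\boldsymbol\theta)\in\boldsymbol V\times\boldsymbol W,\qquad \mathcal B((\bar{\mathbf y},\bar{\boldsymbol\kappa}),\phi)=0\quad\forall\phi\in Q.$$
   Context: Setting. $\Omega\subset\mathbb R^d$, $d\in\{2,3\}$, is an open bounded polygonal/polyhedral Lipschitz domain. $\nu\in W^{1,\infty}(\Omega)$ and $\sigma\in L^\infty(\Omega)$ are scalar functions with $\nu_0<\nu(x)<\nu_1$ and $\sigma_{\min}<\sigma(x)<\sigma_{\max}$ in $\Omega$ for constants $\nu_0,\nu_1,\sigma_{\min},\sigma_{\max}\in(0,\infty)$; $\boldsymbol\beta\in[W^{1,\infty}(\Omega)]^d$, $\mathbf f\in[L^2(\Omega)]^d$, $\gamma>0$, $\mathbf y_d\in[L^2(\Omega)]^d$, $\boldsymbol\kappa_d\in[L^2(\Omega)]^{d(d-1)/2}$; $\mathbf a,\mathbf b\in\mathbb R^d$ with $\mathbf a<\mathbf b$ componentwise. $\boldsymbol V=[H^1_0(\Omega)]^d$, $\boldsymbol V_0=\{\mathbf v\in\boldsymbol V:\nabla\cdot\mathbf v=0\}$, $\boldsymbol W=[L^2(\Omega)]^{d(d-1)/2}$, $Q=L^2_0(\Omega)$ (mean-zero $L^2$ functions). Admissible controls: $\mathcal A_d=\{\mathbf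 u\in[L^2(\Omega)]^d: a_i\le u_i(x)\le b_i\text{ for a.e. }x\in\Omega,\ i=1,\dots,d\}$. $(\cdot,\cdot)$ and $\|\cdot\|_0$ are the $L^2(\Omega)$ inner product and norm, $\|\cdot\|_\infty$ the $L^\infty(\Omega)$ norm. $\boldsymbol\varepsilon(\mathbf y)=\frac12(\nabla\mathbf y+(\nabla\mathbf y)^T)$. For $d=3$, $\mathbf{curl}$ and $\times$ are the usual ones; for $d=2$, $\mathbf{curl}(\mathbf w)=\partial_1w_2-\partial_2w_1$ for vector fields, $\nabla\nu\times\mathbf v=\partial_1\nu\,v_2-\partial_2\nu\,v_1$, elements of $\boldsymbol W$ are scalar and ''$\cdot$'' between scalars is multiplication. Forms (with parameters $\rho_1,\rho_2>0$): $$\mathcal A((\mathbf y,\boldsymbol\kappa),(\mathbf v,\boldsymbol\theta))=-\int_\Omega2\boldsymbol\varepsilon(\mathbf y)\nabla\nu\cdot\mathbf v+\int_\Omega\nu\boldsymbol\kappa\cdot\mathbf{curl}(\mathbf v)+\int_\Omega\boldsymbol\kappa\cdot(\nabla\nu\times\mathbf v)+\int_\Omega\nu\boldsymbol\kappa\cdot\boldsymbol\theta-\int_\Omega\nu\boldsymbol\theta\cdot\mathbf{curl}(\mathbf y)+\int_\Omega(\sigma\mathbf y+(\boldsymbol\beta\cdot\nabla)\mathbf y)\cdot\mathbf v+\rho_1\int_\Omega(\mathbf{curl}(\mathbf y)-\boldsymbol\kappa)\cdot\mathbf{curl}(\mathbf v)+\rho_2\int_\Omega(\nabla\cdot\mathbf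 y)(\nabla\cdot\mathbf v),$$ $$\mathcal B((\mathbf v,\boldsymbol\theta),\phi)=-\int_\Omega\phi\,\nabla\cdot\mathbf v.$$ *)

(* Defs.v *)
From HB Require Import structures.
From mathcomp Require Import all_boot all_order all_algebra.
From mathcomp Require Import all_classical all_reals all_analysis.

Set Implicit Arguments.
Unset Strict Implicit.
Unset Printing Implicit Defensive.
Import Order.TTheory GRing.Theory Num.Theory.
Import numFieldNormedType.Exports.

Local Open Scope classical_set_scope.
Local Open Scope ring_scope.

(** R^d is the type 'rV[R]_d of row vectors, with the sigma-algebra generated
    by the coordinate functions, i.e. the Borel sigma-algebra. *)
Section measurable_row.
Context (R : realType) (d : nat).

Definition row_coord (i : 'I_d) (x : 'rV[R]_d) : measurableTypeR R := x 0 i.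

Let row_set0 : g_sigma_preimage row_coord set0.
Proof. exact: sigma_algebra0. Qed.

Let row_setC A : g_sigma_preimage row_coord A -> g_sigma_preimage row_coord (~` A).
Proof. exact: sigma_algebraC. Qed.

Let row_bigcup (F : _^nat) : (forall i, g_sigma_preimage row_coord (F i)) ->
  g_sigma_preimage row_coord (\bigcup_i (F i)).
Proof. exact: sigma_algebra_bigcup. Qed.

HB.instance Definition _ := @isMeasurable.Build default_measure_display
  'rV[R]_d (g_sigma_preimage row_coord) row_set0 row_setC row_bigcup.

End measurable_row.

Lemma measurable_row_coord (R : realType) d (i : 'I_d) :
  measurable_fun [set: 'rV[R]_d] (@row_coord R d i).
Proof.
move=> _ Y mY; rewrite setTI; apply: sub_sigma_algebra => /=.
rewrite -bigcup_seq/=; exists i => /=; first by rewrite mem_index_enum.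
by exists Y => //; rewrite setTI.
Qed.

Lemma measurable_fun_rowP (R : realType) d dT (T : measurableType dT)
    (f : T -> 'rV[R]_d) :
  (forall i, measurable_fun [set: T] (@row_coord R d i \o f)) ->
  measurable_fun [set: T] f.
Proof.
move=> mf; apply: (@measurability _ _ _ _ setT f
  (\big[setU/set0]_(i < d) preimage_set_system setT (@row_coord R d i) measurable)).
  by [].
move=> _ [B + <-]; rewrite -bigcup_seq => -[i _ [A mA <-]].
by rewrite setTI; exact: (mf i).
Qed.

Definition row_snoc (R : realType) d (p : 'rV[R]_d * measurableTypeR R) :
    'rV[R]_d.+1 :=
  \row_i oapp (p.1 0) p.2 (unlift ord_max i).

Lemma measurable_row_snoc (R : realType) d :
  measurable_fun setT (@row_snoc R d).
Proof.
apply: measurable_fun_rowP => i.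
have [j ->|->] := unliftP ord_max i.
  rewrite (_ : _ \o _ = @row_coord R d j \o fst); last first.
    by apply/funext => p; rewrite /= /row_coord /row_snoc mxE liftK.
  by apply: measurableT_comp => //; exact: measurable_row_coord.
rewrite (_ : _ \o _ = snd)//.
by apply/funext => p; rewrite /= /row_coord /row_snoc mxE unlift_none.
Qed.

(** The d-fold product of the one-dimensional Lebesgue measure, transported to
    row vectors. *)
Fixpoint lebesgue_row (R : realType) (d : nat) :
    {measure set 'rV[R]_d -> \bar R} :=
  match d with
  | 0 => [the measure _ _ of dirac (0 : 'rV[R]_0)]
  | n.+1 => measure_function_pushforward__canonical__measure_function_Measure
      [the measure _ _ of (lebesgue_row R n \x (@lebesgue_measure R))%E]
      (@measurable_row_snoc R n)
  end.

Definition dot (R : realType) k (v w : 'rV[R]_k) : R := \sum_i v 0 i * w 0 i.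

(** Euclidean norm; the library norm [`|v|] on row vectors is the sup norm. *)
Definition enorm (R : realType) k (v : 'rV[R]_k) : R := Num.sqrt (dot v v).

(** Number of components of a curl: 1 for d = 2, 3 for d = 3. *)
Definition curl_dim (d : nat) : nat := (d * d.-1)./2.

(** Axial vector of a d x d matrix: M_01 - M_10 for d = 2, and
    M_(k+1, k+2) - M_(k+2, k+1), k in Z/3, for d = 3 (only d = 2, 3 are used).
    With M_ij = v_i w_j it gives the cross product of v and w, with M_ij the
    i-th partial derivative of w_j it gives the curl of w. *)
Definition axial (R : realType) (d : nat) : 'M[R]_d -> 'rV[R]_(curl_dim d) :=
  match d return 'M[R]_d -> 'rV[R]_(curl_dim d) with
  | 2 => fun M => \row__ (M 0 1 - M 1 0)
  | 3 => fun M => \row_(k < 3) (M (k + 1) (k + 2) - M (k + 2) (k + 1))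
  | _ => fun _ => 0
  end.

Definition cross (R : realType) d (v w : 'rV[R]_d) : 'rV[R]_(curl_dim d) :=
  axial (v^T *m w).

Definition boundary (R : realType) d (A : set 'rV[R]_d) : set 'rV[R]_d :=
  closure A `\` A°.

Definition polytope (R : realType) d (s : seq 'rV[R]_d) : set 'rV[R]_d :=
  [set x | exists2 w : 'I_(size s) -> R,
    (forall i, 0 <= w i) /\ \sum_i w i = 1 & x = \sum_i w i *: s`_i].

(** The boundary is a finite union of flat polytopes: segments for d = 2,
    plane convex polygons for d = 3. *)
Definition polyhedral_boundary (R : realType) d (Omega : set 'rV[R]_d) :=
  exists2 faces : seq (seq 'rV[R]_d),
    (forall s, s \in faces -> exists (n : 'rV[R]_d) (c : R),
       n != 0 /\ forall x, polytope s x -> dot n x = c)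
    & boundary Omega = [set x | exists2 s, s \in faces & polytope s x].

(** Near each boundary point, Omega is the strict epigraph of a Lipschitz
    function in a rotated frame with vertical axis e: the height of y is
    dot y e and its horizontal part is y - (dot y e) e. *)
Definition lipschitz_boundary (R : realType) d (Omega : set 'rV[R]_d) :=
  forall x, boundary Omega x ->
  exists (U : set 'rV[R]_d) (e : 'rV[R]_d) (g : 'rV[R]_d -> R),
    [/\ open U, U x, dot e e = 1, lipschitz g &
        Omega `&` U = [set y | U y /\ g (y - dot y e *: e) < dot y e]].

Definition polyhedral_lipschitz_domain (R : realType) d
    (Omega : set 'rV[R]_d) :=
  [/\ open Omega, connected Omega /\ Omega !=set0, bounded_set Omega,
      polyhedral_boundary Omega & lipschitz_boundary Omega].

(** Functions and fields are total on R^d; only their values on Omega, up to a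
    null set, are relevant. *)
Section spaces.
Context (R : realType) (d : nat).
Local Notation pt := 'rV[R]_d.
Local Notation mu := (lebesgue_row R d).
Implicit Types (Omega : set pt) (p : \bar R).

Definition in_Lp p Omega (f : pt -> R) : Prop := f \_ Omega \in Lfun mu p.

Definition Lp_norm p Omega (f : pt -> R) : R :=
  fine ('N[mu]_p[EFin \o f \_ Omega])%E.

Definition coordf k (v : pt -> 'rV[R]_k) (i : 'I_k) : pt -> R := fun x => v x 0 i.

Definition in_L2 k Omega (v : pt -> 'rV[R]_k) : Prop :=
  forall i, in_Lp 2%:E Omega (coordf v i).

Definition L2_inner k Omega (v w : pt -> 'rV[R]_k) : R :=
  \int[mu]_(x in Omega) dot (v x) (w x).

Definition L2_norm k Omega (v : pt -> 'rV[R]_k) : R :=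
  Lp_norm 2%:E Omega (fun x => enorm (v x)).

Definition Q_space Omega (phi : pt -> R) : Prop :=
  in_Lp 2%:E Omega phi /\ \int[mu]_(x in Omega) phi x = 0.

Definition unit_vec (i : 'I_d) : pt := delta_mx 0 i.

Definition iter_partial (s : seq 'I_d) (f : pt -> R) : pt -> R :=
  foldr (fun i g => 'D_(unit_vec i) g) f s.

Definition smooth (f : pt -> R) : Prop :=
  forall s x, differentiable (iter_partial s f) x.

Definition test_function Omega (phi : pt -> R) : Prop :=
  smooth phi /\ exists K, [/\ compact K, K `<=` Omega &
    forall x, ~ K x -> phi x = 0].

Definition L1_loc Omega (f : pt -> R) : Prop :=
  measurable_fun Omega f /\
  forall K, compact K -> K `<=` Omega -> mu.-integrable K (EFin \o f).

Definition weak_partial Omega (i : 'I_d) (f g : pt -> R) : Prop :=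
  [/\ L1_loc Omega f, L1_loc Omega g &
      forall phi, test_function Omega phi ->
        \int[mu]_(x in Omega) (f x * 'D_(unit_vec i) phi x) =
        - \int[mu]_(x in Omega) (g x * phi x)].

(** A representative of the i-th weak partial derivative of f, unique up to a
    null set when it exists (and an irrelevant default otherwise). *)
Definition pd Omega (i : 'I_d) (f : pt -> R) : pt -> R :=
  xget (cst 0) [set g | weak_partial Omega i f g].

Definition in_W1p p Omega (f : pt -> R) : Prop :=
  in_Lp p Omega f /\
  forall i, exists2 g, in_Lp p Omega g & weak_partial Omega i f g.

Definition H1_norm Omega (f : pt -> R) : R :=
  Num.sqrt (Lp_norm 2%:E Omega f ^+ 2 +
            \sum_i Lp_norm 2%:E Omega (pd Omega i f) ^+ 2).

(** Closure of the test functions in the norm of H^1(Omega). *)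
Definition in_H10 Omega (f : pt -> R) : Prop :=
  in_W1p 2%:E Omega f /\
  forall eps : R, 0 < eps -> exists2 phi, test_function Omega phi &
    H1_norm Omega (fun x => f x - phi x) < eps.

Definition grad Omega (f : pt -> R) (x : pt) : pt := \row_i pd Omega i f x.

(** Row index: direction of differentiation; column index: component. *)
Definition jac Omega (v : pt -> pt) (x : pt) : 'M[R]_d :=
  \matrix_(i, j) pd Omega i (coordf v j) x.

Definition divg Omega (v : pt -> pt) (x : pt) : R := \tr (jac Omega v x).

Definition curl Omega (v : pt -> pt) (x : pt) : 'rV[R]_(curl_dim d) :=
  axial (jac Omega v x).

Definition strain Omega (v : pt -> pt) (x : pt) : 'M[R]_d :=
  2^-1 *: (jac Omega v x + (jac Omega v x)^T).

(** (beta . nabla) y *)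
Definition convect Omega (beta y : pt -> pt) (x : pt) : pt :=
  beta x *m jac Omega y x.

Definition V_space Omega (v : pt -> pt) : Prop :=
  forall i, in_H10 Omega (coordf v i).

Definition V0_space Omega (v : pt -> pt) : Prop :=
  V_space Omega v /\ {ae mu, forall x, Omega x -> divg Omega v x = 0}.

Definition W_space Omega (k : pt -> 'rV[R]_(curl_dim d)) : Prop := in_L2 Omega k.

(** The matrix-vector product of the symmetric matrix [strain y] with
    [grad nu] is written in row form. *)
Definition A_form Omega (nu sigma : pt -> R) (beta : pt -> pt) (rho1 rho2 : R)
    (y : pt -> pt) (kappa : pt -> 'rV[R]_(curl_dim d))
    (v : pt -> pt) (theta : pt -> 'rV[R]_(curl_dim d)) : R :=
  - (\int[mu]_(x in Omega)
       dot (2 *: (grad Omega nu x *m strain Omega y x)) (v x))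
  + \int[mu]_(x in Omega) (nu x * dot (kappa x) (curl Omega v x))
  + \int[mu]_(x in Omega) dot (kappa x) (cross (grad Omega nu x) (v x))
  + \int[mu]_(x in Omega) (nu x * dot (kappa x) (theta x))
  - \int[mu]_(x in Omega) (nu x * dot (theta x) (curl Omega y x))
  + \int[mu]_(x in Omega)
       dot (sigma x *: y x + convect Omega beta y x) (v x)
  + rho1 * (\int[mu]_(x in Omega)
       dot (curl Omega y x - kappa x) (curl Omega v x))
  + rho2 * (\int[mu]_(x in Omega) (divg Omega y x * divg Omega v x)).

Definition B_form Omega (v : pt -> pt) (theta : pt -> 'rV[R]_(curl_dim d))
    (phi : pt -> R) : R :=
  - (\int[mu]_(x in Omega) (phi x * divg Omega v x)).

Definition is_state Omega nu sigma beta rho1 rho2 (F : pt -> pt)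
    (y : pt -> pt) (kappa : pt -> 'rV[R]_(curl_dim d)) : Prop :=
  [/\ V0_space Omega y, W_space Omega kappa &
      forall v theta, V0_space Omega v -> W_space Omega theta ->
        A_form Omega nu sigma beta rho1 rho2 y kappa v theta =
        L2_inner Omega F v].

Definition admissible Omega (a b : pt) (u : pt -> pt) : Prop :=
  in_L2 Omega u /\
  forall i, {ae mu, forall x, Omega x -> a 0 i <= u x 0 i <= b 0 i}.

Definition cost Omega (Sy : (pt -> pt) -> pt -> pt)
    (Sk : (pt -> pt) -> pt -> 'rV[R]_(curl_dim d))
    (yd : pt -> pt) (kd : pt -> 'rV[R]_(curl_dim d)) (gamma : R)
    (u : pt -> pt) : R :=
  2^-1 * L2_norm Omega (fun x => Sy u x - yd x) ^+ 2
  + 2^-1 * L2_norm Omega (fun x => Sk u x - kd x) ^+ 2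
  + gamma / 2 * L2_norm Omega u ^+ 2.

Definition minimizer (Ad : (pt -> pt) -> Prop) (F : (pt -> pt) -> R)
    (u : pt -> pt) : Prop :=
  Ad u /\ forall w, Ad w -> F u <= F w.

End spaces.

(* Main.v *)
(** On divergence-free fields of [H^1_0] one has |curl y| = |grad y|, so Young's
    inequality makes the mixed form coercive on V_0 x W, up to the convective
    term. After integration by parts the latter is half the integral of
    (div beta) |y|^2, which the Ladyzhenskaya inequality bounds by |div beta|_0
    times the squared H^1 norm; hence the constant C = 1. Lax-Milgram then gives
    the state, and the reduced cost is strongly convex and continuous on the
    closed convex set of admissible controls.

    The residual of the state equation is a bounded linear form on V that
    vanishes on V_0, and is represented by a pressure because of the inf-sup
    condition for the divergence. To prove the latter, let w in V solve
    (grad w, grad v) = (q, div v) for all v. Then h = q - div w is harmonic, and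
    its gradient is bounded by |grad w|_0 in the dual of H^1_0. This controls h
    up to a constant in the interior, by a Caccioppoli estimate, the Poincare
    inequality on cubes and chains of balls. Near the boundary, the dual bound is
    tested with (h - c) eta e, where eta increases along the vertical direction e
    of the local epigraph: this controls the integral of (h - c)^2 D_e eta and
    absorbs the boundary layer. *)
From HB Require Import structures.
Require Import Defs.
From mathcomp Require Import all_boot all_order all_algebra.
From mathcomp Require Import all_classical all_reals all_analysis.
From mathcomp Require Import measurable_realfun ess_sup_inf.
From mathcomp Require Import ring lra.

Set Implicit Arguments.
Unset Strict Implicit.
Unset Printing Implicit Defensive.
Import Order.TTheory GRing.Theory Num.Theory.
Import numFieldNormedType.Exports.

Local Open Scope classical_set_scope.
Local Open Scope ring_scope.

(** * Semi-inner product spaces *)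

Section semi_hilbert.
Context {R : realType}.
Implicit Types V : lmodType R.

(** Functions are total and never identified almost everywhere. Hence every space is a predicate
    with a semi-definite inner product, and uniqueness, linearity of derivatives and linearity of
    the solution operator hold only up to null elements.

    The inf-sup condition takes the form [|q|^2 <= K |w|^2]: the norm of the Riesz representative
    [w] of [v |-> (q, div v)] is the dual norm of the gradient of [q]. This lower bound makes the
    least squares problem for the pressure solvable without a closed range argument.

    The remainder [h] is only square integrable, so its gradient is never estimated: gradient bounds
    are proved for mollifications, whose radius is chosen after all other data and whose error joins
    the right-hand side. Near the boundary no constant may depend on the distance from the support
    of [eta] to the boundary, since that distance tends to 0; this forces profiles with uniform
    Lipschitz bounds. The boundary estimates contain a small multiple of the norm of [h - c] on all
    of [Omega], so one constant [c] must serve on every patch, and absorption takes place only after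
    the patches are joined. *)

Lemma discr_le (a b c : R) : 0 <= a ->
  (forall t, 0 <= a * t ^+ 2 + 2 * b * t + c) -> b ^+ 2 <= a * c.
Proof.
move=> a0 H; have [a_eq0|an0] := eqVneq a 0.
  have [->|bn0] := eqVneq b 0; first by rewrite expr0n/= a_eq0 mul0r.
  have := H (- (c + 1) / (2 * b)); rewrite a_eq0 mul0r add0r.
  have -> : 2 * b * (- (c + 1) / (2 * b)) + c = -1 by field.
  by rewrite lerNr oppr0 ler10.
have a_gt0 : 0 < a by rewrite lt_neqAle eq_sym an0.
have := H (- b / a).
have -> : a * (- b / a) ^+ 2 + 2 * b * (- b / a) + c = (a * c - b ^+ 2) / a.
  by field.
by rewrite pmulr_lge0 ?invr_gt0// subr_ge0.
Qed.

Lemma quad_min0 (b c : R) : 0 <= c ->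
  (forall t, 0 <= c * t ^+ 2 + 2 * b * t) -> b = 0.
Proof.
move=> c0 H; have := @discr_le c b 0 c0; rewrite mulr0 => /(_ _)/wrap[t|].
  by rewrite addr0.
by move=> b2; apply/eqP; rewrite -sqrf_eq0 eq_le b2 sqr_ge0.
Qed.

Lemma sqr_small (A x y e : R) : 0 <= A -> 0 < e -> x ^+ 2 <= A * y ->
  y < e ^+ 2 / (A + 1) -> `|x| < e.
Proof.
move=> A0 e0 xy ye; have A1 : 0 < A + 1 by lra.
rewrite -(@ltr_pXn2r _ 2)// ?nnegrE ?ltW// real_normK ?num_real//.
have y2 : y * (A + 1) < e ^+ 2 by rewrite -ltr_pdivlMr.
have : A * y <= A * (e ^+ 2 / (A + 1)) by rewrite ler_wpM2l// ltW.
have -> : A * (e ^+ 2 / (A + 1)) = e ^+ 2 - e ^+ 2 / (A + 1) by field; lra.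
have : 0 < e ^+ 2 / (A + 1) by rewrite divr_gt0 ?exprn_gt0.
lra.
Qed.

Definition subspace V (S : V -> Prop) :=
  S 0 /\ forall (a : R) u v, S u -> S v -> S (a *: u + v).

(** Squared distances are compared with [e] itself, which avoids square roots. Limits are determined
    only up to elements of zero norm. *)
Definition cvg_ip V (ip : V -> V -> R) (u_ : nat -> V) (l : V) :=
  forall e : R, 0 < e -> exists N, forall n, (N <= n)%N ->
    ip (u_ n - l) (u_ n - l) < e.

Definition cauchy_ip V (ip : V -> V -> R) (u_ : nat -> V) :=
  forall e : R, 0 < e -> exists N, forall m n, (N <= m)%N -> (N <= n)%N ->
    ip (u_ m - u_ n) (u_ m - u_ n) < e.

(** [ip] is only assumed to be a semi-definite inner product on [S]: functions
    that agree almost everywhere are not identified. *)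
Record semi_ip V (S : V -> Prop) (ip : V -> V -> R) : Prop := SemiIp {
  sip_sub : subspace S ;
  sip_lin : forall a u v w, S u -> S v -> S w ->
    ip (a *: u + v) w = a * ip u w + ip v w ;
  sip_sym : forall u v, S u -> S v -> ip u v = ip v u ;
  sip_ge0 : forall u, S u -> 0 <= ip u u }.

Definition complete_ip V (S : V -> Prop) (ip : V -> V -> R) :=
  forall u_, (forall n, S (u_ n)) -> cauchy_ip ip u_ ->
    exists2 l, S l & cvg_ip ip u_ l.

Definition lin_on V (S : V -> Prop) (l : V -> R) :=
  forall a u v, S u -> S v -> l (a *: u + v) = a * l u + l v.

Section subspaces.
Context V (S : V -> Prop).
Hypothesis HS : subspace S.

Lemma sub0 : S 0. Proof. by case: HS. Qed.
Lemma subDZ a u v : S u -> S v -> S (a *: u + v). Proof. case: HS => _; exact. Qed.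
Lemma subZ a u : S u -> S (a *: u).
Proof. by move=> Su; rewrite -[_ *: _]addr0; apply: subDZ => //; exact: sub0. Qed.
Lemma subD u v : S u -> S v -> S (u + v).
Proof. by move=> Su Sv; rewrite -[u]scale1r; apply: subDZ. Qed.
Lemma subN u : S u -> S (- u).
Proof. by move=> Su; rewrite -scaleN1r; apply: subZ. Qed.
Lemma subB u v : S u -> S v -> S (u - v).
Proof. by move=> Su Sv; apply: subD => //; exact: subN. Qed.

Section linear_forms.
Context (l : V -> R).
Hypothesis Hl : lin_on S l.
Lemma lin0 : l 0 = 0.
Proof. have := Hl 1 sub0 sub0; rewrite scaler0 addr0 mul1r; lra. Qed.
Lemma linZ a u : S u -> l (a *: u) = a * l u.
Proof. by move=> Su; have := Hl a Su sub0; rewrite addr0 lin0 addr0. Qed.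
Lemma linD u v : S u -> S v -> l (u + v) = l u + l v.
Proof. by move=> Su Sv; have := Hl 1 Su Sv; rewrite scale1r mul1r. Qed.
Lemma linN u : S u -> l (- u) = - l u.
Proof. by move=> Su; rewrite -scaleN1r linZ// mulN1r. Qed.
Lemma linB u v : S u -> S v -> l (u - v) = l u - l v.
Proof. by move=> Su Sv; rewrite linD ?linN//; exact: subN. Qed.
End linear_forms.
End subspaces.

(** * Minimization of strongly convex functionals and Riesz representation *)

Section semi_ip_theory.
Context V (S : V -> Prop) (ip : V -> V -> R).
Hypothesis H : semi_ip S ip.
Let HS := sip_sub H.

Lemma ip_linl w : S w -> lin_on S (ip^~ w).
Proof. by move=> Sw a u v Su Sv; exact: (sip_lin H). Qed.
Lemma ip_linr w : S w -> lin_on S (ip w).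
Proof.
move=> Sw a u v Su Sv; have Suv := subDZ HS a Su Sv.
by rewrite (sip_sym H Sw Suv) (sip_lin H)// (sip_sym H Su)// (sip_sym H Sv).
Qed.

Lemma ip_quad a b u v : S u -> S v ->
  ip (a *: u + b *: v) (a *: u + b *: v) =
  a ^+ 2 * ip u u + 2 * a * b * ip u v + b ^+ 2 * ip v v.
Proof.
move=> Su Sv.
have Sa := subZ HS a Su; have Sb := subZ HS b Sv; have Sab := subD HS Sa Sb.
rewrite (linD (ip_linl Sab))// !(linD (ip_linr _))//.
rewrite !(linZ HS (ip_linl _))// !(linZ HS (ip_linr _))//.
rewrite (sip_sym H Sv Su); ring.
Qed.

Lemma ip_sqrB u v : S u -> S v ->
  ip (u - v) (u - v) = ip u u - 2 * ip u v + ip v v.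
Proof.
move=> Su Sv; have := ip_quad 1 (-1) Su Sv; rewrite scale1r scaleN1r => ->; ring.
Qed.

Lemma ip_sqrD u v : S u -> S v ->
  ip (u + v) (u + v) = ip u u + 2 * ip u v + ip v v.
Proof.
move=> Su Sv; have := ip_quad 1 1 Su Sv; rewrite !scale1r => ->; ring.
Qed.

Lemma ip_sqrB_sym u v : S u -> S v -> ip (u - v) (u - v) = ip (v - u) (v - u).
Proof. by move=> Su Sv; rewrite !ip_sqrB// (sip_sym H Su Sv); ring. Qed.

Lemma ip_CS u v : S u -> S v -> ip u v ^+ 2 <= ip u u * ip v v.
Proof.
move=> Su Sv; apply: discr_le; first exact: (sip_ge0 H).
move=> t; have := sip_ge0 H (subD HS (subZ HS t Su) (subZ HS 1 Sv)).
rewrite ip_quad// !mulr1 expr1n mul1r; set x := ip u v; set y := ip u u; set z := ip v v.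
by congr (0 <= _); ring.
Qed.

Lemma ip_le_sqrD u v : S u -> S v ->
  ip (u + v) (u + v) <= 2 * ip u u + 2 * ip v v.
Proof.
move=> Su Sv; have := sip_ge0 H (subB HS Su Sv).
rewrite ip_sqrB// ip_sqrD//; lra.
Qed.

Lemma ip0_eq0 u v : S u -> S v -> ip u u = 0 -> ip u v = 0.
Proof.
move=> Su Sv u0; have := ip_CS Su Sv; rewrite u0 mul0r => h.
by apply/eqP; rewrite -sqrf_eq0 eq_le h sqr_ge0.
Qed.

Lemma cvg_ip_lin (l : V -> R) (M : R) (u_ : nat -> V) (v : V) :
  lin_on S l -> 0 <= M -> (forall u, S u -> l u ^+ 2 <= M * ip u u) ->
  (forall n, S (u_ n)) -> S v -> cvg_ip ip u_ v ->
  forall e : R, 0 < e -> exists N, forall n, (N <= n)%N -> `|l (u_ n) - l v| < e.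
Proof.
move=> Hl M0 HM Su Sv uv e e0.
have [|N HN] := uv (e ^+ 2 / (M + 1)); first by rewrite divr_gt0 ?exprn_gt0//; lra.
exists N => n /HN Hn; rewrite -(linB HS Hl)//.
by apply: sqr_small Hn => //; apply: HM; exact: subB.
Qed.

Lemma cvg_ip_sqr (u_ : nat -> V) (v : V) :
  (forall n, S (u_ n)) -> S v -> cvg_ip ip u_ v ->
  forall e : R, 0 < e -> exists N, forall n, (N <= n)%N ->
    `|ip (u_ n) (u_ n) - ip v v| < e.
Proof.
move=> Su Sv uv e e0.
have [||N1 HN1] := cvg_ip_lin (ip_linr Sv) (sip_ge0 H Sv) _ Su Sv uv (e := e / 4).
  by move=> u ? /=; exact: ip_CS.
  lra.
have [|N2 HN2] := uv (e / 4); first lra.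
exists (maxn N1 N2) => n; rewrite geq_max => /andP[/HN1 h1 /HN2 h2].
have -> : ip (u_ n) (u_ n) - ip v v =
    ip (u_ n - v) (u_ n - v) + 2 * (ip v (u_ n) - ip v v).
  by rewrite ip_sqrB// (sip_sym H Sv (Su n)); ring.
apply: le_lt_trans (ler_normD _ _) _; rewrite normrM (ger0_norm (ler0n _ 2)).
have q0 := sip_ge0 H (subB HS (Su n) Sv); rewrite (ger0_norm q0); move: h1 h2.
by set x := ip (_ - _) _; set y := `| _ |; lra.
Qed.

(** Comparing [J] at a midpoint with the infimum bounds [c] times the squared distance by the excess
    of [J] at the end points, so a minimizing sequence is Cauchy. The last hypothesis supplies both
    closedness of [K] and lower semicontinuity of [J]. *)
Lemma strongly_convex_min (K : V -> Prop) (J : V -> R) (c m : R) :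
  complete_ip S ip -> 0 < c ->
  (exists u, K u) -> (forall u, K u -> S u) ->
  (forall u, K u -> m <= J u) ->
  (forall u v, K u -> K v -> K (2^-1 *: (u + v)) /\
    J (2^-1 *: (u + v)) <= (J u + J v) / 2 - c * ip (u - v) (u - v)) ->
  (forall u_ l, (forall n, K (u_ n)) -> S l -> cvg_ip ip u_ l ->
    K l /\ forall e : R, 0 < e -> exists N, forall n, (N <= n)%N ->
      J l <= J (u_ n) + e) ->
  exists2 u, K u & forall w, K w -> J u <= J w.
Proof.
move=> cpl c0 [u0 Ku0] KS mJ Jmid Jlsc.
pose A := [set J u | u in K]; pose I := inf A.
have hA : has_inf A.
  by split; [exists (J u0), u0|exists m => _ [u Ku <-]; exact: mJ].
have IJ u : K u -> I <= J u by move=> Ku; apply: ge_inf; [case: hA|exists u].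
have [u_ Hu] : {u_ : nat -> V & forall n, K (u_ n) /\ J (u_ n) < I + n.+1%:R^-1}.
  apply: (@choice _ _ (fun n u => K u /\ J u < I + n.+1%:R^-1)) => n.
  have [|_ [u Ku <-] Hu] := @inf_adherent _ A n.+1%:R^-1 _ hA.
    by rewrite invr_gt0 ltr0n.
  by exists u.
have Ku n : K (u_ n) by case: (Hu n).
have Su n : S (u_ n) by exact: KS.
have inv_small (e : R) : 0 < e -> exists N, forall n, (N <= n)%N -> n.+1%:R^-1 < e.
  move=> e0; exists (Num.truncn e^-1) => n Nn.
  rewrite invf_plt ?posrE ?ltr0n//.
  apply: lt_le_trans (truncnS_gt _) _; by rewrite ler_nat.
have [l Sl ul] : exists2 l, S l & cvg_ip ip u_ l.
  apply: cpl => // e e0.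
  have [|N HN] := inv_small (c * e); first exact: mulr_gt0.
  exists N => p n /HN hp /HN hn.
  have [Kh Jh] := Jmid _ _ (Ku p) (Ku n).
  have := IJ _ Kh; case: (Hu p) (Hu n) => _ Jp [_ Jn] h.
  rewrite -(ltr_pM2l c0); move: h Jh Jp Jn hp hn.
  set x := p.+1%:R^-1; set y := n.+1%:R^-1; set q := ip _ _; lra.
have [Kl Jl] := Jlsc u_ l Ku Sl ul.
exists l => // w Kw; suff hh (e : R) : 0 < e -> J l <= J w + e.
  by apply/ler_addgt0Pr => e; exact: hh.
move=> e0.
have [|N1 HN1] := Jl (e / 2); first lra.
have [|N2 HN2] := inv_small (e / 2); first lra.
have := HN1 (maxn N1 N2) (leq_maxl _ _); have := HN2 (maxn N1 N2) (leq_maxr _ _).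
case: (Hu (maxn N1 N2)) => _; have := IJ _ Kw; set x := _^-1; lra.
Qed.

(** The representative is the minimizer of the energy [ip u u - 2 * l u]. By the parallelogram
    identity this energy is strongly convex with constant 1/4, and the vanishing of its first
    variation at the minimizer is the claim. *)
Lemma riesz (l : V -> R) (M : R) : complete_ip S ip -> lin_on S l ->
  (forall u, S u -> l u ^+ 2 <= M * ip u u) ->
  exists2 z, S z & forall v, S v -> ip z v = l v.
Proof.
move=> cpl Hl HM0.
wlog M0 : M HM0 / 0 <= M => [hw|].
  apply: (hw `|M|) => // u Su; apply: le_trans (HM0 u Su) _.
  by rewrite ler_wpM2r ?ler_norm// (sip_ge0 H).
have HM := HM0.
pose J u := ip u u - 2 * l u.
have [||||||z Sz Hz] := @strongly_convex_min S J 4^-1 (- M) cpl.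
- by rewrite invr_gt0.
- by exists 0; exact: sub0.
- by [].
- move=> u Su; rewrite /J; have h := HM _ Su; have q0 := sip_ge0 H Su.
  suff : 2 * l u <= ip u u + M by lra.
  apply: le_trans (ler_norm _) _; rewrite -(@ler_pXn2r _ 2)// ?nnegrE ?addr_ge0//.
  rewrite real_normK ?num_real//; have := sqr_ge0 (ip u u - M); nra.
- move=> u v Su Sv; split; first by apply: subZ => //; exact: subD.
  rewrite /J scalerDr ip_quad// (linD Hl) ?(linZ HS Hl)//; [|exact: subZ..].
  rewrite ip_sqrB//; lra.
- move=> u_ v Su Sv uv; split=> // e e0.
  have [|N1 HN1] := cvg_ip_sqr Su Sv uv (e := e / 2); first lra.
  have [|N2 HN2] := cvg_ip_lin Hl M0 HM Su Sv uv (e := e / 4); first lra.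
  exists (maxn N1 N2) => n; rewrite geq_max => /andP[/HN1 + /HN2].
  by rewrite /J !ltr_norml => /andP[? ?] /andP[? ?]; lra.
- exists z => // v Sv; apply/eqP; rewrite -subr_eq0; apply/eqP.
  apply: (@quad_min0 _ (ip v v)) => [|t]; first exact: (sip_ge0 H).
  have := Hz _ (subD HS (subZ HS 1 Sz) (subZ HS t Sv)); rewrite /J ip_quad//.
  rewrite (linD Hl) ?(linZ HS Hl)//; [lra|exact: subZ..].
Qed.

End semi_ip_theory.

(** * Least squares and the Lax-Milgram lemma *)

Section operators.
Context V1 V2 (S1 : V1 -> Prop) (S2 : V2 -> Prop)
  (ip1 : V1 -> V1 -> R) (ip2 : V2 -> V2 -> R).
Hypotheses (H1 : semi_ip S1 ip1) (H2 : semi_ip S2 ip2).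
Context (T : V1 -> V2).
Hypothesis TS : forall u, S1 u -> S2 (T u).
Hypothesis Tlin : forall a u v w, S1 u -> S1 v -> S2 w ->
  ip2 (T (a *: u + v)) w = a * ip2 (T u) w + ip2 (T v) w.
Let HS1 := sip_sub H1.
Lemma semi_ip_comp : semi_ip S1 (fun u v => ip2 (T u) (T v)).
Proof.
split=> [//|a u v w Su Sv Sw|u v Su Sv|u Su]; first by rewrite Tlin//; exact: TS.
- by rewrite (sip_sym H2)//; exact: TS.
- by apply: (sip_ge0 H2); exact: TS.
Qed.

(* The normal equations of the least squares problem min |T p - z|; only
   solvable because T is bounded below. *)
Lemma least_squares (M c : R) (z : V2) : complete_ip S1 ip1 -> 0 < c -> S2 z ->
  (forall u, S1 u -> ip2 (T u) (T u) <= M * ip1 u u) ->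
  (forall u, S1 u -> c * ip1 u u <= ip2 (T u) (T u)) ->
  exists2 p, S1 p & forall r, S1 r -> ip2 (T p) (T r) = ip2 z (T r).
Proof.
move=> cpl c0 Sz HM Hc.
apply: (riesz (M := ip2 z z) semi_ip_comp).
- move=> u_ Su Cu; have [||l Sl ul] := cpl u_ => //.
    move=> e e0; have [|N HN] := Cu (c * e); first exact: mulr_gt0.
    exists N => m n Nm Nn; rewrite -(ltr_pM2l c0).
    by apply: le_lt_trans (HN _ _ Nm Nn); apply: Hc; exact: subB.
  exists l => // e e0.
  have M1 : 0 < `|M| + 1 by have := normr_ge0 M; lra.
  have [|N HN] := ul (e / (`|M| + 1)); first exact: divr_gt0.
  exists N => n /HN; rewrite ltr_pdivlMr// => hn.
  have Sd := subB HS1 (Su n) Sl.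
  apply: le_lt_trans (HM _ Sd) _; apply: le_lt_trans hn.
  have := sip_ge0 H1 Sd; have := ler_norm M; nra.
- move=> a u v Su Sv; have Suv := subDZ HS1 a Su Sv.
  have [Tu Tv Tuv] := And3 (TS Su) (TS Sv) (TS Suv).
  by rewrite (sip_sym H2 Sz Tuv) Tlin// (sip_sym H2 Sz Tu) (sip_sym H2 Sz Tv).
- by move=> u Su; apply: (ip_CS H2) => //; exact: TS.
Qed.

End operators.

(** Riesz representatives turn [a u] into [T u] and [l] into [z]; coercivity gives [c |u| <= |T u|],
    so [T p = z] has a least squares solution [p]. Its residual [d] is orthogonal to the range of
    [T], and testing with [T d] itself gives [c |d|^2 <= a d d = ip (T d) d = 0]. *)
Lemma lax_milgram V (S : V -> Prop) (ip : V -> V -> R) (a : V -> V -> R)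
    (M c N : R) (l : V -> R) :
  semi_ip S ip -> complete_ip S ip -> 0 <= M -> 0 < c ->
  (forall w, S w -> lin_on S (a^~ w)) -> (forall w, S w -> lin_on S (a w)) ->
  (forall u v, S u -> S v -> a u v ^+ 2 <= M * ip u u * ip v v) ->
  (forall u, S u -> c * ip u u <= a u u) ->
  lin_on S l -> (forall u, S u -> l u ^+ 2 <= N * ip u u) ->
  exists2 u, S u & forall v, S v -> a u v = l v.
Proof.
move=> H cpl M0 c0 al ar aM ac Hl lN; have HS := sip_sub H.
have rT u : exists z, S u -> S z /\ forall v, S v -> ip z v = a u v.
  have [Su|nSu] := pselect (S u); last by exists 0.
  have [z Sz Hz] := riesz H cpl (ar _ Su) (fun v Sv => aM u v Su Sv).
  by exists z.
have [T HT] := choice rT.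
have TS u : S u -> S (T u) by move=> /HT[].
have TE u v : S u -> S v -> ip (T u) v = a u v by move=> /HT[_]; exact.
have [z Sz Hz] := riesz H cpl Hl lN.
have [|||||p Sp Hp] := @least_squares _ _ S S ip ip H H T TS _ M (c ^+ 2) z cpl.
- by move=> b u v w Su Sv Sw; rewrite !TE//; [exact: al|exact: subDZ].
- exact: exprn_gt0.
- by [].
- move=> u Su; have q0 := sip_ge0 H (TS _ Su); have := aM _ _ Su (TS _ Su).
  rewrite -(TE _ _ Su (TS _ Su)); have [->|qn0] := eqVneq (ip (T u) (T u)) 0.
    by move=> _; apply: mulr_ge0 => //; exact: (sip_ge0 H).
  by rewrite expr2 ler_pM2r// lt_neqAle eq_sym qn0.
- move=> u Su; have := ac _ Su; rewrite -TE// => h.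
  have q0 := sip_ge0 H Su; have := ip_CS H (TS _ Su) Su.
  have [q00|qn0] := eqVneq (ip u u) 0; first by rewrite q00 !mulr0 => _; exact: (sip_ge0 H) (TS _ Su).
  have qp : 0 < ip u u by rewrite lt_neqAle eq_sym qn0.
  have : (c * ip u u) ^+ 2 <= ip (T u) u ^+ 2.
    by rewrite ler_pXn2r ?nnegrE//; [apply: mulr_ge0 => //; lra|apply: le_trans h; apply: mulr_ge0 => //; lra].
  move=> h1 h2; rewrite -(ler_pM2r qp).
  by apply: le_trans h2; apply: le_trans h1; rewrite exprMn; lra.
exists p => // v Sv; set d := T p - z; have STp := TS _ Sp.
have Sd : S d by exact: subB.
have dT r : S r -> ip d (T r) = 0.
  move=> Sr; have STr := TS _ Sr.
  by rewrite (linB HS (ip_linl H STr))// Hp// subrr.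
have d0 : ip d d = 0.
  have STd := TS _ Sd.
  apply/eqP; rewrite eq_le (sip_ge0 H)// andbT -(ler_pM2l c0) mulr0.
  by apply: le_trans (ac _ Sd) _; rewrite -TE// (sip_sym H)// dT.
rewrite -TE// -Hz//; apply/eqP; rewrite -subr_eq0.
by rewrite -(linB HS (ip_linl H Sv))// (ip0_eq0 H).
Qed.

End semi_hilbert.

(** * Subspaces, products and vector fields *)

Section semi_hilbert_products.
Context {R : realType}.

Lemma semi_ip_sub (V : lmodType R) (S S' : V -> Prop) ip :
  semi_ip S ip -> subspace S' -> (forall v, S' v -> S v) -> semi_ip S' ip.
Proof.
move=> H HS' SS; split=> // *.
- by apply: (sip_lin H); exact: SS.
- by apply: (sip_sym H); exact: SS.
- by apply: (sip_ge0 H); exact: SS.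
Qed.

Lemma semi_ipD (V : lmodType R) (S : V -> Prop) ip ip' :
  semi_ip S ip -> semi_ip S ip' -> semi_ip S (fun u v => ip u v + ip' u v).
Proof.
move=> H H'; split=> [|a u v w Su Sv Sw|u v Su Sv|u Su].
- exact: sip_sub H.
- by rewrite (sip_lin H)// (sip_lin H')//; ring.
- by rewrite (sip_sym H)// (sip_sym H').
- by rewrite addr_ge0// ?(sip_ge0 H)// (sip_ge0 H').
Qed.

Lemma semi_ip_sum (V : lmodType R) (S : V -> Prop) (I : Type) (s : seq I)
    (ip : I -> V -> V -> R) : subspace S ->
  (forall i, semi_ip S (ip i)) -> semi_ip S (fun u v => \sum_(i <- s) ip i u v).
Proof.
move=> HS H; split=> [//|a u v w Su Sv Sw|u v Su Sv|u Su].
- rewrite mulr_sumr -big_split/=; apply: eq_bigr => i _; exact: (sip_lin (H i)).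
- apply: eq_bigr => i _; exact: (sip_sym (H i)).
- apply: sumr_ge0 => i _; exact: (sip_ge0 (H i)).
Qed.

Lemma semi_ip_lin (V V' : lmodType R) (S : V -> Prop) (S' : V' -> Prop) ip (T : V' -> V) :
  semi_ip S ip -> subspace S' -> (forall v, S' v -> S (T v)) ->
  (forall a u v, T (a *: u + v) = a *: T u + T v) ->
  semi_ip S' (fun u v => ip (T u) (T v)).
Proof.
move=> H HS' TS Tl; split=> [//|a u v w Su Sv Sw|u v Su Sv|u Su].
- by rewrite Tl (sip_lin H)//; exact: TS.
- by rewrite (sip_sym H)//; exact: TS.
- by apply: (sip_ge0 H); exact: TS.
Qed.

Section pairs.
Context (V1 V2 : lmodType R) (S1 : V1 -> Prop) (S2 : V2 -> Prop)
  (ip1 : V1 -> V1 -> R) (ip2 : V2 -> V2 -> R).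
Hypotheses (H1 : semi_ip S1 ip1) (H2 : semi_ip S2 ip2).

Definition pair_sub (p : V1 * V2) := S1 p.1 /\ S2 p.2.
Definition pair_ip (p q : V1 * V2) := ip1 p.1 q.1 + ip2 p.2 q.2.

Lemma pair_subspace : subspace pair_sub.
Proof.
split; first by split; [exact: sub0 (sip_sub H1)|exact: sub0 (sip_sub H2)].
move=> a u v [u1 u2] [v1 v2]; split; [exact: subDZ (sip_sub H1) _ _ _ _ _|].
exact: subDZ (sip_sub H2) _ _ _ _ _.
Qed.

Lemma pair_semi_ip : semi_ip pair_sub pair_ip.
Proof.
apply: semi_ipD.
  by apply: (semi_ip_lin H1 pair_subspace) => // v [].
by apply: (semi_ip_lin H2 pair_subspace) => // v [].
Qed.

Lemma pair_complete : complete_ip S1 ip1 -> complete_ip S2 ip2 -> complete_ip pair_sub pair_ip.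
Proof.
move=> c1 c2 u_ Su Cu.
have B1 m n : S1 ((u_ m).1 - (u_ n).1) by apply: subB (sip_sub H1) _ _ _ _; case: (Su m); case: (Su n).
have B2 m n : S2 ((u_ m).2 - (u_ n).2) by apply: subB (sip_sub H2) _ _ _ _; case: (Su m); case: (Su n).
have [||l1 Sl1 ul1] := c1 (fst \o u_) _ _.
- by move=> n; case: (Su n).
- move=> e e0; have [N HN] := Cu e e0; exists N => m n Nm Nn.
  by apply: le_lt_trans (HN m n Nm Nn); rewrite lerDl; exact: (sip_ge0 H2) (B2 _ _).
have [||l2 Sl2 ul2] := c2 (snd \o u_) _ _.
- by move=> n; case: (Su n).
- move=> e e0; have [N HN] := Cu e e0; exists N => m n Nm Nn.
  by apply: le_lt_trans (HN m n Nm Nn); rewrite lerDr; exact: (sip_ge0 H1) (B1 _ _).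
exists (l1, l2) => // e e0.
have [|N1 HN1] := ul1 (e / 2); first by rewrite divr_gt0.
have [|N2 HN2] := ul2 (e / 2); first by rewrite divr_gt0.
exists (maxn N1 N2) => n; rewrite geq_max => /andP[/HN1 h1 /HN2 h2].
by rewrite /pair_ip [e]splitr; exact: ltrD.
Qed.

End pairs.

Section vector_fields.
Context (T : Type) (S : (T -> R) -> Prop) (ip : (T -> R) -> (T -> R) -> R) (k : nat).
Hypothesis H : semi_ip S ip.

Definition vec_sub (v : T -> 'rV[R]_k) := forall i, S (fun x => v x 0 i).
Definition vec_ip (u v : T -> 'rV[R]_k) := \sum_i ip (fun x => u x 0 i) (fun x => v x 0 i).

Lemma coord_lin (a : R) (u v : T -> 'rV[R]_k) i :
  (fun x => (a *: u + v) x 0 i) = a *: (fun x => u x 0 i) + (fun x => v x 0 i).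
Proof. by apply/funext => x; rewrite !fctE !mxE. Qed.

Lemma vec_subspace : subspace vec_sub.
Proof.
split=> [i|a u v Su Sv i].
  have -> : (fun x => (0 : T -> 'rV[R]_k) x 0 i) = 0 by apply/funext => x; rewrite -[LHS]/((0 : 'rV[R]_k) 0 i) mxE.
  exact: sub0 (sip_sub H).
by rewrite coord_lin; exact: subDZ (sip_sub H) _ _ _ (Su i) (Sv i).
Qed.

Lemma vec_semi_ip : semi_ip vec_sub vec_ip.
Proof.
apply: semi_ip_sum => [|i]; first exact: vec_subspace.
by apply: (semi_ip_lin H vec_subspace) => // a u v; exact: coord_lin.
Qed.

Lemma vec_ip_coord_le (v : T -> 'rV[R]_k) i : vec_sub v ->
  ip (fun x => v x 0 i) (fun x => v x 0 i) <= vec_ip v v.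
Proof.
move=> Sv; rewrite /vec_ip (bigD1 i)//= lerDl; apply: sumr_ge0 => j _.
exact: (sip_ge0 H).
Qed.

Lemma vec_complete : complete_ip S ip -> complete_ip vec_sub vec_ip.
Proof.
move=> cS u_ Su Cu.
have coordB (u v : T -> 'rV[R]_k) i :
    (fun x => (u - v) x 0 i) = (fun x => u x 0 i) - (fun x => v x 0 i).
  by apply/funext => x; rewrite !fctE !mxE.
have [l Hl] : {l : 'I_k -> T -> R & forall i, S (l i) /\ cvg_ip ip (fun n x => u_ n x 0 i) (l i)}.
  apply: (@choice _ _ (fun i l => S l /\ cvg_ip ip (fun n x => u_ n x 0 i) l)) => i.
  have [||l Sl ul] := cS (fun n x => u_ n x 0 i); last by exists l.
  - by move=> n; exact: Su.
  - move=> e e0; have [N HN] := Cu e e0; exists N => m n Nm Nn.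
    apply: le_lt_trans (HN m n Nm Nn); rewrite -coordB; apply: vec_ip_coord_le.
    exact: subB vec_subspace _ _ _ _.
exists (fun x => \row_i l i x) => [i|e e0].
  by under eq_fun do rewrite mxE; case: (Hl i).
(* Dividing by [k.+1] rather than [k] covers fields without components and keeps the sum of the [k]
   errors strictly below [e]. *)
have [N HN] : {N : 'I_k -> nat & forall i n, (N i <= n)%N ->
    ip ((fun x => u_ n x 0 i) - l i) ((fun x => u_ n x 0 i) - l i) < e / k.+1%:R}.
  apply: (@choice _ _ (fun i N => forall n, (N <= n)%N ->
    ip ((fun x => u_ n x 0 i) - l i) ((fun x => u_ n x 0 i) - l i) < e / k.+1%:R)) => i.
  by apply: (Hl i).2; rewrite divr_gt0.
exists (\max_i N i) => n Nn.
have h i : ip (fun x => (u_ n - (fun x0 => \row_i0 l i0 x0)) x 0 i)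
     (fun x => (u_ n - (fun x0 => \row_i0 l i0 x0)) x 0 i) <= e / k.+1%:R.
  rewrite coordB (_ : (fun x => (\row_i0 l i0 x) 0 i) = l i); last first.
    by apply/funext => x; rewrite mxE.
  by apply/ltW/HN; apply: leq_trans Nn; exact: leq_bigmax.
apply: le_lt_trans (ler_sum _ (fun i _ => h i)) _.
rewrite sumr_const card_ord -[_ *+ k]mulr_natr -mulrA gtr_pMr//.
by rewrite mulrC ltr_pdivrMr// mul1r ltr_nat.
Qed.

End vector_fields.
End semi_hilbert_products.

(** * Lebesgue measure on row vectors *)

Section row_measurable.
Context {R : realType} {d : nat}.
Local Notation pt := 'rV[R]_d.

Lemma row_ballP (x y : pt) (r : R) : 0 < r ->
  ball x r y <-> forall i, `|x 0 i - y 0 i| < r.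
Proof.
move=> r0; split=> [[_ h] i|h]; first exact: (h 0 i).
by split=> // i j; rewrite (ord1 i); exact: h.
Qed.

Lemma row_ball_bigcap (x : pt) (r : R) : 0 < r ->
  ball x r = \bigcap_(i in [set: 'I_d]) (@row_coord R d i @^-1` ball (x 0 i) r).
Proof.
move=> r0; apply/seteqP; split=> [y /(row_ballP _ _ r0) h i _|y h]; first exact: h.
by apply/(row_ballP _ _ r0) => i; exact: (h i).
Qed.

Lemma measurable_row_ball (x : pt) (r : R) : measurable (ball x r).
Proof.
have [r0|r0] := ltP 0 r; last first.
  by rewrite (_ : ball x r = set0)//; apply/seteqP; split=> // y [] /lt_geF; rewrite r0.
rewrite row_ball_bigcap//; apply: fin_bigcap_measurable => // i _.
rewrite -[_ @^-1` _]setTI; apply: measurable_row_coord => //.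
by apply: open_measurable; exact: ball_open.
Qed.

(** Balls of the sup norm with rational centre and radius form a countable family, and this is what
    makes open sets measurable for the coordinate sigma-algebra. A radius between [e / 4] and
    [e / 2] leaves room to move the centre to a rational point. *)
Lemma open_row_bigcup (A : set pt) : open A ->
  A = \bigcup_(p in [set p : 'rV[rat]_d * rat |
        ball (map_mx ratr p.1 : pt) (ratr p.2) `<=` A])
      ball (map_mx ratr p.1 : pt) (ratr p.2).
Proof.
move=> oA; apply/seteqP; split=> [x Ax|x [p] /= h]; last exact: h.
have [/= e e0 xeA] : nbhs_ball x A by apply/nbhs_ballP; exact: open_nbhs_nbhs.
have [r] : exists r : rat, e / 4 < ratr r < e / 2.
  have oi : open (`]e / 4, e / 2[%classic : set R) by exact: itv_open.
  have [|y /= [+ [r _ ry]]] := @dense_rat R `]e / 4, e / 2[%classic _ oi.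
    by exists (3 / 8 * e) => /=; rewrite in_itv/=; lra.
  by rewrite -ry in_itv/= => ?; exists r.
move=> /andP[r1 r2].
have r0 : (0:R) < ratr r by lra.
have [q Hq] : {q : 'I_d -> rat & forall i, `|x 0 i - ratr (q i)| < ratr r}.
  apply: (@choice _ _ (fun i q => `|x 0 i - ratr q| < ratr r)) => i.
  have [|y /= [+ [q _ qy]]] := @dense_rat R (ball (x 0 i) (ratr r)) _ (ball_open _ _).
    by exists (x 0 i); exact: ballxx.
  by rewrite -qy; exists q.
exists (\row_i q i, r) => /=.
  move=> y /(row_ballP _ _ r0) /= h; apply: xeA; apply/(row_ballP _ _ e0) => i.
  have := h i; have := Hq i; rewrite !mxE => h1 h2.
  rewrite (_ : _ - _ = (x 0 i - ratr (q i)) + (ratr (q i) - y 0 i)); last by ring.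
  by apply: le_lt_trans (ler_normD _ _) _; lra.
by apply/(row_ballP _ _ r0) => i; rewrite !mxE distrC.
Qed.

Lemma open_measurable_row (A : set pt) : open A -> measurable A.
Proof.
move=> /open_row_bigcup ->; rewrite bigcup_mkcond.
apply: countable_bigcupT_measurable => [|p]; first exact: countableP.
by case: ifP => // _; exact: measurable_row_ball.
Qed.

Lemma closed_measurable_row (A : set pt) : closed A -> measurable A.
Proof.
by move=> cA; rewrite -[A]setCK; apply: measurableC; apply: open_measurable_row; exact: closed_openC.
Qed.

Lemma compact_measurable_row (A : set pt) : compact A -> measurable A.
Proof. by move=> cA; apply: closed_measurable_row; apply: compact_closed. Qed.

Lemma continuous_measurable_row (f : pt -> R) :
  continuous f -> measurable_fun setT f.
Proof.
move=> cf; apply: (measurability _ (RGenOInfty.measurableE R)) => _ [_ [a ->] <-].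
rewrite setTI; apply: open_measurable_row; apply: open_comp => [x _|]; first exact: cf.
by rewrite set_itvE; exact: open_gt.
Qed.

End row_measurable.

(** * Translation invariance and Tonelli's theorem, one coordinate at a time *)

Section lebesgue_translation.
Context {R : realType}.
Local Notation leb := (@lebesgue_measure R).
Local Open Scope ereal_scope.

Lemma measurable_shift (z : R) : measurable_fun [set: measurableTypeR R] (fun t : measurableTypeR R => (t + z)%R : measurableTypeR R).
Proof. by apply: measurable_funD => //; exact: measurable_cst. Qed.

(** The image of Lebesgue measure under a translation agrees with it on half-open intervals, hence
    equals it by uniqueness. *)
Lemma ge0_integral_shift1 (f : R -> \bar R) (z : R) :
  measurable_fun [set: measurableTypeR R] f -> (forall t, 0 <= f t) ->
  \int[leb]_t f (t + z)%R = \int[leb]_t f t.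
Proof.
move=> mf f0; pose nu := measure_function_pushforward__canonical__measure_function_Measure leb (measurable_shift z).
transitivity (\int[nu]_t f t).
  by rewrite ge0_integral_pushforward//; exact: measurable_shift.
apply: eq_measure_integral => A mA _; symmetry; apply: lebesgue_measure_unique mA => //.
move=> _ [[a b] /= _ <-]; rewrite /nu /pushforward.
have -> : (fun t : R => (t + z)%R) @^-1` `]a, b]%classic = `](a - z)%R, (b - z)%R]%classic.
  by apply/seteqP; split=> t /=; rewrite !in_itv/= ltrBlDr lerBrDr.
rewrite !lebesgue_measure_itv/= !lte_fin ltrD2r.
by case: ifP => // _; rewrite -!EFinB; congr EFin; ring.
Qed.

End lebesgue_translation.

Section tonelli_sigma_finite.
Context {R : realType} {dT : measure_display} {T : measurableType dT}
  (m : {measure set T -> \bar R}).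
Hypothesis sf : sigma_finite setT m.
Local Notation leb := (@lebesgue_measure R).
Local Open Scope ereal_scope.

(** The dummy argument puts the proof of sigma-finiteness into the term, so that a canonical
    sigma-finite measure structure can be attached to an arbitrary [m] for Tonelli's theorem. *)
Definition sf_copy (_ : sigma_finite setT m) : set T -> \bar R := m.
Local Notation ms := (sf_copy sf).

HB.instance Definition _ := isMeasure.Build _ _ _ ms
  (measure0 m) (measure_ge0 m) (@measure_semi_sigma_additive _ _ _ m).
HB.instance Definition _ := Measure_isSigmaFinite.Build _ _ _ ms sf.

Lemma tonelli_sf (f : T * measurableTypeR R -> \bar R) :
  measurable_fun setT f -> (forall x, 0 <= f x) ->
  [/\ measurable_fun setT (fun x => \int[leb]_t f (x, t)),
     measurable_fun [set: measurableTypeR R] (fun t : R => \int[m]_x f (x, t)),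
     \int[(m \x leb)%E]_p f p = \int[m]_x \int[leb]_t f (x, t) &
     \int[(m \x leb)%E]_p f p = \int[leb]_t \int[m]_x f (x, t)].
Proof.
move=> mf f0; split.
- exact: (@measurable_fun_fubini_tonelli_F _ _ T (measurableTypeR R) R leb f mf f0).
- exact: (@measurable_fun_fubini_tonelli_G _ _ T (measurableTypeR R) R ms f mf f0).
- exact: (@fubini_tonelli1 _ _ _ _ _ ms leb f mf f0).
- exact: (@fubini_tonelli2 _ _ _ _ _ ms leb f mf f0).
Qed.

End tonelli_sigma_finite.

Section lebesgue_row_step.
Context {R : realType}.
Local Notation leb := (@lebesgue_measure R).
Local Open Scope ereal_scope.

Lemma row_snoc_ball n (x : 'rV[R]_n.+1) (r : R) : (0 < r)%R ->
  @row_snoc R n @^-1` ball x r =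
  ball (\row_i x 0%R (lift ord_max i))%R r `*` ball (x 0%R ord_max) r.
Proof.
move=> r0; apply/seteqP; split=> [[y t] /(row_ballP _ _ r0) /= h|[y t] /= [/(row_ballP _ _ r0) h1 h2]].
  split=> /=; last by have := h ord_max; rewrite mxE unlift_none.
  by apply/(row_ballP _ _ r0) => i; have := h (lift ord_max i); rewrite !mxE liftK.
apply/(row_ballP _ _ r0) => i; rewrite mxE /=.
by have [j ->|->//] := unliftP ord_max i; have := h1 j; rewrite mxE.
Qed.

Lemma lebesgue_row_ball n (x : 'rV[R]_n) (r : R) : (0 < r)%R ->
  lebesgue_row R n (ball x r) = ((2 * r) ^+ n)%:E.
Proof.
move=> r0; elim: n x => [x|n IH x].
  rewrite /= diracE mem_set//; apply/(row_ballP _ _ r0) => -[] //.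
rewrite /= /pushforward row_snoc_ball// product_measure1E//; last 2 first.
  exact: measurable_row_ball.
  exact: measurable_ball.
rewrite exprSr EFinM; congr (_ * _); first exact: IH.
by rewrite -[LHS]/(leb _) lebesgue_measure_ball ?ltW// mulr_natl.
Qed.

Lemma lebesgue_row_sigma_finite n : sigma_finite setT (lebesgue_row R n).
Proof.
exists (fun k => ball (0%R : 'rV[R]_n) k.+1%:R%R) => [|k]; last first.
  by split; [exact: measurable_row_ball|rewrite lebesgue_row_ball// ltry].
apply/seteqP; split=> // x _; exists (Num.truncn (mx_norm x)) => //.
rewrite -ball_normE /ball_/= sub0r normrN; exact: truncnS_gt.
Qed.

Lemma measurable_row_snocr n (x : 'rV[R]_n) :
  measurable_fun setT (fun t : measurableTypeR R => row_snoc (x, t)).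
Proof. by apply: (measurableT_comp (@measurable_row_snoc R n)); exact: pair1_measurable. Qed.

Lemma integral_row_step n (f : 'rV[R]_n.+1 -> \bar R) :
  measurable_fun setT f -> (forall x, 0 <= f x) ->
  measurable_fun setT (fun x => \int[leb]_t f (row_snoc (x, t))) /\
  \int[lebesgue_row R n.+1]_x f x =
  \int[lebesgue_row R n]_x \int[leb]_t f (row_snoc (x, t)).
Proof.
move=> mf f0; have sf := lebesgue_row_sigma_finite n.
have mg : measurable_fun setT (f \o @row_snoc R n).
  by apply: measurableT_comp => //; exact: measurable_row_snoc.
have [h1 _ h2 _] := tonelli_sf sf mg (fun _ => f0 _); split=> //.
by rewrite -h2 /= (ge0_integral_pushforward (@measurable_row_snoc R n)).
Qed.

Lemma ge0_integral_shift n (z : 'rV[R]_n) (f : 'rV[R]_n -> \bar R) :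
  measurable_fun setT f -> (forall x, 0 <= f x) ->
  \int[lebesgue_row R n]_x f (x + z)%R = \int[lebesgue_row R n]_x f x.
Proof.
elim: n z f => [z f mf f0|n IH z f mf f0].
  by apply: eq_integral => x _; congr f; apply/rowP => -[].
have mfz : measurable_fun setT (fun x : 'rV[R]_n.+1 => f (x + z)%R).
  apply: measurableT_comp => //; apply: measurable_fun_rowP => i.
  rewrite (_ : _ \o _ = fun x : 'rV[R]_n.+1 => (row_coord i x + z 0%R i)%R); last first.
    by apply/funext => x; rewrite /row_coord/= mxE.
  apply: measurable_funD; first exact: measurable_row_coord.
  exact: measurable_cst.
have [m1 ->] := integral_row_step mfz (fun _ => f0 _).
have [m2 ->] := integral_row_step mf f0.
pose z' : 'rV[R]_n := (\row_i z 0 (lift ord_max i))%R.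
pose g (x : 'rV[R]_n) := \int[leb]_t f (row_snoc (x, t)).
have g0 x : 0 <= g x by apply: integral_ge0 => t _; exact: f0.
transitivity (\int[lebesgue_row R n]_x g (x + z')%R); last exact: IH.
apply: eq_integral => x _; rewrite /g.
rewrite -[RHS](@ge0_integral_shift1 _ _ (z 0%R ord_max)); last 2 first.
  exact: measurableT_comp mf (measurable_row_snocr _).
  by move=> t; exact: f0.
apply: eq_integral => t _; congr f; apply/rowP => i.
by rewrite !mxE /=; case: (unliftP ord_max i) => [j ->|->] /=; rewrite ?/z' ?mxE.
Qed.

End lebesgue_row_step.

(** * Smooth functions and test functions *)

Section smooth_functions.
Context {R : realType} {d : nat}.
Local Notation pt := 'rV[R]_d.
Local Notation D i f := ('D_(@unit_vec R d i) f).
Implicit Types (f g : pt -> R) (i j : 'I_d).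

(** A coinduction principle: since [smooth] quantifies over all iterated partials, it suffices to
    exhibit a class of differentiable functions that is stable under partials. *)
Lemma smooth_class (P : (pt -> R) -> Prop) :
  (forall f, P f -> forall x, differentiable f x) ->
  (forall f i, P f -> P (D i f)) -> forall f, P f -> smooth f.
Proof.
move=> Pd Pp f Pf s x; apply: Pd.
by elim: s => //= i s IH; exact: Pp.
Qed.

Lemma smooth_diff f x : smooth f -> differentiable f x.
Proof. by move=> /(_ [::] x). Qed.

Lemma smooth_derivable f x v : smooth f -> derivable f x v.
Proof. by move=> /smooth_diff sf; apply: diff_derivable; exact: sf. Qed.

Lemma smooth_partial f i : smooth f -> smooth (D i f).
Proof.
move=> sf s x; have := sf (rcons s i) x.
by rewrite /iter_partial foldr_rcons.
Qed.

Lemma smooth_continuous f : smooth f -> continuous f.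
Proof. by move=> sf x; apply: differentiable_continuous; exact: smooth_diff. Qed.

Lemma smooth_measurable f : smooth f -> measurable_fun setT f.
Proof. by move=> /smooth_continuous; exact: continuous_measurable_row. Qed.

Lemma derive_row f x v : differentiable f x -> 'D_v f x = \sum_i v 0 i * D i f x.
Proof.
move=> df; rewrite deriveE//.
rewrite {1}[v]row_sum_delta linear_sum/=; apply: eq_bigr => i _.
by rewrite linearZ/= deriveE.
Qed.

Lemma derive_sum_seq (T : Type) (s : seq T) (F : T -> pt -> R) x v :
  (forall k, differentiable (F k) x) ->
  differentiable (fun y => \sum_(k <- s) F k y) x /\
  'D_v (fun y => \sum_(k <- s) F k y) x = \sum_(k <- s) 'D_v (F k) x.
Proof.
move=> dF; elim: s => [|k s [IH1 IH2]].
  have -> : (fun y => \sum_(k <- [::]) F k y) = cst 0.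
    by apply/funext => y; rewrite big_nil.
  by split; [exact: differentiable_cst|rewrite derive_cst big_nil].
have -> : (fun y => \sum_(l <- k :: s) F l y) = F k + (fun y => \sum_(l <- s) F l y).
  by apply/funext => y; rewrite big_cons.
split; first exact: differentiableD.
by rewrite deriveD ?IH2 ?big_cons//; exact: diff_derivable.
Qed.

Lemma smooth_cst (c : R) : smooth (cst c : pt -> R).
Proof.
apply: (smooth_class (P := fun f => exists c, f = cst c)); last by exists c.
  by move=> _ [{}c ->] x; exact: differentiable_cst.
by move=> _ i [{}c ->]; exists 0; apply/funext => x; rewrite derive_cst.
Qed.

Lemma smoothD f g : smooth f -> smooth g -> smooth (fun x => f x + g x).
Proof.
move=> sf sg; apply: (smooth_class (P := fun h => exists f g,
    [/\ smooth f, smooth g & h = f + g])); last by exists f, g.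
  by move=> _ [{}f [{}g [{}sf {}sg ->]]] x; apply: differentiableD; exact: smooth_diff.
move=> _ i [{}f [{}g [{}sf {}sg ->]]]; exists (D i f), (D i g).
split; [exact: smooth_partial..|apply/funext => x].
by rewrite deriveD//; exact: smooth_derivable.
Qed.

Lemma smooth_sum (T : Type) (s : seq T) (F : T -> pt -> R) :
  (forall k, smooth (F k)) -> smooth (fun x => \sum_(k <- s) F k x).
Proof.
move=> sF; elim: s => [|k s IH].
  rewrite (_ : (fun _ => _) = cst 0); first exact: smooth_cst.
  by apply/funext => x; rewrite big_nil.
rewrite (_ : (fun _ => _) = (fun x => F k x + \sum_(l <- s) F l x)).
  exact: smoothD.
by apply/funext => x; rewrite big_cons.
Qed.

(** A partial derivative of a product is a sum of products, so products alone are not stable under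
    differentiation; the algebra generated by smooth functions is. *)
Inductive smooth_alg : (pt -> R) -> Prop :=
| SA_base f : smooth f -> smooth_alg f
| SA_add f g : smooth_alg f -> smooth_alg g -> smooth_alg (fun x => f x + g x)
| SA_mul f g : smooth_alg f -> smooth_alg g -> smooth_alg (fun x => f x * g x).

Lemma smooth_alg_smooth f : smooth_alg f -> smooth f.
Proof.
move: f; apply: smooth_class.
  move=> f; elim=> [{}f sf x|{}f g _ IHf _ IHg x|{}f g _ IHf _ IHg x].
  - exact: smooth_diff.
  - exact: differentiableD.
  - exact: differentiableM.
have diffA h : smooth_alg h -> forall x, differentiable h x.
  elim=> [{}f sf x|{}f g _ IHf _ IHg x|{}f g _ IHf _ IHg x].
  - exact: smooth_diff.
  - exact: differentiableD.
  - exact: differentiableM.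
move=> f i; elim=> [{}f sf|{}f g sf IHf sg IHg|{}f g sf IHf sg IHg].
- by apply: SA_base; exact: smooth_partial.
- rewrite (_ : D i _ = fun x => D i f x + D i g x); first exact: SA_add.
  apply/funext => x; rewrite -[X in 'D_ _ X _]/(f + g) deriveD//;
  by apply: diff_derivable; exact: diffA.
- rewrite (_ : D i _ = fun x => f x * D i g x + g x * D i f x).
    by apply: SA_add; exact: SA_mul.
  apply/funext => x; rewrite -[X in 'D_ _ X _]/(f * g) deriveM//;
  by apply: diff_derivable; exact: diffA.
Qed.

Lemma smoothM f g : smooth f -> smooth g -> smooth (fun x => f x * g x).
Proof. by move=> sf sg; apply: smooth_alg_smooth; apply: SA_mul; exact: SA_base. Qed.

Lemma smoothZ (c : R) f : smooth f -> smooth (fun x => c * f x).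
Proof. by move=> sf; apply: (smoothM (smooth_cst c)). Qed.

Lemma smoothN f : smooth f -> smooth (fun x => - f x).
Proof.
move=> sf; rewrite (_ : (fun _ => _) = fun x => -1 * f x); first exact: smoothZ.
by apply/funext => x; rewrite mulN1r.
Qed.

Lemma smoothB f g : smooth f -> smooth g -> smooth (fun x => f x - g x).
Proof. by move=> sf sg; apply: smoothD => //; exact: smoothN. Qed.

Lemma smooth_prod (T : Type) (s : seq T) (F : T -> pt -> R) :
  (forall k, smooth (F k)) -> smooth (fun x => \prod_(k <- s) F k x).
Proof.
move=> sF; elim: s => [|k s IH].
  rewrite (_ : (fun _ => _) = cst 1); first exact: smooth_cst.
  by apply/funext => x; rewrite big_nil.
rewrite (_ : (fun _ => _) = (fun x => F k x * \prod_(l <- s) F l x)).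
  exact: smoothM.
by apply/funext => x; rewrite big_cons.
Qed.

Lemma smoothX f n : smooth f -> smooth (fun x => f x ^+ n).
Proof.
move=> sf; elim: n => [|n IH].
  rewrite (_ : (fun _ => _) = cst 1); first exact: smooth_cst.
  by apply/funext => x; rewrite expr0.
rewrite (_ : (fun _ => _) = (fun x => f x * f x ^+ n)); first exact: smoothM.
by apply/funext => x; rewrite exprS.
Qed.

Lemma derive_reflect f (a : pt) x v : differentiable f (a - x) ->
  differentiable (fun y => f (a - y)) x /\
  'D_v (fun y => f (a - y)) x = - 'D_v f (a - x).
Proof.
move=> df.
have dr : differentiable (fun y : pt => a - y) x.
  by apply: differentiableB => //; exact: differentiable_cst.
have dfr : differentiable (f \o (fun y : pt => a - y)) x by exact: differentiable_comp.
split=> //; rewrite -[X in 'D_ _ X _]/(f \o (fun y : pt => a - y)).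
rewrite deriveE// diff_comp//= deriveE//.
rewrite (_ : 'd (fun y : pt => a - y) x v = - v) ?linearN//.
rewrite -deriveE// -[X in 'D_ _ X _]/(cst a - id) deriveB ?derive_cst ?derive_id ?sub0r//.
Qed.

Lemma smooth_reflect f (a : pt) : smooth f -> smooth (fun x => f (a - x)).
Proof.
move=> sf; apply: (smooth_class (P := fun h => exists c f,
    smooth f /\ h = fun x => c * f (a - x))); last by exists 1, f; split => //; apply/funext => x; rewrite mul1r.
- move=> _ [c [{}f [{}sf ->]]] x.
  have [h _] := derive_reflect 0 (smooth_diff (a - x) sf).
  apply: differentiableM => //; exact: differentiable_cst.
- move=> _ i [c [{}f [{}sf ->]]]; exists (- c), (D i f); split.
    exact: smooth_partial.
  apply/funext => x.
  have [h h2] := derive_reflect (@unit_vec R d i) (smooth_diff (a - x) sf).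
  rewrite -[X in 'D_ _ X _]/(cst c * (fun y => f (a - y))) deriveM ?derive_cst//; last first.
    exact: diff_derivable.
  by rewrite h2 scaler0 addr0 scalerN mulNr.
Qed.

Lemma smooth_shift f (a : pt) : smooth f -> smooth (fun x => f (x + a)).
Proof.
move=> sf; have := smooth_reflect (- a) (smooth_reflect 0 sf).
by congr smooth; apply/funext => x; rewrite /= sub0r opprB opprK.
Qed.

Lemma derive_shift f (a : pt) x v :
  'D_v (fun y => f (y + a)) x = 'D_v f (x + a).
Proof.
rewrite /derive; set F := fun h => _; set G := (X in _ = lim (X @ _)).
suff -> : F = G by [].
by apply/funext => h; rewrite /F /G /= addrA.
Qed.

(** A uniform quadratic remainder is stronger than differentiability but survives integration, which
    is how convolutions are differentiated. *)
Lemma differentiable_taylor2 f (x : pt) (c : 'I_d -> R) (C : R) :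
  (forall k, `|f (x + k) - f x - \sum_i c i * k 0 i| <= C * `|k| ^+ 2) ->
  differentiable f x /\ forall i, D i f x = c i.
Proof.
move=> hC.
have [df dfE] : exists df : {linear pt -> R}, forall k, df k = \sum_i c i * k 0 i.
  suff lin : linear (fun k : pt => \sum_i c i * k 0 i : R).
    by pose df := GRing.isLinear.Build _ _ _ _ _ lin; exists (HB.pack_for {linear pt -> R} (fun k : pt => \sum_i c i * k 0 i : R) df).
  move=> a u v; rewrite scaler_sumr -big_split/=; apply: eq_bigr => i _.
  by rewrite !mxE mulrDr mulrCA.
have cdf : continuous df.
  have -> : (df : pt -> R) = (fun k : pt => \sum_i c i * k 0 i) by apply/funext.
  move=> k; apply: differentiable_continuous.
  apply: (derive_sum_seq _ (F := fun i (k : pt) => c i * k 0 i) 0 _).1 => i.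
  by apply: differentiableM => //; exact: differentiable_coord.
have fo : f \o shift x = cst (f x) + df +o_ (0:pt) id.
  apply/eqaddoP => e e0.
  have C1 : 0 < `|C| + 1 by rewrite ltr_wpDl.
  have H0 : \forall k \near (0 : pt), `|k| < e / (`|C| + 1).
    by apply: nbhs0_lt; exact: divr_gt0.
  near=> k.
  rewrite [X in `|X|](_ : _ = f (x + k) - f x - \sum_i c i * k 0 i); last first.
    by rewrite -dfE -addrA -opprD addrC [x + k]addrC addrC.
  apply: le_trans (hC k) _; rewrite expr2 mulrA; apply: ler_wpM2r => //.
  have ke : `|k| < e / (`|C| + 1).
    near: k; exact: H0.
  rewrite ltr_pdivlMr// in ke; apply: le_trans (ltW ke).
  rewrite mulrC; apply: ler_wpM2l => //; have := ler_norm C; lra.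
have dfx : 'd f x = df :> (pt -> R) by exact: diff_unique.
have fd : differentiable f x by apply/diff_locallyP; rewrite dfx; split.
split=> // i; rewrite deriveE// dfx dfE (bigD1 i)//= big1 ?addr0 => [|j ji].
  by rewrite mxE !eqxx mulr1.
by rewrite mxE (negbTE ji) andbF mulr0.
Unshelve. all: by end_near. Qed.

End smooth_functions.

(** * Smooth bumps with compact support *)

Section exp_bump.
Context {R : realType}.

(** The flat functions [p(1/t) exp(-1/t)], extended by 0. The polynomial parameter makes the family
    stable under differentiation. *)
Definition psi (p : {poly R}) (t : R) : R :=
  if 0 < t then p.[t^-1] * expR (- t^-1) else 0.

(** With [u = t^-1], the exponential series gives [u ^+ (i + 2) <= (i + 2)! * expR u] for every
    monomial of [p]. The two spare powers are those needed for a vanishing derivative at 0. *)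
Lemma psi_quad_bound (p : {poly R}) : exists2 C : R, 0 <= C & forall t, `|psi p t| <= C * t ^+ 2.
Proof.
pose C := \sum_(i < size p) `|p`_i| * (i.+2)`!%:R : R.
exists C => [|t]; first by apply: sumr_ge0 => i _; apply: mulr_ge0.
rewrite /psi; case: ifPn => [t0|_]; last first.
  by rewrite normr0 mulr_ge0 ?sqr_ge0// sumr_ge0// => i _; apply: mulr_ge0.
have u0 : 0 < t^-1 by rewrite invr_gt0.
rewrite -[t in t ^+ 2]invrK; set u := t^-1 in u0 *.
rewrite normrM (gtr0_norm (expR_gt0 _)) expRN exprVn.
rewrite ler_pdivrMr ?expR_gt0// mulrAC ler_pdivlMr ?exprn_gt0//.
rewrite horner_coef -ler_pdivlMr ?exprn_gt0//.
apply: le_trans (ler_norm_sum _ _ _) _.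
rewrite ler_pdivlMr ?exprn_gt0// !mulr_suml; apply: ler_sum => i _.
rewrite normrM normrX (gtr0_norm u0) -!mulrA ler_wpM2l// -exprD addn2.
have := expR_ge1Dxn i.+1 (ltW u0) => h.
rewrite mulrC -ler_pdivrMr ?ltr0n ?fact_gt0//; lra.
Qed.

(** For [t > 0] the product rule gives the factor [t^-2 (p - p')(1/t)], which is again a polynomial
    in [1/t]; at 0 the quadratic bound makes the difference quotient vanish. *)
Lemma is_derive_psi (p : {poly R}) (t : R) :
  is_derive t (1 : R) (psi p) (psi ('X^2 * (p - p^`())) t).
Proof.
have [t0|t0|->] := ltgtP t 0.
- have -> : psi ('X^2 * (p - p^`())) t = 0 by rewrite /psi (lt_gtF t0).
  apply: (near_eq_is_derive (f := cst 0)).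
  near=> s; rewrite /psi ifF//; apply/negbTE; rewrite -leNgt ltW//.
  by near: s; exact: lt_nbhsl.
- have -> : psi ('X^2 * (p - p^`())) t = ('X^2 * (p - p^`())).[t^-1] * expR (- t^-1).
    by rewrite /psi t0.
  have tn0 : t != 0 by rewrite gt_eqF.
  have dV : is_derive t (1 : R) (fun s : R => s^-1) (- t ^- 2).
    have := @is_deriveV R id t 1 1 tn0 (is_derive_id _ _).
    by rewrite /GRing.scale/= mulr1 => h; exact: h.
  have dp : is_derive t (1 : R) (horner p \o (fun s : R => s^-1)) ((- t ^- 2) * p^`().[t^-1]).
    rewrite mulrC; apply: is_derive1_comp.
  have de : is_derive t (1 : R) (expR \o (fun s : R => - s^-1)) (t ^- 2 * expR (- t^-1)).
    rewrite mulrC; apply: is_derive1_comp; apply: is_derive_eq; by rewrite opprK.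
  have H : is_derive t (1 : R) (fun s : R => p.[s^-1] * expR (- s^-1))
      (('X^2 * (p - p^`())).[t^-1] * expR (- t^-1)).
    rewrite -[X in is_derive _ _ X _]/((horner p \o (fun s : R => s^-1)) * (expR \o (fun s : R => - s^-1))).
    have H0 := is_deriveM dp de; apply: (is_derive_eq H0).
    rewrite /= /GRing.scale/= hornerM hornerXn hornerD hornerN -exprVn.
    set a := p.[_]; set b := (p^`()).[_]; set e := expR _; set u := t^-1; ring.
  apply: near_eq_is_derive H.
  near=> s; rewrite /psi ifT//; near: s; exact: lt_nbhsr.
- have -> : psi ('X^2 * (p - p^`())) 0 = 0 by rewrite /psi ltxx.
  have [C C0 hC] := psi_quad_bound p.
  have lim0 : h^-1 *: (psi p (h *: 1 + 0) - psi p 0) @[h --> 0^'] --> (0 : R).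
    apply/cvgr0Pnorm_lt => e e0; have C1 : 0 < C + 1 by lra.
    have H0 : \forall h \near (0 : R)^', `|h| < e / (C + 1).
      by apply: dnbhs0_lt; exact: divr_gt0.
    near=> h.
    have h0 : h != 0 by near: h; exact: nbhs_dnbhs_neq.
    rewrite /psi ltxx subr0 addr0 -/(psi p _) normrZ normfV /GRing.scale/= mulr1.
    have hp : 0 < `|h| by rewrite normr_gt0.
    rewrite mulrC ltr_pdivrMr//; apply: le_lt_trans (hC _) _.
    rewrite -real_normK ?num_real// expr2 mulrA ltr_pM2r//.
    have : `|h| < e / (C + 1).
      near: h; exact: H0.
    rewrite ltr_pdivlMr//; apply: le_lt_trans.
    by rewrite mulrDr mulr1 mulrC lerDl ltW.
  apply: DeriveDef; first by apply/cvg_ex; exists 0.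
  exact/cvg_lim.
Unshelve. all: by end_near. Qed.

Lemma psi1_ge0 (t : R) : 0 <= psi 1 t.
Proof. by rewrite /psi; case: ifP => // _; rewrite hornerC mul1r expR_ge0. Qed.

Lemma psi1_le1 (t : R) : psi 1 t <= 1.
Proof.
rewrite /psi; case: ifP => // t0; rewrite hornerC mul1r -expR0 ler_expR.
by rewrite oppr_le0 invr_ge0 ltW.
Qed.

Lemma psi1_gt0 (t : R) : (0 < psi 1 t) = (0 < t).
Proof.
by rewrite /psi; case: ifP => t0; rewrite ?ltxx// hornerC mul1r expR_gt0.
Qed.

Lemma psi1_eq0 (t : R) : t <= 0 -> psi 1 t = 0.
Proof. by rewrite /psi leNgt => /negbTE ->. Qed.

End exp_bump.

Section bump_row.
Context {R : realType} {d : nat}.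
Local Notation pt := 'rV[R]_d.
Local Notation D i f := ('D_(@unit_vec R d i) f).
Implicit Types (f g : pt -> R) (i j : 'I_d).

Lemma smooth_psi (p : {poly R}) (c s : R) i :
  smooth (fun x : pt => psi p (c + s * x 0 i)).
Proof.
pose L (x : pt) : R := c + s * x 0 i.
have dL x : differentiable L x.
  apply: differentiableD => //; apply: differentiableM => //.
  exact: differentiable_coord.
have DL x j : D j L x = s * (j == i)%:R.
  rewrite /L -[X in 'D_ _ X _]/(cst c + cst s * (fun x : pt => x 0 i)).
  rewrite deriveD ?derive_cst ?add0r//; last first.
    apply: diff_derivable; apply: differentiableM => //; exact: differentiable_coord.
  rewrite deriveM ?derive_cst//; last by apply: diff_derivable; exact: differentiable_coord.
  rewrite scaler0 addr0 /cst /GRing.scale/=; congr (_ * _).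
  rewrite /derive; apply/cvg_lim => //; apply: cvg_near_cst.
  near=> h; have h0 : h != 0 by near: h; exact: nbhs_dnbhs_neq.
  rewrite /= /unit_vec !mxE eqxx/= addrK /GRing.scale/= mulrA mulVf// mul1r eq_sym.
  by [].
have dC q x : differentiable (psi q \o L) x.
  apply: differentiable_comp => //; apply/derivable1_diffP.
  by have [] := is_derive_psi q (L x).
apply: (smooth_class (P := fun f => exists c q, f = fun x => c * psi q (L x))).
- by move=> _ [e [q ->]] x; apply: differentiableM => //; exact: dC.
- move=> _ j [e [q ->]]; exists (e * (s * (j == i)%:R)), ('X^2 * (q - q^`())).
  apply/funext => x.
  rewrite -[X in 'D_ _ X _]/(cst e * (psi q \o L)) deriveM ?derive_cst//; last first.
    by apply: diff_derivable; exact: dC.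
  rewrite scaler0 addr0 /cst -mulrA; congr (_ * _).
  have dq : differentiable (psi q) (L x).
    by apply/derivable1_diffP; have [] := is_derive_psi q (L x).
  have e0 : 'd L x (@unit_vec R d j) = s * (j == i)%:R by rewrite -deriveE// DL.
  rewrite deriveE// diff_comp//= e0.
  rewrite -[X in 'd _ _ X]mulr1 -[_ * 1]/(_ *: 1) linearZ/= -deriveE//.
  by have [_ ->] := is_derive_psi q (L x).
- by exists 1, p; apply/funext => x; rewrite mul1r.
Unshelve. all: by end_near. Qed.

(** For [r > 0], positive exactly on the open cube of centre [a] and half-side [r]. The factors [1]
    and [-1] keep each argument in the affine form handled by [smooth_psi]. *)
Definition bump (a : pt) (r : R) (x : pt) : R :=
  \prod_i (psi 1 (r - a 0 i + 1 * x 0 i) * psi 1 (r + a 0 i + (-1) * x 0 i)).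

Lemma smooth_bump a r : smooth (bump a r).
Proof. by apply: smooth_prod => i; apply: smoothM; exact: smooth_psi. Qed.

Lemma bump_ge0 a r x : 0 <= bump a r x.
Proof. by apply: prodr_ge0 => i _; rewrite mulr_ge0// psi1_ge0. Qed.

Lemma bump_le1 a r x : bump a r x <= 1.
Proof.
suff /andP[] : 0 <= bump a r x <= 1 by [].
apply: (big_ind (fun y : R => 0 <= y <= 1)) => [|y z|i _]; first by rewrite ler01 lexx.
  by move=> /andP[y0 y1] /andP[z0 z1]; rewrite mulr_ge0//= mulr_ile1.
by rewrite mulr_ge0 ?psi1_ge0//= mulr_ile1 ?psi1_ge0 ?psi1_le1.
Qed.

Lemma bump_gt0 a r x : 0 < r -> ball a r x -> 0 < bump a r x.
Proof.
move=> r0 /(row_ballP _ _ r0) h; apply: prodr_gt0 => i _.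
by have := h i; rewrite ltr_norml => /andP[h1 h2]; rewrite mulr_gt0// psi1_gt0; lra.
Qed.

Lemma bump_eq0 a r x : 0 < r -> ~ ball a r x -> bump a r x = 0.
Proof.
move=> r0 nb; have [i hi] : exists i, r <= `|a 0 i - x 0 i|.
  apply: contrapT => /forallNP h; apply: nb; apply/(row_ballP _ _ r0) => i.
  by have /negP := h i; rewrite -ltNge.
rewrite /bump (bigD1 i)//=; move: hi; rewrite ler_normr => /orP[] hi.
  by rewrite psi1_eq0 ?mul0r ?mul0r//; lra.
by rewrite mulrC [X in _ * (_ * X)]psi1_eq0 ?mulr0 ?mulr0//; lra.
Qed.

Lemma bump0N r x : bump 0 r (- x) = bump 0 r x.
Proof.
apply: eq_bigr => i _; rewrite mulrC !mxE; congr (psi _ _ * psi _ _); ring.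
Qed.

End bump_row.

(** * Test functions: bounds, mean value theorem and Taylor remainder *)

Section test_functions.
Context {R : realType} {d : nat}.
Local Notation pt := 'rV[R]_d.
Local Notation D i f := ('D_(@unit_vec R d i) f).
Implicit Types (f g phi : pt -> R) (i j : 'I_d) (O K : set pt).

Lemma row_norm_lt (x : pt) (r : R) : 0 < r -> (`|x| < r) <-> forall i, `|x 0 i| < r.
Proof.
move=> r0; have -> : (`|x| < r) <-> ball 0 r x.
  by rewrite -ball_normE /ball_ /= sub0r normrN.
rewrite (row_ballP _ _ r0); split=> h i; have := h i; by rewrite mxE sub0r normrN.
Qed.

Lemma row_norm_coord (x : pt) i : `|x 0 i| <= `|x|.
Proof.
apply/ler_addgt0Pr => e e0; have : `|x| < `|x| + e by rewrite ltrDl.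
by move=> /row_norm_lt h; rewrite ltW// h// ltr_pwDr.
Qed.

Lemma row_norm_le (x : pt) (r : R) : 0 <= r -> (forall i, `|x 0 i| <= r) -> `|x| <= r.
Proof.
move=> r0 h; apply/ler_addgt0Pr => e e0; rewrite ltW//.
by apply/row_norm_lt => [|i]; [rewrite ltr_pwDr|rewrite (le_lt_trans (h i))// ltrDl].
Qed.

Lemma compact_closed_cube (a : pt) (r : R) : compact [set x : pt | `|a - x| <= r].
Proof.
apply: bounded_closed_compact.
  exists (`|a| + `|r|); split; first exact: num_real.
  move=> M hM x /= h; rewrite -[x]opprK -(addKr a (- x)) normrN addrC.
  apply: le_trans (ler_normD _ _) _; rewrite normrN; apply: le_trans (ltW hM).
  by rewrite addrC lerD2l (le_trans h)// ler_norm.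
rewrite (_ : [set x | _] = closed_ball_ (fun x : pt => `|x|) a r)//; exact: closed_closed_ball_.
Qed.

Lemma cball_sub_ball (a : pt) (r s : R) : r < s -> [set x : pt | `|a - x| <= r] `<=` ball a s.
Proof. by move=> rs x /= h; rewrite -ball_normE /ball_ /=; exact: le_lt_trans rs. Qed.

Lemma ball_sub_cball (a : pt) (r : R) : ball a r `<=` [set x : pt | `|a - x| <= r].
Proof. by move=> x; rewrite -ball_normE /ball_ /= => /ltW. Qed.

Lemma eq0_off_partial f K i : closed K -> (forall x, ~ K x -> f x = 0) ->
  forall x, ~ K x -> D i f x = 0.
Proof.
move=> cK f0 x nK; have -> : D i f x = D i (cst 0 : pt -> R) x; last by rewrite derive_cst.
apply: near_eq_derive; have := closed_openC cK; rewrite openE => /(_ x nK); apply: filterS => y; exact: f0.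
Qed.

Lemma test_partial O phi i : test_function O phi -> test_function O (D i phi).
Proof.
move=> [sphi [K [cK KO phi0]]]; split; first exact: smooth_partial.
exists K; split=> //; apply: eq0_off_partial => //.
by apply: compact_closed => //; exact: norm_hausdorff.
Qed.

Lemma test_cst0 O : test_function O (cst 0 : pt -> R).
Proof. by split; [exact: smooth_cst|exists set0; split=> //; exact: compact0]. Qed.

Lemma testD O f g : test_function O f -> test_function O g ->
  test_function O (fun x => f x + g x).
Proof.
move=> [sf [K [cK KO f0]]] [sg [L [cL LO g0]]]; split; first exact: smoothD.
exists (K `|` L); split=> [|x []|x /not_orP[nK nL]]; first exact: compactU.
- exact: KO.
- exact: LO.
- by rewrite f0// g0// addr0.
Qed.

Lemma testM O f g : smooth f -> test_function O g -> test_function O (fun x => f x * g x).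
Proof.
move=> sf [sg [L [cL LO g0]]]; split; first exact: smoothM.
by exists L; split=> // x nL; rewrite g0// mulr0.
Qed.

Lemma testZ O (c : R) g : test_function O g -> test_function O (fun x => c * g x).
Proof. by move=> tg; apply: (testM (smooth_cst c)). Qed.

Lemma test_sum O (T : Type) (s : seq T) (F : T -> pt -> R) :
  (forall k, test_function O (F k)) -> test_function O (fun x => \sum_(k <- s) F k x).
Proof.
move=> tF; elim: s => [|k s IH].
  rewrite (_ : (fun _ => _) = cst 0); first exact: test_cst0.
  by apply/funext => x; rewrite big_nil.
rewrite (_ : (fun _ => _) = (fun x => F k x + \sum_(l <- s) F l x)).
  exact: testD.
by apply/funext => x; rewrite big_cons.
Qed.

Lemma test_sub O O' phi : O `<=` O' -> test_function O phi -> test_function O' phi.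
Proof.
move=> OO [sphi [K [cK KO phi0]]]; split=> //; exists K; split=> //.
exact: subset_trans OO.
Qed.

Lemma test_bump O (a : pt) (r : R) : 0 < r ->
  [set x : pt | `|a - x| <= r] `<=` O -> test_function O (bump a r).
Proof.
move=> r0 KO; split; first exact: smooth_bump.
exists [set x : pt | `|a - x| <= r]; split=> //; first exact: compact_closed_cube.
by move=> x nK; apply: bump_eq0 => // /ball_sub_cball.
Qed.

Lemma cont_compact_bounded f K : compact K -> continuous f -> (forall x, ~ K x -> f x = 0) ->
  exists2 M : R, 0 <= M & forall x, `|f x| <= M.
Proof.
move=> cK cf f0.
have : compact (f @` K) by apply: continuous_compact => //; apply: continuous_subspaceT.
move=> /compact_bounded[M [_ /(_ (`|M| + 1))]] hM.
have {}hM : forall y, (f @` K) y -> `|y| <= `|M| + 1.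
  by apply: hM; have := ler_norm M; lra.
exists (`|M| + 1) => [|x]; first by rewrite addr_ge0.
have [Kx|nKx] := pselect (K x); first by apply: hM; exists x.
by rewrite f0// normr0 addr_ge0.
Qed.

Lemma test_bounded O phi : test_function O phi ->
  exists2 M : R, 0 <= M & forall x, `|phi x| <= M.
Proof.
move=> [sphi [K [cK _ phi0]]]; apply: cont_compact_bounded cK _ phi0.
exact: smooth_continuous.
Qed.

Lemma is_derive_line f (x v : pt) (t : R) : smooth f ->
  is_derive t (1 : R) (fun s : R => f (x + s *: v)) ('D_v f (x + t *: v)).
Proof.
move=> sf; pose g s := f (x + s *: v).
have E : (fun h : R => h^-1 *: ((g \o shift t) (h *: (1 : R)) - g t)) =
   (fun h : R => h^-1 *: ((f \o shift (x + t *: v)) (h *: v) - f (x + t *: v))).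
  apply/funext => h; rewrite /g /=; congr (_ *: (f _ - _)).
  by rewrite -[h%:A]/(h * 1) mulr1 scalerDl addrCA.
apply: DeriveDef; first by rewrite /derivable E; exact: smooth_derivable.
by rewrite /derive E.
Qed.

Lemma mvt_line f (x v : pt) : smooth f ->
  exists2 t : R, 0 <= t <= 1 & f (x + v) - f x = 'D_v f (x + t *: v).
Proof.
move=> sf; have dl t := is_derive_line x v t sf.
have cl : {within `[0, 1], continuous (fun s : R => f (x + s *: v))}.
  apply: continuous_subspaceT => t; apply: differentiable_continuous.
  by apply/derivable1_diffP; case: (dl t).
have [t] := MVT_segment ler01 (fun t _ => dl t) cl.
rewrite in_itv /= => t01; rewrite scale1r scale0r addr0 subr0 mulr1 => h.
by exists t.
Qed.

Lemma smooth_lip f (M : R) : smooth f -> (forall i x, `|D i f x| <= M) ->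
  forall x v, `|f (x + v) - f x| <= d%:R * M * `|v|.
Proof.
move=> sf hM x v; have [t _ ->] := mvt_line x v sf.
rewrite derive_row; last exact: smooth_diff.
apply: le_trans (ler_norm_sum _ _ _) _.
apply: le_trans (_ : \sum_(i < d) M * `|v| <= _); last first.
  by rewrite sumr_const card_ord -[_ *+ d]mulr_natl mulrA.
apply: ler_sum => i _; rewrite normrM mulrC; apply: ler_pM => //.
exact: row_norm_coord.
Qed.

(** The mean value theorem along the segment turns the remainder into increments of first partials,
    and these are Lipschitz because the second partials are bounded. *)
Lemma test_taylor2 O phi : test_function O phi -> exists2 C : R, 0 <= C &
  forall x k, `|phi (x + k) - phi x - \sum_i D i phi x * k 0 i| <= C * `|k| ^+ 2.
Proof.
move=> tphi.
have [M0 hM0] : {M : 'I_d -> 'I_d -> R & forall i j, 0 <= M i j /\ forall x, `|D j (D i phi) x| <= M i j}.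
  apply: (@choice _ _ (fun i (M : 'I_d -> R) => forall j, 0 <= M j /\ forall x, `|D j (D i phi) x| <= M j)) => i.
  have [j|M hM] := @choice _ _ (fun j (M : R) => 0 <= M /\ forall x, `|D j (D i phi) x| <= M); last by exists M.
  by have [M M0 hM] := test_bounded (test_partial j (test_partial i tphi)); exists M.
pose M := \sum_i \sum_j M0 i j.
have M0ge i j : 0 <= M0 i j by case: (hM0 i j).
have Mge0 : 0 <= M by apply: sumr_ge0 => i _; apply: sumr_ge0.
have hM i j x : `|D j (D i phi) x| <= M.
  case: (hM0 i j) => _ /(_ x) h; apply: (le_trans h).
  rewrite /M (bigD1 i)//= (bigD1 j)//= -addrA lerDl addr_ge0//.
    exact: sumr_ge0.
  by apply: sumr_ge0 => ? _; apply: sumr_ge0.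
have sphi := tphi.1.
exists (d%:R * (d%:R * M)) => [|x k]; first by rewrite !mulr_ge0.
have [t /andP[t0 t1] ->] := mvt_line x k sphi.
rewrite derive_row; last exact: smooth_diff.
rewrite -sumrB; apply: le_trans (ler_norm_sum _ _ _) _.
apply: le_trans (_ : \sum_(i < d) d%:R * M * `|k| ^+ 2 <= _); last first.
  by rewrite sumr_const card_ord -[_ *+ d]mulr_natl mulrA.
apply: ler_sum => i _; rewrite [D i phi x * _]mulrC -mulrBr normrM mulrC expr2 mulrA.
apply: ler_pM => //; last exact: row_norm_coord.
apply: le_trans (smooth_lip (smooth_partial i sphi) (hM i) _ _) _.
rewrite ler_wpM2l ?mulr_ge0// normrZ ger0_norm// ler_piMl//.
Qed.

End test_functions.

(** * Integrable and square integrable functions *)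

Section real_integrals.
Context {dT : measure_display} {T : measurableType dT} {R : realType}
  (mu : {measure set T -> \bar R}) (D : set T).
Hypothesis mD : measurable D.
Implicit Types (f g h : T -> R).

Definition intg f := mu.-integrable D (EFin \o f).

Lemma intg_mf f : intg f -> measurable_fun D f.
Proof. by move=> /measurable_int /measurable_EFinP. Qed.

Lemma intgD f g : intg f -> intg g -> intg (fun x => f x + g x).
Proof. by move=> If Ig; exact: (integrableD mD If Ig). Qed.

Lemma intgZ (c : R) f : intg f -> intg (fun x => c * f x).
Proof. by move=> If; exact: (integrableZl mD c If). Qed.

Lemma intgN f : intg f -> intg (fun x => - f x).
Proof. by move=> If; exact: (integrableN If). Qed.

Lemma intgB f g : intg f -> intg g -> intg (fun x => f x - g x).
Proof. by move=> If Ig; apply: intgD => //; exact: intgN. Qed.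

Lemma intg0 : intg (fun=> 0).
Proof. exact: integrable0. Qed.

Lemma intg_sum (I : Type) (s : seq I) (F : I -> T -> R) :
  (forall i, intg (F i)) -> intg (fun x => \sum_(i <- s) F i x).
Proof.
move=> IF; elim: s => [|i s IH].
  by rewrite /intg (_ : (fun _ => _) = fun=> 0); [exact: intg0|apply/funext => x; rewrite big_nil].
rewrite (_ : (fun _ => _) = fun x => F i x + \sum_(j <- s) F j x); first exact: intgD.
by apply/funext => x; rewrite big_cons.
Qed.

Lemma intg_le f g : measurable_fun D f -> intg g ->
  (forall x, D x -> `|f x| <= g x) -> intg f.
Proof.
move=> mf Ig fg; apply: le_integrable Ig => //; first exact/measurable_EFinP.
by move=> x Dx /=; rewrite lee_fin (le_trans (fg _ Dx))// ler_norm.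
Qed.

Lemma intg_eq f g : {in D, f =1 g} -> intg f -> intg g.
Proof.
by move=> fg; apply: eq_integrable => // x xD /=; rewrite fg.
Qed.

Lemma intg_norm f : intg f -> intg (fun x => `|f x|).
Proof. by move=> If; apply: (integrable_norm If). Qed.

Lemma intg_mulb f g (M : R) : intg f -> measurable_fun D g ->
  (forall x, D x -> `|g x| <= M) -> intg (fun x => f x * g x).
Proof.
move=> If mg gM.
apply: (@intg_le _ (fun x => M * `|f x|)).
- by apply: measurable_funM => //; exact: intg_mf.
- by apply: intgZ; exact: intg_norm.
- by move=> x Dx; rewrite normrM mulrC ler_wpM2r// gM.
Qed.

Lemma RintD f g : intg f -> intg g ->
  \int[mu]_(x in D) (f x + g x) = \int[mu]_(x in D) f x + \int[mu]_(x in D) g x.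
Proof. by move=> If Ig; rewrite RintegralD. Qed.

Lemma RintZ (c : R) f : intg f ->
  \int[mu]_(x in D) (c * f x) = c * \int[mu]_(x in D) f x.
Proof. by move=> If; rewrite RintegralZl. Qed.

Lemma RintN f : intg f -> \int[mu]_(x in D) (- f x) = - \int[mu]_(x in D) f x.
Proof.
move=> If; rewrite -mulN1r -RintZ//; apply: eq_Rintegral => x _; by rewrite mulN1r.
Qed.

Lemma RintB f g : intg f -> intg g ->
  \int[mu]_(x in D) (f x - g x) = \int[mu]_(x in D) f x - \int[mu]_(x in D) g x.
Proof. by move=> If Ig; rewrite RintegralB. Qed.

Lemma Rint0 : \int[mu]_(x in D) (0 : R) = 0.
Proof. by rewrite /Rintegral integral0. Qed.

Lemma Rint_sum (I : Type) (s : seq I) (F : I -> T -> R) :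
  (forall i, intg (F i)) ->
  \int[mu]_(x in D) (\sum_(i <- s) F i x) = \sum_(i <- s) \int[mu]_(x in D) F i x.
Proof.
move=> IF; elim: s => [|i s IH].
  by rewrite big_nil -[RHS]Rint0; apply: eq_Rintegral => x _; rewrite big_nil.
rewrite big_cons -IH -RintD//; last exact: intg_sum.
by apply: eq_Rintegral => x _; rewrite big_cons.
Qed.

Lemma le_Rint f g : intg f -> intg g -> (forall x, D x -> f x <= g x) ->
  \int[mu]_(x in D) f x <= \int[mu]_(x in D) g x.
Proof. by move=> If Ig fg; apply: le_Rintegral. Qed.

Lemma Rint_ae f g : measurable_fun D f -> measurable_fun D g -> ae_eq mu D f g ->
  \int[mu]_(x in D) f x = \int[mu]_(x in D) g x.
Proof.
move=> mf mg fg; rewrite /Rintegral; congr fine.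
apply: ae_eq_integral => //; [exact/measurable_EFinP..|].
by apply: filterS fg => x h Dx /=; rewrite h.
Qed.

Lemma intg_ae f g : intg f -> measurable_fun D g -> ae_eq mu D f g -> intg g.
Proof.
move=> If mg fg; apply/integrableP; split; first exact/measurable_EFinP.
rewrite -(@ae_eq_integral _ _ _ mu D _ (fun x => (`|(f x)%:E|)%E))//.
- by have /integrableP[] := If.
- by apply: measurableT_comp => //; apply/measurable_EFinP; exact: intg_mf.
- by apply: measurableT_comp => //; exact/measurable_EFinP.
- by apply: filterS fg => x h Dx /=; rewrite h.
Qed.

(** The function [max f g] equals [g] almost everywhere and dominates [f] everywhere, which reduces
    the claim to a pointwise comparison. *)
Lemma le_Rint_ae f g : intg f -> intg g ->
  {ae mu, forall x, D x -> f x <= g x} ->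
  \int[mu]_(x in D) f x <= \int[mu]_(x in D) g x.
Proof.
move=> If Ig fg.
have mm : measurable_fun D (fun x => Num.max (f x) (g x)).
  by apply: measurable_maxr; exact: intg_mf.
have ae : ae_eq mu D g (fun x => Num.max (f x) (g x)).
  by apply: filterS fg => x h Dx; rewrite max_r// h.
rewrite (Rint_ae _ mm ae); last exact: intg_mf.
apply: le_Rint => // [|x Dx]; last by rewrite le_max lexx.
exact: intg_ae ae.
Qed.

Lemma Rint_ge0 f : (forall x, D x -> 0 <= f x) -> 0 <= \int[mu]_(x in D) f x.
Proof. by move=> f0; apply: Rintegral_ge0. Qed.

Lemma Rint_norm f : intg f ->
  `|\int[mu]_(x in D) f x| <= \int[mu]_(x in D) `|f x|.
Proof. by move=> If; apply: le_normr_Rintegral. Qed.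

Lemma EFin_Rint f : intg f -> (\int[mu]_(x in D) f x)%:E = (\int[mu]_(x in D) (f x)%:E)%E.
Proof. by move=> If; rewrite /Rintegral fineK// integrable_fin_num. Qed.

Lemma Rint_eq0 f : intg f -> (forall x, D x -> 0 <= f x) ->
  \int[mu]_(x in D) f x = 0 -> ae_eq mu D f (cst 0).
Proof.
move=> If f0 h.
have : (\int[mu]_(x in D) `|(f x)%:E|)%E = 0%E.
  rewrite -[RHS]/(0%:E) -h EFin_Rint//; apply: eq_integral => x /set_mem Dx.
  by rewrite gee0_abs// lee_fin f0.
move/(ae_eq_integral_abs mu mD (measurable_int _ If)).
by apply: filterS => x h' Dx; have := h' Dx => -[].
Qed.

Lemma dominated_Rint (f_ : nat -> T -> R) f g :
  (forall n, measurable_fun D (f_ n)) -> measurable_fun D f -> intg g ->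
  {ae mu, forall x, D x -> f_ n x @[n --> \oo] --> f x} ->
  {ae mu, forall x, D x -> forall n, `|f_ n x| <= g x} ->
  intg f /\ \int[mu]_(x in D) f_ n x @[n --> \oo] --> \int[mu]_(x in D) f x.
Proof.
move=> mf_ mf Ig cf bf.
have m1 n : measurable_fun D (fun x => (f_ n x)%:E) by apply/measurable_EFinP.
have m2 : measurable_fun D (EFin \o f) by apply/measurable_EFinP.
have m3 : {ae mu, forall x, D x -> (f_ n x)%:E @[n --> \oo] --> (EFin \o f) x}.
  by apply: filterS cf => x h Dx; apply/fine_cvgP; split; [exact: nearW|exact: h].
have m4 : {ae mu, forall x, forall n, D x -> (`|(f_ n x)%:E| <= (EFin \o g) x)%E}.
  by apply: filterS bf => x h n Dx; rewrite lee_fin h.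
have [If _ h] := dominated_convergence mD m1 m2 m3 Ig m4.
split=> //; rewrite /Rintegral; apply: fine_cvg.
by rewrite fineK//; apply: integrable_fin_num.
Qed.

Lemma intg_cst (M : R) : (mu D < +oo)%E -> intg (fun=> M).
Proof.
move=> fD; apply/integrableP; split; first exact/measurable_EFinP/measurable_cst.
by rewrite /= integral_cst// lte_mul_pinfty// ?lee_fin.
Qed.

Lemma Rint_le_cst f (M : R) : intg f -> (mu D < +oo)%E -> (forall x, D x -> f x <= M) ->
  \int[mu]_(x in D) f x <= M * fine (mu D).
Proof.
move=> If fD fM; rewrite -Rintegral_cst//; apply: le_Rint => //.
exact: intg_cst.
Qed.

End real_integrals.

(** * Square integrable functions and their completeness *)

Section L2_space.
Context {dT : measure_display} {T : measurableType dT} {R : realType}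
  (mu : {measure set T -> \bar R}) (D : set T).
Hypothesis mD : measurable D.
Implicit Types (f g h : T -> R).
Local Notation intg := (intg mu D).

Definition L2 f := measurable_fun D f /\ intg (fun x => f x ^+ 2).

Definition ip2 f g : R := \int[mu]_(x in D) (f x * g x).

Lemma L2_mul f g : L2 f -> L2 g -> intg (fun x => f x * g x).
Proof.
move=> [mf If] [mg Ig]; apply: (intg_le mD (g := fun x => f x ^+ 2 + g x ^+ 2)).
- exact: measurable_funM.
- exact: intgD.
- move=> x Dx; have := sqr_ge0 (f x - g x); have := sqr_ge0 (f x + g x).
  by rewrite ler_norml sqrrB sqrrD; lra.
Qed.

Lemma L2_0 : L2 (0 : T -> R).
Proof.
split; first exact: measurable_cst.
by rewrite (_ : (fun _ => _) = fun=> 0); [exact: intg0|apply/funext => x; rewrite expr0n].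
Qed.

Lemma L2DZ (a : R) f g : L2 f -> L2 g -> L2 (a *: f + g).
Proof.
move=> Lf Lg; have [mf If] := Lf; have [mg Ig] := Lg; split.
  by apply: measurable_funD => //; apply: measurable_funM => //; exact: measurable_cst.
apply: (@intg_eq _ _ _ _ _ mD (fun x => a ^+ 2 * f x ^+ 2 + (2 * a * (f x * g x) + g x ^+ 2))).
  move=> x _; rewrite -[(a *: f + g) x]/(a * f x + g x); ring.
do 2?apply: intgD => //; apply: intgZ => //; exact: L2_mul.
Qed.

Lemma L2_subspace : subspace L2.
Proof. by split; [exact: L2_0|move=> a f g; exact: L2DZ]. Qed.

Lemma L2D f g : L2 f -> L2 g -> L2 (fun x => f x + g x).
Proof. exact: (subD L2_subspace). Qed.
Lemma L2B f g : L2 f -> L2 g -> L2 (fun x => f x - g x).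
Proof. exact: (subB L2_subspace). Qed.
Lemma L2Z (a : R) f : L2 f -> L2 (fun x => a * f x).
Proof. exact: (subZ L2_subspace a). Qed.
Lemma L2_sum (I : Type) (s : seq I) (F : I -> T -> R) :
  (forall i, L2 (F i)) -> L2 (fun x => \sum_(i <- s) F i x).
Proof.
move=> LF; elim: s => [|i s IH].
  by rewrite (_ : (fun _ => _) = 0); [exact: L2_0|apply/funext => x; rewrite big_nil].
rewrite (_ : (fun _ => _) = fun x => F i x + \sum_(j <- s) F j x); first exact: L2D.
by apply/funext => x; rewrite big_cons.
Qed.

Lemma L2_semi_ip : semi_ip L2 ip2.
Proof.
split=> [|a f g h Lf Lg Lh|f g Lf Lg|f Lf].
- exact: L2_subspace.
- rewrite /ip2 -RintZ//; last exact: L2_mul.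
  rewrite -RintD//; [|by apply: intgZ => //; exact: L2_mul|exact: L2_mul].
  by apply: eq_Rintegral => x _; rewrite !fctE /GRing.scale/=; ring.
- by apply: eq_Rintegral => x _; rewrite mulrC.
- by apply: Rint_ge0 => x _; rewrite -expr2 sqr_ge0.
Qed.

Lemma L2_le f g : measurable_fun D f -> L2 g -> (forall x, D x -> `|f x| <= `|g x|) -> L2 f.
Proof.
move=> mf [mg Ig] fg; split=> //.
apply: (intg_le mD _ Ig); first exact: measurable_funX.
move=> x Dx; rewrite normrX -[g x ^+ 2]real_normK ?num_real//.
by rewrite ler_pXn2r ?nnegrE// fg.
Qed.

Lemma L2_mulb f g (M : R) : L2 f -> measurable_fun D g ->
  (forall x, D x -> `|g x| <= M) -> L2 (fun x => g x * f x).
Proof.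
move=> Lf mg gM; apply: (@L2_le _ (fun x => M * f x)).
- by apply: measurable_funM => //; case: Lf.
- exact: L2Z.
- by move=> x Dx; rewrite !normrM ler_wpM2r// (le_trans (gM x Dx))// ler_norm.
Qed.

Lemma L2_ae f g : L2 f -> measurable_fun D g -> ae_eq mu D f g -> L2 g.
Proof.
move=> [mf If] mg fg; split=> //; apply: (intg_ae mD If); first exact: measurable_funX.
by apply: filterS fg => x h Dx; rewrite h.
Qed.

Lemma ip2_ae f g f' g' : L2 f -> L2 g -> L2 f' -> L2 g' ->
  ae_eq mu D f f' -> ae_eq mu D g g' -> ip2 f g = ip2 f' g'.
Proof.
move=> [mf _] [mg _] [mf' _] [mg' _] ff gg; apply: (Rint_ae mD).
- exact: measurable_funM.
- exact: measurable_funM.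
- by apply: filterS2 ff gg => x h1 h2 Dx; rewrite h1// h2.
Qed.

Lemma ip2_sqr f : ip2 f f = \int[mu]_(x in D) (f x ^+ 2).
Proof. by apply: eq_Rintegral => x _; rewrite expr2. Qed.

Lemma ip2_eq0_ae f : L2 f -> ip2 f f = 0 -> ae_eq mu D f (cst 0).
Proof.
move=> [mf If]; rewrite ip2_sqr => f0; have : ae_eq mu D (fun x => f x ^+ 2) (cst 0).
  by apply: (Rint_eq0 mD) => // x _; exact: sqr_ge0.
by apply: filterS => x h Dx; apply/eqP; rewrite -sqrf_eq0; apply/eqP; exact: h.
Qed.

Lemma L2_intg f : (mu D < +oo)%E -> L2 f -> intg f.
Proof.
move=> fD [mf If]; apply: (intg_le mD (g := fun x => 1 + f x ^+ 2)) => //.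
  by apply: intgD => //; exact: intg_cst.
move=> x Dx; rewrite ler_norml; have := sqr_ge0 (f x - 1); have := sqr_ge0 (f x + 1).
rewrite sqrrB sqrrD; lra.
Qed.

Lemma L2_cst (c : R) : (mu D < +oo)%E -> L2 (fun=> c).
Proof. by move=> fD; split; [exact: measurable_cst|exact: intg_cst]. Qed.

(* Riesz-Fischer. For a sequence with [|u_(n+1) - u_n|^2 <= 8^-n] the series
   [G = sum_n 4^n |u_(n+1) - u_n|^2] is integrable and controls the tails
   pointwise: [|u_N - u_n|^2 <= 4 * 4^-n * G]. *)
Lemma L2_fast_complete (u_ : nat -> T -> R) : (forall n, L2 (u_ n)) ->
  (forall n, ip2 (u_ n.+1 - u_ n) (u_ n.+1 - u_ n) <= 8 ^- n) ->
  exists f, [/\ L2 f, cvg_ip ip2 u_ f &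
    {ae mu, forall x, D x -> u_ n x @[n --> \oo] --> f x}].
Proof.
move=> Lu du; pose w n x := 4 ^+ n * (u_ n.+1 x - u_ n x) ^+ 2.
have w0 n x : 0 <= w n x by rewrite mulr_ge0 ?sqr_ge0// exprn_ge0.
have Ld n : L2 (fun x => u_ n.+1 x - u_ n x) by exact: L2B.
have Iw n : intg (w n) by apply: intgZ => //; case: (Ld n).
have Rw n : \int[mu]_(x in D) w n x <= 2 ^- n.
  rewrite RintZ//; last by case: (Ld n).
  have := du n; rewrite ip2_sqr => h.
  apply: le_trans (ler_wpM2l (exprn_ge0 _ (ler0n _ 4)) h) _.
  have -> : 8 ^+ n = 4 ^+ n * 2 ^+ n :> R by rewrite -exprMn; congr (_ ^+ _); ring.
  rewrite invfM mulrA divff ?mul1r//.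
pose G x : \bar R := (\sum_(0 <= n <oo) (w n x)%:E)%E.
have mw n : measurable_fun D (fun x => (w n x)%:E).
  by apply/measurable_EFinP; exact: (intg_mf (Iw n)).
have mG : measurable_fun D G.
  by apply: ge0_emeasurable_sum => // n x Dx _; rewrite lee_fin.
have G0 x : (0 <= G x)%E by apply: nneseries_ge0 => n _ _; rewrite lee_fin.
have IG : mu.-integrable D G.
  apply/integrableP; split=> //.
  under eq_integral => x _ do rewrite gee0_abs//.
  rewrite integral_nneseries//; last by move=> n x _; rewrite lee_fin.
  apply: (@le_lt_trans _ _ 2%:E); last exact: ltry.
  apply: lime_le.
    by apply: is_cvg_nneseries => n _ _; apply: integral_ge0 => x _; rewrite lee_fin.
  apply: nearW => n; rewrite big_mkord.
  apply: (@le_trans _ _ (\sum_(i < n) (2 ^- i : R)%:E)%E).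
    by apply: lee_sum => i _; rewrite -EFin_Rint// lee_fin.
  rewrite sumEFin lee_fin.
  have := geometric_le_lim n (ler01 : 0 <= (1:R)) (_ : 0 < (2^-1 : R)) _.
  rewrite invr_gt0 ltr0n ger0_norm ?invr_ge0// => /(_ isT).
  rewrite invf_lt1 ?ltr1n// => /(_ isT).
  rewrite (_ : 1 - 2^-1 = 2^-1 :> R) ?div1r ?invrK; last lra.
  rewrite /series/= big_mkord; congr (_ <= _); apply: eq_bigr => i _.
  by rewrite mul1r exprVn.
pose g x := fine (G x).
have gw x n : G x \is a fin_num -> w n x <= g x.
  move=> fG; rewrite -lee_fin fineK//.
  apply: le_trans (_ : (\sum_(0 <= i < n.+1) (w i x)%:E <= _)%E).
    rewrite big_nat_recr//= leeDr// sume_ge0// => i _; by rewrite lee_fin.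
  by apply: nneseries_lim_ge => i _ _; rewrite lee_fin.
have g0 x : 0 <= g x by apply: fine_ge0.
(* The factor [1 - 2 ^- N] is the partial geometric sum; with it the induction on [N] closes
   exactly. *)
have tail x N n : G x \is a fin_num -> `|u_ (n + N)%N x - u_ n x| <= 2 * Num.sqrt (g x) * 2 ^- n * (1 - 2 ^- N).
  move=> fG; elim: N => [|N IH]; first by rewrite addn0 subrr normr0 expr0 invr1 subrr mulr0.
  have step : `|u_ (n + N).+1 x - u_ (n + N)%N x| <= Num.sqrt (g x) * 2 ^- (n + N).
    rewrite -(@ler_pXn2r _ 2)// ?nnegrE ?mulr_ge0 ?sqrtr_ge0 ?invr_ge0 ?exprn_ge0//.
    rewrite exprMn sqr_sqrtr// real_normK ?num_real// -exprVn -exprM mulnC exprM exprVn.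
    rewrite exprVn ler_pdivlMr ?exprn_gt0// mulrC.
    by rewrite (_ : 2 ^+ 2 = 4 :> R) ?natrX//; [exact: gw|rewrite -natrX].
  rewrite addnS (_ : _ - _ = (u_ (n + N).+1 x - u_ (n + N)%N x) + (u_ (n + N)%N x - u_ n x)); last by ring.
  apply: le_trans (ler_normD _ _) _; apply: le_trans (lerD step IH) _.
  rewrite exprD invfM exprS invfM; set a := 2 ^- n; set b := 2 ^- N; set s := Num.sqrt _.
  by rewrite le_eqVlt; apply/orP; left; apply/eqP; field.
have aeG : {ae mu, forall x, D x -> G x \is a fin_num} by exact: (integrable_ae mD IG).
pose E := D `&` [set x | G x \is a fin_num].
have mE : measurable E.
  exact: emeasurable_fin_num.
have small (e c : R) : 0 < e -> 0 <= c -> exists n, forall m, (n <= m)%N -> c * 2 ^- m < e.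
  move=> e0 c0; exists (Num.truncn (c / e)) => m nm.
  rewrite ltr_pdivrMr ?exprn_gt0// -ltr_pdivrMl// mulrC.
  apply: lt_le_trans (truncnS_gt _) _; rewrite -natrX ler_nat.
  by apply: leq_trans (ltn_expl m (ltnSn 1)); rewrite ltnS.
have tail' x N n : G x \is a fin_num -> (n <= N)%N -> `|u_ N x - u_ n x| <= 2 * Num.sqrt (g x) * 2 ^- n.
  move=> fG nN; have := tail x (N - n)%N n fG; rewrite subnKC// => h; apply: le_trans h _.
  by rewrite ler_piMr// ?gerBl ?invr_ge0 ?exprn_ge0// !mulr_ge0// ?sqrtr_ge0// invr_ge0 exprn_ge0.
have cvgu x : E x -> cvgn (fun n => u_ n x).
  move=> [Dx fG]; apply: cauchy_cvg; apply: cauchy_exP => e e0.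
  have [n hn] := small e (2 * Num.sqrt (g x)) e0 (mulr_ge0 (ler0n _ 2) (sqrtr_ge0 _)).
  exists (u_ n x); exists n => // m /= nm; rewrite -ball_normE /ball_/= distrC.
  by apply: le_lt_trans (tail' _ _ _ fG nm) _; exact: hn.
(* Truncation to the set where [G] is finite makes the sequence converge at every point, so its
   limit is measurable; almost everywhere nothing changes. *)
pose v n x := u_ n x * \1_E x.
have mE1 : measurable_fun D (\1_E : T -> R) by exact: measurable_indic.
have mv n : measurable_fun D (v n) by apply: measurable_funM => //; case: (Lu n).
have vE n x : E x -> v n x = u_ n x by move=> Ex; rewrite /v indicE mem_set// mulr1.
have v0 n x : ~ E x -> v n x = 0 by move=> Ex; rewrite /v indicE memNset// mulr0.
have Lv n : L2 (v n).
  apply: (L2_le (mv n) (Lu n)) => x _; rewrite /v normrM ler_piMr//.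
  by rewrite indicE; case: (_ \in _); rewrite ?normr1 ?normr0.
pose f x := limn (v^~ x).
have cv x : v n x @[n --> \oo] --> f x.
  have [Ex|nEx] := pselect (E x).
    rewrite /f (_ : v^~ x = u_^~ x); first exact: cvgu.
    by apply/funext => n; exact: vE.
  rewrite /f (_ : v^~ x = fun=> 0); first exact: is_cvg_cst.
  by apply/funext => n; exact: v0.
have mf : measurable_fun D f by exact: (measurable_fun_cvg mv (fun x _ => cv x)).
have fv n x : D x -> `|f x - v n x| <= 2 * Num.sqrt (g x) * 2 ^- n.
  move=> Dx; have c : `|v N x - v n x| @[N --> \oo] --> `|f x - v n x|.
    by apply: cvg_norm; apply: cvgB; [exact: cv|exact: cvg_cst].
  rewrite -(cvg_lim _ c)//; apply: limr_le; first by apply/cvg_ex; eexists; exact: c.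
  exists n => // N /= nN; have [Ex|nEx] := pselect (E x).
    by rewrite !vE//; apply: tail' => //; case: Ex.
  by rewrite !v0// subrr normr0 !mulr_ge0// ?sqrtr_ge0// invr_ge0 exprn_ge0.
have fv2 n x : D x -> (f x - v n x) ^+ 2 <= 4 * 4 ^- n * g x.
  move=> Dx; rewrite -real_normK ?num_real//.
  apply: le_trans (_ : (2 * Num.sqrt (g x) * 2 ^- n) ^+ 2 <= _).
    by rewrite ler_pXn2r ?nnegrE ?fv// !mulr_ge0// ?sqrtr_ge0// invr_ge0 exprn_ge0.
  rewrite !exprMn sqr_sqrtr// -exprVn -exprM mulnC exprM exprVn.
  rewrite (_ : 2 ^+ 2 = 4 :> R); last by rewrite -natrX.
  by rewrite -exprVn mulrAC.
have Ig : intg g.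
  apply: (le_integrable mD _ _ IG).
    by apply/measurable_EFinP; apply: measurableT_comp mG; exact: fine_measurable.
  move=> x Dx /=; rewrite /g; have := G0 x; case: (G x) => [r||]//= _.
  by rewrite normr0 lee_fin ler01 || rewrite normr0 leey.
have Lfv n : L2 (f - v n).
  split; first by apply: measurable_funB.
  apply: (intg_le mD _ (intgZ mD (4 * 4 ^- n) Ig)).
    by apply: measurable_funX; exact: measurable_funB.
  by move=> x Dx; rewrite normrX real_normK ?num_real//; exact: fv2.
have Lf : L2 f.
  have := L2D (Lv 0%N) (Lfv 0%N); rewrite (_ : (fun x => _) = f)//.
  by apply/funext => x; rewrite -[(f - v 0%N) x]/(f x - v 0%N x) addrC subrK.
have aeE : {ae mu, forall x, D x -> E x} by apply: filterS aeG => x h Dx; split=> //; exact: h.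
have ipv n : ip2 (u_ n - f) (u_ n - f) <= 4 * 4 ^- n * \int[mu]_(x in D) g x.
  have Luf : L2 (u_ n - f) by exact: (subB L2_subspace).
  have Lvf : L2 (v n - f) by exact: (subB L2_subspace).
  have ae : ae_eq mu D (u_ n - f) (v n - f).
    by apply: filterS aeE => x h Dx; rewrite -[LHS]/(u_ n x - f x) -[RHS]/(v n x - f x) vE//; exact: h.
  rewrite (ip2_ae Luf Luf Lvf Lvf ae ae) ip2_sqr -RintZ//.
  apply: le_Rint => //; [by case: Lvf|exact: intgZ|].
  by move=> x Dx; rewrite -[(v n - f) x]/(v n x - f x) -sqrrN opprB fv2.
exists f; split => //.
- move=> e e0; have Ig0 : 0 <= \int[mu]_(x in D) g x by apply: Rint_ge0 => x _.
  have [n hn] := small e (4 * \int[mu]_(x in D) g x) e0 (mulr_ge0 (ler0n _ 4) Ig0).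
  exists n => m nm; apply: le_lt_trans (ipv m) _; apply: le_lt_trans (hn m nm).
  rewrite mulrAC; apply: ler_wpM2l; first by rewrite mulr_ge0.
  by rewrite lef_pV2 ?posrE ?exprn_gt0//; apply: lerXn2r; rewrite ?nnegrE// ler_nat.
- apply: filterS aeE => x h Dx; rewrite (_ : (fun n => u_ n x) = v^~ x)//.
  by apply/funext => n; rewrite vE//; exact: h.
Qed.

Lemma L2_complete : complete_ip L2 ip2.
Proof.
move=> u_ Lu Cu.
have [s [s_mono Hs]] : exists s : nat -> nat, (forall n, (s n < s n.+1)%N) /\
    forall n m, (s n <= m)%N -> ip2 (u_ m - u_ (s n)) (u_ m - u_ (s n)) <= 8 ^- n.
  have [N HN] : {N : nat -> nat & forall n p q, (N n <= p)%N -> (N n <= q)%N ->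
      ip2 (u_ p - u_ q) (u_ p - u_ q) < 8 ^- n}.
    apply: (@choice _ _ (fun n N => forall p q, (N <= p)%N -> (N <= q)%N ->
      ip2 (u_ p - u_ q) (u_ p - u_ q) < 8 ^- n)) => n.
    by apply: Cu; rewrite invr_gt0 exprn_gt0.
  pose s := fix s n := if n is m.+1 then maxn (N m.+1) (s m).+1 else N 0%N.
  have sN n : (N n <= s n)%N by case: n => //= n; exact: leq_maxl.
  exists s; split=> [n|n m snm]; first by rewrite /= leq_max ltnSn orbT.
  by apply/ltW/HN => //; exact: leq_trans snm.
have [|f [Lf cf _]] := @L2_fast_complete (u_ \o s) (fun n => Lu (s n)).
  by move=> n; apply: Hs; exact: ltnW.
exists f => // e e0.
have sn n : (n <= s n)%N by elim: n => // n IH; exact: leq_ltn_trans IH (s_mono n).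
have [|N1 HN1] := cf (e / 4); first by rewrite divr_gt0.
have [|N2 HN2] := Cu (e / 4); first by rewrite divr_gt0.
exists N2 => n N2n; pose M := maxn N1 N2.
have -> : u_ n - f = (u_ n - u_ (s M)) + (u_ (s M) - f) by rewrite addrA subrK.
apply: le_lt_trans (ip_le_sqrD L2_semi_ip _ _) _; [exact: (subB L2_subspace)..|].
have h1 := HN1 M (leq_maxl _ _).
have h2 := HN2 n (s M) N2n (leq_trans (leq_maxr N1 N2) (sn M)).
rewrite /= in h1; lra.
Qed.

(** A fast subsequence converges almost everywhere to some [g], and [g - f] has zero norm since both
    are limits in mean square. This lets pointwise constraints, such as bounds on controls, pass to
    the limit. *)
Lemma L2_cvg_subseq_ae (u_ : nat -> T -> R) f : (forall n, L2 (u_ n)) -> L2 f ->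
  cvg_ip ip2 u_ f ->
  exists s : nat -> nat, {ae mu, forall x, D x -> u_ (s n) x @[n --> \oo] --> f x}.
Proof.
move=> Lu Lf uf.
(* The divisor 16 pays for the two distances to [f], each doubled, in the distance between
   consecutive terms. *)
have [s Hs] : {s : nat -> nat & forall n, ip2 (u_ (s n) - f) (u_ (s n) - f) <= 8 ^- n / 16}.
  apply: (@choice _ _ (fun n s => ip2 (u_ s - f) (u_ s - f) <= 8 ^- n / 16)) => n.
  have [|N HN] := uf (8 ^- n / 16); first by rewrite divr_gt0// invr_gt0 exprn_gt0.
  by exists N; rewrite ltW// HN.
have Lus n : L2 (u_ (s n) - f) by exact: (subB L2_subspace).
have [||g [Lg cg ae]] := @L2_fast_complete (u_ \o s).
- by move=> n; exact: Lu.
- move=> n /=; rewrite (_ : _ - _ = (u_ (s n.+1) - f) - (u_ (s n) - f)); last first.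
    by rewrite opprB addrA subrK.
  apply: le_trans (ip_le_sqrD L2_semi_ip _ _) _ => //; first exact: (subN L2_subspace).
  have := Hs n; have := Hs n.+1.
  rewrite [X in _ + 2 * X](_ : _ = ip2 (u_ (s n) - f) (u_ (s n) - f)); last first.
    by apply: eq_Rintegral => x _; rewrite mulrNN.
  have : 8 ^- n.+1 <= 8 ^- n :> R.
    by rewrite lef_pV2 ?posrE ?exprn_gt0// exprS ler_peMl ?exprn_ge0// ler1n.
  have : 0 <= 8 ^- n :> R by rewrite invr_ge0 exprn_ge0.
  set a := 8 ^- n; set b := 8 ^- n.+1; lra.
exists s; have Lgf : L2 (g - f) by exact: (subB L2_subspace).
have gf : ip2 (g - f) (g - f) = 0.
  apply/eqP; rewrite eq_le (sip_ge0 L2_semi_ip)// andbT.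
  suff hh (e : R) : 0 < e -> ip2 (g - f) (g - f) <= 0 + e by apply/ler_addgt0Pr => e; exact: hh.
  move=> e0; have [|N HN] := cg (e / 4); first by rewrite divr_gt0.
  have [n [Nn hn]] : exists n, (N <= n)%N /\ 8 ^- n / 16 < e / 4.
    exists (maxn N (Num.truncn e^-1)); split; first exact: leq_maxl.
    set m := maxn _ _; have : e^-1 < 8 ^+ m.
      apply: lt_le_trans (truncnS_gt _) _; rewrite -natrX ler_nat.
      apply: leq_ltn_trans (leq_maxr N _) _; exact: ltn_expl.
    rewrite -invf_plt ?posrE ?exprn_gt0// => h; lra.
  have h := HN n Nn; have h2 := Hs n.
  have -> : g - f = (g - u_ (s n)) + (u_ (s n) - f) by rewrite addrA subrK.
  apply: le_trans (ip_le_sqrD L2_semi_ip _ _) _ => //; first exact: (subB L2_subspace).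
  rewrite (ip_sqrB_sym L2_semi_ip)//; rewrite /= in h; lra.
apply: filterS2 ae (ip2_eq0_ae Lgf gf) => x h1 h2 Dx.
have <- : g x = f x by apply/eqP; rewrite -subr_eq0; apply/eqP; exact: h2.
exact: h1.
Qed.

End L2_space.

(** * Weak derivatives and Sobolev spaces *)

Section du_bois_reymond.
Context {R : realType} {d : nat}.
Local Notation pt := 'rV[R]_d.
Local Notation mu := (lebesgue_row R d).
Implicit Types (g phi : pt -> R) (O Omega B : set pt).

(** An enumeration of rational balls inside [O] indexed by all naturals. Indices that decode to no
    such ball yield radius 0, hence the guards [0 < (q k).2]. *)
Lemma open_row_unpickle O : open O -> exists q : nat -> pt * R,
  (forall k, 0 < (q k).2 -> ball (q k).1 (q k).2 `<=` O) /\
  (forall x, O x -> exists k, 0 < (q k).2 /\ ball (q k).1 (q k).2 x).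
Proof.
move=> oO.
pose c (p : 'rV[rat]_d * rat) : pt * R := (map_mx ratr p.1, ratr p.2).
exists (fun k => if unpickle k is Some p then
  if `[< ball (c p).1 (c p).2 `<=` O >] then c p else (0, 0) else (0, 0)); split.
  move=> k; case: unpickle => [p|/=]; last by rewrite ltxx.
  by case: asboolP => //=; rewrite ltxx.
move=> x Ox; move: (Ox); rewrite {1}(open_row_bigcup oO) => -[p /= pO xp].
exists (pickle p); rewrite pickleK asboolT//; split=> //.
by case: xp.
Qed.

Lemma ball_shrink (a x : pt) (r : R) : ball a r x -> exists s : R,
  [/\ 0 < s, s < r & ball a s x].
Proof.
rewrite -ball_normE /ball_ /= => h.
exists ((`|a - x| + r) / 2).
by have := normr_ge0 (a - x); split; lra.
Qed.

Lemma vanish_restrict_int g K Omega : (forall x, ~ K x -> g x = 0) -> K `<=` Omega ->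
  \int[mu]_(x in Omega) g x = \int[mu]_(x in K) g x.
Proof.
move=> g0 KO; rewrite [RHS]Rintegral_mkcond [LHS]Rintegral_mkcond; congr Rintegral.
apply/funext => x; rewrite /patch; case: ifPn => [/set_mem xO|/negP nxO].
  by case: ifPn => // /negP xK; rewrite g0// => Kx; apply: xK; exact: mem_set.
by rewrite memNset// => Kx; apply: nxO; apply: mem_set; exact: KO.
Qed.

(** Identifies the coordinate sigma-algebra with the one generated by open sets, a family stable
    under intersection from which a Dynkin induction can start. *)
Lemma measurable_row_open :
  (default_measure_display).-measurable = <<s [set O : set pt | open O] >>.
Proof.
apply/seteqP; split; last first.
  apply: smallest_sub; first exact: sigma_algebra_measurable.
  by move=> O oO; exact: open_measurable_row.
apply: smallest_sub; first exact: smallest_sigma_algebra.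
move=> A; rewrite -bigcup_seq => -[i _ [Y mY <-]].
pose T := g_sigma_algebraType [set O : set pt | open O].
have mf : measurable_fun [set: T] (@row_coord R d i : T -> measurableTypeR R).
  apply: (measurability _ (RGenOInfty.measurableE R)) => _ [_ [a ->] <-].
  rewrite setTI; apply: sub_sigma_algebra => /=; apply: open_comp.
    by move=> x _; exact: coord_continuous.
  by rewrite set_itvE; exact: open_gt.
exact: mf measurableT _ mY.
Qed.

Section dbr.
Context (Omega : set pt) (g : pt -> R).
Hypothesis g_test : forall phi, test_function Omega phi ->
  \int[mu]_(x in Omega) (g x * phi x) = 0.
Context (K : set pt) (B : set pt).
Hypotheses (cK : compact K) (KO : K `<=` Omega) (BK : B `<=` K) (oB : open B).
Hypothesis Ig : intg mu K g.
Let mK := compact_measurable_row cK.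
Let mB := open_measurable_row oB.
Let IgB : intg mu B g.
Proof. exact: (integrableS mK mB BK Ig). Qed.

(** The indicator of [O] is a bounded pointwise limit of the test functions [1 - P n]: off [O] every
    bump [b k] vanishes and [P n] is 1, while at a point of [O] some [b k] is positive and the
    exponent [n] drives the product to 0. *)
Let int_open O : open O -> O `<=` B -> \int[mu]_(x in B) (g x * \1_O x) = 0.
Proof.
move=> oOo OB; have [q [qO qc]] := open_row_unpickle oOo.
pose b k : pt -> R := if 0 < (q k).2 then bump (q k).1 (q k).2 else cst 0.
have sb k : smooth (b k) by rewrite /b; case: ifP => _; [exact: smooth_bump|exact: smooth_cst].
have b0 k x : ~ O x -> b k x = 0.
  rewrite /b; case: ifP => // q0 nO; apply: bump_eq0 => // h; apply: nO.
  exact: qO h.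
have b01 k x : 0 <= b k x <= 1.
  by rewrite /b; case: ifP => _; rewrite ?bump_ge0 ?bump_le1// lexx ler01.
pose P n x := \prod_(k < n) (1 - b k x) ^+ n.
have P01 n x : 0 <= P n x <= 1.
  apply: (big_ind (fun y : R => 0 <= y <= 1)) => [|y z|i _]; first by rewrite ler01 lexx.
    by move=> /andP[y0 y1] /andP[z0 z1]; rewrite mulr_ge0//= mulr_ile1.
  have /andP[h0 h1] := b01 i x.
  by rewrite exprn_ge0 ?subr_ge0//= exprn_ile1// ?subr_ge0// gerBl.
have sP n : smooth (fun x => 1 - P n x).
  apply: smoothB; first exact: smooth_cst.
  apply: smooth_prod => k; apply: smoothX; apply: smoothB => //; exact: smooth_cst.
have P1 n x : ~ O x -> P n x = 1.
  by move=> nO; rewrite /P big1// => k _; rewrite b0// subr0 expr1n.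
have tP n : test_function Omega (fun x => 1 - P n x).
  split=> //; exists K; split=> // x nK; rewrite P1 ?subrr// => Ox; apply: nK.
  exact/BK/OB.
have mP n : measurable_fun setT (fun x => 1 - P n x) by exact: smooth_measurable.
have cvgP x : 1 - P n x @[n --> \oo] --> (\1_O x : R).
  have [Ox|nO] := pselect (O x); last first.
    rewrite indicE memNset//; apply: cvg_near_cst; apply: nearW => n.
    by rewrite P1// subrr.
  rewrite indicE mem_set// -[X in _ --> X]subr0; apply: cvgB; first exact: cvg_cst.
  have [k [q0 kx]] := qc x Ox.
  have bk : 0 < b k x by rewrite /b q0 bump_gt0.
  have /andP[_ bk1] := b01 k x.
  apply: (@squeeze_cvgr _ _ _ _ (fun=> 0) (fun n => (1 - b k x) ^+ n)); last 2 first.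
  - exact: cvg_cst.
  - by apply: cvg_expr; rewrite ger0_norm ?subr_ge0// gtrBl.
  exists k.+1 => // n /= kn; have /andP[-> _] /= := P01 n x.
  rewrite /P (bigD1 (Ordinal kn))//= ler_piMr ?exprn_ge0 ?subr_ge0//.
  apply: prodr_ile1 => i _.
  have /andP[h0 h1] := b01 i x.
  by rewrite exprn_ge0 ?subr_ge0//= exprn_ile1// ?subr_ge0// gerBl.
have i0 n : \int[mu]_(x in B) (g x * (1 - P n x)) = 0.
  rewrite -(g_test (tP n)) [RHS](@vanish_restrict_int _ B)//.
    by move=> x nB; rewrite P1 ?subrr ?mulr0// => /OB.
  exact: subset_trans KO.
have mO1 : measurable_fun B (\1_O : pt -> R).
  by apply: measurable_funTS; apply: measurable_indic; exact: open_measurable_row.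
have mgP n : measurable_fun B (fun x => g x * (1 - P n x)).
  by apply: measurable_funM; [exact: intg_mf IgB|exact: measurable_funTS].
have mgO : measurable_fun B (fun x => g x * \1_O x).
  by apply: measurable_funM => //; exact: intg_mf IgB.
have bd n x : `|g x * (1 - P n x)| <= `|g x|.
  rewrite normrM ler_piMr// ger0_norm; have /andP[? ?] := P01 n x; rewrite ?subr_ge0//.
  by rewrite gerBl.
have [_ h] := dominated_Rint mB mgP mgO (intg_norm IgB)
  (nearW _ (fun x _ => cvgM (cvg_cst (g x)) (cvgP x)))
  (nearW _ (fun x _ n => bd n x)).
apply: (cvg_unique _ h) => //.
rewrite (_ : (fun n => _) = fun=> 0); first exact: cvg_cst.
by apply/funext => n; exact: i0.
Qed.

(** The sets over which [g] has zero integral form a Dynkin class containing the open sets, hence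
    all measurable sets. *)
Lemma dbr_local : ae_eq mu B g (cst 0).
Proof.
pose Q A := \int[mu]_(x in B) (g x * \1_A x) = 0.
have Ig1 (A : set pt) : measurable A -> intg mu B (fun x => g x * \1_A x).
  move=> mA; apply: (intg_mulb mB (M := 1)) => //.
  by move=> x _; rewrite indicE; case: (_ \in _); rewrite ?normr1 ?normr0.
have QT : Q setT.
  rewrite /Q -[RHS](int_open oB (@subset_refl _ B)); apply: eq_Rintegral => x xB.
  by rewrite !indicE xB in_setT.
have Qm (A : set pt) : measurable A -> Q A.
  move=> mA.
  apply: (dynkin_induction measurable_row_open) => //.
  - by move=> O1 O2 /= o1 o2; exact: openI.
  - move=> O /= oOo; rewrite /Q -[RHS](int_open (openI oOo oB) (@subIsetr _ _ _)).
    by apply: eq_Rintegral => x xB; rewrite !indicE in_setI xB andbT.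
  - move=> A' mA' QA'; rewrite /Q.
    have -> : \int[mu]_(x in B) (g x * \1_(~` A') x) =
        \int[mu]_(x in B) (g x * \1_setT x) - \int[mu]_(x in B) (g x * \1_A' x).
      rewrite -RintB//; [|exact: Ig1..].
      apply: eq_Rintegral => x _; rewrite !indicE in_setT in_setC.
      by case: (_ \in A') => /=; ring.
    by rewrite QT QA' subrr.
  - move=> F mF tF QF; rewrite /Q.
    have S1 n j x : (j < n)%N -> F j x -> \sum_(k < n) \1_(F k) x = 1 :> R.
      move=> jn Fj; rewrite (bigD1 (Ordinal jn))//= big1 ?addr0 ?indicE ?mem_set// => k kj.
      rewrite indicE memNset// => Fk; move/eqP: kj; apply; apply/val_inj => /=.
      by apply: (tF _ _ I I); exists x.
    have S01 n x : `|\sum_(k < n) \1_(F k) x| <= 1 :> R.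
      have [[j Fj]|nF] := pselect (exists j : 'I_n, F j x).
        by rewrite (S1 _ j)// normr1.
      rewrite big1 ?normr0// => k _; rewrite indicE memNset// => Fk; apply: nF; by exists k.
    have cF x : \sum_(k < n) \1_(F k) x @[n --> \oo] --> (\1_(\bigcup_k F k) x : R).
      have [[j _ Fj]|nF] := pselect ((\bigcup_k F k) x); last first.
        apply: cvg_near_cst; apply: nearW => n; rewrite [RHS]indicE memNset//.
        rewrite big1// => k _; rewrite indicE memNset// => Fk; apply: nF; by exists k.
      apply: cvg_near_cst; exists j.+1 => // n /= jn.
      rewrite [RHS]indicE mem_set; last by exists j.
      exact: S1 jn Fj.
    have mcF : measurable (\bigcup_k F k) by exact: bigcup_measurable.
    have mgS n : measurable_fun B (fun x => g x * \sum_(k < n) \1_(F k) x).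
      apply: measurable_funM; first exact: intg_mf IgB.
      by apply: measurable_sum => k; exact: measurable_indic.
    have bd n x : `|g x * \sum_(k < n) \1_(F k) x| <= `|g x| by rewrite normrM ler_piMr.
    have [_ h] := dominated_Rint mB mgS (intg_mf (Ig1 _ mcF)) (intg_norm IgB)
      (nearW _ (fun x _ => cvgM (cvg_cst (g x)) (cF x)))
      (nearW _ (fun x _ n => bd n x)).
    apply: (cvg_unique _ h) => //.
    rewrite (_ : (fun n => _) = fun=> 0); first exact: cvg_cst.
    apply/funext => n; under eq_Rintegral do rewrite mulr_sumr.
    by rewrite Rint_sum// => [|k]; [rewrite big1// => k _; exact: QF|exact: Ig1].
  - by rewrite -measurable_row_open.
have IE : mu.-integrable B (EFin \o g) by [].
have m0 : measurable_fun B (cst 0%E : pt -> \bar R) by exact: measurable_cst.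
have := @integral_ae_eq _ _ _ mu B mB (cst 0%E) (EFin \o g) IE m0 _.
move=> /(_ _)/wrap[E EB mE|].
  rewrite integral0 -EFin_Rint//; last exact: (integrableS mB mE EB IE).
  congr EFin; rewrite -[RHS](Qm E mE).
  rewrite Rintegral_mkcond [RHS]Rintegral_mkcond; congr Rintegral; apply/funext => x.
  rewrite /patch indicE; case: ifPn => [xE|nxE].
    by rewrite mem_set ?mulr1//; apply: EB; exact: set_mem.
  by case: ifPn => //; rewrite mulr0.
by apply: filterS => x h Bx; have := h Bx => -[].
Qed.

End dbr.

(** Since [g] is only locally integrable, the local result is applied on rational cubes of [Omega]
    shrunk by [1/(m+1)]: each lies in a compact subset of [Omega], and countably many of them cover
    [Omega]. *)
Lemma du_bois_reymond Omega g : open Omega -> L1_loc Omega g ->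
  (forall phi, test_function Omega phi -> \int[mu]_(x in Omega) (g x * phi x) = 0) ->
  ae_eq mu Omega g (cst 0).
Proof.
move=> oO [mg Ig] g_test.
have [q [qO qc]] := open_row_unpickle oO.
pose C (n : nat * nat) : set pt := [set x | `|(q n.1).1 - x| <= (q n.1).2 - n.2.+1%:R^-1].
pose B (n : nat * nat) : set pt := ball (q n.1).1 ((q n.1).2 - n.2.+1%:R^-1).
have h n : {ae mu, forall x, B n x -> g x = 0}.
  have [r0|r0] := ltP 0 (q n.1).2; last first.
    apply: nearW => x [/lt_le_trans h _]; exfalso.
    have : (q n.1).2 - n.2.+1%:R^-1 <= 0 by rewrite subr_le0 (le_trans r0)// invr_ge0.
    by move=> /h; rewrite ltxx.
  have cC : compact (C n) by exact: compact_closed_cube.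
  have CO : C n `<=` Omega.
    apply: subset_trans (qO n.1 r0); apply: cball_sub_ball.
    by rewrite ltrBlDr ltrDl invr_gt0.
  apply: (dbr_local g_test cC CO) => //.
  - exact: ball_sub_cball.
  - exact: ball_open.
  - exact: Ig.
have /ae_foralln : forall k, {ae mu, forall x, (if unpickle k is Some n then B n x else False) -> g x = 0}.
  move=> k; case: unpickle => [n|]; [exact: h|exact: nearW].
apply: filterS => x hx Ox.
have [k [r0 kx]] := qc x Ox.
have [s [s0 sr xs]] := ball_shrink kx.
pose m := Num.truncn ((q k).2 - s)^-1.
apply: (hx (pickle (k, m))); rewrite pickleK /B/=.
apply: le_ball xs; rewrite lerBrDr -lerBrDl ltW//.
rewrite invf_plt ?posrE ?subr_gt0//; exact: truncnS_gt.
Qed.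

End du_bois_reymond.

(** * Integrals of test functions and integration by parts *)

Section row_integrals.
Context {R : realType} {d : nat}.
Local Notation pt := 'rV[R]_d.
Local Notation mu := (lebesgue_row R d).
Local Notation D i f := ('D_(@unit_vec R d i) f).
Implicit Types (f g phi : pt -> R) (O Omega K : set pt) (i j : 'I_d).

Lemma bounded_row_ball Omega : bounded_set Omega -> exists2 r : R, 0 < r & Omega `<=` ball 0 r.
Proof.
move=> [M [_ hM]]; exists (`|M| + 2) => [|x Ox]; first by rewrite ltr_pwDr.
rewrite -ball_normE /ball_/= sub0r normrN.
have Mlt : M < `|M| + 1 by rewrite (le_lt_trans (ler_norm M))// ltrDl.
by have /= := hM _ Mlt x Ox; move=> /le_lt_trans; apply; rewrite ltrD2l ltr1n.
Qed.

Lemma bounded_row_lty Omega : measurable Omega -> bounded_set Omega -> (mu Omega < +oo)%E.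
Proof.
move=> mO /bounded_row_ball[r r0 Or].
apply: (@le_lt_trans _ _ (mu (ball 0 r))); last by rewrite lebesgue_row_ball// ltry.
by apply: le_measure; rewrite ?inE//; exact: measurable_row_ball.
Qed.

Lemma compact_row_ball K : compact K -> exists2 r : R, 0 < r & K `<=` ball 0 r.
Proof. by move=> /compact_bounded; exact: bounded_row_ball. Qed.

Lemma measurable_row_shift (z : pt) : measurable_fun setT (fun x : pt => x + z).
Proof.
apply: measurable_fun_rowP => i.
rewrite (_ : _ \o _ = fun x : pt => row_coord i x + z 0 i); last first.
  by apply/funext => x; rewrite /row_coord/= mxE.
by apply: measurable_funD; [exact: measurable_row_coord|exact: measurable_cst].
Qed.

Lemma Rint_shift (z : pt) f : measurable_fun setT f ->
  \int[mu]_x f (x + z) = \int[mu]_x f x.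
Proof.
move=> mf; rewrite /Rintegral; congr fine.
have mp : measurable_fun setT ((EFin \o f)^\+)%E.
  by apply: measurable_funepos; exact/measurable_EFinP.
have mn : measurable_fun setT ((EFin \o f)^\-)%E.
  by apply: measurable_funeneg; exact/measurable_EFinP.
have ep : (\int[mu]_x (EFin \o f)^\+ (x + z)%R = \int[mu]_x (EFin \o f)^\+ x)%E.
  exact: ge0_integral_shift.
have en : (\int[mu]_x (EFin \o f)^\- (x + z)%R = \int[mu]_x (EFin \o f)^\- x)%E.
  exact: ge0_integral_shift.
rewrite [LHS]integralE [RHS]integralE; congr (_ - _)%E.
  by rewrite -[RHS]ep; apply: eq_integral => x _; rewrite !funeposE.
by rewrite -[RHS]en; apply: eq_integral => x _; rewrite !funenegE.
Qed.

Lemma intg_shift (z : pt) f : intg mu setT f -> intg mu setT (fun x => f (x + z)).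
Proof.
move=> If; have mf := intg_mf If; apply/integrableP; split.
  by apply/measurable_EFinP; apply: measurableT_comp => //; exact: measurable_row_shift.
have /integrableP[_] := If; rewrite -(ge0_integral_shift z)//.
by apply: measurableT_comp => //; exact/measurable_EFinP.
Qed.

Lemma intg_bounded_supp f (M r : R) : measurable_fun setT f ->
  (forall x, `|f x| <= M) -> (forall x, ~ ball 0 r x -> f x = 0) -> intg mu setT f.
Proof.
move=> mf fM f0.
have Ig : intg mu setT (fun x => M * \1_(ball (0 : pt) r) x).
  apply: (intgZ measurableT); apply/integrableP; split.
    by apply/measurable_EFinP; apply: measurable_indic; exact: measurable_row_ball.
  rewrite (_ : (fun x => _) = (fun x => (\1_(ball (0 : pt) r) x)%:E)); last first.
    by apply/funext => x; rewrite gee0_abs//= lee_fin.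
  rewrite integral_indic ?setIT//; last exact: measurable_row_ball.
  have [r0|r0] := ltP 0 r; first by rewrite lebesgue_row_ball// ltry.
  rewrite (_ : ball (0 : pt) r = set0) ?measure0//.
  by apply/seteqP; split=> // y [] /lt_geF; rewrite r0.
apply: (intg_le measurableT mf Ig) => x _; rewrite indicE; case: (boolP (x \in _)) => [_|/negP nx]; first by rewrite mulr1.
by rewrite f0 ?normr0 ?mulr0// => h; apply: nx; exact: mem_set.
Qed.

Lemma intg_test O phi : test_function O phi -> intg mu setT phi.
Proof.
move=> tp; have [M _ hM] := test_bounded tp; have [sp [K [cK _ p0]]] := tp.
have [r r0 Kr] := compact_row_ball cK.
apply: (@intg_bounded_supp _ M r) => //; first exact: smooth_measurable.
by move=> x nb; apply: p0 => /Kr.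
Qed.

Lemma Rint_test_setT Omega phi : test_function Omega phi ->
  \int[mu]_(x in Omega) phi x = \int[mu]_x phi x.
Proof.
move=> [sp [K [cK KO p0]]].
by rewrite (vanish_restrict_int p0 KO) [RHS](vanish_restrict_int p0 (@subsetT _ K)).
Qed.

(* By translation invariance [int (F (x + t e_i) - F x) = 0]; divide by [t]. *)
Lemma Rint_partial_test Omega phi i : test_function Omega phi ->
  \int[mu]_(x in Omega) D i phi x = 0.
Proof.
move=> tp; rewrite (Rint_test_setT (test_partial i tp)).
have [sp [K [cK KO p0]]] := tp.
have [r r0 Kr] := compact_row_ball cK.
have [C C0 hC] := test_taylor2 tp.
have Ip := intg_test tp; have IDp := intg_test (test_partial i tp).
pose B : set pt := ball 0 (r + 1).
have mB : measurable B by exact: measurable_row_ball.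
have key (t : R) : 0 < t -> t <= 1 -> t * `|\int[mu]_x D i phi x| <= C * t ^+ 2 * fine (mu B).
  move=> t0 t1; pose e : pt := t *: @unit_vec R d i.
  have ne : `|e| <= t.
    apply: row_norm_le => [|j]; first exact: ltW.
    rewrite /e /unit_vec !mxE eqxx/=; case: eqP => _; rewrite ?mulr1 ?mulr0 ?normr0 ?gtr0_norm//.
    exact: ltW.
  have Is : intg mu setT (fun x => phi (x + e) - phi x - t * D i phi x).
    apply: (intgB measurableT); last exact: (intgZ measurableT).
    by apply: (intgB measurableT) => //; exact: intg_shift.
  have -> : t * `|\int[mu]_x D i phi x| = `|\int[mu]_x (phi (x + e) - phi x - t * D i phi x)|.
    rewrite RintB//; [|by apply: (intgB measurableT) => //; exact: intg_shift|exact: (intgZ measurableT)].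
    rewrite RintB//; last exact: intg_shift.
    rewrite Rint_shift ?subrr ?sub0r ?normrN; last exact: smooth_measurable.
    by rewrite RintZ// normrM (gtr0_norm t0).
  have v0 x : ~ B x -> phi (x + e) - phi x - t * D i phi x = 0.
    move=> nB.
    have nr y : `|y| <= t -> ~ K (x + y).
      move=> yt /Kr; rewrite -ball_normE /ball_/= sub0r normrN => h; apply: nB.
      rewrite /B -ball_normE /ball_/= sub0r normrN.
      rewrite -[x](addrK y); apply: le_lt_trans (ler_normB _ _) _.
      by apply: ltr_leD => //; exact: le_trans t1.
    rewrite (p0 _ (nr e ne)).
    have nK : ~ K x by have := nr 0; rewrite normr0 addr0 => /(_ (ltW t0)).
    have clK : closed K by apply: compact_closed => //; exact: norm_hausdorff.
    by rewrite p0// (eq0_off_partial _ clK p0)// mulr0 !subr0.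
  have Isn := intg_norm Is.
  apply: le_trans (Rint_norm measurableT Is) _.
  rewrite (@vanish_restrict_int _ _ _ B)//; last by move=> x nB; rewrite v0// normr0.
  apply: Rint_le_cst => //; first exact: (integrableS measurableT mB (@subsetT _ _) Isn).
    by rewrite lebesgue_row_ball ?ltry//; lra.
  move=> x _; have := hC x e; rewrite (bigD1 i)//= big1; last first.
    by move=> j ji; rewrite /e /unit_vec !mxE (negbTE ji) andbF !mulr0.
  rewrite addr0 {2}/e /unit_vec !mxE !eqxx/= mulr1 [D i phi x * t]mulrC => h; apply: le_trans h _.
  by rewrite ler_wpM2l// lerXn2r ?nnegrE// ltW.
apply/eqP; rewrite -normr_le0; set a := `| _ | in key *.
have hh (e : R) : 0 < e -> a <= 0 + e.
  move=> e0; have m0 : 0 <= C * fine (mu B) by rewrite mulr_ge0// fine_ge0.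
  pose t := Num.min 1 (e / (C * fine (mu B) + 1)).
  have t0 : 0 < t by rewrite lt_min ltr01 divr_gt0// ltr_wpDl.
  have t1 : t <= 1 by rewrite ge_min lexx.
  have te : t * (C * fine (mu B) + 1) <= e.
    by rewrite -ler_pdivlMr ?ltr_wpDl// ge_min lexx orbT.
  rewrite add0r; apply: le_trans te; have := key t t0 t1.
  rewrite expr2 mulrCA -mulrA -mulrA ler_pM2l// => h; apply: le_trans h _.
  rewrite [t * fine _]mulrC mulrA [_ * t]mulrC ler_wpM2l ?ltW//; lra.
by apply/ler_addgt0Pr => e; exact: hh.
Qed.

Lemma Rint_by_parts Omega f phi i : measurable Omega -> smooth f -> test_function Omega phi ->
  \int[mu]_(x in Omega) (f x * D i phi x) = - \int[mu]_(x in Omega) (D i f x * phi x).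
Proof.
move=> mO sf tp; have sp := tp.1; apply/eqP; rewrite -subr_eq0 opprK; apply/eqP.
have IT g : test_function Omega g -> intg mu Omega g.
  by move=> tg; exact: (integrableS measurableT mO (@subsetT _ _) (intg_test tg)).
rewrite -RintD//; [|apply: IT..]; last 2 first.
- by apply: testM => //; exact: test_partial.
- by apply: testM => //; exact: smooth_partial.
rewrite -[RHS](Rint_partial_test i (testM sf tp)); apply: eq_Rintegral => x _.
rewrite -[X in _ = 'D_ _ X _]/(f * phi) deriveM; [|exact: smooth_derivable..].
by rewrite /GRing.scale/= [phi x * _]mulrC.
Qed.

End row_integrals.

(** * Library norms in terms of the inner product and of essential bounds *)

Section Lp_bridge.
Context {R : realType} {d : nat}.
Local Notation pt := 'rV[R]_d.
Local Notation mu := (lebesgue_row R d).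
Context (Omega : set pt).
Hypothesis mO : measurable Omega.
Implicit Types (f g : pt -> R).
Local Notation L2 := (L2 mu Omega).
Local Notation ip := (ip2 mu Omega).

Let restr_sqr f : (fun x => (f \_ Omega) x ^+ 2) = (fun x => f x ^+ 2) \_ Omega.
Proof. by apply/funext => x; rewrite /patch; case: ifP => // _; rewrite expr0n. Qed.

Let powR2 (y : R) : `|y| `^ 2 = y ^+ 2.
Proof. by rewrite -[2]/(2%:R) powR_mulrn// real_normK ?num_real. Qed.

Let abse_pow2 (y : R) : (`|y%:E| `^ 2)%E = (y ^+ 2)%:E.
Proof. by rewrite -powR2. Qed.

Lemma in_Lp2P f : in_Lp 2%:E Omega f <-> L2 f.
Proof.
rewrite /in_Lp; split=> [h|[mf If]].
  have := Lfun2_integrable_sqr h; rewrite inE in h.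
  have /andP[/set_mem/= mf _] := h.
  have {}mf : measurable_fun Omega f by apply/(measurable_restrictT _ mO).
  rewrite restr_sqr => h2; split=> //; apply/(integrable_mkcond _ mO).
  by rewrite restrict_EFin.
rewrite inE; apply/andP; split.
  by rewrite inE /=; apply/(measurable_restrictT _ mO).
rewrite inE /= /finite_norm unlock; apply: poweR_lty.
under eq_integral => x _ do rewrite abse_pow2.
move/(integrable_mkcond _ mO): If; rewrite restrict_EFin -restr_sqr => /integrableP[_].
by under eq_integral => x _ do rewrite gee0_abs ?lee_fin ?sqr_ge0//.
Qed.

Lemma Lp_norm_sqr f : L2 f -> Lp_norm 2%:E Omega f ^+ 2 = ip f f.
Proof.
move=> [mf If]; rewrite /Lp_norm ip2_sqr Rintegral_mkcond -restr_sqr /Rintegral.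
have : 0 <= fine ('N[mu]_2[EFin \o f \_ Omega])%E by rewrite fine_ge0// Lnorm_ge0.
move=> h; rewrite -(powR_mulrn 2 h) -fine_poweR poweR_Lnorm//.
by under eq_integral => x _ do rewrite abse_pow2.
Qed.

Lemma Lp_norm_ge0 p f : 0 <= Lp_norm p Omega f.
Proof. by rewrite /Lp_norm fine_ge0// Lnorm_ge0. Qed.

(** The library norm for the exponent [+oo] distinguishes whether the whole space has positive
    measure. *)
Lemma row_setT_gt0 : (0 < mu [set: pt])%E.
Proof.
apply: (@lt_le_trans _ _ (mu (ball 0 1))).
  by rewrite lebesgue_row_ball// lte_fin exprn_gt0// mulr1.
by apply: le_measure; rewrite ?inE//; exact: measurable_row_ball.
Qed.

Lemma in_Lpoo_bounded f : in_Lp +oo Omega f ->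
  measurable_fun Omega f /\ {ae mu, forall x, Omega x -> `|f x| <= Lp_norm +oo Omega f}.
Proof.
rewrite /in_Lp inE => /andP[/set_mem/= mf]; rewrite inE /= /finite_norm /Lp_norm.
rewrite unlock row_setT_gt0 => h; split; first by apply/(measurable_restrictT _ mO).
have := ess_sup_ge mu (abse \o (EFin \o f \_ Omega)).
have h0 : (0 <= ess_sup mu (abse \o (EFin \o f \_ Omega)))%E.
  apply: ess_sup_gee; first exact: row_setT_gt0.
  by apply: nearW => x; exact: abse_ge0.
move: h h0; set N := ess_sup _ _; case: N => [r||]// _ _.
by apply: filterS => x /=; rewrite /patch => + Ox; rewrite mem_set// lee_fin.
Qed.

(** The a priori bound [M] makes the essential supremum finite; an infinite one would be sent to 0
    by [fine]. *)
Lemma Lp_norm_oo_ae f (M : R) : {ae mu, forall x, Omega x -> `|f x| <= M} -> 0 <= M ->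
  {ae mu, forall x, Omega x -> `|f x| <= Lp_norm +oo Omega f}.
Proof.
move=> fM M0; rewrite /Lp_norm unlock row_setT_gt0.
have := ess_sup_ge mu (abse \o (EFin \o f \_ Omega)).
have h0 : (0 <= ess_sup mu (abse \o (EFin \o f \_ Omega)))%E.
  apply: ess_sup_gee; first exact: row_setT_gt0.
  by apply: nearW => x; exact: abse_ge0.
have h1 : (ess_sup mu (abse \o (EFin \o f \_ Omega)) <= M%:E)%E.
  apply/ess_supP; apply: filterS fM => x h /=; rewrite /patch lee_fin.
  by case: ifPn => [/set_mem/h//|_]; rewrite normr0.
move: h0 h1; set N := ess_sup _ _; case: N => [r||]// _ _.
by apply: filterS => x /=; rewrite /patch => + Ox; rewrite mem_set// lee_fin.
Qed.

End Lp_bridge.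

Lemma derive_mulf {R : realType} {d : nat} (f g : 'rV[R]_d -> R) (x v : 'rV[R]_d) :
  smooth f -> smooth g ->
  'D_v (fun y => f y * g y) x = f x * 'D_v g x + g x * 'D_v f x.
Proof.
move=> sf sg; rewrite -[X in 'D_ _ X _ = _]/(f * g) deriveM//; exact: smooth_derivable.
Qed.

(** * The spaces W^{1,2} and H^1_0, and the Poincare inequality *)

Section sobolev.
Context {R : realType} {d : nat}.
Local Notation pt := 'rV[R]_d.
Local Notation mu := (lebesgue_row R d).
Local Notation D i f := ('D_(@unit_vec R d i) f).
Context (Omega : set pt).
Hypotheses (oO : open Omega) (bO : bounded_set Omega).
Implicit Types (f g phi : pt -> R) (i j : 'I_d).
Let mO := open_measurable_row oO.
Let fO := bounded_row_lty mO bO.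
Local Notation L2 := (L2 mu Omega).
Local Notation ip := (ip2 mu Omega).
Local Notation wp := (weak_partial Omega).
Local Notation pd := (pd Omega).
Local Notation test := (test_function Omega).

Lemma L2_L1_loc f : L2 f -> L1_loc Omega f.
Proof.
move=> Lf; split; first by case: Lf.
move=> K cK KO; apply: (integrableS mO (compact_measurable_row cK) KO).
exact: (L2_intg mO fO Lf).
Qed.

Lemma L1_loc_mul_test f phi : L1_loc Omega f -> test phi -> intg mu Omega (fun x => f x * phi x).
Proof.
move=> [mf If] tp; have [M M0 hM] := test_bounded tp.
have [sp [K [cK KO p0]]] := tp; have mK := compact_measurable_row cK.
have mp := smooth_measurable sp.
have mfp : measurable_fun Omega (fun x => f x * phi x).
  by apply: measurable_funM => //; exact: measurable_funTS.
have IK : intg mu K (fun x => f x * phi x).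
  by apply: (intg_mulb mK (If K cK KO) (measurable_funTS mp) (M := M)) => x _.
apply/(integrable_mkcond _ mO); move/(integrable_mkcond _ mK): IK.
rewrite !restrict_EFin; congr (integrable _ _ (EFin \o _)); apply/funext => x; rewrite /patch.
case: ifPn => [/set_mem Kx|/negP nK]; first by rewrite mem_set//; exact: KO.
by case: ifPn => // _; rewrite p0 ?mulr0// => Kx; apply: nK; exact: mem_set.
Qed.

Lemma test_L2 phi : test phi -> L2 phi.
Proof.
move=> tp; split; first exact: measurable_funTS (smooth_measurable tp.1).
have := testM tp.1 tp => /intg_test h.
apply: (@intg_eq _ _ _ _ _ mO (fun x => phi x * phi x)); first by move=> x _; rewrite expr2.
exact: (integrableS measurableT mO (@subsetT _ _) h).
Qed.

Lemma wp_uniq i f g g' : wp i f g -> wp i f g' -> ae_eq mu Omega g g'.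
Proof.
move=> [_ Lg Hg] [_ Lg' Hg'].
have Lgg : L1_loc Omega (fun x => g x - g' x).
  case: Lg Lg' => mg Ig [mg' Ig']; split; first exact: measurable_funB.
  move=> K cK KO; apply: (intgB (compact_measurable_row cK)); [exact: Ig|exact: Ig'].
have : ae_eq mu Omega (fun x => g x - g' x) (cst 0).
  apply: (du_bois_reymond oO Lgg) => phi tp.
  have e : \int[mu]_(x in Omega) ((g x - g' x) * phi x) =
      \int[mu]_(x in Omega) (g x * phi x) - \int[mu]_(x in Omega) (g' x * phi x).
    rewrite -RintB//; [|exact: L1_loc_mul_test..].
    by apply: eq_Rintegral => x _; rewrite mulrBl.
  by rewrite e; have := Hg phi tp; rewrite (Hg' phi tp) => /oppr_inj ->; rewrite subrr.
by apply: filterS => x h Ox; apply/eqP; rewrite -subr_eq0; apply/eqP; exact: h.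
Qed.

Lemma wp_lin i (a : R) f g f' g' : wp i f f' -> wp i g g' ->
  wp i (a *: f + g) (a *: f' + g').
Proof.
have LL u v : L1_loc Omega u -> L1_loc Omega v -> L1_loc Omega (a *: u + v).
  move=> [mu_ Iu] [mv Iv]; split.
    by apply: measurable_funD => //; apply: measurable_funM => //; exact: measurable_cst.
  move=> K cK KO; have mK := compact_measurable_row cK.
  apply: (@intg_eq _ _ _ _ _ mK (fun x => a * u x + v x)) => //.
  by apply: (intgD mK); [apply: (intgZ mK); exact: Iu|exact: Iv].
move=> [Lf Lf' Hf] [Lg Lg' Hg]; split; [exact: LL|exact: LL|move=> phi tp].
have e u v psi : L1_loc Omega u -> L1_loc Omega v -> test psi ->
    \int[mu]_(x in Omega) ((a *: u + v) x * psi x) =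
    a * \int[mu]_(x in Omega) (u x * psi x) + \int[mu]_(x in Omega) (v x * psi x).
  move=> Lu Lv tpsi; have Iu := L1_loc_mul_test Lu tpsi; have Iv := L1_loc_mul_test Lv tpsi.
  rewrite -RintZ// -RintD//; last exact: (intgZ mO).
  by apply: eq_Rintegral => x _; rewrite -[(a *: u + v) x]/(a * u x + v x) mulrDl mulrA.
rewrite (e _ _ _ Lf Lg (test_partial i tp)) (e _ _ _ Lf' Lg' tp) Hf// Hg//; ring.
Qed.

Lemma pdP i f : (exists g, wp i f g) -> wp i f (pd i f).
Proof. by move=> [g h]; rewrite /Defs.pd; exact: (xgetPex (cst 0) (ex_intro _ g h)). Qed.

Lemma pd_uniq i f g : wp i f g -> ae_eq mu Omega (pd i f) g.
Proof. by move=> h; apply: (wp_uniq (pdP _) h); exists g. Qed.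

Lemma smooth_wp i f : smooth f -> L2 f -> L2 (D i f) -> wp i f (D i f).
Proof.
move=> sf Lf Ldf; split; [exact: L2_L1_loc..|].
by move=> phi tp; rewrite (Rint_by_parts i mO sf tp).
Qed.

Lemma test_wp i phi : test phi -> wp i phi (D i phi).
Proof.
move=> tp; apply: (smooth_wp tp.1); first exact: test_L2.
by apply: test_L2; exact: test_partial.
Qed.

Lemma pd_test i phi : test phi -> ae_eq mu Omega (pd i phi) (D i phi).
Proof. by move=> tp; apply: pd_uniq; exact: test_wp. Qed.

(** Phrased for the chosen representatives [pd] instead of existentially, so that inner products of
    gradients can be written directly. *)
Definition W12 f := L2 f /\ forall i, wp i f (pd i f) /\ L2 (pd i f).

Lemma wp_W12 f (g : 'I_d -> pt -> R) : L2 f -> (forall i, L2 (g i) /\ wp i f (g i)) -> W12 f.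
Proof.
move=> Lf H; split=> // i; have [Lg wg] := H i.
have wpd : wp i f (pd i f) by apply: pdP; exists (g i).
split=> //; apply: (L2_ae mO Lg); first by case: wpd => _ [].
by move: (pd_uniq wg); apply: filterS => x h Ox; rewrite h.
Qed.

Lemma in_W12P f : in_W1p 2%:E Omega f <-> W12 f.
Proof.
split=> [[/(in_Lp2P mO) Lf H]|[Lf H]].
  apply: (@wp_W12 f (fun i => pd i f)) => // i.
  have [g /(in_Lp2P mO) Lg wg] := H i.
  have wpd : wp i f (pd i f) by apply: pdP; exists g.
  split=> //; apply: (L2_ae mO Lg); first by case: wpd => _ [].
  by move: (pd_uniq wg); apply: filterS => x h Ox; rewrite h.
split; first exact/(in_Lp2P mO).
by move=> i; exists (pd i f); [apply/(in_Lp2P mO); case: (H i)|case: (H i)].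
Qed.

Lemma pd_lin i (a : R) f g : W12 f -> W12 g ->
  ae_eq mu Omega (pd i (a *: f + g)) (a *: pd i f + pd i g).
Proof.
move=> [_ Hf] [_ Hg]; apply: pd_uniq; apply: wp_lin; [by case: (Hf i)|by case: (Hg i)].
Qed.

Lemma W12_subspace : subspace W12.
Proof.
split=> [|a f g Wf Wg]; last first.
  apply: (@wp_W12 _ (fun i => a *: pd i f + pd i g)).
    by apply: (L2DZ mO); [case: Wf|case: Wg].
  move=> i; have [wf Lf] := Wf.2 i; have [wg Lg] := Wg.2 i.
  by split; [exact: (L2DZ mO)|exact: wp_lin].
have t0 := test_cst0 Omega.
apply: (@wp_W12 _ (fun i => D i (cst 0))); first exact: test_L2.
by move=> i; split; [apply: test_L2; exact: test_partial|exact: test_wp].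
Qed.

Lemma test_W12 phi : test phi -> W12 phi.
Proof.
move=> tp; apply: (@wp_W12 _ (fun i => D i phi)); first exact: test_L2.
by move=> i; split; [apply: test_L2; exact: test_partial|exact: test_wp].
Qed.

Definition gip f g := \sum_i ip (pd i f) (pd i g).

Lemma pd_semi_ip i : semi_ip W12 (fun f g => ip (pd i f) (pd i g)).
Proof.
have H := L2_semi_ip mu mO.
split=> [|a f g h Wf Wg Wh|f g Wf Wg|f Wf]; first exact: W12_subspace.
- have [_ Lf] := Wf.2 i; have [_ Lg] := Wg.2 i; have [_ Lh] := Wh.2 i.
  have [_ Lfg] := (subDZ W12_subspace a Wf Wg).2 i.
  rewrite -(sip_lin H)//; apply: (ip2_ae mO) => //; first exact: (L2DZ mO).
    exact: pd_lin.
  exact: ae_eq_refl.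
- by apply: (sip_sym H); [case: (Wf.2 i)|case: (Wg.2 i)].
- by apply: (sip_ge0 H); case: (Wf.2 i).
Qed.

Lemma gip_semi_ip : semi_ip W12 gip.
Proof. apply: semi_ip_sum => [|i]; [exact: W12_subspace|exact: pd_semi_ip]. Qed.

Lemma ip_W12 : semi_ip W12 ip.
Proof.
by apply: (semi_ip_sub (L2_semi_ip mu mO) W12_subspace) => f [].
Qed.

Definition ip_H1 f g := ip f g + gip f g.

Lemma H1_semi_ip : semi_ip W12 ip_H1.
Proof. exact: semi_ipD ip_W12 gip_semi_ip. Qed.

Lemma pd_ip_le_gip i f : W12 f -> ip (pd i f) (pd i f) <= gip f f.
Proof.
move=> Wf; rewrite /gip (bigD1 i)//= lerDl; apply: sumr_ge0 => j _.
exact: (sip_ge0 (pd_semi_ip j)).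
Qed.

Lemma H1_norm_sqr f : W12 f -> H1_norm Omega f ^+ 2 = ip_H1 f f.
Proof.
move=> Wf; rewrite /H1_norm sqr_sqrtr.
  rewrite Lp_norm_sqr//; last by case: Wf.
  congr (_ + _); apply: eq_bigr => i _; rewrite Lp_norm_sqr//.
  by case: (Wf.2 i).
by rewrite addr_ge0 ?sqr_ge0// sumr_ge0// => i _; rewrite sqr_ge0.
Qed.

Lemma H1_norm_ge0 f : 0 <= H1_norm Omega f.
Proof. exact: sqrtr_ge0. Qed.

Local Notation H10 := (in_H10 Omega).

Lemma H10_W12 f : H10 f -> W12 f.
Proof. by move=> [/in_W12P]. Qed.

Lemma H10P f : H10 f <-> W12 f /\ forall e : R, 0 < e ->
  exists2 phi, test phi & ip_H1 (f - phi) (f - phi) < e.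
Proof.
split=> [[/in_W12P Wf Hf]|[Wf Hf]].
  split=> // e e0; have [|phi tp h] := Hf (Num.sqrt e); first by rewrite sqrtr_gt0.
  exists phi => //; have Wfp : W12 (f - phi) := subB W12_subspace Wf (test_W12 tp).
  rewrite -H1_norm_sqr// -[e]sqr_sqrtr ?ltW//.
  by rewrite ltr_pXn2r ?nnegrE ?H1_norm_ge0 ?sqrtr_ge0.
split; first exact/in_W12P.
move=> e e0; have [|phi tp h] := Hf (e ^+ 2); first by rewrite exprn_gt0.
exists phi => //; have Wfp : W12 (f - phi) := subB W12_subspace Wf (test_W12 tp).
move: h; rewrite -H1_norm_sqr// ltr_pXn2r ?nnegrE ?H1_norm_ge0// ltW//.
Qed.

Lemma test_H10 phi : test phi -> H10 phi.
Proof.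
move=> tp; apply/H10P; split; first exact: test_W12.
move=> e e0; exists phi => //; rewrite subrr.
by rewrite (lin0 W12_subspace (ip_linl H1_semi_ip (sub0 W12_subspace))).
Qed.

Lemma test_DZ (a : R) f g : test f -> test g -> test (a *: f + g).
Proof. by move=> tf tg; apply: testD => //; exact: testZ. Qed.

Lemma H10_subspace : subspace H10.
Proof.
split; first by apply: test_H10; exact: test_cst0.
move=> a f g /H10P[Wf Hf] /H10P[Wg Hg]; apply/H10P; split; first exact: (subDZ W12_subspace).
move=> e e0; pose c := 2 * a ^+ 2 + 2.
have c0 : 0 < c by rewrite /c; have := sqr_ge0 a; lra.
have [|p tp hp] := Hf (e / c / 2); first by rewrite !divr_gt0.
have [|q tq hq] := Hg (e / c / 2); first by rewrite !divr_gt0.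
exists (a *: p + q); first exact: test_DZ.
have Wfp : W12 (f - p) := subB W12_subspace Wf (test_W12 tp).
have Wgq : W12 (g - q) := subB W12_subspace Wg (test_W12 tq).
have -> : a *: f + g - (a *: p + q) = a *: (f - p) + (g - q).
  by rewrite scalerBr opprD addrACA.
apply: le_lt_trans (ip_le_sqrD H1_semi_ip (subZ W12_subspace a Wfp) Wgq) _.
rewrite -[a *: (f - p)]addr0 -[0](scale0r (f - p)) (ip_quad H1_semi_ip)//.
rewrite mulr0 mul0r expr0n/= mul0r !addr0.
have hp0 := sip_ge0 H1_semi_ip Wfp; have hq0 := sip_ge0 H1_semi_ip Wgq.
have : e = c * (e / c / 2) + c * (e / c / 2) by field; rewrite gt_eqF.
move=> ->; move: hp hq hp0 hq0; rewrite /c; set x := ip_H1 _ _; set y := ip_H1 _ _.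
set z := _ / 2 => hp hq x0 y0.
have := sqr_ge0 a => a0.
nra.
Qed.

(* Integrating [phi^2 = phi^2 * D_i x_i] by parts. *)
Lemma poincare_test (r : R) i phi : Omega `<=` ball 0 r -> test phi ->
  ip phi phi <= 4 * r ^+ 2 * ip (D i phi) (D i phi).
Proof.
move=> Or tp; have Lp := test_L2 tp; have LDp := test_L2 (test_partial i tp).
pose c (x : pt) : R := x 0 i.
have Dc j x : D j c x = (j == i)%:R /\ differentiable c x.
  have dc : differentiable c x by exact: differentiable_coord.
  split=> //; rewrite /derive; apply/cvg_lim => //; apply: cvg_near_cst.
  near=> h; have h0 : h != 0 by near: h; exact: nbhs_dnbhs_neq.
  by rewrite /c /= /unit_vec !mxE eqxx/= addrK /GRing.scale/= mulrA mulVf// mul1r eq_sym.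
have sc : smooth c.
  apply: (smooth_class (P := fun f => f = c \/ exists k, f = cst k)); last by left.
    by move=> f [->|[k ->]] x; [case: (Dc i x)|exact: differentiable_cst].
  move=> f j [->|[k ->]]; right; [exists (j == i)%:R|exists 0]; apply/funext => x.
    by case: (Dc j x).
  by rewrite derive_cst.
have tpp : test (fun x => phi x * phi x) by apply: testM => //; exact: tp.1.
have e : ip phi phi = - (2 * ip (fun x => c x * phi x) (D i phi)).
  have -> : ip phi phi = \int[mu]_(x in Omega) (D i c x * (phi x * phi x)).
    by apply: eq_Rintegral => x _; case: (Dc i x) => -> _; rewrite eqxx mul1r.
  apply: oppr_inj; rewrite opprK -(Rint_by_parts i mO sc tpp) /ip2 -RintZ//; last first.
    apply: (integrableS measurableT mO (@subsetT _ _)).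
    apply: (intg_test (O := Omega)); apply: testM; last exact: test_partial.
    by apply: smoothM => //; exact: tp.1.
  apply: eq_Rintegral => x _.
  by rewrite (derive_mulf _ _ tp.1 tp.1); ring.
have cr x : Omega x -> `|c x| <= r.
  move=> /Or; rewrite -ball_normE /ball_/= sub0r normrN => /ltW.
  by apply: le_trans; exact: row_norm_coord.
have Lcp : L2 (fun x => c x * phi x).
  by apply: test_L2; exact: testM.
have cp_le : ip (fun x => c x * phi x) (fun x => c x * phi x) <= r ^+ 2 * ip phi phi.
  rewrite /ip2 -RintZ//; last exact: L2_mul.
  apply: le_Rint => //; [exact: L2_mul|by apply: intgZ => //; exact: L2_mul|].
  move=> x Ox; rewrite -!expr2 exprMn ler_wpM2r ?sqr_ge0//.
  by rewrite -real_normK ?num_real// lerXn2r ?nnegrE ?cr// (le_trans _ (cr x Ox)).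
have H := L2_semi_ip mu mO.
have CS := ip_CS H Lcp LDp.
have p0 := sip_ge0 H Lp; have D0 := sip_ge0 H LDp.
have : ip phi phi ^+ 2 <= 4 * (r ^+ 2 * ip phi phi * ip (D i phi) (D i phi)).
  rewrite {1}e sqrrN exprMn -natrX ler_wpM2l//; apply: le_trans CS _.
  by rewrite ler_wpM2r.
have [->|pn0] := eqVneq (ip phi phi) 0; first by move=> _; rewrite mulr_ge0// mulr_ge0// sqr_ge0.
have pp : 0 < ip phi phi by rewrite lt_neqAle eq_sym pn0.
rewrite expr2 (_ : 4 * (_ * _ * _) = 4 * r ^+ 2 * ip (D i phi) (D i phi) * ip phi phi); last by ring.
by rewrite ler_pM2r.
Unshelve. all: by end_near. Qed.

Lemma pd_sub i f g : W12 f -> W12 g ->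
  ae_eq mu Omega (pd i (f - g)) (pd i f - pd i g).
Proof.
move=> Wf Wg; have := pd_lin i (-1) Wg Wf.
by rewrite !scaleN1r ![- _ + _]addrC.
Qed.

Lemma poincare : (0 < d)%N -> exists2 C : R, 0 < C &
  forall f, H10 f -> ip f f <= C * gip f f.
Proof.
move=> d0; have [r r0 Or] := bounded_row_ball bO; pose i := Ordinal d0.
(* Four times the constant for test functions: passing from [f] to a test function and back doubles
   a squared norm twice. *)
exists (16 * r ^+ 2) => [|f /H10P[Wf Hf]]; first by rewrite mulr_gt0// exprn_gt0.
have Hh (e : R) : 0 < e -> ip f f <= 16 * r ^+ 2 * gip f f + e.
  move=> e0; have K0 : 0 < 16 * r ^+ 2 + 2 by rewrite addr_gt0// mulr_gt0// exprn_gt0.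
  have [|phi tp h] := Hf (e / (16 * r ^+ 2 + 2)); first exact: divr_gt0.
  have Wp := test_W12 tp; have Wfp : W12 (f - phi) by exact: (subB W12_subspace).
  have Wpf : W12 (phi - f) by exact: (subB W12_subspace).
  have hp := poincare_test i Or tp.
  have e1 : ip (D i phi) (D i phi) <= gip phi phi.
    apply: le_trans (pd_ip_le_gip i Wp); rewrite le_eqVlt; apply/orP; left; apply/eqP.
    have ae : ae_eq mu Omega (D i phi) (pd i phi).
      by move: (pd_test i tp); apply: filterS => x h' Ox; rewrite h'.
    have LD := test_L2 (test_partial i tp); have Lp := (Wp.2 i).2.
    exact: (ip2_ae mO).
  have e2 : ip f f <= 2 * ip (f - phi) (f - phi) + 2 * ip phi phi.
    rewrite -{1 2}[f](subrK phi); exact: (ip_le_sqrD ip_W12).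
  have e3 : gip phi phi <= 2 * gip (f - phi) (f - phi) + 2 * gip f f.
    rewrite (ip_sqrB_sym gip_semi_ip)// -{1 2}[phi](subrK f); exact: (ip_le_sqrD gip_semi_ip).
  have p1 := sip_ge0 ip_W12 Wfp; have p2 := sip_ge0 gip_semi_ip Wfp.
  rewrite ltr_pdivlMr// in h; move: h; rewrite /ip_H1.
  have r2 : 0 < r ^+ 2 by rewrite exprn_gt0.
  move: p1 p2 e1 e2 e3 hp r2.
  set a := ip f f; set b := ip (f - phi) _; set c := gip (f - phi) _; set g := gip f f.
  set p := ip phi phi; set q := ip (D i phi) _; set s := gip phi phi; set w := r ^+ 2.
  move=> b0 c0 qs ap sp pq w0 h.
  have h1 : w * q <= w * s by rewrite ler_wpM2l// ltW.
  have h2 : w * s <= w * (2 * c + 2 * g) by rewrite ler_wpM2l// ltW.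
  have h3 : 0 <= w * b by rewrite mulr_ge0// ltW.
  nra.
by apply/ler_addgt0Pr => e; exact: Hh.
Qed.

Lemma grad_vec_L2 f : W12 f -> vec_sub L2 (grad Omega f).
Proof.
move=> Wf i; rewrite (_ : (fun x => _) = pd i f); first by case: (Wf.2 i).
by apply/funext => x; rewrite /grad mxE.
Qed.

(** By the Poincare inequality the functions are Cauchy along with their gradients. The identity
    defining weak derivatives pairs with fixed test functions, so it passes to the limit, and a
    diagonal choice of test functions keeps the limit in the closure. *)
Lemma H10_complete : (0 < d)%N -> complete_ip H10 gip.
Proof.
move=> d0 u_ Hu Cu; have [C C0 HC] := poincare d0.
have Wu n := H10_W12 (Hu n).
have Hmn m n : H10 (u_ m - u_ n) by exact: (subB H10_subspace).
have LH := L2_semi_ip mu mO.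
have cL := @L2_complete _ _ _ mu _ mO.
have [||f Lf uf] := cL u_.
- by move=> n; case: (Wu n).
- move=> e e0; have [|N HN] := Cu (e / C); first exact: divr_gt0.
  exists N => m n Nm Nn; apply: le_lt_trans (HC _ (Hmn m n)) _.
  by rewrite mulrC -ltr_pdivlMr//; exact: HN.
pose G n := grad Omega (u_ n).
have GE n i x : (G n x) 0 i = pd i (u_ n) x by rewrite /G /grad mxE.
have vL := @vec_complete _ _ _ _ d LH cL.
have [||l Ll Gl] := vL G.
- by move=> n; exact: grad_vec_L2.
- move=> e e0; have [N HN] := Cu e e0; exists N => m n Nm Nn.
  apply: le_lt_trans (HN m n Nm Nn); rewrite le_eqVlt; apply/orP; left; apply/eqP.
  have Wmn := H10_W12 (Hmn m n).
  have Lmn i : L2 (fun x => (G m - G n) x 0 i).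
    rewrite (_ : (fun x => _) = pd i (u_ m) - pd i (u_ n)).
      by apply: (subB (L2_subspace mu mO)); [case: ((Wu m).2 i)|case: ((Wu n).2 i)].
    by apply/funext => x; rewrite !fctE !mxE.
  apply: eq_bigr => i _; have Lp := (Wmn.2 i).2.
  have ae : ae_eq mu Omega (fun x => (G m - G n) x 0 i) (pd i (u_ m - u_ n)).
    move: (pd_sub i (Wu m) (Wu n)); apply: filterS => x h Ox; rewrite h//.
    by rewrite !fctE !mxE.
  exact: (ip2_ae mO).
pose g i x := l x 0 i.
have Lg i : L2 (g i) by exact: Ll.
have pdg i : cvg_ip ip (fun n => pd i (u_ n)) (g i).
  move=> e e0; have [N HN] := Gl e e0; exists N => n Nn; apply: le_lt_trans (HN n Nn).
  rewrite (_ : pd i (u_ n) - g i = (fun x => (G n - l) x 0 i)).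
    apply: (vec_ip_coord_le LH); apply: (subB (vec_subspace _ LH)) => //; exact: grad_vec_L2.
  by apply/funext => x; rewrite !fctE !mxE.
have wg i : wp i f (g i).
  split; [exact: L2_L1_loc..|move=> phi tp].
  have Lp := test_L2 tp; have LDp := test_L2 (test_partial i tp).
  apply/eqP; rewrite -subr_eq0 opprK -normr_le0.
  rewrite -[X in _ + X]/(ip (g i) phi) -[X in X + _]/(ip f (D i phi)).
  have hh (e : R) : 0 < e -> `|ip f (D i phi) + ip (g i) phi| <= 0 + e.
    move=> e0.
    have [||N1 HN1] := cvg_ip_lin LH (ip_linl LH LDp) (sip_ge0 LH LDp) _ (fun n => (Wu n).1) Lf uf (e := e / 2).
    - by move=> v Lv; rewrite mulrC; exact: (ip_CS LH).
    - by rewrite divr_gt0.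
    have [||N2 HN2] := cvg_ip_lin LH (ip_linl LH Lp) (sip_ge0 LH Lp) _ (fun n => ((Wu n).2 i).2) (Lg i) (pdg i) (e := e / 2).
    - by move=> v Lv; rewrite mulrC; exact: (ip_CS LH).
    - by rewrite divr_gt0.
    pose n := maxn N1 N2.
    have [[_ _ wn] _] := (Wu n).2 i; have := wn phi tp.
    rewrite -[X in X = _]/(ip (u_ n) (D i phi)) -[X in _ = - X]/(ip (pd i (u_ n)) phi) => en.
    have h1 := HN1 n (leq_maxl _ _); have h2 := HN2 n (leq_maxr _ _).
    rewrite add0r (_ : _ + _ = - (ip (u_ n) (D i phi) - ip f (D i phi))
      - (ip (pd i (u_ n)) phi - ip (g i) phi)); last by rewrite en; ring.
    apply: le_trans (ler_normB _ _) _; rewrite normrN.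
    by rewrite [e]splitr ltW// ltrD.
  by apply/ler_addgt0Pr => e; exact: hh.
have Wf : W12 f by apply: (wp_W12 (g := g)).
have aeg i := pd_uniq (wg i).
have gc : cvg_ip gip u_ f.
  move=> e e0; have [N HN] := Gl e e0; exists N => n Nn; apply: le_lt_trans (HN n Nn).
  rewrite le_eqVlt; apply/orP; left; apply/eqP; apply: eq_bigr => i _.
  have Wuf : W12 (u_ n - f) by exact: (subB W12_subspace).
  have Lp := (Wuf.2 i).2.
  have LGl : L2 (fun x => (G n - l) x 0 i).
    by apply: (subB (vec_subspace _ LH)) => //; exact: grad_vec_L2.
  have ae : ae_eq mu Omega (pd i (u_ n - f)) (fun x => (G n - l) x 0 i).
    have h1 := pd_sub i (Wu n) Wf; have h2 := aeg i.
    apply: filterS2 h1 h2 => x h1 h2 Ox; rewrite h1//.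
    rewrite -[LHS]/(pd i (u_ n) x - pd i f x) h2// -GE.
    by rewrite !fctE !mxE.
  exact: (ip2_ae mO).
exists f => //; apply/H10P; split=> // e e0.
have [|N1 HN1] := uf (e / 8); first by rewrite divr_gt0.
have [|N2 HN2] := gc (e / 8); first by rewrite divr_gt0.
pose n := maxn N1 N2; have /H10P[_ Hn] := Hu n.
have [|phi tp h] := Hn (e / 4); first by rewrite divr_gt0.
exists phi => //.
have Wfu : W12 (f - u_ n) by exact: (subB W12_subspace).
have Wup : W12 (u_ n - phi) := subB W12_subspace (Wu n) (test_W12 tp).
rewrite (_ : f - phi = (f - u_ n) + (u_ n - phi)); last by rewrite addrA subrK.
apply: le_lt_trans (ip_le_sqrD H1_semi_ip _ _) _ => //.
rewrite (ip_sqrB_sym H1_semi_ip)// {1}/ip_H1.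
have h1 := HN1 n (leq_maxl _ _); have h2 := HN2 n (leq_maxr _ _).
move: h1 h2 h; set a := ip _ _; set b := gip _ _; set c := ip_H1 _ _; lra.
Qed.

End sobolev.

(** * Mollification *)

Section row_fubini.
Context {R : realType} {d : nat}.
Local Notation pt := 'rV[R]_d.
Local Notation mu := (lebesgue_row R d).
Local Notation ms := (sf_copy (@lebesgue_row_sigma_finite R d)).

Lemma row_tonelli (f : pt * pt -> \bar R) :
  measurable_fun setT f -> (forall p, (0 <= f p)%E) ->
  measurable_fun setT (fun x => \int[mu]_y f (x, y))%E /\
  (\int[mu]_x \int[mu]_y f (x, y) = \int[mu]_y \int[mu]_x f (x, y))%E.
Proof.
move=> mf f0; split; last exact: (@fubini_tonelli _ _ pt pt R ms ms f mf f0).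
exact: (@measurable_fun_fubini_tonelli_F _ _ pt pt R ms f mf f0).
Qed.

Lemma row_fubini (f : pt * pt -> R) : measurable_fun setT f ->
  (forall x, intg mu setT (fun y => f (x, y))) ->
  (forall y, intg mu setT (fun x => f (x, y))) ->
  (\int[mu]_x \int[mu]_y (`|f (x, y)|)%:E < +oo)%E ->
  \int[mu]_x \int[mu]_y f (x, y) = \int[mu]_y \int[mu]_x f (x, y).
Proof.
move=> mf I1 I2 foo.
have Ip : (ms \x ms)%E.-integrable setT (EFin \o f).
  apply/(@integrable12ltyP _ _ _ _ _ ms ms); [exact/measurable_EFinP|exact: foo].
have h := Fubini Ip.
transitivity (fine (\int[mu]_x \int[mu]_y (f (x, y))%:E)%E).
  congr fine; apply: eq_integral => x _; exact: EFin_Rint.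
transitivity (fine (\int[mu]_y \int[mu]_x (f (x, y))%:E)%E).
  by congr fine; exact: h.
by congr fine; apply: eq_integral => x _; rewrite -EFin_Rint.
Qed.

Lemma measurable_row_add : measurable_fun setT (fun p : pt * pt => p.1 + p.2).
Proof.
apply: measurable_fun_rowP => i.
rewrite (_ : _ \o _ = fun p : pt * pt => row_coord i p.1 + row_coord i p.2); last first.
  by apply/funext => x; rewrite /row_coord/= mxE.
by apply: measurable_funD; apply: measurableT_comp => //; exact: measurable_row_coord.
Qed.

End row_fubini.

Section convolution.
Context {R : realType} {d : nat}.
Local Notation pt := 'rV[R]_d.
Local Notation mu := (lebesgue_row R d).
Local Notation D i f := ('D_(@unit_vec R d i) f).
Local Notation test := (test_function (setT : set pt)).
Implicit Types (f g h phi rho : pt -> R) (i j : 'I_d).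
Let mT : measurable (setT : set pt) := measurableT.

Definition conv h rho (x : pt) : R := \int[mu]_y (h y * rho (x - y)).

Lemma intg_conv h rho x : intg mu setT h -> test rho -> intg mu setT (fun y => h y * rho (x - y)).
Proof.
move=> Ih tr; have [M M0 hM] := test_bounded tr.
apply: (intg_mulb mT Ih (M := M)) => [|y _]; last exact: hM.
by apply: smooth_measurable; apply: smooth_reflect; exact: tr.1.
Qed.

(** The uniform Taylor bound of [rho] is integrated against [|h|], in place of differentiation under
    the integral sign. *)
Lemma conv_differentiable h rho x : intg mu setT h -> test rho ->
  differentiable (conv h rho) x /\ forall i, D i (conv h rho) x = conv h (D i rho) x.
Proof.
move=> Ih tr; have [C C0 hC] := test_taylor2 tr.
have In := intg_norm Ih.
apply: (@differentiable_taylor2 _ _ _ _ _ (C * \int[mu]_y `|h y|)) => k.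
have It := test_partial _ tr.
have Is i : intg mu setT (fun y => h y * D i rho (x - y) * k 0 i).
  apply: (@intg_eq _ _ _ _ _ mT (fun y => k 0 i * (h y * D i rho (x - y)))).
    by move=> y _; rewrite mulrC.
  by apply: (intgZ mT); exact: (intg_conv x Ih (It i)).
have -> : conv h rho (x + k) - conv h rho x - \sum_i conv h (D i rho) x * k 0 i =
    \int[mu]_y (h y * (rho (x - y + k) - rho (x - y) - \sum_i D i rho (x - y) * k 0 i)).
  have -> : \sum_i conv h (D i rho) x * k 0 i = \int[mu]_y \sum_i (h y * D i rho (x - y) * k 0 i).
    rewrite Rint_sum//; apply: eq_bigr => i _; rewrite mulrC -RintZ//; last exact: (intg_conv x Ih (It i)).
    by apply: eq_Rintegral => y _; rewrite mulrC.
  rewrite /conv -RintB//; [|exact: intg_conv..]; rewrite -RintB//.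
  - apply: eq_Rintegral => y _; rewrite [x - y + k]addrAC !mulrBr mulr_sumr.
    by congr (_ - _ - _); apply: eq_bigr => i _; rewrite mulrA.
  - by apply: (intgB mT); exact: intg_conv.
  - exact: intg_sum.
have If : intg mu setT (fun y => h y * (rho (x - y + k) - rho (x - y) - \sum_i D i rho (x - y) * k 0 i)).
  apply: (@intg_eq _ _ _ _ _ mT (fun y => h y * rho (x + k - y) - h y * rho (x - y) - \sum_i (h y * D i rho (x - y) * k 0 i))).
    move=> y _; rewrite [x - y + k]addrAC !mulrBr mulr_sumr.
    by congr (_ - _ - _); apply: eq_bigr => i _; rewrite mulrA.
  by apply: (intgB mT); [apply: (intgB mT); exact: intg_conv|exact: intg_sum].
apply: le_trans (Rint_norm mT If) _.
rewrite mulrAC -RintZ//; apply: le_Rint => //; [exact: intg_norm|exact: intgZ|].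
by move=> y _; rewrite normrM mulrC ler_wpM2r.
Qed.

Lemma smooth_conv h rho : intg mu setT h -> test rho -> smooth (conv h rho).
Proof.
move=> Ih tr; apply: (smooth_class (P := fun f => exists2 r, test r & f = conv h r)).
- by move=> _ [r tr' ->] x; case: (conv_differentiable x Ih tr').
- move=> _ i [r tr' ->]; exists (D i r); first exact: test_partial.
  by apply/funext => x; case: (conv_differentiable x Ih tr').
- by exists rho.
Qed.

Lemma conv_partial h rho i : intg mu setT h -> test rho -> D i (conv h rho) = conv h (D i rho).
Proof. by move=> Ih tr; apply/funext => x; case: (conv_differentiable x Ih tr). Qed.

Lemma conv_lin a f g rho : intg mu setT f -> intg mu setT g -> test rho ->
  forall x, conv (a *: f + g) rho x = a * conv f rho x + conv g rho x.
Proof.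
move=> If Ig tr x; rewrite /conv -RintZ//; last exact: intg_conv.
rewrite -RintD//; [|by apply: (intgZ mT); exact: intg_conv|exact: intg_conv].
by apply: eq_Rintegral => y _; rewrite -[(a *: f + g) y]/(a * f y + g y) mulrDl mulrA.
Qed.

Section even_kernel.
Context (rho : pt -> R).
Hypotheses (tr : test rho) (rho_even : forall x, rho (- x) = rho x).
Let mr : measurable_fun setT rho := smooth_measurable tr.1.

Lemma conv_shift h x : measurable_fun setT h -> conv h rho x = \int[mu]_z (rho z * h (x + z)).
Proof.
move=> mh; rewrite /conv.
rewrite -(@Rint_shift _ _ x (fun y => h y * rho (x - y))); last first.
  apply: measurable_funM => //; apply: smooth_measurable; apply: smooth_reflect; exact: tr.1.
apply: eq_Rintegral => z _; rewrite opprD addrCA subrr addr0 rho_even mulrC.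
by rewrite addrC.
Qed.

Lemma intg_conv_shift h x : intg mu setT h -> intg mu setT (fun z => rho z * h (x + z)).
Proof.
move=> Ih; have [M M0 hM] := test_bounded tr.
apply: (@intg_eq _ _ _ _ _ mT (fun z => h (z + x) * rho z)).
  by move=> z _; rewrite mulrC addrC.
apply: (intg_mulb mT (M := M)) => //; exact: intg_shift.
Qed.

(** Fubini's theorem moves the mollification from [h] to [g] and exhibits the pairing as an average,
    with weight [rho], of pairings of [h] with translates of [g]. *)
Lemma conv_pairing h g : intg mu setT h -> test g ->
  \int[mu]_x (conv h rho x * g x) = \int[mu]_z (rho z * \int[mu]_y (h y * g (y - z))).
Proof.
move=> Ih tg; have mh := intg_mf Ih; have mg := smooth_measurable tg.1.
have [M M0 hM] := test_bounded tr; have [N N0 hN] := test_bounded tg.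
pose f (p : pt * pt) := rho p.2 * h (p.1 + p.2) * g p.1.
have mf : measurable_fun setT f.
  apply: measurable_funM; first apply: measurable_funM.
  - exact: measurableT_comp.
  - by apply: measurableT_comp => //; exact: measurable_row_add.
  - exact: measurableT_comp.
have I1 x : intg mu setT (fun z => f (x, z)).
  apply: (@intg_eq _ _ _ _ _ mT (fun z => g x * (rho z * h (x + z)))).
    by move=> z _; rewrite /f/= mulrC.
  by apply: (intgZ mT); exact: intg_conv_shift.
have I2 z : intg mu setT (fun x => f (x, z)).
  apply: (@intg_eq _ _ _ _ _ mT (fun x => rho z * (h (x + z) * g x))).
    by move=> x _; rewrite /f/= mulrA.
  apply: (intgZ mT); apply: (intg_mulb mT (M := N)) => //; exact: intg_shift.
have Ign := intg_norm (intg_test tg); have Ihn := intg_norm Ih.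
transitivity (\int[mu]_x \int[mu]_z f (x, z)).
  apply: eq_Rintegral => x _; rewrite conv_shift// mulrC -RintZ//; last exact: intg_conv_shift.
  by apply: eq_Rintegral => z _; rewrite /f/= mulrC.
rewrite row_fubini//.
  apply: eq_Rintegral => z _.
  have Isz : intg mu setT (fun x => h (x + z) * g x).
    by apply: (intg_mulb mT (M := N)) => //; exact: intg_shift.
  transitivity (rho z * \int[mu]_x (h (x + z) * g x)).
    by rewrite -RintZ//; apply: eq_Rintegral => x _; rewrite /f/= mulrA.
  congr (_ * _).
  rewrite -[RHS](Rint_shift z); last first.
    apply: measurable_funM => //; apply: measurableT_comp => //; exact: measurable_row_shift.
  by apply: eq_Rintegral => y _; rewrite addrK.
apply: (@le_lt_trans _ _ (\int[mu]_x (`|g x| * (M * \int[mu]_y `|h y|))%:E)%E).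
  apply: ge0_le_integral => //.
  - by move=> x _; apply: integral_ge0 => y _; rewrite lee_fin.
  - apply: (row_tonelli (f := fun p => (`|f p|)%:E) _ _).1 => //.
    by apply/measurable_EFinP; apply: measurableT_comp.
  - by apply/measurable_EFinP; apply: measurable_funM => //; apply: measurableT_comp.
  move=> x _; rewrite -EFin_Rint//; last by apply: intg_norm; exact: I1.
  rewrite lee_fin -(Rint_shift x (f := fun y => `|h y|)); last exact: measurableT_comp.
  rewrite mulrA -RintZ//; last exact: (intg_shift x Ihn).
  apply: le_Rint => //; [exact/intg_norm/I1|by apply: (intgZ mT); exact: (intg_shift x Ihn)|].
  move=> z _; rewrite /f/= !normrM mulrC -mulrA ler_wpM2l// [z + x]addrC.
  by rewrite ler_wpM2r// hM.
rewrite -EFin_Rint ?ltry//.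
apply: (@intg_eq _ _ _ _ _ mT (fun x => (M * \int[mu]_y `|h y|) * `|g x|)).
  by move=> x _; rewrite mulrC.
exact: (intgZ mT).
Qed.

Context (rho0 : forall x, 0 <= rho x) (rho1 : \int[mu]_x rho x = 1).

(* Jensen's inequality for the probability density [rho]. *)
Lemma conv_sqr_le h x : intg mu setT h -> L2 mu setT h ->
  conv h rho x ^+ 2 <= \int[mu]_z (rho z * h (x + z) ^+ 2).
Proof.
move=> Ih [mh Ih2]; rewrite conv_shift//; set a := \int[mu]_z _.
have I1 := intg_conv_shift x Ih.
have I2 := intg_conv_shift x Ih2.
have Ir := intg_test tr.
have : 0 <= \int[mu]_z (rho z * (h (x + z) - a) ^+ 2).
  by apply: Rint_ge0 => z _; rewrite mulr_ge0// sqr_ge0.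
have -> : \int[mu]_z (rho z * (h (x + z) - a) ^+ 2) =
    \int[mu]_z (rho z * h (x + z) ^+ 2) - 2 * a * a + a ^+ 2 * 1.
  have e1 : \int[mu]_z (2 * a * (rho z * h (x + z))) = 2 * a * a by rewrite RintZ.
  have e2 : \int[mu]_z (a ^+ 2 * rho z) = a ^+ 2 * 1 by rewrite RintZ// rho1.
  have J1 := intgZ mT (2 * a) I1; have J2 := intgZ mT (a ^+ 2) Ir.
  rewrite -e1 -e2 -RintB// -RintD//; last exact: (intgB mT).
  by apply: eq_Rintegral => z _; ring.
lra.
Qed.

(** Integrate the pointwise Jensen bound over [x] and exchange the integrals: by translation
    invariance the inner integral no longer depends on [z]. *)
Lemma conv_L2 h : intg mu setT h -> L2 mu setT h ->
  L2 mu setT (conv h rho) /\ ip2 mu setT (conv h rho) (conv h rho) <= ip2 mu setT h h.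
Proof.
move=> Ih Lh; have [mh Ih2] := Lh.
have mc : measurable_fun setT (conv h rho) by exact: smooth_measurable (smooth_conv Ih tr).
have key : (\int[mu]_x ((conv h rho x) ^+ 2)%:E <= (\int[mu]_x (h x ^+ 2))%:E)%E.
  pose f (p : pt * pt) := (rho p.2 * h (p.1 + p.2) ^+ 2)%:E.
  have mf : measurable_fun setT f.
    apply/measurable_EFinP; apply: measurable_funM; first exact: measurableT_comp.
    by apply: measurable_funX; apply: measurableT_comp => //; exact: measurable_row_add.
  have f0 p : (0 <= f p)%E by rewrite lee_fin mulr_ge0// sqr_ge0.
  have [m1 e1] := row_tonelli mf f0.
  apply: (@le_trans _ _ (\int[mu]_x \int[mu]_z f (x, z))%E).
    apply: ge0_le_integral; [exact: mT|by move=> x _; rewrite lee_fin sqr_ge0| |exact: m1|].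
      by apply/measurable_EFinP; exact: measurable_funX.
    move=> x _; rewrite -(EFin_Rint mT (intg_conv_shift x Ih2)) lee_fin.
    exact: conv_sqr_le.
  rewrite e1.
  have -> : (\int[mu]_z \int[mu]_x f (x, z) = \int[mu]_z (rho z * \int[mu]_x (h x ^+ 2))%:E)%E.
    apply: eq_integral => z _; rewrite -(Rint_shift z (f := fun x => h x ^+ 2)); last first.
      exact: measurable_funX.
    have Is := intg_shift z Ih2.
    by rewrite -(RintZ mT _ Is) (EFin_Rint mT (intgZ mT (rho z) Is)).
  have Ir := intg_test tr.
  rewrite -EFin_Rint; [|exact: mT|]; last first.
    apply: (@intg_eq _ _ _ _ _ mT (fun z => \int[mu]_x (h x ^+ 2) * rho z)).
      by move=> z _; rewrite mulrC.
    exact: (intgZ mT).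
  rewrite lee_fin; under eq_Rintegral do rewrite mulrC.
  by rewrite (RintZ mT _ Ir) rho1 mulr1.
have Ic : intg mu setT (fun x => conv h rho x ^+ 2).
  apply/integrableP; split; first by apply/measurable_EFinP; exact: measurable_funX.
  under eq_integral do rewrite gee0_abs ?lee_fin ?sqr_ge0//.
  exact: le_lt_trans key (ltry _).
split; first by split.
by rewrite !ip2_sqr -lee_fin EFin_Rint.
Qed.

End even_kernel.
End convolution.

(** * Density of test functions and convergence of mollifications *)

Section density.
Context {R : realType}.

Lemma closure_subspace (V : lmodType R) (S T : V -> Prop) ip :
  semi_ip S ip -> subspace T -> (forall v, T v -> S v) ->
  subspace (fun u => S u /\ forall e : R, 0 < e -> exists2 t, T t & ip (u - t) (u - t) < e).
Proof.
move=> H HT TS; have HS := sip_sub H; split.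
  split=> [|e e0]; first exact: sub0 HS.
  exists 0; first exact: sub0 HT.
  have := ip_quad H 0 0 (sub0 HS) (sub0 HS).
  by rewrite subr0 !scale0r addr0 => ->; rewrite !(expr0n, mul0r, mulr0, addr0).
move=> a u v [Su Hu] [Sv Hv]; split=> [|e e0]; first exact: subDZ HS _ _ _ _ _.
have k0 : 0 < a ^+ 2 + 1 by rewrite ltr_wpDl// sqr_ge0.
have [|s Ts us] := Hu (e / (4 * (a ^+ 2 + 1))); first by rewrite divr_gt0// mulr_gt0.
have [|t Tt vt] := Hv (e / 4); first by rewrite divr_gt0.
exists (a *: s + t); first exact: subDZ HT _ _ _ _ _.
have Sus := subB HS Su (TS _ Ts); have Svt := subB HS Sv (TS _ Tt).
have -> : a *: u + v - (a *: s + t) = a *: (u - s) + (v - t).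
  by rewrite opprD addrACA scalerBr.
apply: le_lt_trans (ip_le_sqrD H (subZ HS a Sus) Svt) _.
have := ip_quad H a 0 Sus Svt; rewrite scale0r addr0 => ->.
rewrite !(mulr0, mul0r, addr0, expr0n)/=.
have h1 : a ^+ 2 * ip (u - s) (u - s) <= e / 4.
  apply: (@le_trans _ _ ((a ^+ 2 + 1) * (e / (4 * (a ^+ 2 + 1))))).
    apply: ler_pM (ltW us) => //; [exact: sqr_ge0|exact: (sip_ge0 H)|lra].
  by rewrite le_eqVlt; apply/orP; left; apply/eqP; field; lra.
lra.
Qed.

Lemma closure_complete (V : lmodType R) (S T : V -> Prop) ip :
  semi_ip S ip -> complete_ip S ip -> (forall v, T v -> S v) ->
  complete_ip (fun u => S u /\ forall e : R, 0 < e -> exists2 t, T t & ip (u - t) (u - t) < e) ip.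
Proof.
move=> H cS TS u_ Hu Cu; have HS := sip_sub H.
have [l Sl ul] := cS u_ (fun n => (Hu n).1) Cu.
exists l => //; split=> // e e0.
have [|N HN] := ul (e / 4); first by rewrite divr_gt0.
have [Su /(_ (e / 4))[|t Tt ut]] := Hu N; first by rewrite divr_gt0.
exists t => //; have := HN N (leqnn _) => lu.
have -> : l - t = (l - u_ N) + (u_ N - t) by rewrite subrKA.
have := ip_le_sqrD H (subB HS Sl Su) (subB HS Su (TS _ Tt)).
rewrite (ip_sqrB_sym H Sl Su); lra.
Qed.

End density.

Section mollifier.
Context {R : realType} {d : nat}.
Local Notation pt := 'rV[R]_d.
Local Notation mu := (lebesgue_row R d).
Local Notation D i f := ('D_(@unit_vec R d i) f).
Local Notation test := (test_function (setT : set pt)).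
Implicit Types (f g h phi rho : pt -> R) (i j : 'I_d).
Let mT : measurable (setT : set pt) := measurableT.

Definition mollifier (e : R) (x : pt) : R := (\int[mu]_y bump 0 e y)^-1 * bump 0 e x.

Section fixed_radius.
Context (e : R).
Hypothesis e0 : 0 < e.

Let test_bump0 : test (bump 0 e : pt -> R).
Proof. exact: test_bump. Qed.

Let bump_int_gt0 : 0 < \int[mu]_y bump (0 : pt) e y.
Proof.
rewrite lt_neqAle Rint_ge0 ?andbT; last by move=> x _; exact: bump_ge0.
apply/eqP => /esym h0.
have := Rint_eq0 mT (intg_test test_bump0) (fun x _ => bump_ge0 _ _ _) h0.
move=> [A [mA A0 sA]]; have : (mu (ball (0%R : pt) e) <= mu A)%E.
  apply: le_measure; rewrite ?inE//; first exact: measurable_row_ball.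
  move=> x xb; apply: sA => /= /(_ I) h.
  by have := bump_gt0 e0 xb; rewrite h ltxx.
rewrite A0 lebesgue_row_ball// lee_fin leNgt => /negP; apply.
by rewrite exprn_gt0// mulr_gt0.
Qed.

Lemma test_mollifier : test (mollifier e).
Proof. exact: testZ. Qed.

Lemma mollifier_even x : mollifier e (- x) = mollifier e x.
Proof. by rewrite /mollifier bump0N. Qed.

Lemma mollifier_ge0 x : 0 <= mollifier e x.
Proof. by apply: mulr_ge0; [rewrite invr_ge0 ltW|exact: bump_ge0]. Qed.

Lemma mollifier_int : \int[mu]_x mollifier e x = 1.
Proof.
by rewrite (RintZ mT _ (intg_test test_bump0)) mulVf// gt_eqF.
Qed.

Lemma mollifier_eq0 x : e <= `|x| -> mollifier e x = 0.
Proof.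
move=> ex; rewrite /mollifier bump_eq0 ?mulr0// -ball_normE /ball_/= sub0r normrN => h.
by have := lt_le_trans h ex; rewrite ltxx.
Qed.

Lemma conv_mollifier_bounds h (m M : R) (x : pt) : intg mu setT h ->
  (forall z, `|z| < e -> m <= h (x + z) <= M) -> m <= conv h (mollifier e) x <= M.
Proof.
move=> Ih hmM; have It := intg_test test_mollifier.
rewrite (conv_shift test_mollifier mollifier_even); last exact: intg_mf Ih.
have I1 := intg_conv_shift test_mollifier x Ih.
have c_int (c : R) : \int[mu]_z (c * mollifier e z) = c by rewrite RintZ// mollifier_int mulr1.
have hz z : m * mollifier e z <= mollifier e z * h (x + z) <= M * mollifier e z.
  have [ze|/mollifier_eq0 ->] := ltP `|z| e; last by rewrite !(mulr0, mul0r) lexx.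
  have /andP[h1 h2] := hmM _ ze.
  by rewrite mulrC ler_wpM2l ?mollifier_ge0//= mulrC ler_wpM2r ?mollifier_ge0.
apply/andP; split.
  rewrite -[leLHS]c_int; apply: le_Rint => // [|z _]; first exact: intgZ.
  by have /andP[] := hz z.
rewrite -[leRHS]c_int; apply: le_Rint => // [|z _]; first exact: intgZ.
by have /andP[] := hz z.
Qed.

Lemma conv_mollifier_near h (x : pt) (s : R) : intg mu setT h ->
  (forall z, `|z| < e -> `|h (x + z) - h x| <= s) -> `|conv h (mollifier e) x - h x| <= s.
Proof.
move=> Ih hs; rewrite ler_distl; apply: conv_mollifier_bounds => // z ze.
by rewrite -ler_distl; exact: hs.
Qed.

End fixed_radius.

Context (Omega : set pt).
Hypotheses (oO : open Omega) (bO : bounded_set Omega).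
Let mO := open_measurable_row oO.
Let fO := bounded_row_lty mO bO.
Local Notation L2 := (L2 mu Omega).
Local Notation ip := (ip2 mu Omega).

Lemma test_subspace : subspace (test_function Omega).
Proof.
split; first exact: test_cst0.
by move=> a f g tf tg; exact: test_DZ.
Qed.

(** The closure of the test functions is complete, so Riesz representation on it yields the
    projection [z] of [f]. The difference [f - z] is orthogonal to every test function, hence null
    by the du Bois-Reymond lemma. *)
Lemma test_dense f : L2 f -> forall e : R, 0 < e ->
  exists2 phi, test_function Omega phi & ip (f - phi) (f - phi) < e.
Proof.
move=> Lf.
have H := L2_semi_ip mu mO; have HS := sip_sub H; have TS phi : test_function Omega phi -> L2 phi by exact: test_L2.
have sC := closure_subspace H test_subspace TS.
have cC := closure_complete H (@L2_complete _ _ _ mu _ mO) TS.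
have HC := semi_ip_sub H sC (fun v (h : _ /\ _) => h.1).
have [|u Su|z [Lz Hz] zf] := riesz HC (l := ip f) (M := ip f f) cC.
- move=> a u v [Su _] [Sv _]; exact: (ip_linr H Lf).
- exact: ip_CS H _ _ Lf Su.1.
have fz : ae_eq mu Omega (f - z) (cst 0).
  apply: (du_bois_reymond oO) => [|phi tp]; first exact: L2_L1_loc (L2B mO Lf Lz).
  have Lp := TS _ tp; rewrite -[LHS]/(ip (f - z) phi).
  rewrite (linB HS (ip_linl H Lp) Lf Lz) zf ?subrr//; split=> // e e0.
  by exists phi => //; rewrite subrr (lin0 HS (ip_linl H (sub0 HS))).
move=> e e0; have [phi tp zp] := Hz (e / 4) (divr_gt0 e0 (ltr0n _ 4)).
exists phi => //; have Lp := TS _ tp.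
have -> : f - phi = (f - z) + (z - phi) by rewrite subrKA.
have := ip_le_sqrD H (subB (sip_sub H) Lf Lz) (subB (sip_sub H) Lz Lp).
have L0 := sub0 (sip_sub H); have Lfz := subB (sip_sub H) Lf Lz.
have -> : ip (f - z) (f - z) = 0.
  have rf : ae_eq mu Omega (f - z) (f - z) by exact: ae_eq_refl.
  by rewrite (ip2_ae mO Lfz Lfz L0 Lfz fz rf) (lin0 HS (ip_linl H Lfz)).
lra.
Qed.

Lemma L2_restrict f : L2 f ->
  [/\ measurable_fun setT (f \_ Omega) /\ intg mu setT (fun x => (f \_ Omega) x ^+ 2), intg mu setT (f \_ Omega) &
      ip2 mu setT (f \_ Omega) (f \_ Omega) = ip f f].
Proof.
move=> Lf; have [mf If] := Lf; have If1 := L2_intg mO fO Lf.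
have e2 : (fun x => (f \_ Omega) x ^+ 2) = (fun x => f x ^+ 2) \_ Omega.
  by apply/funext => x; rewrite !patchE; case: ifP => // _; rewrite expr0n.
have mr : measurable_fun setT (f \_ Omega) by apply/(measurable_restrictT _ mO).
have intr g : intg mu Omega g -> intg mu setT (g \_ Omega).
  move=> Ig; rewrite /intg.
  have := (integrable_mkcond (EFin \o g) mO).1 Ig.
  by apply: eq_integrable => // x _; rewrite /= !patchE; case: ifP.
split; [split => //; rewrite e2; exact: intr|exact: intr|].
by rewrite !ip2_sqr e2 -Rintegral_mkcond.
Qed.

(** Approximate [f] by a test function [phi]. Convolution does not increase the norm of [f - phi],
    and on [phi] it is uniformly close to the identity by the Lipschitz bound. *)
Lemma mollifier_L2_cvg f : L2 f -> forall e : R, 0 < e -> exists2 s : R, 0 < s &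
  forall r : R, 0 < r -> r < s ->
    L2 (conv (f \_ Omega) (mollifier r)) /\
    ip (conv (f \_ Omega) (mollifier r) - f) (conv (f \_ Omega) (mollifier r) - f) < e.
Proof.
move=> Lf e e0; have H := L2_semi_ip mu mO; have HS := sip_sub H.
(* Three errors of size [e / 12] enter with weights 2, 4 and 4. *)
have [phi tp fp] := test_dense Lf (divr_gt0 e0 (ltr0n _ 12)).
have Lp : L2 phi by exact: test_L2.
have tpT : test phi by apply: test_sub tp.
have Ip := intg_test tp.
have [L L0 hL] : exists2 L : R, 0 <= L & forall x v, `|phi (x + v) - phi x| <= L * `|v|.
  have hM i : exists M : R, forall x, `|D i phi x| <= M.
    by have [M _ hM] := test_bounded (test_partial i tp); exists M.
  have [M_ hM_] := choice hM.
  have M0 : 0 <= \sum_i `|M_ i| by apply: sumr_ge0.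
  exists (d%:R * \sum_i `|M_ i|); first exact: mulr_ge0.
  apply: smooth_lip tp.1 _ => i x; apply: le_trans (hM_ i x) _.
  by rewrite (bigD1 i)//= (le_trans (ler_norm _))// lerDl sumr_ge0.
pose m := fine (mu Omega); have m0 : 0 <= m by exact: fine_ge0.
have k0 : 0 < L ^+ 2 * m + 1 by rewrite ltr_wpDl// mulr_ge0// sqr_ge0.
pose s := Num.min 1 (e / (12 * (L ^+ 2 * m + 1))).
have s0 : 0 < s by rewrite lt_min ltr01 divr_gt0// mulr_gt0.
exists s => // r r0 rs.
have tr := test_mollifier r0; have er := @mollifier_even r.
have conv_restr g : L2 g -> L2 (conv (g \_ Omega) (mollifier r)) /\
    ip (conv (g \_ Omega) (mollifier r)) (conv (g \_ Omega) (mollifier r)) <= ip g g.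
  move=> Lg; have [LT IT <-] := L2_restrict Lg.
  have [[mc Ic] hc] := conv_L2 tr er (mollifier_ge0 r0) (mollifier_int r0) IT LT.
  split; first split; first exact: measurable_funTS.
    exact: integrableS Ic.
  apply: le_trans hc; rewrite !ip2_sqr !/Rintegral.
  rewrite fine_le//.
  - by rewrite -(EFin_Rint mO (integrableS measurableT mO (@subsetT _ _) Ic)).
  - by rewrite -(EFin_Rint mT Ic).
  apply: ge0_subset_integral => //; first by apply/measurable_EFinP; exact: measurable_funX.
  by move=> x _; rewrite lee_fin sqr_ge0.
have [Lcf _] := conv_restr f Lf; split=> //.
have Lfp := subB HS Lf Lp.
have [Lcd hcd] := conv_restr _ Lfp.
have pO : phi \_ Omega = phi.
  apply/funext => x; rewrite patchE; case: ifPn => // /negP xO.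
  case: tp => _ [K [_ KO ->//]]; apply: contra_not xO => /KO; exact: mem_set.
have cE : conv (f \_ Omega) (mollifier r) - f =
    (conv ((f - phi) \_ Omega) (mollifier r)) + ((conv phi (mollifier r) - phi) + (phi - f)).
  have [_ If _] := L2_restrict Lf; have [_ Id _] := L2_restrict Lfp.
  apply/funext => x.
  have := conv_lin 1 Id Ip tr x.
  have -> : 1 *: ((f - phi) \_ Omega) + phi = f \_ Omega.
    rewrite scale1r -{2}pO; apply/funext => y.
    rewrite -[LHS]/(((f - phi) \_ Omega) y + (phi \_ Omega) y) !patchE.
    by case: ifP; rewrite ?addr0// subrK.
  rewrite mul1r => h; rewrite -[LHS]/(conv (f \_ Omega) (mollifier r) x - f x) h.
  rewrite -[RHS]/(_ + (conv phi (mollifier r) x - phi x + (phi x - f x))); ring.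
have Lc : L2 (conv phi (mollifier r) - phi).
  apply: (L2B mO) => //; have [h _] := conv_restr _ Lp; by rewrite pO in h.
have hc : ip (conv phi (mollifier r) - phi) (conv phi (mollifier r) - phi) <= e / 12.
  rewrite ip2_sqr; apply: (@le_trans _ _ ((L * r) ^+ 2 * m)).
    apply: Rint_le_cst => //; first by case: Lc.
    move=> x _; rewrite -real_normK ?num_real//.
    apply: lerXn2r; rewrite ?nnegrE//; first by rewrite mulr_ge0 // ltW.
    apply: conv_mollifier_near => // z /ltW zr.
    by apply: le_trans (hL _ _) _; rewrite ler_wpM2l.
  have r1 : r < 1 by apply: lt_le_trans rs _; rewrite ge_min lexx.
  have r2 : r < e / (12 * (L ^+ 2 * m + 1)) by apply: lt_le_trans rs _; rewrite ge_min lexx orbT.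
  rewrite exprMn mulrAC; have A0 : 0 <= L ^+ 2 * m by rewrite mulr_ge0// sqr_ge0.
  apply: (@le_trans _ _ ((L ^+ 2 * m + 1) * r)).
    have r2r : r ^+ 2 <= r by rewrite expr2 ler_piMl// ltW.
    apply: (@le_trans _ _ (L ^+ 2 * m * r)); first by rewrite ler_wpM2l.
    by rewrite ler_wpM2r ?ltW//; lra.
  apply: (@le_trans _ _ ((L ^+ 2 * m + 1) * (e / (12 * (L ^+ 2 * m + 1))))).
    by rewrite ler_wpM2l// ltW.
  by rewrite le_eqVlt; apply/orP; left; apply/eqP; field; lra.
rewrite cE; have Lpf := subB HS Lp Lf.
apply: le_lt_trans (ip_le_sqrD H Lcd (subD HS Lc Lpf)) _.
have := ip_le_sqrD H Lc Lpf; rewrite (ip_sqrB_sym H Lp Lf); lra.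
Qed.

End mollifier.

(** * Harmonic functions with gradient bounded in the dual of H10 *)

Ltac smooth_auto := repeat first
  [ assumption | apply: smoothM | apply: smoothD | apply: smoothB | apply: smooth_sum => ?
  | apply: smoothX | apply: smooth_partial | apply: smoothZ | apply: smooth_cst ].

Section caccioppoli.
Context {R : realType} {d : nat}.
Local Notation pt := 'rV[R]_d.
Local Notation mu := (lebesgue_row R d).
Local Notation D i f := ('D_(@unit_vec R d i) f).
Local Notation test := (test_function (setT : set pt)).
Implicit Types (f g h phi eta u w : pt -> R) (i j : 'I_d).
Let mT : measurable (setT : set pt) := measurableT.

Definition lap u (x : pt) : R := \sum_j D j (D j u) x.

Context (K : set pt).
Hypothesis cK : compact K.

Definition supp_test f := smooth f /\ forall x, ~ K x -> f x = 0.

Lemma supp_testT f : supp_test f -> test f.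
Proof. by move=> [sf f0]; split=> //; exists K. Qed.

Lemma supp_testM f g : smooth f -> supp_test g -> supp_test (fun x => f x * g x).
Proof. by move=> sf [sg g0]; split=> [|x /g0 ->]; [exact: smoothM|rewrite mulr0]. Qed.

Lemma supp_test_partial i f : supp_test f -> supp_test (D i f).
Proof.
move=> [sf f0]; split; first exact: smooth_partial.
exact: eq0_off_partial (compact_closed (@norm_hausdorff _ _) cK) f0.
Qed.

Lemma supp_test_sum (I : Type) (s : seq I) (F : I -> pt -> R) :
  (forall k, supp_test (F k)) -> supp_test (fun x => \sum_(k <- s) F k x).
Proof.
move=> hF; split=> [|x nK]; first by apply: smooth_sum => k; case: (hF k).
by rewrite big1// => k _; case: (hF k) => _ ->.
Qed.

Lemma by_parts_sum (F V : 'I_d -> pt -> R) :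
  (forall j, smooth (F j)) -> (forall j, supp_test (V j)) ->
  \int[mu]_x (\sum_j F j x * D j (V j) x) = - \int[mu]_x (\sum_j D j (F j) x * V j x).
Proof.
move=> sF tV; have tV' j := supp_test_partial j (tV j).
rewrite !(Rint_sum mT); last 2 first.
- by move=> j; apply: intg_test; apply: supp_testT; apply: supp_testM => //; exact: smooth_partial.
- by move=> j; apply: intg_test; apply: supp_testT; exact: supp_testM.
rewrite -sumrN; apply: eq_bigr => j _; apply: (Rint_by_parts j mT) => //.
by apply: supp_testT.
Qed.

Context (eta : pt -> R) (L : R).
Hypotheses (teta : supp_test eta) (etaL : forall x, \sum_i D i eta x ^+ 2 <= L).
Let seta := teta.1.

Let supp_eta f g : smooth g -> (forall x, f x = g x * eta x) -> supp_test f.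
Proof.
by move=> sg fg; have -> : f = fun x => g x * eta x; [apply/funext|exact: supp_testM].
Qed.

(** Test the equation with [eta ^+ 4 * w]. The fourth power leaves the weight [eta ^+ 2] on the
    right-hand side, which is the weight of the first-order energy to which the bound is later
    compared. *)
Lemma caccioppoli w : smooth w -> (forall x, K x -> lap w x = 0) ->
  \int[mu]_x (eta x ^+ 4 * \sum_j D j w x ^+ 2) <= 16 * L * \int[mu]_x (eta x ^+ 2 * w x ^+ 2).
Proof.
move=> sw w0; pose V j x := eta x ^+ 4 * w x.
have tV j : supp_test (V j).
  by apply: (supp_eta (g := fun x => eta x ^+ 3 * w x)) => [|x]; [smooth_auto|rewrite /V; ring].
have DV j x : D j (V j) x = eta x ^+ 4 * D j w x + 4 * eta x ^+ 3 * D j eta x * w x.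
  have D2 y : D j (fun z => eta z ^+ 2) y = 2 * eta y * D j eta y.
    rewrite (_ : (fun _ => _) = fun z => eta z * eta z); last by apply/funext => z; rewrite expr2.
    by rewrite derive_mulf//; ring.
  have D4 : D j (fun z => eta z ^+ 4) x = 4 * eta x ^+ 3 * D j eta x.
    rewrite (_ : (fun _ => _) = fun z => eta z ^+ 2 * eta z ^+ 2); last by apply/funext => z; ring.
    by rewrite derive_mulf ?D2; [ring|smooth_auto|smooth_auto].
  by rewrite derive_mulf ?D4; [ring|smooth_auto|smooth_auto].
have := by_parts_sum (fun j => smooth_partial j sw) tV.
have -> : \int[mu]_x (\sum_j D j (D j w) x * V j x) = 0.
  rewrite -[RHS](Rint0 mu (setT : set pt)); apply: eq_Rintegral => x _.
  rewrite -mulr_suml -[\sum__ _]/(lap w x).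
  have [/w0 ->|nK] := pselect (K x); first by rewrite mul0r.
  by rewrite /V (teta.2 _ nK) expr0n/= !(mul0r, mulr0).
rewrite oppr0 => h0.
pose a x := eta x ^+ 4 * \sum_j D j w x ^+ 2; pose b x := eta x ^+ 2 * w x ^+ 2.
pose c x := \sum_j D j w x * D j (V j) x.
have Ia : intg mu setT a.
  apply/intg_test/supp_testT/(supp_eta (g := fun x => eta x ^+ 3 * \sum_j D j w x ^+ 2)).
    smooth_auto.
  by move=> x; rewrite /a; ring.
have Ib : intg mu setT b.
  apply/intg_test/supp_testT/(supp_eta (g := fun x => eta x * w x ^+ 2)); first smooth_auto.
  by move=> x; rewrite /b; ring.
have Ic : intg mu setT c.
  apply/intg_test/supp_testT/supp_test_sum => j.
  by apply: supp_testM; [smooth_auto|exact: supp_test_partial].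
rewrite -[X in X <= _]/(\int[mu]_x a x) -[X in _ <= _ * X]/(\int[mu]_x b x).
(* For each direction the difference of the two sides is half the square of
   [eta ^+ 2 * D j w + 4 * eta * w * D j eta], before [L] bounds the gradient of [eta]. *)
have pw x : 2^-1 * a x - 8 * L * b x <= c x.
  rewrite /c (eq_bigr (fun j => eta x ^+ 4 * D j w x ^+ 2 +
      4 * eta x ^+ 3 * w x * (D j eta x * D j w x))); last by move=> j _; rewrite DV; ring.
  have : \sum_j (2^-1 * (eta x ^+ 4 * D j w x ^+ 2) - 8 * b x * D j eta x ^+ 2) <=
    \sum_j (eta x ^+ 4 * D j w x ^+ 2 + 4 * eta x ^+ 3 * w x * (D j eta x * D j w x)).
    apply: ler_sum => j _; rewrite /b.
    have := sqr_ge0 (eta x ^+ 2 * D j w x + 4 * eta x * w x * D j eta x).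
    by rewrite -subr_ge0 => h; rewrite -subr_ge0; nra.
  apply: le_trans; rewrite sumrB -!mulr_sumr lerB// [8 * L * _]mulrAC.
  by apply: ler_wpM2l (etaL x); rewrite /b mulr_ge0 ?ler0n// mulr_ge0 ?sqr_ge0.
have : \int[mu]_x (2^-1 * a x - 8 * L * b x) <= 0.
  by rewrite -h0; apply: le_Rint => //; apply: (intgB mT); exact: intgZ.
rewrite RintB//; [|exact: intgZ..]; rewrite !RintZ//; lra.
Qed.

(** The dual bound tested with [V j = eta ^+ 2 * D j u] gives the square of the energy [E] on the
    left. On the right the Dirichlet integral of [V] is at most [40 * L * E]: 32 from the
    Caccioppoli estimate for the harmonic functions [D j u] and 8 from differentiating [eta ^+ 2].
    One factor [E] cancels. *)
Lemma dual_gradient_bound u (C : R) : 0 <= C -> 0 <= L -> smooth u ->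
  (forall x, K x -> lap u x = 0) -> (forall i x, K x -> lap (D i u) x = 0) ->
  (forall V : 'I_d -> pt -> R, (forall j, supp_test (V j)) ->
     (\int[mu]_x (u x * \sum_j D j (V j) x)) ^+ 2 <=
     C * \sum_j \sum_i \int[mu]_x (D i (V j) x ^+ 2)) ->
  \int[mu]_x (eta x ^+ 2 * \sum_j D j u x ^+ 2) <= 40 * C * L.
Proof.
move=> C0 L0 su u0 Du0 dual; pose V j x := eta x ^+ 2 * D j u x.
have tV j : supp_test (V j).
  by apply: (supp_eta (g := fun x => eta x * D j u x)) => [|x]; [smooth_auto|rewrite /V; ring].
have DV i j x : D i (V j) x = eta x ^+ 2 * D i (D j u) x + 2 * eta x * D i eta x * D j u x.
  have D2 y : D i (fun z => eta z ^+ 2) y = 2 * eta y * D i eta y.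
    rewrite (_ : (fun _ => _) = fun z => eta z * eta z); last by apply/funext => z; rewrite expr2.
    by rewrite derive_mulf//; ring.
  by rewrite derive_mulf ?D2; [ring|smooth_auto|smooth_auto].
set E := \int[mu]_x _.
have tE j : supp_test (fun x => eta x ^+ 2 * D j u x ^+ 2).
  by apply: (supp_eta (g := fun x => eta x * D j u x ^+ 2)) => [|x]; [smooth_auto|ring].
have IE j : intg mu setT (fun x => eta x ^+ 2 * D j u x ^+ 2) by exact/intg_test/supp_testT.
have EE : E = \sum_j \int[mu]_x (eta x ^+ 2 * D j u x ^+ 2).
  by rewrite -Rint_sum//; apply: eq_Rintegral => x _; rewrite mulr_sumr.
have E0 : 0 <= E by rewrite EE; apply: sumr_ge0 => j _; apply: Rint_ge0 => x _; rewrite mulr_ge0 ?sqr_ge0.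
have := dual V tV.
have -> : \int[mu]_x (u x * \sum_j D j (V j) x) = - E.
  transitivity (\int[mu]_x (\sum_j u x * D j (V j) x)).
    by apply: eq_Rintegral => x _; rewrite mulr_sumr.
  rewrite by_parts_sum//; congr (- _); apply: eq_Rintegral => x _; rewrite mulr_sumr.
  by apply: eq_bigr => j _; rewrite /V; ring.
have IDV i j : intg mu setT (fun x => D i (V j) x ^+ 2).
  apply/intg_test/supp_testT; rewrite (_ : (fun _ => _) = fun x => D i (V j) x * D i (V j) x).
    by apply: supp_testM; [apply: smooth_partial; case: (tV j)|exact: supp_test_partial].
  by apply/funext => x; rewrite expr2.
have hj j : \sum_i \int[mu]_x (D i (V j) x ^+ 2) <= 40 * L * \int[mu]_x (eta x ^+ 2 * D j u x ^+ 2).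
  have I4 : intg mu setT (fun x => eta x ^+ 4 * \sum_i D i (D j u) x ^+ 2).
    apply/intg_test/supp_testT/(supp_eta (g := fun x => eta x ^+ 3 * \sum_i D i (D j u) x ^+ 2)).
      smooth_auto.
    by move=> x; ring.
  have := caccioppoli (smooth_partial j su) (Du0 j) => hc.
  have : \int[mu]_x (\sum_i D i (V j) x ^+ 2) <=
      \int[mu]_x (2 * (eta x ^+ 4 * \sum_i D i (D j u) x ^+ 2) + 8 * L * (eta x ^+ 2 * D j u x ^+ 2)).
    apply: le_Rint => //; [exact: intg_sum|by apply: (intgD mT); exact: intgZ|move=> x _].
    apply: (@le_trans _ _ (\sum_i (2 * (eta x ^+ 4 * D i (D j u) x ^+ 2) +
        8 * (eta x ^+ 2 * D j u x ^+ 2) * D i eta x ^+ 2))).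
      apply: ler_sum => i _; rewrite DV.
      have := sqr_ge0 (eta x ^+ 2 * D i (D j u) x - 2 * eta x * D i eta x * D j u x).
      by move=> h; rewrite -subr_ge0; nra.
    rewrite big_split/= -!mulr_sumr lerD// [8 * L * _]mulrAC.
    by apply: ler_wpM2l (etaL x); rewrite mulr_ge0 ?ler0n// mulr_ge0 ?sqr_ge0.
  rewrite Rint_sum// RintD//; [|exact: intgZ..]; rewrite !RintZ//.
  move=> h; apply: le_trans h _; rewrite -/(intg _ _ _) in hc *; lra.
have hs : \sum_j \sum_i \int[mu]_x (D i (V j) x ^+ 2) <= 40 * L * E.
  by rewrite EE mulr_sumr; apply: ler_sum.
rewrite sqrrN => h; have h2 : E ^+ 2 <= 40 * C * L * E.
  apply: le_trans h _; rewrite [40 * C]mulrC -!mulrA ler_wpM2l// !mulrA.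
  exact: hs.
have [E1|E1] := eqVneq E 0; first by rewrite E1 !mulr_ge0.
have Ep : 0 < E by rewrite lt_neqAle eq_sym E1.
by rewrite -(ler_pM2r Ep) -expr2.
Qed.

End caccioppoli.

Lemma ler_norm_sqr {R : realDomainType} (a b : R) : `|a| <= b -> a ^+ 2 <= b ^+ 2.
Proof.
move=> ab; rewrite -real_normK ?num_real//; apply: lerXn2r => //.
by rewrite nnegrE (le_trans _ ab).
Qed.

Lemma lap_reflect {R : realType} {d : nat} (f : 'rV[R]_d -> R) (x y : 'rV[R]_d) :
  smooth f -> lap (fun z => f (x - z)) y = lap f (x - y).
Proof.
move=> sf; apply: eq_bigr => j _; set v := unit_vec R j.
have e1 g : smooth g -> 'D_v (fun z => g (x - z)) = fun z => - 'D_v g (x - z).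
  by move=> sg; apply/funext => z; exact: (derive_reflect v (smooth_diff (x - z) sg)).2.
rewrite (e1 _ sf); have sD := smooth_partial j sf.
rewrite (_ : (fun z => _) = fun z => -1 * 'D_v f (x - z)); last by apply/funext => z; rewrite mulN1r.
rewrite derive_mulf; [|exact: smooth_cst|exact: (smooth_reflect x sD)].
rewrite derive_cst mulr0 addr0 mulN1r.
by have := congr1 (fun f => f y) (e1 _ sD) => /= ->; rewrite opprK.
Qed.

Lemma norm_mul_le {R : realDomainType} (m a b : R) :
  0 <= m -> `|a| <= b \/ m = 0 -> `|m * a| <= b * m.
Proof.
move=> m0 [ab|->]; last by rewrite mul0r mulr0 normr0.
by rewrite normrM ger0_norm// mulrC ler_wpM2r.
Qed.

Lemma test_neg {R : realType} {d : nat} (g : 'rV[R]_d -> R) :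
  test_function setT g -> test_function setT (fun x => g (0 - x)).
Proof.
move=> [sg [L [cL _ L0]]]; split; first exact: smooth_reflect.
exists ((fun y : 'rV[R]_d => - y) @` L); split; [|exact: subsetT|].
  apply: continuous_compact cL.
  by apply: continuous_subspaceT => y; apply: continuousN.
move=> x nL; apply: L0 => Lx; apply: nL; exists (0 - x) => //.
by rewrite sub0r opprK.
Qed.

(* The two properties of the remainder [h = q - div w] of a function [q] after
   solving the Dirichlet problem for [w]: [h] is harmonic, and its gradient is
   small in the dual of [H^1_0]. *)
Section dual_bounded.
Context {R : realType} {d : nat}.
Local Notation pt := 'rV[R]_d.
Local Notation mu := (lebesgue_row R d).
Local Notation D i f := ('D_(@unit_vec R d i) f).
Local Notation testT := (test_function (setT : set pt)).
Context (Omega : set pt).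
Hypotheses (oO : open Omega) (bO : bounded_set Omega).
Implicit Types (f g h phi eta u w : pt -> R) (i j : 'I_d).
Let mT : measurable (setT : set pt) := measurableT.
Let mO := open_measurable_row oO.
Local Notation L2 := (L2 mu Omega).
Local Notation ip := (ip2 mu Omega).
Local Notation test := (test_function Omega).

Record dual_bounded h (C : R) : Prop := DualBounded {
  db_L2 : L2 h ;
  db_ge0 : 0 <= C ;
  db_harmonic : forall phi, test phi -> ip h (lap phi) = 0 ;
  db_dual : forall V : 'I_d -> pt -> R, (forall j, test (V j)) ->
    (ip h (fun x => \sum_j D j (V j) x)) ^+ 2 <=
    C * \sum_j \sum_i \int[mu]_x (D i (V j) x ^+ 2) }.

Context (h : pt -> R) (C : R).
Hypothesis hC : dual_bounded h C.
Let h0 := h \_ Omega.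
Let Lh := db_L2 hC.
Let Ih0 : intg mu setT h0.
Proof. by have [_ h1 _] := L2_restrict oO bO Lh. Qed.

Let int_h0 g : \int[mu]_y (h0 y * g y) = \int[mu]_(y in Omega) (h y * g y).
Proof.
rewrite [RHS]Rintegral_mkcond; apply: eq_Rintegral => y _.
by rewrite /h0 !patchE; case: ifP; rewrite ?mul0r.
Qed.

(** The Laplacian falls on the kernel, so its value at [x] is the pairing of [h] with the Laplacian
    of the reflected kernel, which is an admissible test function. *)
Lemma lap_conv_eq0 sigma x : testT sigma -> test (fun y => sigma (x - y)) ->
  lap (conv h0 sigma) x = 0.
Proof.
move=> ts tx.
have -> : lap (conv h0 sigma) x = \int[mu]_y (h0 y * lap sigma (x - y)).
  rewrite /lap; transitivity (\sum_j conv h0 (D j (D j sigma)) x).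
    by apply: eq_bigr => j _; rewrite (conv_partial j Ih0 ts); exact: (conv_differentiable x Ih0 (test_partial j ts)).2.
  rewrite /conv -(Rint_sum mT); last by move=> j; exact: (intg_conv x Ih0 (test_partial j (test_partial j ts))).
  by apply: eq_Rintegral => y _; rewrite mulr_sumr.
rewrite (int_h0 (fun y => lap sigma (x - y))) -[RHS](db_harmonic hC tx).
by apply: eq_Rintegral => y _; rewrite lap_reflect//; exact: ts.1.
Qed.

Context (r : R).
Hypothesis r0 : 0 < r.
Local Notation u := (conv h0 (mollifier r)).
Local Notation tr := (test_mollifier r0).
Context (K : set pt).
Hypotheses (cK : compact K) (Kr : forall x z, K x -> `|z| <= r -> Omega (x + z)).

Let reflect_test sigma x : K x -> testT sigma -> (forall z, ~ (`|z| <= r) -> sigma z = 0) ->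
  test (fun y => sigma (x - y)).
Proof.
move=> Kx ts s0; split; first exact: smooth_reflect ts.1.
exists [set y | `|x - y| <= r]; split=> [||y /= ny]; [exact: compact_closed_cube| |exact: s0].
by move=> y /= xy; have := Kr Kx (z := y - x); rewrite distrC [x + _]addrC subrK; exact.
Qed.

Let moll0 (z : pt) : ~ (`|z| <= r) -> mollifier r z = 0.
Proof. by move=> /negP; rewrite -ltNge => /ltW; exact: mollifier_eq0. Qed.

Lemma moll_harmonic x : K x -> lap u x = 0.
Proof. by move=> Kx; exact: lap_conv_eq0 tr (reflect_test Kx tr moll0). Qed.

Lemma moll_partial_harmonic i x : K x -> lap (D i u) x = 0.
Proof.
move=> Kx; rewrite (conv_partial i Ih0 tr); have ts := test_partial i tr.
apply: (lap_conv_eq0 ts); apply: (reflect_test Kx ts) => z nz.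
apply: (@eq0_off_partial _ _ _ [set z : pt | `|z| <= r]) => //.
have := @compact_closed_cube R d 0 r.
rewrite (_ : [set x0 | _] = [set z : pt | `|z| <= r]).
  exact: compact_closed (@norm_hausdorff _ _).
by apply/seteqP; split=> y /=; rewrite sub0r normrN.
Qed.

(** The constant is unchanged: the pairing with the mollification is an average of pairings of [h]
    with translates of [V], all supported in [Omega] and all of the same Dirichlet integral. *)
Lemma moll_dual (V : 'I_d -> pt -> R) : (forall j, supp_test K (V j)) ->
  (\int[mu]_x (u x * \sum_j D j (V j) x)) ^+ 2 <=
  C * \sum_j \sum_i \int[mu]_x (D i (V j) x ^+ 2).
Proof.
move=> tV; set S := \sum_j _.
have tVT j := supp_testT cK (tV j).
pose g x := \sum_j D j (V j) x.
have tg : testT g by apply: test_sum => j; exact: test_partial.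
rewrite (conv_pairing tr (@mollifier_even _ _ r) Ih0 tg).
pose J z := \int[mu]_y (h0 y * g (y - z)).
have S0 : 0 <= C * S.
  rewrite mulr_ge0 ?(db_ge0 hC)//; apply: sumr_ge0 => j _; apply: sumr_ge0 => i _.
  by apply: Rint_ge0 => x _; exact: sqr_ge0.
have JS z : `|z| < r -> `|J z| <= Num.sqrt (C * S).
  move=> zr; rewrite -(@ler_pXn2r _ 2)// ?nnegrE ?sqrtr_ge0// real_normK ?num_real// sqr_sqrtr//.
  pose W j := fun y => V j (y + (- z)).
  have DW i j y : D i (W j) y = D i (V j) (y - z) by exact: derive_shift.
  have -> : J z = ip h (fun x => \sum_j D j (W j) x).
    rewrite /J int_h0; apply: eq_Rintegral => y _; congr (_ * _); apply: eq_bigr => j _.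
    by rewrite DW.
  apply: le_trans (db_dual hC _) _ => [j|].
    split; first exact: smooth_shift (tV j).1.
    exists [set y + z | y in K]; split.
    - apply: (@continuous_compact _ _ (fun y : pt => y + z)) => //.
      by apply: continuous_subspaceT => y; apply: continuousD => //; exact: cst_continuous.
    - by move=> _ [y Ky <-]; apply: Kr => //; exact: ltW.
    - move=> y ny; apply: (tV j).2 => Ky; apply: ny; exists (y - z) => //; by rewrite subrK.
  apply: (ler_wpM2l (db_ge0 hC)); rewrite /S; apply: ler_sum => j _; apply: ler_sum => i _.
  rewrite -(Rint_shift (- z) (f := fun x => D i (V j) x ^+ 2)); last first.
    by apply: measurable_funX; apply: smooth_measurable; exact: smooth_partial (tV j).1.
  by rewrite le_eqVlt; apply/orP; left; apply/eqP; apply: eq_Rintegral => x _; rewrite DW.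
(* As a convolution [J] is smooth, which provides its integrability against the mollifier. *)
have Jc : J = conv h0 (fun x => g (- x)).
  by apply/funext => z; apply: eq_Rintegral => y _; rewrite opprB.
have tg' : testT (fun x => g (0 - x)) by exact: test_neg.
have sJ : smooth J.
  rewrite Jc (_ : (fun x => g (- x)) = fun x => g (0 - x)); first exact: smooth_conv.
  by apply/funext => x; rewrite sub0r.
have IJ : intg mu setT (fun z => mollifier r z * J z).
  have := intg_test (testM sJ tr); congr intg; by apply/funext => z; rewrite mulrC.
rewrite -/(J _); apply: (@le_trans _ _ (Num.sqrt (C * S) ^+ 2)); last by rewrite sqr_sqrtr.
apply: ler_norm_sqr.
apply: le_trans (Rint_norm mT IJ) _.
have -> : Num.sqrt (C * S) = \int[mu]_z (Num.sqrt (C * S) * mollifier r z).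
  by rewrite (RintZ mT _ (intg_test tr)) (mollifier_int r0) mulr1.
apply: (le_Rint mT (intg_norm IJ) (intgZ mT _ (intg_test tr))) => z _.
apply: norm_mul_le (mollifier_ge0 r0 z) _.
by have [zr|zr] := ltP `|z| r; [left; exact: JS|right; exact: mollifier_eq0].
Qed.

Lemma moll_gradient_bound eta (L : R) : 0 <= L -> supp_test K eta ->
  (forall x, \sum_i D i eta x ^+ 2 <= L) ->
  \int[mu]_x (eta x ^+ 2 * \sum_j D j u x ^+ 2) <= 40 * C * L.
Proof.
move=> L0 te eL; apply: (dual_gradient_bound cK te eL (db_ge0 hC) L0).
- exact: smooth_conv Ih0 tr.
- exact: moll_harmonic.
- exact: moll_partial_harmonic.
- exact: moll_dual.
Qed.

End dual_bounded.

Lemma sum_CS {R : realType} (I : finType) (a b : I -> R) :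
  (\sum_i a i * b i) ^+ 2 <= (\sum_i a i ^+ 2) * (\sum_i b i ^+ 2).
Proof.
apply: discr_le; first by apply: sumr_ge0 => i _; exact: sqr_ge0.
move=> t; have : 0 <= \sum_i (a i * t + b i) ^+ 2 by apply: sumr_ge0 => i _; exact: sqr_ge0.
congr (0 <= _); rewrite mulr_suml mulr_sumr mulr_suml -!big_split/=.
by apply: eq_bigr => i _; ring.
Qed.

(** * The Poincare inequality on cubes *)

Section cube_poincare.
Context {R : realType} {d : nat}.
Local Notation pt := 'rV[R]_d.
Local Notation mu := (lebesgue_row R d).
Local Notation D i f := ('D_(@unit_vec R d i) f).
Implicit Types (f g : pt -> R) (i j : 'I_d).
Let mT : measurable (setT : set pt) := measurableT.
Let leb : {measure set (measurableTypeR R) -> \bar R} := lebesgue_measure.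

Definition sqr_grad f (x : pt) := \sum_i D i f x ^+ 2.

Lemma sqr_grad_ge0 f x : 0 <= sqr_grad f x.
Proof. by apply: sumr_ge0 => i _; exact: sqr_ge0. Qed.

Lemma smooth_sqr_grad f : smooth f -> smooth (sqr_grad f).
Proof. by move=> sf; smooth_auto. Qed.

Lemma measurable_sqr_grad f : smooth f -> measurable_fun setT (sqr_grad f).
Proof. by move=> sf; apply: smooth_measurable; exact: smooth_sqr_grad. Qed.

Lemma derive_sqr_le f (x z : pt) : smooth f ->
  'D_z f x ^+ 2 <= d%:R * `|z| ^+ 2 * sqr_grad f x.
Proof.
move=> sf; rewrite derive_row; last exact: smooth_diff.
apply: le_trans (sum_CS _ _) _; rewrite ler_wpM2r ?sqr_grad_ge0//.
apply: (@le_trans _ _ (\sum_(i < d) `|z| ^+ 2)); last by rewrite sumr_const card_ord -[_ *+ d]mulr_natl.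
by apply: ler_sum => i _; apply: ler_norm_sqr; exact: row_norm_coord.
Qed.

(** The increment [a] is the integral of the derivative [g] along the segment, and [a ^+ 2] is at
    most the integral of [g ^+ 2] because that of [(g - a) ^+ 2] is nonnegative. *)
Lemma line_sqr_le f (x z : pt) : smooth f ->
  (((f (x + z) - f x) ^+ 2)%:E <=
   \int[leb]_(t in `[0%R, 1%R]) (d%:R * `|z| ^+ 2 * sqr_grad f (x + t *: z))%:E)%E.
Proof.
move=> sf; pose F (t : R) : R := f (x + t *: z); pose g (t : R) : R := 'D_z f (x + t *: z).
have line_cont (h : pt -> R) : continuous h -> continuous (fun t : R => h (x + t *: z)).
  move=> ch t; apply: continuous_comp; last exact: ch.
  by apply: continuousD; [exact: cst_continuous|exact: scalel_continuous].
have Fd t : is_derive t (1 : R) F (g t) by exact: is_derive_line.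
have cF : continuous F by apply: line_cont; exact: smooth_continuous.
have cDz : continuous ('D_z f).
  rewrite (_ : 'D_z f = fun y => \sum_i z 0 i * D i f y); last first.
    by apply/funext => y; rewrite derive_row//; exact: smooth_diff.
  by apply: smooth_continuous; smooth_auto.
have cg : continuous g by exact: (line_cont _ cDz).
have cI : compact (`[0%R, 1%R] : set R) by exact: segment_compact.
have cont_intg (h : R -> R) : continuous h -> intg leb `[0%R, 1%R] h.
  by move=> ch; apply: continuous_compact_integrable => //; exact: continuous_subspaceT.
have mI : measurable (`[0%R, 1%R] : set (measurableTypeR R)) by exact: measurable_itv.
have Ig := cont_intg _ cg.
have cg2 : continuous (fun t => g t ^+ 2).
  by move=> t; apply: (@continuousM _ _ g g t); exact: cg.
have Ig2 := cont_intg _ cg2.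
have lI : leb [set` `[0%R, 1%R]] = 1%E.
  by have := @lebesgue_measure_itv R `[0%R, 1%R]; rewrite /= lte_fin ltr01 -EFinB subr0.
have c_int (c : R) : \int[leb]_(t in `[0%R, 1%R]) c = c by rewrite Rintegral_cst// lI mulr1.
have Ic (c : R) : intg leb `[0%R, 1%R] (fun=> c) by apply: cont_intg; exact: cst_continuous.
have ftc : \int[leb]_(t in `[0%R, 1%R]) g t = f (x + z) - f x.
  apply: EFin_inj; rewrite (EFin_Rint mI Ig).
  rewrite (continuous_FTC2 (F := F) ltr01); last first.
  - by move=> t _; rewrite derive1E; apply: derive_val.
  - split; [by move=> t _; exact: ex_derive| |].
    + by apply: cvg_at_right_filter; exact: cF.
    + by apply: cvg_at_left_filter; exact: cF.
  - exact: continuous_subspaceT.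
  by rewrite /F scale1r scale0r addr0.
set a := f (x + z) - f x in ftc *.
have : 0 <= \int[leb]_(t in `[0%R, 1%R]) (g t - a) ^+ 2 by apply: Rint_ge0 => t _; exact: sqr_ge0.
have -> : \int[leb]_(t in `[0%R, 1%R]) (g t - a) ^+ 2 =
    \int[leb]_(t in `[0%R, 1%R]) g t ^+ 2 - 2 * a * a + a ^+ 2.
  have e1 : \int[leb]_(t in `[0%R, 1%R]) (2 * a * g t) = 2 * a * a by rewrite (RintZ mI _ Ig) ftc.
  have J1 := intgZ mI (2 * a) Ig.
  rewrite -e1 -[a ^+ 2]c_int -(RintB mI Ig2 J1) -(RintD mI (intgB mI Ig2 J1) (Ic _)).
  by apply: eq_Rintegral => t _; ring.
move=> h; apply: (@le_trans _ _ (\int[leb]_(t in `[0%R, 1%R]) g t ^+ 2)%:E).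
  by rewrite lee_fin; lra.
rewrite (EFin_Rint mI Ig2); apply: ge0_le_integral => //.
- by move=> t _; rewrite lee_fin sqr_ge0.
- by apply/measurable_EFinP; apply: intg_mf Ig2.
- apply/measurable_EFinP; apply: (@intg_mf _ _ _ leb); apply: cont_intg.
  by apply: (line_cont (fun y => d%:R * `|z| ^+ 2 * sqr_grad f y)); apply: smooth_continuous; smooth_auto.
- by move=> t _; rewrite lee_fin; exact: derive_sqr_le.
Qed.

Context (a : pt) (r : R).
Hypothesis r0 : 0 < r.
Local Notation Q := (ball a r).
Let mQ : measurable Q := measurable_row_ball a r.

Let Q_line x z (t : R) : Q x -> Q (x + z) -> 0 <= t <= 1 -> Q (x + t *: z).
Proof.
rewrite -!ball_normE /ball_/= => Qx Qz /andP[t0 t1].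
have -> : a - (x + t *: z) = (1 - t) *: (a - x) + t *: (a - (x + z)).
  by apply/rowP => i; rewrite !mxE; ring.
apply: le_lt_trans (ler_normD _ _) _; rewrite !normrZ !ger0_norm//; last by rewrite subr_ge0.
have [t10|t1n] := eqVneq t 1; first by rewrite t10 subrr mul0r add0r mul1r.
have t1p : 0 < 1 - t by rewrite subr_gt0 lt_neqAle t1n.
have : (1 - t) * `|a - x| < (1 - t) * r by rewrite ltr_pM2l.
have : t * `|a - (x + z)| <= t * r by rewrite ler_wpM2l// ltW.
lra.
Qed.

(** By convexity the segment from [x] to [x + z] stays in the cube. After exchanging integrals,
    translation invariance makes the contribution of each parameter [t] at most the full energy. *)
Lemma translate_sqr_le f (z : pt) : smooth f ->
  (\int[mu]_x (\1_Q x * \1_Q (x + z) * (f (x + z) - f x) ^+ 2)%:E <=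
   (d%:R * `|z| ^+ 2)%:E * \int[mu]_(x in Q) (sqr_grad f x)%:E)%E.
Proof.
move=> sf; pose c := d%:R * `|z| ^+ 2; have c0 : 0 <= c by rewrite mulr_ge0// sqr_ge0.
pose g0 x := \1_Q x * sqr_grad f x.
have g00 x : 0 <= g0 x by rewrite mulr_ge0 ?sqr_grad_ge0//.
have mg0 : measurable_fun setT g0.
  apply: measurable_funM; first exact: measurable_indic.
  exact: measurable_sqr_grad.
have mG : measurable_fun Q (fun x => (sqr_grad f x)%:E).
  by apply/measurable_EFinP; apply: measurable_funTS; exact: measurable_sqr_grad.
pose H (p : pt * measurableTypeR R) := (\1_`[0%R, 1%R] p.2 * (c * g0 (p.1 + p.2 *: z)))%:E.
have mH : measurable_fun setT H.
  apply/measurable_EFinP; apply: measurable_funM.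
    by apply: measurableT_comp => //; exact: measurable_indic.
  apply: measurable_funM => //; apply: measurableT_comp => //.
  apply: measurable_fun_rowP => i.
  rewrite (_ : _ \o _ = fun p : pt * measurableTypeR R => row_coord i p.1 + p.2 * z 0 i); last first.
    by apply/funext => p; rewrite /row_coord/= !mxE.
  apply: measurable_funD; first by apply: measurableT_comp => //; exact: measurable_row_coord.
  exact: measurable_funM.
have H0 p : (0 <= H p)%E by rewrite lee_fin mulr_ge0// mulr_ge0.
have [m1 _ e1 e2] := tonelli_sf (@lebesgue_row_sigma_finite R d) mH H0.
have mz : measurable_fun setT (fun x : pt => x + z) by exact: measurable_row_shift.
have mf := smooth_measurable sf.
apply: (@le_trans _ _ (\int[mu]_x \int[lebesgue_measure]_t H (x, t))%E).
  apply: ge0_le_integral; [exact: mT| | |exact: m1|].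
  - by move=> x _; rewrite lee_fin mulr_ge0 ?sqr_ge0// mulr_ge0.
  - apply/measurable_EFinP; apply: measurable_funM; last first.
      by apply: measurable_funX; apply: measurable_funB => //; exact: measurableT_comp.
    apply: measurable_funM; first exact: measurable_indic.
    by apply: measurableT_comp => //; exact: measurable_indic.
  move=> x _; have [[Qx Qz]|nQ] := pselect (Q x /\ Q (x + z)); last first.
    have -> : \1_Q x * \1_Q (x + z) = 0 :> R.
      have [Qx|nQx] := pselect (Q x); last by rewrite indicE memNset// mul0r.
      have [Qz|nQz] := pselect (Q (x + z)); first by case: nQ.
      by rewrite [X in _ * X]indicE memNset// mulr0.
    by rewrite mul0r; apply: integral_ge0.
  rewrite !indicE !mem_set// !mul1r; apply: le_trans (line_sqr_le x z sf) _.
  rewrite integral_mkcond; apply: ge0_le_integral => //.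
  - by move=> t _; rewrite patchE; case: ifP => // _; rewrite lee_fin !mulr_ge0 ?sqr_grad_ge0 ?sqr_ge0.
  - apply/(measurable_restrictT _ (measurable_itv _)).
    apply/measurable_EFinP; apply: measurable_funM => //.
    apply: measurable_funTS; apply: measurableT_comp; first exact: measurable_sqr_grad.
    apply: measurable_fun_rowP => i.
    rewrite (_ : _ \o _ = fun t : measurableTypeR R => x 0 i + t * z 0 i); last first.
      by apply/funext => p; rewrite /row_coord/= !mxE.
    by apply: measurable_funD => //; exact: measurable_funM.
  - by apply: measurableT_comp mH _; exact: measurable_pair1.
  move=> t _; rewrite patchE /H indicE/=; case: ifPn => tI; last by rewrite lee_fin mul0r.
  rewrite mul1r /g0 indicE mem_set ?mul1r//.
  by apply: Q_line => //; move/set_mem: tI => /=; rewrite in_itv/=.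
rewrite -e1 e2; set G := (\int[mu]_(x in Q) _)%E.
have G0 : (0 <= G)%E by apply: integral_ge0 => x _; rewrite lee_fin sqr_grad_ge0.
have slice t : (\int[mu]_x H (x, t) = (\1_`[0%R, 1%R] t)%:E * (c%:E * G))%E.
  have HE x : (H (x, t) = (\1_`[0%R, 1%R] t)%:E * (c%:E * (g0 (x + t *: z))%:E))%E by [].
  under eq_integral do rewrite HE.
  have mgz : measurable_fun setT (fun x : pt => (g0 (x + t *: z))%:E).
    by apply/measurable_EFinP; apply: measurableT_comp => //; exact: measurable_row_shift.
  rewrite ge0_integralZl//; last 2 first.
  - by apply: emeasurable_funM.
  - by move=> x _; rewrite mule_ge0 ?lee_fin.
  rewrite ge0_integralZl//; last by move=> x _; rewrite lee_fin.
  rewrite (ge0_integral_shift (t *: z) (f := fun x => (g0 x)%:E))//; last exact/measurable_EFinP.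
  congr (_ * (_ * _))%E; rewrite /G [RHS]integral_mkcond; apply: eq_integral => x _.
  by rewrite /g0 patchE indicE; case: ifP => _; rewrite ?mul1r ?mul0r.
under eq_integral do rewrite slice.
rewrite ge0_integralZr//; last 2 first.
- by apply/measurable_EFinP; exact: measurable_indic.
- by rewrite mule_ge0// lee_fin.
rewrite integral_indic//.
rewrite setIT; set l := (X in (X * _ <= _)%E).
have -> : l = 1%E by have := @lebesgue_measure_itv R `[0%R, 1%R]; rewrite /= lte_fin ltr01 -EFinB subr0.
by rewrite mul1e.
Qed.

(** Substitute [y = x + z] and integrate the translation estimate over [z]; only [|z| < 2 * r]
    contributes, a cube of volume [(4 * r) ^+ d]. *)
Lemma double_sqr_le f : smooth f ->
  (\int[mu]_(x in Q) \int[mu]_(y in Q) ((f y - f x) ^+ 2)%:E <=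
   ((4 * r) ^+ d * (d%:R * (2 * r) ^+ 2))%:E * \int[mu]_(x in Q) (sqr_grad f x)%:E)%E.
Proof.
move=> sf; set G := (\int[mu]_(x in Q) (sqr_grad f x)%:E)%E.
have G0 : (0 <= G)%E by apply: integral_ge0 => x _; rewrite lee_fin sqr_grad_ge0.
have mf := smooth_measurable sf.
pose F (p : pt * pt) := (\1_Q p.1 * \1_Q (p.1 + p.2) * (f (p.1 + p.2) - f p.1) ^+ 2)%:E.
have madd := @measurable_row_add R d.
have mF : measurable_fun setT F.
  apply/measurable_EFinP; apply: measurable_funM; last first.
    by apply: measurable_funX; apply: measurable_funB; exact: measurableT_comp.
  by apply: measurable_funM; apply: measurableT_comp => //; exact: measurable_indic.
have F0 p : (0 <= F p)%E by rewrite lee_fin mulr_ge0 ?sqr_ge0// mulr_ge0.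
have [_ e1] := row_tonelli mF F0.
have -> : (\int[mu]_(x in Q) \int[mu]_(y in Q) ((f y - f x) ^+ 2)%:E =
    \int[mu]_x \int[mu]_z F (x, z))%E.
  rewrite integral_mkcond; apply: eq_integral => x _; rewrite patchE.
  case: ifPn => xQ; last first.
    by rewrite /F/= indicE (negbTE xQ); under eq_integral do rewrite !mul0r; rewrite integral0.
  rewrite /F/= indicE xQ integral_mkcond.
  rewrite -(ge0_integral_shift x (f := (fun y => ((f y - f x) ^+ 2)%:E) \_ Q)); last 2 first.
  - apply/(measurable_restrictT _ mQ); apply/measurable_EFinP; apply: measurable_funX.
    by apply: measurable_funB; [exact: measurable_funTS|exact: measurable_cst].
  - by move=> y; rewrite patchE; case: ifP => _; [rewrite lee_fin; exact: sqr_ge0|exact: lexx].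
  apply: eq_integral => z _; rewrite patchE indicE [z + x]addrC.
  by case: ifP => _; rewrite !(mul1r, mul0r).
rewrite e1.
have r20 : 0 < 2 * r by rewrite mulr_gt0.
have mB : measurable (ball (0%R : pt) (2 * r)) by exact: measurable_row_ball.
apply: (@le_trans _ _ (\int[mu]_z ((\1_(ball (0%R : pt) (2 * r)) z)%:E * ((d%:R * (2 * r) ^+ 2)%:E * G)))%E).
  apply: ge0_le_integral; [exact: mT| | | |].
  - by move=> z _; apply: integral_ge0.
  - have mF' : measurable_fun setT (fun p : pt * pt => F (p.2, p.1)).
      by apply: (measurableT_comp mF); exact: measurable_swap.
    by have [] := row_tonelli mF' (fun p => F0 _).
  - apply: emeasurable_funM; last exact: measurable_cst.
    by apply/measurable_EFinP; exact: measurable_indic.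
  clear mF F0 madd e1; move=> z _; have [zb|zb] := ltP `|z| (2 * r).
    rewrite indicE mem_set ?mul1e; last by rewrite -ball_normE /ball_/= sub0r normrN.
    apply: le_trans (translate_sqr_le z sf) _; rewrite lee_wpmul2r// lee_fin ler_wpM2l//.
    by apply: lerXn2r; rewrite ?nnegrE// ltW.
  rewrite (_ : (\int[mu]_x F (x, z) = 0)%E); first 
    apply: mule_ge0; first by rewrite lee_fin.
    by apply: mule_ge0 => //; rewrite lee_fin mulr_ge0 ?sqr_ge0.
  rewrite -[RHS](integral0 mu setT); apply: eq_integral => x _.
  have [Qx|nQx] := pselect (Q x); last by rewrite /F/= indicE memNset// !mul0r.
  have [Qz|nQz] := pselect (Q (x + z)); last first.
    by rewrite /F/= [\1_Q (x + z)]indicE memNset// mulr0 mul0r.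
  exfalso; move: Qx Qz zb; rewrite -!ball_normE /ball_/= => Qx Qz; rewrite leNgt => /negP; apply.
  have -> : z = (a - x) - (a - (x + z)) by apply/rowP => i; rewrite !mxE; ring.
  by apply: le_lt_trans (ler_normB _ _) _; rewrite mulr_natl mulr2n ltrD.
clear mF F0 madd e1; rewrite ge0_integralZr//; last 2 first.
- by apply/measurable_EFinP; exact: measurable_indic.
- by rewrite mule_ge0// lee_fin mulr_ge0// sqr_ge0.
rewrite integral_indic// setIT lebesgue_row_ball//.
have -> : (4 * r) ^+ d = (2 * (2 * r)) ^+ d by congr (_ ^+ _); ring.
by rewrite [X in (_ <= X * _)%E]EFinM muleA.
Qed.

(** A suitable constant [m] is found among the values of [f]: if every [f x] failed, integrating the
    failure over [x] would exceed the double integral bound. The [+ 1] in [(A + 1) / q] makes the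
    contradiction strict. *)
Lemma cube_poincare : exists2 K : R, 0 < K & forall f (B : R), smooth f -> 0 < B ->
  (\int[mu]_(x in Q) (sqr_grad f x)%:E <= B%:E)%E ->
  exists m : R, (\int[mu]_(x in Q) ((f x - m) ^+ 2)%:E <= (K * B)%:E)%E.
Proof.
pose A := (4 * r) ^+ d * (d%:R * (2 * r) ^+ 2); pose q := (2 * r) ^+ d.
have q0 : 0 < q by rewrite exprn_gt0// mulr_gt0.
have A0 : 0 <= A by rewrite mulr_ge0 ?exprn_ge0 ?mulr_ge0 ?exprn_ge0 ?mulr_ge0// ltW.
exists ((A + 1) / q) => [|f B sf B0 hB]; first by rewrite divr_gt0// ltr_wpDl.
have mf := smooth_measurable sf.
apply: contrapT => /forallNP hm.
have := double_sqr_le sf; apply/negP; rewrite -ltNge.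
apply: (@le_lt_trans _ _ (A * B)%:E).
  by rewrite (EFinM A) lee_wpmul2l// lee_fin.
apply: (@lt_le_trans _ _ (\int[mu]_(x in Q) ((A + 1) / q * B)%:E)%E).
  rewrite integral_cst// lebesgue_row_ball// -EFinM lte_fin -/q.
  have -> : (A + 1) / q * B * q = (A + 1) * B by field; rewrite gt_eqF.
  by rewrite ltr_pM2r// ltrDl.
apply: ge0_le_integral => //.
- by move=> x _; rewrite lee_fin mulr_ge0 ?divr_ge0// ?ltW// ltr_wpDl.
- pose F (p : pt * pt) := (\1_Q p.2 * (f p.2 - f p.1) ^+ 2)%:E.
  have mF : measurable_fun setT F.
    apply/measurable_EFinP; apply: measurable_funM.
      by apply: measurableT_comp => //; exact: measurable_indic.
    by apply: measurable_funX; apply: measurable_funB; exact: measurableT_comp.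
  have F0 p : (0 <= F p)%E by rewrite lee_fin mulr_ge0// sqr_ge0.
  have [mF1 _] := row_tonelli mF F0.
  apply: measurable_funTS; apply: eq_measurable_fun mF1 => x _.
  rewrite [RHS]integral_mkcond; apply: eq_integral => y _; rewrite /F/= patchE indicE.
  by case: ifP => _; rewrite ?mul1r ?mul0r.
move=> x _; have /negP := hm (f x); rewrite -ltNge => /ltW h.
by apply: le_trans h _.
Qed.

End cube_poincare.

(** Compactness as an induction principle for properties of sets that are local and stable under
    binary unions. Otherwise the sets [K] minus [U], with [P U], would generate a proper filter
    without cluster point in [K]. *)
Lemma compact_ind {T : topologicalType} (P : set T -> Prop) (K : set T) : compact K ->
  P set0 -> (forall A B, P A -> P B -> P (A `|` B)) ->
  (forall x, K x -> exists2 U, nbhs x U & P U) -> exists2 U, P U & K `<=` U.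
Proof.
move=> cK P0 PU Px; apply: contrapT => /forall2NP hK.
pose F := filter_from P (fun U => K `\` U).
have FF : Filter F.
  apply: filter_from_filter; first by exists set0.
  by move=> A B PA PB; exists (A `|` B); [exact: PU|rewrite setDUr].
have PF : ProperFilter F.
  apply: filter_from_proper => // U PU'; have [//|/existsNP[x hx]] := hK U.
  by exists x; apply: contrapT => h; apply: hx => Kx; apply: contrapT => nU; apply: h.
have [|x [Kx cx]] := cK F PF; first by exists set0 => // x [].
have [U xU PxU] := Px x Kx.
have [|y [[_ ny] Uy]] := cx (K `\` U) U _ xU; last exact: ny.
by exists U.
Qed.

Section Rint_sets.
Context {dT : measure_display} {T : measurableType dT} {R : realType}.
Context (mu : {measure set T -> \bar R}).
Implicit Types (f : T -> R) (A B : set T).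

Lemma Rint_subset f A B : measurable A -> measurable B -> A `<=` B -> intg mu B f ->
  (forall x, B x -> 0 <= f x) -> \int[mu]_(x in A) f x <= \int[mu]_(x in B) f x.
Proof.
move=> mA mB AB If f0.
have IA : intg mu A f by exact: integrableS If.
rewrite -lee_fin !EFin_Rint//; apply: ge0_subset_integral => //.
by apply/measurable_EFinP; exact: intg_mf If.
Qed.

Lemma Rint_setU_le f A B : measurable A -> measurable B -> intg mu (A `|` B) f ->
  (forall x, (A `|` B) x -> 0 <= f x) ->
  \int[mu]_(x in A `|` B) f x <= \int[mu]_(x in A) f x + \int[mu]_(x in B) f x.
Proof.
move=> mA mB If f0; have mU := measurableU _ _ mA mB.
have mBA : measurable (B `\` A) by exact: measurableD.
have e : A `|` B = A `|` (B `\` A) by rewrite setUDr setDv setD0.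
rewrite {1}e Rintegral_setU//; last 2 first.
- by rewrite -e.
- by apply/disj_setPS => x [] ? [].
rewrite lerD2l; apply: Rint_subset => //.
- by apply: integrableS If => //; exact: subsetUr.
- by move=> x Bx; apply: f0; right.
Qed.

End Rint_sets.

Section cutoff.
Context {R : realType} {d : nat}.
Local Notation pt := 'rV[R]_d.

Lemma psi1_le (s t : R) : s <= t -> psi 1 s <= psi 1 t.
Proof.
move=> st; have [s0|s0] := ltP 0 s; last by rewrite (psi1_eq0 s0) psi1_ge0.
have t0 := lt_le_trans s0 st.
rewrite /psi s0 t0 !hornerC !mul1r ler_expR lerN2 lef_pV2//.
Qed.

(** A bump on the double cube divided by a lower bound [m] of its values on the inner cube. The
    result is at least 1 there, not equal to 1. *)
Lemma cutoff (a : pt) (r : R) : 0 < r -> exists eta : pt -> R,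
  [/\ smooth eta, forall x, 0 <= eta x, forall x, `|a - x| <= r -> 1 <= eta x &
      forall x, ~ (`|a - x| <= 2 * r) -> eta x = 0].
Proof.
move=> r0; pose m := \prod_(i < d) (psi 1 r * psi 1 r).
have m0 : 0 < m by apply: prodr_gt0 => i _; rewrite mulr_gt0// psi1_gt0.
exists (fun x => m^-1 * bump a (2 * r) x); split.
- by apply: smoothZ; exact: smooth_bump.
- by move=> x; rewrite mulr_ge0 ?bump_ge0// invr_ge0 ltW.
- move=> x ax; rewrite mulrC ler_pdivlMr// mul1r; apply: ler_prod => i _.
  rewrite mulr_ge0 ?psi1_ge0//=; apply: ler_pM; rewrite ?psi1_ge0//; apply: psi1_le.
    by have := le_trans (row_norm_coord (a - x) i) ax; rewrite !mxE ler_norml => /andP[]; lra.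
  by have := le_trans (row_norm_coord (a - x) i) ax; rewrite !mxE ler_norml => /andP[]; lra.
- move=> x nx; rewrite bump_eq0 ?mulr0 ?mulr_gt0// -ball_normE /ball_/= => h.
  by apply: nx; exact: ltW.
Qed.

End cutoff.

Lemma sqrB_le2 {R : realDomainType} (x y z : R) :
  (y - z) ^+ 2 <= 2 * (x - y) ^+ 2 + 2 * (x - z) ^+ 2.
Proof. by have := sqr_ge0 (x - y + (x - z)); nra. Qed.

Lemma sqrB_le2' {R : realDomainType} (x y z : R) :
  (x - z) ^+ 2 <= 2 * (x - y) ^+ 2 + 2 * (y - z) ^+ 2.
Proof. by have := sqr_ge0 (x - y - (y - z)); nra. Qed.

Lemma ball_nested {R : realType} {d : nat} (a b : 'rV[R]_d) (r : R) : ball a r b ->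
  exists2 s : R, 0 < s & ball b s `<=` ball a r.
Proof.
rewrite -ball_normE /ball_/= => ab; exists (r - `|a - b|); first by rewrite subr_gt0.
move=> x /= bx.
have -> : a - x = (a - b) + (b - x) by rewrite subrKA.
by apply: le_lt_trans (ler_normD _ _) _; rewrite -ltrBrDl.
Qed.

(** * Interior estimates, propagated by connectedness *)

Section interior_estimate.
Context {R : realType} {d : nat}.
Local Notation pt := 'rV[R]_d.
Local Notation mu := (lebesgue_row R d).
Local Notation D i f := ('D_(@unit_vec R d i) f).
Context (Omega : set pt).
Hypotheses (oO : open Omega) (bO : bounded_set Omega).
Implicit Types (f g h phi eta u w : pt -> R) (i j : 'I_d).
Let mT : measurable (setT : set pt) := measurableT.
Let mO := open_measurable_row oO.
Let fO := bounded_row_lty mO bO.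
Local Notation L2 := (L2 mu Omega).
Local Notation db := (dual_bounded Omega).

Lemma intg_sqr_sub h (c : R) : L2 h -> intg mu Omega (fun x => (h x - c) ^+ 2).
Proof. by move=> Lh; have [] := L2B mO Lh (L2_cst mO c fO). Qed.

Lemma intg_sqr_subS h (c : R) S : measurable S -> S `<=` Omega -> L2 h ->
  intg mu S (fun x => (h x - c) ^+ 2).
Proof. by move=> mS SO Lh; apply: integrableS (intg_sqr_sub c Lh). Qed.

(** The Poincare inequality applies to a mollification [u], whose gradient is bounded on the cube
    with a constant independent of the radius; the radius is then taken so small that the squared
    distance from [u] to [h] is below [C]. The cutoff lives in the closed cube of half-side [2 * r]
    and the mollifier reaches at most [r] further, hence the margin [4 * r]. *)
Lemma local_poincare (a : pt) (r : R) : 0 < r -> ball a (4 * r) `<=` Omega ->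
  exists2 K : R, 0 < K & forall h (C : R), db h C -> 0 < C ->
    exists m : R, \int[mu]_(x in ball a r) (h x - m) ^+ 2 <= K * C.
Proof.
move=> r0 aO; have [K K0 hK] := cube_poincare a r0.
have [eta [seta eta0 eta1 etaS]] := cutoff a r0.
pose S := [set x : pt | `|a - x| <= 2 * r].
have cS : compact S by exact: compact_closed_cube.
have te : supp_test S eta by [].
have [L L0 hL] : exists2 L : R, 0 < L & forall x, \sum_i D i eta x ^+ 2 <= L.
  have hM i : exists M : R, forall x, D i eta x ^+ 2 <= M.
    have [M M0 hM] := test_bounded (test_partial i (supp_testT cS te)).
    by exists (M ^+ 2) => x; exact: ler_norm_sqr.
  have [M_ hM_] := choice hM.
  exists (1 + \sum_i `|M_ i|); first by rewrite ltr_pwDl// sumr_ge0.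
  move=> x; rewrite ler_wpDl//; apply: ler_sum => i _; exact: le_trans (hM_ i x) (ler_norm _).
have mQ := measurable_row_ball a r.
have QO : ball a r `<=` Omega.
  by apply: subset_trans aO; apply: le_ball; lra.
exists (K * (40 * L) * 2 + 2) => [|h C hC C0].
  by have := mulr_gt0 K0 (mulr_gt0 (ltr0n _ 40) L0); lra.
have Lh := db_L2 hC; have HL := L2_semi_ip mu mO.
have [s s0 hs] := mollifier_L2_cvg oO bO Lh C0.
pose e := Num.min (s / 2) r.
have e0 : 0 < e by rewrite lt_min r0 divr_gt0.
have es : e < s by apply: (@le_lt_trans _ _ (s / 2)); [rewrite ge_min lexx|lra].
have er : e <= r by rewrite ge_min lexx orbT.
have [Lu hu] := hs e e0 es; set u := conv _ _ in Lu hu.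
have [_ Ih _] := L2_restrict oO bO Lh.
have su : smooth u by exact: smooth_conv Ih (test_mollifier e0).
have Sr x z : S x -> `|z| <= e -> Omega (x + z).
  rewrite /S/= => Sx ze; apply: aO; rewrite -ball_normE /ball_/= opprD addrA.
  apply: le_lt_trans (ler_normB _ _) _; lra.
have hg := moll_gradient_bound oO bO hC e0 cS Sr (ltW L0) te hL.
have B0 : 0 < 40 * C * L by rewrite !mulr_gt0.
have tI : supp_test S (fun x => eta x ^+ 2 * sqr_grad u x).
  have -> : (fun x => eta x ^+ 2 * sqr_grad u x) = fun x => (eta x * sqr_grad u x) * eta x.
    by apply/funext => x; ring.
  by apply: supp_testM => //; apply: smoothM => //; exact: smooth_sqr_grad.
have Ig : intg mu setT (fun x => eta x ^+ 2 * sqr_grad u x) by apply: intg_test; exact: (supp_testT cS tI).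
have [|m hm] := hK u (40 * C * L) su B0.
  apply: (@le_trans _ _ (\int[mu]_x (eta x ^+ 2 * sqr_grad u x))%:E); last by rewrite lee_fin.
  rewrite (EFin_Rint mT Ig) [leLHS]integral_mkcond.
  apply: ge0_le_integral; [exact: mT| | | |].
  - by move=> x _; rewrite patchE; case: ifP => // _; rewrite lee_fin sqr_grad_ge0.
  - apply/(measurable_restrictT _ mQ); apply/measurable_EFinP; apply: measurable_funTS.
    exact: measurable_sqr_grad.
  - by apply/measurable_EFinP; exact: intg_mf Ig.
  move=> x _; rewrite patchE; case: ifPn => [/set_mem xQ|_]; rewrite lee_fin; last first.
    by rewrite mulr_ge0 ?sqr_ge0 ?sqr_grad_ge0.
  rewrite ler_peMl ?sqr_grad_ge0// -[leLHS](expr1n R 2) lerXn2r ?nnegrE//.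
  by apply: eta1; move: xQ; rewrite -ball_normE /ball_/= => /ltW.
exists m.
have Lum := intg_sqr_subS m mQ QO Lu.
have I1 := intg_sqr_subS m mQ QO Lh.
have [_ I2] := L2B mO Lu Lh.
have I2Q : intg mu (ball a r) (fun x => (u x - h x) ^+ 2) by exact: integrableS I2.
have J1 := intgZ mQ 2 I2Q; have J2 := intgZ mQ 2 Lum.
apply: (@le_trans _ _ (\int[mu]_(x in ball a r) (2 * (u x - h x) ^+ 2 + 2 * (u x - m) ^+ 2))).
  apply: le_Rint => //; first exact: intgD.
  by move=> x _; exact: sqrB_le2.
rewrite RintD// !RintZ//.
have k1 : \int[mu]_(x in ball a r) (u x - h x) ^+ 2 <= C.
  apply: le_trans (ltW hu); rewrite ip2_sqr; apply: Rint_subset => // x _; exact: sqr_ge0.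
have k2 : \int[mu]_(x in ball a r) (u x - m) ^+ 2 <= K * (40 * C * L).
  by rewrite -lee_fin (EFin_Rint mQ Lum).
have -> : (K * (40 * L) * 2 + 2) * C = 2 * C + 2 * (K * (40 * C * L)) by ring.
by apply: lerD; rewrite ler_pM2l.
Qed.

Context (x0 : pt) (r0 : R).

(* [c] plays the role of the mean value of [h]: it is only required to be the
   right constant on one fixed ball. *)
Definition controlled (S : set pt) := exists K : R, forall h (C c : R), db h C -> 0 < C ->
  \int[mu]_(x in ball x0 r0) (h x - c) ^+ 2 <= C -> \int[mu]_(x in S) (h x - c) ^+ 2 <= K * C.

Lemma controlledS S S' : measurable S -> measurable S' -> S `<=` S' -> S' `<=` Omega ->
  controlled S' -> controlled S.
Proof.
move=> mS mS' SS' SO [K hK]; exists K => h C c hC C0 /(hK _ _ _ hC C0); apply: le_trans.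
apply: Rint_subset => // [|x _]; last exact: sqr_ge0.
exact: intg_sqr_subS (db_L2 hC).
Qed.

Lemma controlledU S S' : measurable S -> measurable S' -> S `<=` Omega -> S' `<=` Omega ->
  controlled S -> controlled S' -> controlled (S `|` S').
Proof.
move=> mS mS' SO SO' [K hK] [K' hK']; exists (K + K') => h C c hC C0 hc.
have := hK _ _ _ hC C0 hc; have := hK' _ _ _ hC C0 hc; rewrite mulrDl.
move=> h1 h2; apply: le_trans (lerD h2 h1).
apply: Rint_setU_le => // [|x _]; last exact: sqr_ge0.
by apply: intg_sqr_subS (db_L2 hC); [exact: measurableU|rewrite subUset].
Qed.

Hypotheses (r00 : 0 < r0) (x0O : ball x0 r0 `<=` Omega) (conO : connected Omega).

(** On the larger ball [h] is close to some constant [m], on the smaller one to [c]. Comparing the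
    two on the smaller ball bounds [(m - c) ^+ 2], at the price of the ratio of the volumes. *)
Lemma controlled_step (a b : pt) (r s : R) : 0 < r -> 0 < s -> ball a (4 * r) `<=` Omega ->
  ball b s `<=` ball a r -> controlled (ball b s) -> controlled (ball a r).
Proof.
move=> r1 s0 aO ba [K hK]; have [P P0 hP] := local_poincare r1 aO.
have aO' : ball a r `<=` Omega by apply: subset_trans aO; apply: le_ball; lra.
have bO' := subset_trans ba aO'.
have mA := measurable_row_ball a r; have mB := measurable_row_ball b s.
pose A := (2 * r) ^+ d; pose B := (2 * s) ^+ d.
have A0 : 0 < A by rewrite exprn_gt0// mulr_gt0.
have B0 : 0 < B by rewrite exprn_gt0// mulr_gt0.
exists (2 * P + 4 * A / B * (P + K)) => h C c hC C0 hc.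
have [m hm] := hP h C hC C0; have Lh := db_L2 hC.
have hb := hK h C c hC C0 hc.
have IA q := intg_sqr_subS q mA aO' Lh; have IB q := intg_sqr_subS q mB bO' Lh.
have fA : (mu (ball a r) < +oo)%E by rewrite lebesgue_row_ball// ltry.
have fB : (mu (ball b s) < +oo)%E by rewrite lebesgue_row_ball// ltry.
have hmB : \int[mu]_(x in ball b s) (h x - m) ^+ 2 <= P * C.
  by apply: le_trans hm; apply: Rint_subset => // x _; exact: sqr_ge0.
have mc : (m - c) ^+ 2 * B <= 2 * (P * C) + 2 * (K * C).
  have -> : (m - c) ^+ 2 * B = \int[mu]_(x in ball b s) (m - c) ^+ 2.
    by rewrite Rintegral_cst// lebesgue_row_ball.
  apply: (@le_trans _ _ (\int[mu]_(x in ball b s) (2 * (h x - m) ^+ 2 + 2 * (h x - c) ^+ 2))).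
    apply: le_Rint => //; first exact: intg_cst.
      by apply: intgD => //; exact: intgZ.
    by move=> x _; exact: sqrB_le2.
  rewrite RintD//; [|exact: intgZ..]; rewrite !RintZ//.
  by apply: lerD; rewrite ler_pM2l.
apply: (@le_trans _ _ (\int[mu]_(x in ball a r) (2 * (h x - m) ^+ 2 + 2 * (m - c) ^+ 2))).
  apply: le_Rint => //.
    by apply: intgD => //; [exact: intgZ|exact: intg_cst].
  by move=> x _; exact: sqrB_le2'.
rewrite RintD//; [|exact: intgZ|exact: intg_cst].
rewrite RintZ// Rintegral_cst// lebesgue_row_ball// -/A.
have e1 : 2 * (P * C) + (4 * A / B * (P + K)) * C = (2 * P + 4 * A / B * (P + K)) * C by ring.
rewrite -e1; apply: lerD; first by rewrite ler_pM2l.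
have e2 : 4 * A / B * (P + K) * C = 2 * ((2 * (P * C) + 2 * (K * C)) / B) * A by field; rewrite gt_eqF.
by rewrite e2 ler_pM2r// ler_pM2l// ler_pdivlMr.
Qed.

(** The points with a controlled ball form a nonempty subset of [Omega] that is open and relatively
    closed; connectedness thus stands in for explicit chains of balls. *)
Lemma controlled_ball x : Omega x -> exists2 r : R, 0 < r &
  ball x r `<=` Omega /\ controlled (ball x r).
Proof.
pose G := [set x | exists2 r : R, 0 < r & ball x r `<=` Omega /\ controlled (ball x r)].
have mb a (r : R) : measurable (ball (a : pt) r) := measurable_row_ball a r.
have GS (a b : pt) (r : R) : ball a r `<=` Omega -> controlled (ball a r) -> ball a r b ->
    exists2 s : R, 0 < s & ball b s `<=` ball a r /\ controlled (ball b s).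
  move=> aO ca ab; have [s s0 hs] := ball_nested ab; exists s; [exact: s0|split; [exact: hs|]].
  exact: controlledS hs aO ca.
have oG : open G.
  rewrite openE => y [r r1 [yO cy]].
  apply: filterS (nbhsx_ballx y r r1) => z yz.
  have [s s0 [h1 h2]] := GS _ _ _ yO cy yz.
  by exists s; [exact: s0|split; [exact: subset_trans yO|exact: h2]].
have oG' : open (Omega `&` ~` G).
  rewrite openE => y [Oy nG].
  have [r /= r1 yO] := (nbhs_ballP _ _).1 (open_nbhs_nbhs (conj oO Oy)).
  have r4 : 0 < r / 4 by rewrite divr_gt0.
  have yO4 : ball y (4 * (r / 4)) `<=` Omega by rewrite mulrC divfK.
  have yO1 : ball y (r / 4) `<=` Omega by apply: subset_trans yO; apply: le_ball; lra.
  apply: filterS (nbhsx_ballx y (r / 4) r4) => z yz; split; first exact: yO1.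
  (* A controlled ball around a point [z] of [ball y (r / 4)] would control that whole ball in one
     step, which would put [y] in [G]. *)
  move=> [s s0 [zO cz]]; apply: nG; exists (r / 4); [exact: r4|split; [exact: yO1|]].
  have [t t0 ht] := ball_nested yz.
  have m0 : 0 < Num.min s t by rewrite lt_min s0.
  apply: (controlled_step r4 m0 yO4 (b := z)).
    by apply: subset_trans ht; apply: le_ball; rewrite ge_min lexx orbT.
  by apply: controlledS cz => //; apply: le_ball; rewrite ge_min lexx.
have GO : Omega `&` G = Omega.
  apply: conO.
  - exists x0; split; first exact: x0O _ (ballxx _ r00).
    by exists r0 => //; split=> //; exists 1 => h C c _ _; rewrite mul1r.
  - by exists G.
  - exists (~` (Omega `&` ~` G)); first exact: open_closedC.
    by rewrite setCI setCK setIUr setICr set0U.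
by rewrite -{1}GO => -[].
Qed.

Lemma controlled_compact K : compact K -> K `<=` Omega -> controlled K.
Proof.
move=> cK KO.
pose P (U : set pt) := [/\ measurable U, U `<=` Omega & controlled U].
have [|||U [mU UO cU] KU] := @compact_ind _ P K cK.
- split; [exact: measurable0|exact: sub0set|].
  by exists 0 => h C c _ C0 _; rewrite Rintegral_set0 mul0r.
- move=> A B [mA AO cA] [mB BO cB]; split; [exact: measurableU|by rewrite subUset|].
  exact: controlledU.
- move=> y Ky; have [r r1 [yO cy]] := controlled_ball (KO _ Ky).
  by exists (ball y r); [exact: nbhsx_ballx|split=> //; exact: measurable_row_ball].
exact: (controlledS (compact_measurable_row cK) mU KU UO).
Qed.

End interior_estimate.

(** * Boundary estimates on Lipschitz domains *)

Lemma sqr_young {R : realFieldType} (e a b : R) : 0 < e -> 2 * a * b <= e * a ^+ 2 + e^-1 * b ^+ 2.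
Proof.
move=> e0; have := mulr_ge0 (ltW (_ : 0 < e^-1)) (sqr_ge0 (e * a - b)).
rewrite invr_gt0 => /(_ e0).
have -> : e^-1 * (e * a - b) ^+ 2 = e * a ^+ 2 - 2 * a * b + e^-1 * b ^+ 2.
  by field; rewrite gt_eqF.
lra.
Qed.

Section flux_estimate.
Context {R : realType} {d : nat}.
Local Notation pt := 'rV[R]_d.
Local Notation mu := (lebesgue_row R d).
Local Notation D i f := ('D_(@unit_vec R d i) f).
Context (Omega : set pt).
Hypotheses (oO : open Omega) (bO : bounded_set Omega).
Implicit Types (f g h phi eta u w : pt -> R) (i j : 'I_d).
Let mT : measurable (setT : set pt) := measurableT.
Let mO := open_measurable_row oO.
Let fO := bounded_row_lty mO bO.
Local Notation L2 := (L2 mu Omega).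
Local Notation db := (dual_bounded Omega).

Lemma compact_margin K : compact K -> K `<=` Omega ->
  exists2 r : R, 0 < r & forall x z, K x -> `|z| <= r -> Omega (x + z).
Proof.
move=> cK KO.
pose P (U : set pt) := exists2 r : R, 0 < r & forall x z, U x -> `|z| <= r -> Omega (x + z).
have [|||U [r r0 hr] KU] := @compact_ind _ P K cK.
- by exists 1.
- move=> A B [r r0 hr] [s s0 hs]; exists (Num.min r s); first by rewrite lt_min r0.
  by move=> x z [Ax|Bx]; rewrite le_min => /andP[zr zs]; [exact: hr|exact: hs].
- move=> x /KO Ox; have [r /= r1 xO] := (nbhs_ballP _ _).1 (open_nbhs_nbhs (conj oO Ox)).
  exists (ball x (r / 2)); first by apply: nbhsx_ballx; rewrite divr_gt0.
  exists (r / 2 / 2) => [|y z]; first by rewrite !divr_gt0.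
  rewrite -ball_normE /ball_/= => xy zr; apply: xO; rewrite -ball_normE /ball_/= opprD addrA.
  by apply: le_lt_trans (ler_normB _ _) _; lra.
by exists r => // x z /KU; exact: hr.
Qed.

Lemma derive_dir_sqr_le u (e x : pt) : smooth u -> dot e e = 1 -> 'D_e u x ^+ 2 <= sqr_grad u x.
Proof.
move=> su e1; rewrite derive_row; last exact: smooth_diff.
apply: le_trans (sum_CS _ _) _.
suff -> : \sum_i e 0 i ^+ 2 = 1 by rewrite mul1r.
by rewrite -e1; apply: eq_bigr => i _; rewrite expr2.
Qed.

(** Integrating by parts in the direction [e] turns the flux into [-2] times the integral of
    [u * 'D_e u * eta], to which Young's inequality with weight [eps] applies. *)
Lemma smooth_flux (K : set pt) u eta (e : pt) (eps : R) : compact K -> K `<=` Omega -> smooth u ->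
  L2 u -> supp_test K eta -> dot e e = 1 -> 0 < eps ->
  \int[mu]_(x in Omega) (u x ^+ 2 * 'D_e eta x) <= eps * \int[mu]_(x in Omega) u x ^+ 2 +
    eps^-1 * \int[mu]_x (eta x ^+ 2 * sqr_grad u x).
Proof.
move=> cK KO su Lu te e1 eps0; have [seta eta0] := te.
have tO f : supp_test K f -> test_function Omega f by move=> [sf f0]; split=> //; exists K.
have De f x : smooth f -> 'D_e f x = \sum_j e 0 j * D j f x.
  by move=> sf; apply: derive_row; exact: smooth_diff.
have sDe f : smooth f -> smooth (fun x => 'D_e f x).
  move=> sf; rewrite (_ : (fun x => _) = fun x => \sum_j e 0 j * D j f x); first by smooth_auto.
  by apply/funext => x; exact: De.
have tE : supp_test K (fun x => u x ^+ 2 * 'D_e eta x).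
  apply: supp_testM; first smooth_auto.
  split; first exact: sDe.
  move=> x nK; rewrite De// big1// => j _.
  by rewrite (supp_test_partial cK j te).2// mulr0.
have tF : supp_test K (fun x => (u x * 'D_e u x) * eta x).
  by apply: supp_testM => //; apply: smoothM => //; exact: sDe.
rewrite (Rint_test_setT (tO _ tE)).
pose F j (x : pt) := e 0 j * u x ^+ 2.
have DF j x : D j (F j) x = 2 * u x * (e 0 j * D j u x).
  have D2 : D j (fun z => u z ^+ 2) x = 2 * u x * D j u x.
    rewrite (_ : (fun _ => _) = fun z => u z * u z); last by apply/funext => z; rewrite expr2.
    by rewrite derive_mulf//; ring.
  rewrite /F derive_mulf ?D2 ?derive_cst; [ring|exact: smooth_cst|smooth_auto].
have := @by_parts_sum _ _ K cK F (fun=> eta) (fun j => _) (fun=> te).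
rewrite /F => /(_ _)/wrap[j|]; first by smooth_auto.
have -> : \int[mu]_x \sum_j e 0 j * u x ^+ 2 * D j eta x = \int[mu]_x (u x ^+ 2 * 'D_e eta x).
  by apply: eq_Rintegral => x _; rewrite De// mulr_sumr; apply: eq_bigr => j _; ring.
have -> : \int[mu]_x \sum_j D j (F j) x * eta x = \int[mu]_x (2 * (u x * 'D_e u x * eta x)).
  apply: eq_Rintegral => x _; rewrite -mulr_suml (eq_bigr _ (fun j _ => DF j x)).
  by rewrite -mulr_sumr -De//; ring.
move=> ->.
have IF := intg_test (supp_testT cK tF).
rewrite (RintZ mT _ IF) -(Rint_test_setT (tO _ tF)).
have tG : supp_test K (fun x => eta x ^+ 2 * sqr_grad u x).
  have -> : (fun x => eta x ^+ 2 * sqr_grad u x) = fun x => (eta x * sqr_grad u x) * eta x.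
    by apply/funext => x; ring.
  by apply: supp_testM => //; apply: smoothM => //; exact: smooth_sqr_grad.
rewrite -[in leRHS](Rint_test_setT (tO _ tG)).
have IG : intg mu Omega (fun x => eta x ^+ 2 * sqr_grad u x).
  exact: integrableS (intg_test (supp_testT cK tG)).
have IFO : intg mu Omega (fun x => u x * 'D_e u x * eta x) by exact: integrableS IF.
have [_ Iu] := Lu.
rewrite -mulrN -(RintN mO IFO) -!RintZ//; last exact: intgN.
have J1 := intgZ mO eps Iu; have J2 := intgZ mO eps^-1 IG.
rewrite -RintD//; apply: le_Rint => //; [by apply: (intgZ mO); exact: intgN|exact: intgD|].
move=> x _; have := sqr_young (u x) (- (eta x * 'D_e u x)) eps0.
have : eps^-1 * (eta x * 'D_e u x) ^+ 2 <= eps^-1 * (eta x ^+ 2 * sqr_grad u x).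
  rewrite ler_pM2l ?invr_gt0// exprMn ler_wpM2l ?sqr_ge0//; exact: derive_dir_sqr_le.
rewrite sqrrN => h1 h2; apply: (le_trans _ (le_trans h2 _)); last by rewrite lerD2l.
by rewrite le_eqVlt; apply/orP; left; apply/eqP; ring.
Qed.

(** The constants depend on [eta] only through [L] and not on [K]: the distance from [K] to the
    boundary limits only the mollification radius. This uniformity is what later allows supports
    that approach the boundary. *)
Lemma flux_estimate (K : set pt) eta (e : pt) (eps L : R) : compact K -> K `<=` Omega ->
  supp_test K eta -> dot e e = 1 -> 0 < eps -> 0 <= L -> (forall x, \sum_i D i eta x ^+ 2 <= L) ->
  forall h (C c : R), db h C -> 0 < C ->
  \int[mu]_(x in Omega) ((h x - c) ^+ 2 * 'D_e eta x) <=
    3 * eps * \int[mu]_(x in Omega) (h x - c) ^+ 2 + (40 * L / eps + 1) * C.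
Proof.
move=> cK KO te e1 eps0 L0 hL h C c hC C0.
have Lh := db_L2 hC; have Lhc := L2B mO Lh (L2_cst mO c fO).
have [r r0 Kr] := compact_margin cK KO.
have [seta eta0] := te.
have [M M0 hM] : exists2 M : R, 0 <= M & forall x, `|'D_e eta x| <= M.
  exists (1 + L); first by rewrite addr_ge0.
  move=> x; have h2 := le_trans (derive_dir_sqr_le x seta e1) (hL x).
  have : 0 <= (`|'D_e eta x| - 1) ^+ 2 by exact: sqr_ge0.
  rewrite sqrrB1 real_normK ?num_real//; have := normr_ge0 ('D_e eta x); lra.
have mDe : measurable_fun setT (fun x => 'D_e eta x).
  apply: smooth_measurable; rewrite (_ : (fun x => _) = fun x => \sum_j e 0 j * D j eta x); first by smooth_auto.
  by apply/funext => x; apply: derive_row; exact: smooth_diff.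
(* The Young weight for replacing [h] by [u] under the flux integral; it satisfies [M * t <= eps],
   the third [eps] of the conclusion. *)
pose t := eps / (M + 1); have M1 : 0 < M + 1 by lra.
have t0 : 0 < t by rewrite divr_gt0.
(* The total weight with which the squared mollification error enters; making that error smaller
   than [C / (k + 1)] costs the single extra [C] of the conclusion. *)
pose k := 2 * eps + M * (1 + t^-1).
have k0 : 0 <= k by rewrite addr_ge0 ?mulr_ge0 ?addr_ge0 ?invr_ge0// ltW.
have [|s s0 hs] := mollifier_L2_cvg oO bO Lh (e := C / (k + 1)).
  by rewrite divr_gt0// ltr_wpDl.
pose q := Num.min (s / 2) r.
have q0 : 0 < q by rewrite lt_min r0 divr_gt0.
have qs : q < s by apply: (@le_lt_trans _ _ (s / 2)); [rewrite ge_min lexx|lra].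
have qr : q <= r by rewrite ge_min lexx orbT.
have [Lu hu] := hs q q0 qs; set u := conv _ _ in Lu hu.
have [_ Ih _] := L2_restrict oO bO Lh.
have su : smooth u by exact: smooth_conv Ih (test_mollifier q0).
have Kq x z : K x -> `|z| <= q -> Omega (x + z) by move=> Kx zq; apply: Kr => //; exact: le_trans zq qr.
have hg := moll_gradient_bound oO bO hC q0 cK Kq L0 te hL.
pose uc x := u x - c.
have suc : smooth uc by smooth_auto.
have Luc : L2 uc := L2B mO Lu (L2_cst mO c fO).
have guc : sqr_grad uc = sqr_grad u.
  apply/funext => x; apply: eq_bigr => j _; congr (_ ^+ 2).
  rewrite (_ : uc = u - cst c) // deriveB ?derive_cst ?subr0//.
  exact: smooth_derivable.
have := smooth_flux cK KO suc Luc te e1 eps0; rewrite guc => hf.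
have [_ Ihc] := Lhc; have [_ Iuc] := Luc; have [_ Iuh] := L2B mO Lu Lh.
set B := \int[mu]_(x in Omega) (h x - c) ^+ 2.
set A' := \int[mu]_(x in Omega) (uc x ^+ 2 * 'D_e eta x) in hf.
set B' := \int[mu]_(x in Omega) uc x ^+ 2 in hf.
pose sg := \int[mu]_(x in Omega) (u x - h x) ^+ 2.
have hsg : sg < C / (k + 1) by rewrite /sg -ip2_sqr.
have sg0 : 0 <= sg by apply: Rint_ge0 => x _; exact: sqr_ge0.
have hB' : B' <= 2 * sg + 2 * B.
  rewrite /B' /sg /B -!RintZ// -RintD//; [|exact: intgZ..].
  apply: le_Rint => //; first by apply: intgD => //; exact: intgZ.
  by move=> x _; exact: sqrB_le2'.
have IA : intg mu Omega (fun x => (h x - c) ^+ 2 * 'D_e eta x).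
  exact: (intg_mulb mO Ihc (measurable_funTS mDe) (fun x _ => hM x)).
have IA' : intg mu Omega (fun x => uc x ^+ 2 * 'D_e eta x).
  exact: (intg_mulb mO Iuc (measurable_funTS mDe) (fun x _ => hM x)).
have hA : \int[mu]_(x in Omega) ((h x - c) ^+ 2 * 'D_e eta x) <=
    A' + (M * (1 + t^-1) * sg + M * t * B).
  have J1 := intgZ mO (M * (1 + t^-1)) Iuh; have J2 := intgZ mO (M * t) Ihc.
  rewrite /A' /sg /B -!RintZ// -RintD// -RintD//; last exact: intgD.
  apply: le_Rint => //; first by apply: intgD => //; exact: intgD.
  move=> x _; set p := 'D_e eta x; set a := h x - c; set b := u x - h x.
  have -> : uc x ^+ 2 = a ^+ 2 + (b ^+ 2 + 2 * a * b) by rewrite /uc /a /b; ring.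
  have y1 := sqr_young a b t0; have y2 := sqr_young a (- b) t0; rewrite sqrrN in y2.
  have : `|b ^+ 2 + 2 * a * b| <= (1 + t^-1) * b ^+ 2 + t * a ^+ 2.
    rewrite ler_norml; have := sqr_ge0 b; have := sqr_ge0 a; move: y1 y2.
    have := mulr_ge0 (ltW t0) (sqr_ge0 a); rewrite mulrN mulrDl mul1r.
    by move=> *; apply/andP; split; lra.
  move=> h1; have : `|(b ^+ 2 + 2 * a * b) * p| <= ((1 + t^-1) * b ^+ 2 + t * a ^+ 2) * M.
    by rewrite normrM; apply: ler_pM => //; exact: hM.
  rewrite ler_norml => /andP[h3 _]; rewrite mulrDl.
  have e2 : ((1 + t^-1) * b ^+ 2 + t * a ^+ 2) * M = M * (1 + t^-1) * b ^+ 2 + M * t * a ^+ 2 by ring.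
  by rewrite e2 in h3; move: h3; lra.
have B0 : 0 <= B by apply: Rint_ge0 => x _; exact: sqr_ge0.
have Mt : M * t * B <= eps * B.
  apply: (ler_wpM2r B0).
  by rewrite /t mulrA ler_pdivrMr// mulrDr mulr1 mulrC lerDl ltW.
have eG : eps^-1 * \int[mu]_x (eta x ^+ 2 * sqr_grad u x) <= 40 * L / eps * C.
  have -> : 40 * L / eps * C = eps^-1 * (40 * C * L) by ring.
  by rewrite ler_pM2l ?invr_gt0.
have eB : eps * B' <= eps * (2 * sg + 2 * B) by rewrite ler_pM2l.
have kC : k * sg <= C.
  have k1 : 0 < k + 1 by lra.
  have : sg * (k + 1) < C by rewrite -ltr_pdivlMr.
  have := mulr_ge0 k0 sg0; lra.
rewrite mulrDl mul1r; move: hA hf Mt eG eB kC; rewrite /k; clear; move=> *; lra.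
Qed.

End flux_estimate.

Section lipschitz_row.
Context {R : realType} {d : nat}.
Local Notation pt := 'rV[R]_d.
Local Notation mu := (lebesgue_row R d).
Local Notation D i f := ('D_(@unit_vec R d i) f).
Let mT : measurable (setT : set pt) := measurableT.
Implicit Types (f g phi T : pt -> R).

Lemma lip_continuous f (k : R) : (forall x y, `|f x - f y| <= k * `|x - y|) -> continuous f.
Proof.
move=> fk x; apply/(@cvgrPdist_lt R R^o pt (nbhs x) _ f (f x)) => e e0.
have k0 : 0 < `|k| + 1 by rewrite ltr_wpDl.
have : ball x (e / (`|k| + 1)) `<=` [set y | `|f x - f y| < e].
  move=> y; rewrite -ball_normE /ball_/= => xy; apply: le_lt_trans (fk _ _) _.
  apply: (@le_lt_trans _ _ (`|x - y| * (`|k| + 1))).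
    by rewrite mulrC ler_wpM2l// (le_trans (ler_norm _))// lerDl.
  by rewrite -ltr_pdivlMr.
move=> h; apply: filterS h _; apply: nbhsx_ballx; exact: divr_gt0.
Qed.

Lemma test_lip O phi : test_function O phi -> exists2 L : R, 0 <= L &
  forall x v, `|phi (x + v) - phi x| <= L * `|v|.
Proof.
move=> tp; have hM i : exists M : R, forall x, `|D i phi x| <= M.
  by have [M _ hM] := test_bounded (test_partial i tp); exists M.
have [M_ hM_] := choice hM.
have M0 : 0 <= \sum_i `|M_ i| by apply: sumr_ge0.
exists (d%:R * \sum_i `|M_ i|); first exact: mulr_ge0.
apply: smooth_lip tp.1 _ => i x; apply: le_trans (hM_ i x) _.
by rewrite (bigD1 i)//= (le_trans (ler_norm _))// lerDl sumr_ge0.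
Qed.

(** A difference quotient of step [s] errs by at most [k * s], so lower bounds on increments pass to
    the derivative. Mollified Lipschitz functions are thus estimated through increments alone. *)
Lemma test_derive_ge O phi (x v : pt) (a s0 : R) : test_function O phi -> 0 < s0 ->
  (forall s : R, 0 < s -> s < s0 -> a * s <= phi (x + s *: v) - phi x) -> a <= 'D_v phi x.
Proof.
move=> tp s00 ha; have [C C0 hC] := test_taylor2 tp.
pose k := C * `|v| ^+ 2; have k0 : 0 <= k by rewrite mulr_ge0// sqr_ge0.
rewrite derive_row; last exact: smooth_diff tp.1.
suff hh (e : R) : 0 < e -> a <= \sum_i v 0 i * D i phi x + e.
  by apply/ler_addgt0Pr => e; exact: hh.
move=> e0; pose s := Num.min (s0 / 2) (e / (k + 1)).
have k1 : 0 < k + 1 by lra.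
have sp : 0 < s by rewrite lt_min !divr_gt0.
have ss : s < s0 by apply: (@le_lt_trans _ _ (s0 / 2)); [rewrite ge_min lexx|lra].
have ks : k * s <= e.
  apply: (@le_trans _ _ ((k + 1) * s)); first by rewrite ler_wpM2r ?ltW//; lra.
  by rewrite mulrC -ler_pdivlMr// ge_min lexx orbT.
have h1 := ha s sp ss; have := hC x (s *: v).
have -> : \sum_i D i phi x * (s *: v) 0 i = s * \sum_i v 0 i * D i phi x.
  by rewrite mulr_sumr; apply: eq_bigr => i _; rewrite mxE; ring.
rewrite normrZ (gtr0_norm sp) ler_norml => /andP[_ h2].
rewrite -(ler_pM2r sp) mulrDl.
have h3 : k * s * s <= e * s by rewrite ler_pM2r.
have h4 : C * (s * `|v|) ^+ 2 = k * s * s by rewrite /k; ring.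
rewrite h4 in h2; rewrite [X in X + _]mulrC.
set q := \sum_i _ in h2 *; move: h1 h2 h3; clear; move=> h1 h2 h3; lra.
Qed.

(** An increment of the mollification is the mollification of the increment, hence an average of
    increments of [T] at points within distance [m]. *)
Lemma moll_diff_bounds T (m a b : R) (x w : pt) : 0 < m -> intg mu setT T ->
  (forall z, `|z| < m -> a <= T (x + z + w) - T (x + z) <= b) ->
  a <= conv T (mollifier m) (x + w) - conv T (mollifier m) x <= b.
Proof.
move=> m0 IT hT; have tm : test_function (setT : set pt) (mollifier m) := test_mollifier m0; have em := @mollifier_even R d m.
have Iw := intg_shift w IT.
have -> : conv T (mollifier m) (x + w) = conv (fun y => T (y + w)) (mollifier m) x.
  rewrite !(conv_shift tm em); [|exact: intg_mf Iw|exact: intg_mf IT].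
  by apply: eq_Rintegral => z _; rewrite addrAC.
have -> : conv (fun y => T (y + w)) (mollifier m) x - conv T (mollifier m) x =
    conv (-1 *: T + (fun y => T (y + w))) (mollifier m) x.
  by rewrite conv_lin// mulN1r addrC.
have Id : intg mu setT (-1 *: T + (fun y => T (y + w))).
  by apply: (intgD mT) => //; exact: (intgZ mT).
apply: conv_mollifier_bounds => // z zm.
by have := hT z zm; rewrite -[(_ + _ : pt -> R) _]/(-1 * T (x + z) + T (x + z + w)) mulN1r addrC.
Qed.

Lemma dir_norm_le1 (e : pt) : dot e e = 1 -> `|e| <= 1.
Proof.
move=> e1; apply: row_norm_le => // i; rewrite -(@ler_pXn2r _ 2)// ?nnegrE//.
rewrite real_normK ?num_real// expr1n -e1 /dot (bigD1 i)//= expr2 lerDl.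
by apply: sumr_ge0 => j _; rewrite -expr2 sqr_ge0.
Qed.

Lemma Rint_indic (O A : set pt) f : A `<=` O ->
  \int[mu]_(x in O) (f x * \1_A x) = \int[mu]_(x in A) f x.
Proof.
move=> AO; rewrite Rintegral_mkcond [RHS]Rintegral_mkcond; apply: eq_Rintegral => x _.
rewrite !patchE indicE; case: (boolP (x \in A)) => [/set_mem Ax|_].
  by rewrite mem_set ?mulr1//; exact: AO.
by rewrite mulr0 if_same.
Qed.

End lipschitz_row.

(** * Estimate up to a Lipschitz boundary *)

Section boundary_estimate.
Context {R : realType} {d : nat}.
Local Notation pt := 'rV[R]_d.
Local Notation mu := (lebesgue_row R d).
Local Notation D i f := ('D_(@unit_vec R d i) f).
Context (Omega : set pt).
Hypotheses (oO : open Omega) (bO : bounded_set Omega) (conO : connected Omega).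
Implicit Types (f g h phi eta u w : pt -> R) (i j : 'I_d).
Let mO := open_measurable_row oO.
Local Notation db := (dual_bounded Omega).
Context (x0 : pt) (r0 : R).
Hypotheses (r00 : 0 < r0) (x0O : ball x0 r0 `<=` Omega).

(** Control up to an arbitrarily small multiple of the norm over all of [Omega]. Unlike
    [controlled], it makes sense for sets that cross the boundary, and the extra term is absorbed
    once such sets cover [Omega]. *)
Definition almost_controlled (S : set pt) := forall e : R, 0 < e -> exists K : R,
  forall h (C c : R), db h C -> 0 < C -> \int[mu]_(x in ball x0 r0) (h x - c) ^+ 2 <= C ->
    \int[mu]_(x in S `&` Omega) (h x - c) ^+ 2 <=
      e * \int[mu]_(x in Omega) (h x - c) ^+ 2 + K * C.

(* [G] is the height above the boundary: [G y = dot y e - g (y - dot y e *: e)]. *)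
Section epigraph.
Context (x1 e : pt) (G : pt -> R) (k r : R).
Hypotheses (e1 : dot e e = 1) (k0 : 0 < k) (r1 : 0 < r).
Hypothesis Glip : forall x y, `|G x - G y| <= k * `|x - y|.
Hypothesis Gshift : forall (y : pt) (s : R), G (y + s *: e) = G y + s.
Hypothesis GO : forall y : pt, `|x1 - y| < 4 * r -> (Omega y <-> 0 < G y).

Let cG : continuous G := lip_continuous Glip.

Let slab (t : R) := [set x : pt | `|x1 - x| <= 3 * r /\ t <= G x].

Let slab_compact t : compact (slab t).
Proof.
rewrite (_ : slab t = [set x | `|x1 - x| <= 3 * r] `&` (G @^-1` [set y | t <= y]))//.
apply: compact_closedI; first exact: compact_closed_cube.
by apply: closed_comp => [x _|]; [exact: cG|exact: closed_ge].
Qed.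

Let slab_sub t : 0 < t -> slab t `<=` Omega.
Proof.
move=> t0 x [x1x Gx]; apply/GO; last exact: lt_le_trans Gx.
by apply: le_lt_trans x1x _; rewrite ltr_pM2r// ltr_nat.
Qed.

Let Gle x y : G x <= G y + k * `|x - y|.
Proof. by have := Glip x y; rewrite ler_norml => /andP[_]; rewrite lerBlDl. Qed.

(* The flux field [eta *: e], where [eta] mollifies a cutoff times the truncated
   height [(G - 2 t)^+]: along [e] it increases at unit speed above level [3 t]. *)
Lemma flux_profile : exists2 ML : R * R, 0 <= ML.1 /\ 0 <= ML.2 &
  forall t : R, 0 < t -> exists2 eta, supp_test (slab t) eta &
    [/\ forall x, \sum_i D i eta x ^+ 2 <= ML.2,
        forall x, `|x1 - x| < r / 2 -> 3 * t <= G x -> 1 - ML.1 * G x <= 'D_e eta x &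
        forall x, - (ML.1 * Num.max (G x) 0) <= 'D_e eta x].
Proof.
have nse (s : R) : 0 < s -> `|s *: e| <= s.
  move=> s0; rewrite normrZ (gtr0_norm s0) -[leRHS]mulr1 ler_pM2l//; exact: dir_norm_le1.
have [chi [schi chi0 chi1 chiS]] := cutoff x1 r1.
have tchi : test_function setT chi.
  split=> //; exists [set x : pt | `|x1 - x| <= 2 * r]; split=> //; exact: compact_closed_cube.
have [M0 M00 hM0] := test_bounded tchi; have [M1 M10 hM1] := test_lip tchi.
pose N := `|G x1| + k * (2 * r); have N0 : 0 <= N by rewrite addr_ge0// !mulr_ge0 ?ltW.
(* A Lipschitz constant of [T = P * chi], independent of [t], so the gradient bound on [eta] does
   not degenerate as [t] tends to 0. *)
pose l := M0 * k + N * M1; have l0 : 0 <= l by rewrite addr_ge0 ?mulr_ge0 ?(ltW k0).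
exists (M1, d%:R * l ^+ 2); first by split=> //=; rewrite mulr_ge0// sqr_ge0.
move=> t t0 /=; pose P y := Num.max (G y - 2 * t) 0.
have P0 y : 0 <= P y by rewrite le_max lexx orbT.
have Plip x y : `|P x - P y| <= k * `|x - y|.
  have half a b : P a <= P b + k * `|a - b|.
    rewrite ge_max; apply/andP; split; last by rewrite addr_ge0// mulr_ge0// ltW.
    have : G b - 2 * t <= P b by rewrite le_max lexx.
    have := Gle a b; lra.
  rewrite ler_norml; have := half x y; have := half y x; rewrite distrC => ? ?.
  by apply/andP; split; lra.
have PN y : `|x1 - y| <= 2 * r -> P y <= N.
  move=> hy; rewrite ge_max N0 andbT.
  have := Gle y x1; rewrite distrC; have := ler_norm (G x1).
  have : k * `|x1 - y| <= k * (2 * r) by rewrite ler_pM2l.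
  rewrite /N; lra.
pose T y := P y * chi y.
have Tlip x y : `|T x - T y| <= l * `|x - y|.
  have chilip a b : `|chi a - chi b| <= M1 * `|a - b|.
    by have := hM1 b (a - b); rewrite [b + _]addrC subrK.
  have half a b : `|x1 - b| <= 2 * r -> `|T a - T b| <= l * `|a - b|.
    move=> hb; have -> : T a - T b = chi a * (P a - P b) + P b * (chi a - chi b) by rewrite /T; ring.
    apply: le_trans (ler_normD _ _) _; rewrite /l mulrDl !normrM -!mulrA; apply: lerD.
      by apply: ler_pM => //.
    by apply: ler_pM => //; rewrite ger0_norm// PN.
  have [hy|hy] := pselect (`|x1 - y| <= 2 * r); first exact: half.
  have [hx|hx] := pselect (`|x1 - x| <= 2 * r); first by rewrite distrC [`|x - y|]distrC; exact: half.
  by rewrite /T (chiS _ hx) (chiS _ hy) !mulr0 subrr normr0 mulr_ge0.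
have cT : continuous T := lip_continuous Tlip.
have IT : intg mu setT T.
  apply: (@intg_bounded_supp _ _ _ (N * M0) (`|x1| + 2 * r + 1)).
  - exact: continuous_measurable_row.
  - move=> x; rewrite /T; have [hx|/chiS ->] := pselect (`|x1 - x| <= 2 * r); last by rewrite mulr0 normr0 mulr_ge0.
    by rewrite normrM; apply: ler_pM => //; rewrite ger0_norm// PN.
  - move=> x nx; rewrite /T chiS ?mulr0// => hx; apply: nx; rewrite -ball_normE /ball_/= sub0r normrN.
    have -> : x = x1 - (x1 - x) by rewrite opprB addrC subrK.
    by have := ler_normB x1 (x1 - x); lra.
(* Moving by less than [m] changes the height by at most [t], which keeps the support of [eta] above
   level [t], and stays within the margins left by the cutoff [chi]. *)
pose m := Num.min (t / k) (r / 4).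
have m0 : 0 < m by rewrite lt_min !divr_gt0.
have mk : k * m <= t by rewrite mulrC -ler_pdivlMr// ge_min lexx.
have mr : m <= r / 4 by rewrite ge_min lexx orbT.
have tm : test_function (setT : set pt) (mollifier m) := test_mollifier m0; have em := @mollifier_even R d m.
pose eta := conv T (mollifier m).
have Gz x z : `|z| < m -> `|G (x + z) - G x| <= t.
  move=> zm; apply: le_trans (Glip _ _) _; rewrite addrC addKr.
  by apply: le_trans mk; rewrite ler_pM2l// ltW.
have te : supp_test (slab t) eta.
  split; first exact: smooth_conv IT tm.
  move=> x nx; rewrite /eta (conv_shift tm em); last exact: intg_mf IT.
  rewrite -[RHS](Rint0 mu (setT : set pt)); apply: eq_Rintegral => z _.
  have [zm|zm] := ltP `|z| m; last by rewrite mollifier_eq0// mul0r.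
  suff -> : T (x + z) = 0 by rewrite mulr0.
  have [hx|hx] := leP `|x1 - x| (3 * r); last first.
    rewrite /T chiS ?mulr0// => hz; have := ler_normD (x1 - (x + z)) z.
    have -> : x1 - (x + z) + z = x1 - x by rewrite opprD addrA subrK.
    lra.
  have [hG|hG] := leP t (G x); first by case: nx.
  rewrite /T (_ : P (x + z) = 0) ?mul0r//; apply/max_idPr.
  by have := Gz x z zm; rewrite ler_norml => /andP[_]; lra.
have tet : test_function setT eta := supp_testT (@slab_compact t) te.
exists eta => //; split.
- move=> x; apply: (@le_trans _ _ (\sum_(i < d) l ^+ 2)); last by rewrite sumr_const card_ord -[_ *+ d]mulr_natl.
  apply: ler_sum => i _; apply: ler_norm_sqr.
  have low (v : pt) : `|v| <= 1 -> - l <= 'D_v eta x.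
    move=> v1; apply: (test_derive_ge (s0 := 1) tet) => // s s0 _.
    have [|] := andP (@moll_diff_bounds R d T m (- l * s) (l * s) x (s *: v) m0 IT _) => // z _.
    rewrite mulNr -ler_norml; apply: le_trans (Tlip _ _) _; rewrite addrC addKr normrZ (gtr0_norm s0).
    by rewrite ler_wpM2l// ler_piMr// ltW.
  have u1 : `|@unit_vec R d i| <= 1.
    by apply: row_norm_le => // j; rewrite mxE; case: (_ == _); rewrite /= ?andbF ?normr0 ?normr1//; case: (_ == _); rewrite /= ?normr0 ?normr1.
  have := low _ u1; have := low (- unit_vec R i); rewrite normrN => /(_ u1).
  rewrite !(derive_row _ (smooth_diff x tet.1)) ler_norml.
  have -> : \sum_j (- unit_vec R i) 0 j * D j eta x = - \sum_j (unit_vec R i) 0 j * D j eta x.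
    by rewrite -sumrN; apply: eq_bigr => j _; rewrite mxE mulNr.
  have -> : \sum_j (unit_vec R i) 0 j * D j eta x = D i eta x.
    rewrite (bigD1 i)//= mxE !eqxx mul1r big1 ?addr0// => j ji.
    by rewrite mxE eqxx/= (negbTE ji) mul0r.
  by move=> ? ?; apply/andP; split; lra.
- move=> x hx hG; apply: (test_derive_ge (s0 := r / 4) tet); first by rewrite divr_gt0.
  move=> s s0 sr; rewrite -[x + _]/(x + s *: e).
  have [|] := andP (@moll_diff_bounds R d T m ((1 - M1 * G x) * s) (l * s) x (s *: e) m0 IT _) => // z zm.
  apply/andP; split; last first.
    apply: le_trans (ler_norm _) _; apply: le_trans (Tlip _ _) _.
    rewrite addrC addKr; apply: (ler_wpM2l l0); exact: nse.
  have := Gz x z zm; rewrite ler_norml => /andP[g1 g2].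
  (* From level [3 * t], a displacement smaller than [m] stays above [2 * t], where the truncation
     in [P] is inactive and [P] grows at unit speed along [e]. *)
  have P1 : P (x + z) = G (x + z) - 2 * t by apply/max_idPl; lra.
  have P2 : P (x + z + s *: e) = P (x + z) + s.
    rewrite P1 /P Gshift; apply/eqP; rewrite -addrA [s + _]addrC addrA; apply/eqP/max_idPl; lra.
  have c1 : 1 <= chi (x + z + s *: e).
    apply: chi1; have -> : x1 - (x + z + s *: e) = (x1 - x) - (z + s *: e).
      by apply/rowP => j; rewrite !mxE; ring.
    apply: le_trans (ler_normB _ _) _; have := ler_normD z (s *: e).
    have := nse s s0.
    lra.
  have c2 := hM1 (x + z) (s *: e).
  have c3 : M1 * `|s *: e| <= M1 * s.
    by apply: (ler_wpM2l M10); exact: nse.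
  have -> : T (x + z + s *: e) - T (x + z) =
    s * chi (x + z + s *: e) + P (x + z) * (chi (x + z + s *: e) - chi (x + z)) by rewrite /T P2; ring.
  have c4 : - (M1 * s) <= chi (x + z + s *: e) - chi (x + z).
    by move: c2; rewrite ler_norml => /andP[c2 _]; lra.
  have p1 : P (x + z) <= G x by rewrite P1; lra.
  have p2 := P0 (x + z).
  have q1 : P (x + z) * - (M1 * s) <= P (x + z) * (chi (x + z + s *: e) - chi (x + z)) by rewrite ler_wpM2l.
  have q2 : P (x + z) * (M1 * s) <= G x * (M1 * s) by rewrite ler_wpM2r// mulr_ge0// ltW.
  have q3 : s * 1 <= s * chi (x + z + s *: e) by rewrite ler_pM2l.
  move: q1 q2 q3; lra.
- move=> x; apply: (test_derive_ge (s0 := 1) tet) => // s s0 _.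
  have [|] := andP (@moll_diff_bounds R d T m (- (M1 * Num.max (G x) 0) * s) (l * s) x (s *: e) m0 IT _) => // z zm.
  apply/andP; split; last first.
    apply: le_trans (ler_norm _) _; apply: le_trans (Tlip _ _) _.
    rewrite addrC addKr; apply: (ler_wpM2l l0); exact: nse.
  have := Gz x z zm; rewrite ler_norml => /andP[g1 g2].
  have P2 : P (x + z) <= P (x + z + s *: e).
    by rewrite /P Gshift ge_max !le_max lexx orbT andbT; apply/orP; left; lra.
  have p1 : P (x + z) <= Num.max (G x) 0.
    by rewrite ge_max !le_max lexx orbT andbT; apply/orP; left; lra.
  have c2 := hM1 (x + z) (s *: e).
  have c3 : M1 * `|s *: e| <= M1 * s.
    by apply: (ler_wpM2l M10); exact: nse.
  have -> : T (x + z + s *: e) - T (x + z) =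
    (P (x + z + s *: e) - P (x + z)) * chi (x + z + s *: e) +
      P (x + z) * (chi (x + z + s *: e) - chi (x + z)) by rewrite /T; ring.
  have c4 : - (M1 * s) <= chi (x + z + s *: e) - chi (x + z).
    by move: c2; rewrite ler_norml => /andP[c2 _]; lra.
  have p2 := P0 (x + z).
  have q1 : P (x + z) * - (M1 * s) <= P (x + z) * (chi (x + z + s *: e) - chi (x + z)) by rewrite ler_wpM2l.
  have q2 : P (x + z) * (M1 * s) <= Num.max (G x) 0 * (M1 * s) by rewrite ler_wpM2r// mulr_ge0// ltW.
  have q3 : 0 <= (P (x + z + s *: e) - P (x + z)) * chi (x + z + s *: e) by rewrite mulr_ge0// subr_ge0.
  move: q1 q2 q3; set mx := Num.max _ _; lra.
Qed.

(** On the part of the ball above level [3 * t], [1 <= 'D_e eta + M * G]; elsewhere the error is at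
    most [M * G]. The term [M * G] is small at heights below [th], and above [th] it is supported in
    a compact slab where the interior estimate applies. Nothing depends on [t], so dominated
    convergence lets it tend to 0. *)
Lemma epigraph_almost_controlled : almost_controlled (ball x1 (r / 2)).
Proof.
have r24 : r / 2 < 4 * r by rewrite ltr_pdivrMr// mulrAC ltr_pMl// -natrM ltr1n.
have [[M L] /= [M0 L0] hML] := flux_profile; move=> eps eps0.
(* The flux estimate costs [3 * ep = eps / 2]; the choice of [th] below makes the thin layer cost at
   most the other half. *)
pose ep := eps / 6; have ep0 : 0 < ep by rewrite divr_gt0.
pose th := eps / (2 * (M + 1)); have M1 : 0 < M + 1 by lra.
have th0 : 0 < th by rewrite divr_gt0// mulr_gt0.
have Mth : M * th <= eps / 2.
  have -> : eps / 2 = (M + 1) * th by rewrite /th; field; rewrite gt_eqF.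
  by rewrite ler_wpM2r ?(ltW th0)//; lra.
(* This slab has the fixed height [th], so [Kc] is chosen before [t] and does not change with it. *)
have [Kc hKc] := controlled_compact oO bO r00 x0O conO (@slab_compact th) (slab_sub th0).
pose N := `|G x1| + k * (3 * r); have N0 : 0 <= N by rewrite addr_ge0// !mulr_ge0// ltW.
exists (40 * L / ep + 1 + M * N * Kc) => h C c hC C0 hc.
have hcs := hKc h C c hC C0 hc.
have Lh := db_L2 hC; set B := \int[mu]_(x in Omega) _.
have If := intg_sqr_sub oO bO c Lh.
have mG : measurable_fun setT G by exact: continuous_measurable_row.
pose A (t : R) := ball x1 (r / 2) `&` [set x | 3 * t <= G x].
have mA t : measurable (A t).
  apply: measurableI; first exact: measurable_row_ball.
  apply: closed_measurable_row; rewrite (_ : [set x | _] = G @^-1` [set y | 3 * t <= y])//.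
  by apply: closed_comp => [x _|]; [exact: cG|exact: closed_ge].
have AO t : 0 < t -> A t `<=` Omega.
  move=> t0 x [xb Gx]; apply/GO; last by apply: lt_le_trans Gx; rewrite mulr_gt0.
  by move: xb; rewrite -ball_normE /ball_/= => xb; exact: lt_trans xb r24.
have ms := compact_measurable_row (@slab_compact th).
set bd := eps * B + _.
have hA t : 0 < t -> \int[mu]_(x in A t) (h x - c) ^+ 2 <= bd.
  move=> t0; have [eta te [hL hlow hneg]] := hML t t0; have [seta eta0] := te.
  have := flux_estimate oO bO (@slab_compact t) (slab_sub t0) te e1 ep0 L0 hL c hC C0.
  rewrite -/B -(Rint_indic (fun x => (h x - c) ^+ 2) (AO t t0)).
  rewrite -(Rint_indic (fun x => (h x - c) ^+ 2) (slab_sub th0)) in hcs.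
  have mi (S : set pt) : measurable S -> measurable_fun Omega (\1_S : pt -> R).
    by move=> mS; apply: measurable_funTS; exact: measurable_indic.
  have bi (S : set pt) (x : pt) : Omega x -> `|\1_S x| <= 1 :> R.
    by move=> _; rewrite indicE; case: (_ \in _); rewrite /= ?normr0 ?normr1.
  have IA := intg_mulb mO If (mi _ (mA t)) (@bi _).
  have Is := intg_mulb mO If (mi _ ms) (@bi _).
  have IE : intg mu Omega (fun x => (h x - c) ^+ 2 * 'D_e eta x).
    apply: (intg_mulb mO If (M := 1 + L)) => [|x _].
      apply: measurable_funTS; apply: smooth_measurable.
      rewrite (_ : (fun x => _) = fun x => \sum_j e 0 j * D j eta x); first by smooth_auto.
      by apply/funext => x; apply: derive_row; exact: smooth_diff.
    have h2 := le_trans (derive_dir_sqr_le x seta e1) (hL x).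
    have : 0 <= (`|'D_e eta x| - 1) ^+ 2 by exact: sqr_ge0.
    rewrite sqrrB1 real_normK ?num_real//; have := normr_ge0 ('D_e eta x); lra.
  have J1 := intgZ mO (M * th) If; have J2 := intgZ mO (M * N) Is.
  have key : \int[mu]_(x in Omega) ((h x - c) ^+ 2 * \1_(A t) x) <=
      \int[mu]_(x in Omega) ((h x - c) ^+ 2 * 'D_e eta x) +
      (M * th * B + M * N * \int[mu]_(x in Omega) ((h x - c) ^+ 2 * \1_(slab th) x)).
    rewrite -(RintZ mO _ If) -(RintZ mO _ Is) -(RintD mO J1 J2) -(RintD mO IE (intgD mO J1 J2)).
    apply: (le_Rint mO IA (intgD mO IE (intgD mO J1 J2))) => x Ox.
    have hx : \1_(A t) x <= 'D_e eta x + (M * th + M * N * \1_(slab th) x).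
      have hi : 0 <= \1_(slab th) x :> R by rewrite indicE.
      have h0 : 0 <= M * th by rewrite mulr_ge0// ltW.
      have hN := mulr_ge0 (mulr_ge0 M0 N0) hi.
      have [xs|xs] := pselect (slab t x); last first.
        have -> : 'D_e eta x = 0.
          rewrite derive_row; last exact: smooth_diff.
          by rewrite big1// => j _; rewrite (supp_test_partial (@slab_compact t) j te).2// mulr0.
        rewrite indicE memNset ?add0r ?addr_ge0// => -[xb Gx]; apply: xs; split.
          by move: xb; rewrite -ball_normE /ball_/=; lra.
        by apply: le_trans (Gx : 3 * t <= G x); rewrite ler_peMl ?(ltW t0)// ler1n.
      have Gp : 0 < G x by apply: lt_le_trans xs.2.
      have GMN : M * G x <= M * th + M * N * \1_(slab th) x.
        have [Gt|Gt] := leP th (G x); last first.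
          by apply: (@le_trans _ _ (M * th)); [rewrite ler_wpM2l// ltW|rewrite lerDl].
        rewrite indicE mem_set; last by split=> //; exact: xs.1.
        rewrite mulr1; apply: (@le_trans _ _ (M * N)); last by rewrite lerDr.
        rewrite ler_wpM2l//; have := Gle x x1; rewrite distrC; have := ler_norm (G x1).
        have : k * `|x1 - x| <= k * (3 * r) by rewrite ler_pM2l//; exact: xs.1.
        rewrite /N; lra.
      rewrite indicE; case: (boolP (x \in A t)) => [/set_mem[xb Gx]|_]/=.
        have := hlow x _ Gx; rewrite -ball_normE /ball_/= in xb => /(_ xb); lra.
      have := hneg x; rewrite (max_idPl (ltW Gp)); lra.
    apply: (le_trans (ler_wpM2l (sqr_ge0 (h x - c)) hx)).
    by rewrite le_eqVlt; apply/orP; left; apply/eqP; ring.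
  have B0 : 0 <= B by apply: Rint_ge0 => x _; exact: sqr_ge0.
  have k1 : M * th * B <= eps / 2 * B by rewrite ler_wpM2r.
  have k2 : M * N * \int[mu]_(x in Omega) ((h x - c) ^+ 2 * \1_(slab th) x) <= M * N * (Kc * C).
    by rewrite ler_wpM2l// mulr_ge0.
  move=> h3; apply: (le_trans key); apply: (le_trans (lerD h3 (lerD k1 k2))).
  by rewrite le_eqVlt; apply/orP; left; apply/eqP; rewrite /bd /ep; field; lra.
have mB : measurable (ball x1 (r / 2) `&` Omega) by apply: measurableI => //; exact: measurable_row_ball.
pose t_ (n : nat) : R := n.+1%:R^-1.
have t0 n : 0 < t_ n by rewrite invr_gt0 ltr0n.
have SO : ball x1 (r / 2) `&` Omega `<=` Omega by exact: subIsetr.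
have [|||||_ cvg] := @dominated_Rint _ _ R mu Omega mO (fun n x => (h x - c) ^+ 2 * \1_(A (t_ n)) x)
  (fun x => (h x - c) ^+ 2 * \1_(ball x1 (r / 2) `&` Omega) x) (fun x => (h x - c) ^+ 2).
- move=> n; apply: measurable_funM; first exact: intg_mf If.
  by apply: measurable_funTS; exact: measurable_indic.
- apply: measurable_funM; first exact: intg_mf If.
  by apply: measurable_funTS; exact: measurable_indic.
- exact: If.
- apply: aeW => x Ox; apply: cvg_near_cst.
  have [xb|xb] := pselect (ball x1 (r / 2) x); last first.
    by near=> n; rewrite !indicE !memNset// => -[].
  have Gp : 0 < G x.
    by apply/GO => //; move: xb; rewrite -ball_normE /ball_/= => xb; apply: lt_trans xb _; lra.
  have : \forall n \near \oo, t_ n < G x / 3.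
    exists (Num.truncn (G x / 3)^-1) => // n /= hn.
    rewrite /t_ invf_plt ?posrE ?ltr0n ?divr_gt0//.
    by apply: lt_le_trans (truncnS_gt _) _; rewrite ler_nat.
  apply: filterS => n hn; rewrite !indicE !mem_set//; split=> //=.
  by rewrite mulrC -ler_pdivlMr// ltW.
- apply: aeW => x Ox n; rewrite normrM ger0_norm ?sqr_ge0// ler_piMr ?sqr_ge0//.
  by rewrite indicE; case: (_ \in _); rewrite /= ?normr0 ?normr1.
rewrite (Rint_indic (fun x => (h x - c) ^+ 2) SO) in cvg.
rewrite -(cvg_lim _ cvg)//; apply: limr_le; first by apply/cvg_ex; eexists; exact: cvg.
near=> n; rewrite (Rint_indic (fun x => (h x - c) ^+ 2) (AO _ (t0 n))); exact: hA.
Unshelve. all: by end_near. Qed.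

End epigraph.

(** The local Lipschitz graph yields a height [G] that is Lipschitz, increases at unit speed along
    [e], and is positive exactly on [Omega] near [x]. *)
Lemma epigraph_nbhs x : lipschitz_boundary Omega -> boundary Omega x ->
  exists2 s : R, 0 < s & almost_controlled (ball x s).
Proof.
move=> lb /lb[U [e [g [oU Ux e1 [M [_ hM]] OU]]]].
have ne := dir_norm_le1 e1.
pose hor (y : pt) := y - dot y e *: e; pose G y := dot y e - g (hor y).
(* The library notion of [lipschitz] provides every constant larger than [M]; this is one of them,
   and it is positive. *)
pose q := `|M| + 1.
have q0 : 0 < q by rewrite ltr_wpDl.
have glip y z : `|g y - g z| <= q * `|y - z|.
  have := hM q; rewrite /q (le_lt_trans (ler_norm M)) ?ltrDl// => /(_ isT (y, z)); exact.
have dotB y z : dot (y - z) e = dot y e - dot z e.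
  by rewrite /dot -sumrB; apply: eq_bigr => i _; rewrite !mxE mulrBl.
have dot_le (v : pt) : `|dot v e| <= d%:R * `|v|.
  apply: le_trans (ler_norm_sum _ _ _) _.
  apply: (@le_trans _ _ (\sum_(i < d) `|v|)); last by rewrite sumr_const card_ord -[_ *+ d]mulr_natl.
  apply: ler_sum => i _; rewrite normrM; apply: (le_trans _ (row_norm_coord v i)).
  by rewrite ler_piMr//; exact: le_trans (row_norm_coord e i) ne.
(* In the sup norm the height functional [dot _ e] is bounded by [d] and the horizontal projection
   by [1 + d]. *)
pose k := d%:R + q * (1 + d%:R) : R.
have k0 : 0 < k by rewrite ltr_wpDl// mulr_gt0// ltr_pwDl.
have Glip y z : `|G y - G z| <= k * `|y - z|.
  have -> : G y - G z = dot (y - z) e - (g (hor y) - g (hor z)) by rewrite /G dotB; ring.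
  apply: le_trans (ler_normB _ _) _; rewrite /k mulrDl -mulrA; apply: lerD; first exact: dot_le.
  apply: le_trans (glip _ _) _; rewrite ler_pM2l//.
  have -> : hor y - hor z = (y - z) - dot (y - z) e *: e.
    by rewrite /hor dotB; apply/rowP => i; rewrite !mxE; ring.
  apply: le_trans (ler_normB _ _) _; rewrite mulrDl mul1r lerD2l normrZ.
  apply: (le_trans _ (dot_le _)); by rewrite ler_piMr.
have dots (y : pt) (s : R) : dot (y + s *: e) e = dot y e + s.
  suff -> : dot (y + s *: e) e = dot y e + s * dot e e by rewrite e1 mulr1.
  by rewrite /dot mulr_sumr -big_split/=; apply: eq_bigr => i _; rewrite !mxE; ring.
have Gshift (y : pt) (s : R) : G (y + s *: e) = G y + s.
  rewrite /G; have -> : hor (y + s *: e) = hor y.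
    by rewrite /hor dots; apply/rowP => i; rewrite !mxE; ring.
  by rewrite dots addrAC.
have [r /= r1 xU] := (nbhs_ballP _ _).1 (open_nbhs_nbhs (conj oU Ux)).
have r4 : 0 < r / 4 by rewrite divr_gt0.
have GO (y : pt) : `|x - y| < 4 * (r / 4) -> (Omega y <-> 0 < G y).
  rewrite mulrC divfK// => xy; have Uy : U y by apply: xU; rewrite -ball_normE.
  rewrite /G subr_gt0; split=> [Oy|h].
    by have : (Omega `&` U) y by []; rewrite OU => -[].
  by have : [set y | U y /\ g (y - dot y e *: e) < dot y e] y by []; rewrite -OU => -[].
exists (r / 4 / 2); first by rewrite divr_gt0.
exact: (epigraph_almost_controlled e1 k0 r4 Glip Gshift GO).
Qed.

Lemma controlled_almost S : controlled Omega x0 r0 S -> S `<=` Omega -> almost_controlled S.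
Proof.
move=> [K hK] SO e e0; exists K => h C c hC C0 hc.
rewrite setIidl//; apply: (le_trans (hK h C c hC C0 hc)); rewrite lerDr mulr_ge0 ?(ltW e0)//.
by apply: Rint_ge0 => x _; exact: sqr_ge0.
Qed.

(** Almost control is local, by the interior estimate or by an epigraph, and stable under unions
    because [e] can be halved; so it holds on a neighbourhood of the compact closure. With factor
    1/2 the norm over [Omega] is absorbed by the left-hand side. *)
Lemma dual_bounded_estimate : lipschitz_boundary Omega -> exists K : R,
  forall h (C c : R), db h C -> 0 < C -> \int[mu]_(x in ball x0 r0) (h x - c) ^+ 2 <= C ->
    \int[mu]_(x in Omega) (h x - c) ^+ 2 <= K * C.
Proof.
move=> lb; pose P (U : set pt) := measurable U /\ almost_controlled U.
have cO : compact (closure Omega).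
  apply: bounded_closed_compact; last exact: closed_closure.
  have [r r1 Or] := bounded_row_ball bO.
  exists (r + 1); split; first exact: num_real.
  move=> s rs x /= xc.
  have cl : closed [set y : pt | `|0 - y| <= r].
    exact: compact_closed (@norm_hausdorff _ _) (@compact_closed_cube R d 0 r).
  have : [set y : pt | `|0 - y| <= r] x.
    apply: cl => B xB; have [y [Oy By]] := xc B xB; exists y; split=> //=.
    by have := Or y Oy; rewrite -ball_normE /ball_/= => /ltW.
  by rewrite /= sub0r normrN; lra.
have [|||U [mU aU] OU] := @compact_ind _ P _ cO.
- split; first exact: measurable0.
  by apply: controlled_almost => //; exists 0 => h C c _ C0 _; rewrite Rintegral_set0 mul0r.
- move=> A B [mA aA] [mB aB]; split; first exact: measurableU.
  move=> e e0; have e2 : 0 < e / 2 by rewrite divr_gt0.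
  have [K hK] := aA _ e2; have [K' hK'] := aB _ e2; exists (K + K') => h C c hC C0 hc.
  have := lerD (hK h C c hC C0 hc) (hK' h C c hC C0 hc).
  set X := \int[mu]_(x in Omega) _; have -> : e / 2 * X + K * C + (e / 2 * X + K' * C) = e * X + (K + K') * C.
    by field.
  apply: le_trans; rewrite setIUl; have Lh := db_L2 hC.
  apply: Rint_setU_le => [|||x _]; [exact: measurableI|exact: measurableI| |exact: sqr_ge0].
  apply: (intg_sqr_subS oO bO) => //; first by apply: measurableU; exact: measurableI.
  by rewrite subUset; split; exact: subIsetr.
- move=> x xc; have [Ox|nOx] := pselect (Omega x).
    have [r r1 [rO cr]] := controlled_ball oO bO r00 x0O conO Ox.
    exists (ball x r); first exact: nbhsx_ballx.
    by split; [exact: measurable_row_ball|exact: controlled_almost].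
  have bx : boundary Omega x by split=> // /interior_subset.
  have [s s0 h] := epigraph_nbhs lb bx.
  by exists (ball x s); [exact: nbhsx_ballx|split=> //; exact: measurable_row_ball].
have h2 : 0 < 2^-1 :> R by [].
have [K hK] := aU _ h2; exists (2 * K) => h C c hC C0 hc.
have := hK h C c hC C0 hc; rewrite setIidr; last by apply: subset_trans OU; exact: subset_closure.
set X := \int[mu]_(x in _) _; lra.
Qed.

End boundary_estimate.

(** * The estimate for functions of mean zero *)

Section mean_zero.
Context {R : realType} {d : nat}.
Local Notation pt := 'rV[R]_d.
Local Notation mu := (lebesgue_row R d).
Context (Omega : set pt).
Hypotheses (oO : open Omega) (bO : bounded_set Omega) (conO : connected Omega).
Hypotheses (nO : Omega !=set0) (lO : lipschitz_boundary Omega).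
Let mO := open_measurable_row oO.
Let fO := bounded_row_lty mO bO.

Lemma dual_bounded_le h (C C' : R) : C <= C' -> dual_bounded Omega h C -> dual_bounded Omega h C'.
Proof.
move=> CC [Lh C0 h1 h2]; split=> //; first exact: le_trans CC.
move=> V tV; apply: (le_trans (h2 V tV)); rewrite ler_wpM2r//.
by apply: sumr_ge0 => j _; apply: sumr_ge0 => i _; apply: Rint_ge0 => x _; exact: sqr_ge0.
Qed.

(** The constant [m] comes from the Poincare inequality on one ball. For [h] of mean zero the cross
    term vanishes and subtracting [m] can only increase the norm over [Omega], so the bound for
    [h - m] holds for [h]. *)
Lemma dual_bounded_mean_zero : exists2 K : R, 0 < K & forall h (C : R), dual_bounded Omega h C ->
  0 < C -> \int[mu]_(x in Omega) h x = 0 -> ip2 mu Omega h h <= K * C.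
Proof.
have [x0 Ox0] := nO.
have [r /= r1 xO] := (nbhs_ballP _ _).1 (open_nbhs_nbhs (conj oO Ox0)).
have r4 : 0 < r / 4 by rewrite divr_gt0.
have x4O : ball x0 (4 * (r / 4)) `<=` Omega by rewrite mulrC divfK.
have x0O : ball x0 (r / 4) `<=` Omega by apply: subset_trans xO; apply: le_ball; lra.
have [K0 K00 hK0] := local_poincare oO bO r4 x4O.
have [K hK] := dual_bounded_estimate oO bO conO r4 x0O lO.
exists (`|K| * (K0 + 1) + 1) => [|h C hC C0 h0]; first by rewrite ltr_wpDl// mulr_ge0// addr_ge0// ltW.
have [m hm] := hK0 h C hC C0.
(* The global estimate takes the same constant in the dual bound and on the reference ball, so [C]
   is enlarged to [(K0 + 1) * C] for both. *)
have C'0 : 0 < (K0 + 1) * C by rewrite mulr_gt0// addr_gt0.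
have C1 : C <= (K0 + 1) * C by rewrite ler_peMl ?(ltW C0)// lerDr ltW.
have hm' : \int[mu]_(x in ball x0 (r / 4)) (h x - m) ^+ 2 <= (K0 + 1) * C.
  by apply: (le_trans hm); rewrite ler_wpM2r ?(ltW C0)// lerDl.
have := hK h _ m (dual_bounded_le C1 hC) C'0 hm'.
have Lh := db_L2 hC; have [_ Ih2] := Lh; have Ih := L2_intg mO fO Lh.
have -> : \int[mu]_(x in Omega) (h x - m) ^+ 2 =
    ip2 mu Omega h h + m ^+ 2 * fine (mu Omega).
  have J1 := intgZ mO (- (2 * m)) Ih; have J2 := intg_cst mO (m ^+ 2) fO.
  rewrite ip2_sqr -[m ^+ 2 * _]Rintegral_cst//.
  have -> : \int[mu]_(x in Omega) h x ^+ 2 = \int[mu]_(x in Omega) h x ^+ 2 +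
      \int[mu]_(x in Omega) (- (2 * m) * h x) by rewrite (RintZ mO _ Ih) h0 mulr0 addr0.
  rewrite -(RintD mO Ih2 J1) -(RintD mO (intgD mO Ih2 J1) J2).
  by apply: eq_Rintegral => x _; ring.
have m0 : 0 <= m ^+ 2 * fine (mu Omega) by rewrite mulr_ge0 ?sqr_ge0 ?fine_ge0.
have kK : K * ((K0 + 1) * C) <= `|K| * ((K0 + 1) * C) by rewrite ler_wpM2r ?ler_norm// ltW.
move=> h1; have -> : (`|K| * (K0 + 1) + 1) * C = `|K| * ((K0 + 1) * C) + C by ring.
lra.
Qed.

End mean_zero.

(** * Symmetry of the gradient on H10 *)

Lemma dist_mid {R : realFieldType} (a b c e : R) :
  `|a - c| < e / 2 -> `|b - c| < e / 2 -> `|a - b| <= e.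
Proof.
move=> h1 h2; have -> : a - b = (a - c) - (b - c) by ring.
by apply: le_trans (ler_normB _ _) _; lra.
Qed.

Lemma sqrB_bound {R : realDomainType} (a b A B X : R) :
  a ^+ 2 <= A * X -> b ^+ 2 <= B * X -> (a - b) ^+ 2 <= (2 * A + 2 * B) * X.
Proof. by have := sqr_ge0 (a + b); nra. Qed.

Lemma lin_onB {R : realType} (V : lmodType R) (S : V -> Prop) (l l' : V -> R) :
  lin_on S l -> lin_on S l' -> lin_on S (fun v => l v - l' v).
Proof. by move=> hl hl' a u v Su Sv; rewrite hl// hl'//; ring. Qed.

Section schwarz.
Context {R : realType} {d : nat}.
Local Notation pt := 'rV[R]_d.
Local Notation D i f := ('D_(@unit_vec R d i) f).
Implicit Types (f g phi : pt -> R) (i j : 'I_d).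

Lemma derive_unit_scale f x (s : R) i : smooth f -> 'D_(s *: unit_vec R i) f x = s * D i f x.
Proof.
move=> sf; rewrite (derive_row _ (smooth_diff x sf)) (bigD1 i)//= !mxE !eqxx mulr1.
by rewrite big1 ?addr0// => j ji; rewrite !mxE eqxx/= (negbTE ji) mulr0 mul0r.
Qed.

(** The mean value theorem is applied to the increment of [f] in direction [j], along direction [i],
    and then to [D i f] along direction [j]. *)
Lemma second_difference f x (s : R) i j : smooth f -> 0 < s ->
  exists2 y : pt, `|y - x| <= 2 * s &
  f (x + s *: unit_vec R i + s *: unit_vec R j) - f (x + s *: unit_vec R i) -
  (f (x + s *: unit_vec R j) - f x) = s * (s * D j (D i f) y).
Proof.
move=> sf s0; set v := s *: unit_vec R i; set w := s *: unit_vec R j.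
have un k : `|s *: unit_vec R k : pt| <= s.
  rewrite normrZ (gtr0_norm s0) ler_piMr ?(ltW s0)//; apply: row_norm_le => // l.
  by rewrite mxE; case: (_ && _); rewrite /= ?normr0 ?normr1.
have unt (c : R) k : 0 <= c -> c <= 1 -> `|c *: (s *: unit_vec R k) : pt| <= s.
  by move=> c0 c1; rewrite normrZ ger0_norm//; apply: (le_trans _ (un k)); rewrite ler_piMl.
pose g y := f (y + w) - f y.
have sg : smooth g by apply: smoothB => //; exact: smooth_shift.
have [t /andP[t0 t1] e1] := mvt_line x v sg.
have e2 : 'D_v g (x + t *: v) = s * (D i f (x + t *: v + w) - D i f (x + t *: v)).
  rewrite (derive_unit_scale _ _ _ sg); congr (_ * _).
  rewrite (_ : g = (fun y => f (y + w)) - f)// deriveB.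
  - by rewrite derive_shift.
  - by apply: smooth_derivable; exact: smooth_shift.
  - exact: smooth_derivable.
have [t' /andP[t'0 t'1] e3] := mvt_line (x + t *: v) w (smooth_partial i sf).
exists (x + t *: v + t' *: w).
  have -> : x + t *: v + t' *: w - x = t *: v + t' *: w by apply/rowP => l; rewrite !mxE; ring.
  apply: le_trans (ler_normD _ _) _; rewrite mulrDl mul1r.
  by apply: lerD; exact: unt.
rewrite -[LHS]/(g (x + v) - g x) e1 e2 e3; congr (_ * _).
by apply: derive_unit_scale; exact: smooth_partial.
Qed.

(** The second difference is symmetric in its directions, so both mixed partials take a common value
    at points arbitrarily close to [x]; continuity concludes. *)
Lemma partialC f i j : smooth f -> D i (D j f) = D j (D i f).
Proof.
move=> sf; apply/funext => x; apply/eqP; rewrite -subr_eq0 -normr_le0.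
have cont k l : continuous (D k (D l f)).
  by apply: smooth_continuous; apply: smooth_partial; exact: smooth_partial.
suff hh (e : R) : 0 < e -> `|D i (D j f) x - D j (D i f) x| <= 0 + e.
  by apply/ler_addgt0Pr => e; exact: hh.
move=> e0; rewrite add0r; have e2 : 0 < e / 2 by rewrite divr_gt0.
have near k l : exists2 r : R, 0 < r & forall y, `|y - x| < r -> `|D k (D l f) x - D k (D l f) y| < e / 2.
  have /(@cvgrPdist_lt R R^o pt (nbhs x) _ _ _)/(_ _ e2)/nbhs_ballP[r /= r0 hr] := cont k l x.
  by exists r => // y yx; apply: hr; rewrite -ball_normE /ball_/= distrC.
have [r r0 hr] := near i j; have [r' r'0 hr'] := near j i.
pose s := Num.min r r' / 4; have s0 : 0 < s by rewrite divr_gt0// lt_min r0.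
have sr : 2 * s < r.
  by have : Num.min r r' <= r by [rewrite ge_min lexx]; rewrite /s; lra.
have sr' : 2 * s < r'.
  by have : Num.min r r' <= r' by [rewrite ge_min lexx orbT]; rewrite /s; lra.
have [y yx ey] := second_difference x i j sf s0.
have [z zx ez] := second_difference x j i sf s0.
have E : D j (D i f) y = D i (D j f) z.
  have sn : s != 0 by rewrite gt_eqF.
  have key : s * (s * D j (D i f) y) = s * (s * D i (D j f) z).
    apply: (eq_trans (esym ey)); apply: (eq_trans _ ez).
    by rewrite [x + s *: unit_vec R i + _]addrAC; ring.
  exact: (mulfI sn (mulfI sn key)).
have h1 := hr' y (le_lt_trans yx sr'); have h2 := hr z (le_lt_trans zx sr).
rewrite -E in h2.
exact: dist_mid h2 h1.
Qed.

End schwarz.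

Section H10_identities.
Context {R : realType} {d : nat}.
Local Notation pt := 'rV[R]_d.
Local Notation mu := (lebesgue_row R d).
Local Notation D i f := ('D_(@unit_vec R d i) f).
Context (Omega : set pt).
Hypotheses (oO : open Omega) (bO : bounded_set Omega).
Implicit Types (f g phi : pt -> R) (i j : 'I_d).
Let mO := open_measurable_row oO.
Let fO := bounded_row_lty mO bO.
Local Notation L2 := (L2 mu Omega).
Local Notation ip := (ip2 mu Omega).
Local Notation pd := (pd Omega).
Local Notation test := (test_function Omega).
Local Notation H10 := (in_H10 Omega).
Local Notation W12 := (W12 Omega).
Local Notation ip_H1 := (ip_H1 Omega).

Lemma H10_test_eq0 (l : (pt -> R) -> R) (M : R) : lin_on W12 l ->
  (forall f, W12 f -> l f ^+ 2 <= M * ip_H1 f f) -> (forall phi, test phi -> l phi = 0) ->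
  forall f, H10 f -> l f = 0.
Proof.
move=> ll lM l0 f /(H10P oO bO)[Wf Hf]; have HW := W12_subspace oO bO.
apply/eqP; rewrite -sqrf_eq0 eq_le sqr_ge0 andbT.
suff hh (e : R) : 0 < e -> l f ^+ 2 <= 0 + e by apply/ler_addgt0Pr => e; exact: hh.
move=> e0; have M1 : 0 < `|M| + 1 by rewrite ltr_wpDl.
have [phi tp hp] := Hf (e / (`|M| + 1)) (divr_gt0 e0 M1).
have Wp := test_W12 oO bO tp; have Wfp := subB HW Wf Wp.
have -> : l f = l (f - phi) by rewrite (linB HW ll)// (l0 _ tp) subr0.
rewrite add0r; apply: (le_trans (lM _ Wfp)); have p0 := sip_ge0 (H1_semi_ip oO bO) Wfp.
apply: (@le_trans _ _ ((`|M| + 1) * ip_H1 (f - phi) (f - phi))).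
  by rewrite ler_wpM2r// (le_trans (ler_norm M))// lerDl.
by rewrite mulrC -ler_pdivlMr// ltW.
Qed.

Let pd_le_H1 i f : W12 f -> ip (pd i f) (pd i f) <= ip_H1 f f.
Proof.
move=> Wf; apply: le_trans (pd_ip_le_gip oO bO i Wf) _.
by rewrite -[ip_H1 f f]/(ip f f + gip Omega f f) lerDr; exact: sip_ge0 (L2_semi_ip mu mO) _ Wf.1.
Qed.

Let pd_lin_on i g : L2 g -> lin_on W12 (fun f => ip (pd i f) g).
Proof.
move=> Lg a u v Wu Wv; have H := L2_semi_ip mu mO.
have Lu := (Wu.2 i).2; have Lv := (Wv.2 i).2.
have Wuv := subDZ (W12_subspace oO bO) a Wu Wv.
have Luv := subDZ (sip_sub H) a Lu Lv.
rewrite -(sip_lin H a Lu Lv Lg); apply: (ip2_ae mO) => //; [exact: (Wuv.2 i).2|exact: pd_lin|exact: ae_eq_refl].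
Qed.

Let pd_bound i g : L2 g -> forall f, W12 f -> ip (pd i f) g ^+ 2 <= ip g g * ip_H1 f f.
Proof.
move=> Lg f Wf; apply: le_trans (ip_CS (L2_semi_ip mu mO) (Wf.2 i).2 Lg) _.
by rewrite mulrC ler_wpM2l ?pd_le_H1// (sip_ge0 (L2_semi_ip mu mO)).
Qed.

Lemma H10_pd_int f i : H10 f -> \int[mu]_(x in Omega) pd i f x = 0.
Proof.
move=> Hf; have L1 := L2_cst mO (1 : R) fO.
have e g : \int[mu]_(x in Omega) g x = ip g (fun=> 1).
  by apply: eq_Rintegral => x _; rewrite mulr1.
rewrite e; apply: (H10_test_eq0 (l := fun f => ip (pd i f) (fun=> 1)) (pd_lin_on i L1) (pd_bound i L1)) => // phi tp.
rewrite -e -(Rint_partial_test i tp); have tD := test_partial i tp.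
by apply: (Rint_ae mO); [exact: ((test_W12 oO bO tp).2 i).2.1|exact: (test_L2 oO tD).1|exact: pd_test].
Qed.

(* Both sides equal [int u D_i D_j phi] up to sign, by symmetry of second derivatives. *)
Lemma H10_pdC f g i j : H10 f -> H10 g -> ip (pd i f) (pd j g) = ip (pd j f) (pd i g).
Proof.
move=> Hf Hg; have Wf := H10_W12 oO Hf; have Wg := H10_W12 oO Hg.
have H := L2_semi_ip mu mO.
have Lfi k := (Wf.2 k).2; have Lgi k := (Wg.2 k).2.
have swap u v : L2 u -> L2 v -> ip u v = ip v u by move=> Lu Lv; exact: sip_sym H _ _ Lu Lv.
apply/eqP; rewrite -subr_eq0; apply/eqP.
apply: (eq_trans (congr2 (fun a b => a - b) (swap _ _ (Lfi i) (Lgi j)) (swap _ _ (Lfi j) (Lgi i)))).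
have hl := lin_onB (pd_lin_on j (Lfi i)) (pd_lin_on i (Lfi j)).
apply: (H10_test_eq0 (l := fun w => ip (pd j w) (pd i f) - ip (pd i w) (pd j f))
    (M := 2 * ip (pd i f) (pd i f) + 2 * ip (pd j f) (pd j f)) hl) => //.
  by move=> w Ww; exact: sqrB_bound (pd_bound j (Lfi i) Ww) (pd_bound i (Lfi j) Ww).
move=> phi tp.
have e k l : ip (pd k phi) (pd l f) = - \int[mu]_(x in Omega) (f x * D l (D k phi) x).
  have [_ _ h] := (Wf.2 l).1; have tD := test_partial k tp.
  rewrite (h _ tD) opprK (swap _ _ ((test_W12 oO bO tp).2 k).2 (Lfi l)).
  by apply: (ip2_ae mO) => //; [exact: ((test_W12 oO bO tp).2 k).2|exact: (test_L2 oO tD)|exact: ae_eq_refl|exact: pd_test].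
have pc x : D i (D j phi) x = D j (D i phi) x := congr1 (fun h => h x) (partialC i j tp.1).
apply: (eq_trans (congr2 (fun a b => a - b) (e j i) (e i j))).
apply/eqP; rewrite subr_eq0; apply/eqP; apply: (congr1 (fun t => - t)).
by apply: eq_Rintegral => x _; exact: (congr1 (fun t => f x * t) (pc x)).
Qed.

End H10_identities.

(** * The inf-sup condition and the pressure *)

Lemma ae_finall {dT : measure_display} {T : measurableType dT} {R : realType}
    (mu : {measure set T -> \bar R}) (I : finType) (P : I -> T -> Prop) :
  (forall i, {ae mu, forall x, P i x}) -> {ae mu, forall x, forall i, P i x}.
Proof. by move=> h; exact: filter_forall. Qed.

Section divergence.
Context {R : realType} {d : nat}.
Local Notation pt := 'rV[R]_d.
Local Notation mu := (lebesgue_row R d).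
Local Notation D i f := ('D_(@unit_vec R d i) f).
Context (Omega : set pt).
Hypotheses (d0 : (0 < d)%N) (oO : open Omega) (bO : bounded_set Omega).
Implicit Types (f g phi q : pt -> R) (u v w : pt -> pt) (i j : 'I_d).
Let mO := open_measurable_row oO.
Let fO := bounded_row_lty mO bO.
Local Notation L2 := (L2 mu Omega).
Local Notation ip := (ip2 mu Omega).
Local Notation pd := (pd Omega).
Local Notation test := (test_function Omega).
Local Notation H10 := (in_H10 Omega).
Local Notation V := (V_space Omega).
Local Notation div := (divg Omega).
Local Notation vgip := (@vec_ip R pt (gip Omega) d).
Let HL := L2_semi_ip mu mO.

Lemma H10_gip : semi_ip H10 (gip Omega).
Proof.
by apply: (semi_ip_sub (gip_semi_ip oO bO) (H10_subspace oO bO)) => f; exact: H10_W12.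
Qed.

Lemma V_semi_ip : semi_ip V vgip.
Proof. exact: (vec_semi_ip d H10_gip). Qed.

Lemma V_complete : complete_ip V vgip.
Proof. exact: (@vec_complete _ _ _ _ d H10_gip (H10_complete oO bO d0)). Qed.

Lemma V_pd_L2 v i j : V v -> L2 (pd i (coordf v j)).
Proof. by move=> Vv; exact: ((H10_W12 oO (Vv j)).2 i).2. Qed.

Lemma divgE v x : div v x = \sum_i pd i (coordf v i) x.
Proof. by rewrite /divg /mxtrace; apply: eq_bigr => i _; rewrite mxE. Qed.

Lemma div_L2 v : V v -> L2 (div v).
Proof.
move=> Vv; rewrite (_ : div v = fun x => \sum_i pd i (coordf v i) x); last first.
  by apply/funext => x; exact: divgE.
by apply: L2_sum => // i; exact: V_pd_L2.
Qed.

Lemma jac_lin a u v : V u -> V v ->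
  {ae mu, forall x, Omega x -> jac Omega (a *: u + v) x = a *: jac Omega u x + jac Omega v x}.
Proof.
move=> Vu Vv.
have h (p : 'I_d * 'I_d) : {ae mu, forall x, Omega x ->
    pd p.1 (coordf (a *: u + v) p.2) x = a * pd p.1 (coordf u p.2) x + pd p.1 (coordf v p.2) x}.
  have := pd_lin oO p.1 a (H10_W12 oO (Vu p.2)) (H10_W12 oO (Vv p.2)).
  by rewrite (_ : coordf (a *: u + v) p.2 = a *: coordf u p.2 + coordf v p.2)//; exact: coord_lin.
have := ae_finall h; apply: filterS => x hx Ox.
by apply/matrixP => i j; rewrite !mxE; exact: hx (i, j) Ox.
Qed.

Lemma div_lin a u v : V u -> V v -> ae_eq mu Omega (div (a *: u + v)) (a *: div u + div v).
Proof.
move=> Vu Vv; apply: filterS (jac_lin a Vu Vv) => x hx Ox.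
by rewrite /divg hx// mxtraceD mxtraceZ.
Qed.

Let VS := sip_sub V_semi_ip.

Lemma ip_div_lin q : L2 q -> lin_on V (fun v => ip q (div v)).
Proof.
move=> Lq a u v Vu Vv; have Vuv := subDZ VS a Vu Vv.
have Ld := subDZ (sip_sub HL) a (div_L2 Vu) (div_L2 Vv).
rewrite -(ip_linr HL Lq a (div_L2 Vu) (div_L2 Vv)).
apply: (ip2_ae mO) => //; [exact: div_L2|exact: ae_eq_refl|exact: div_lin].
Qed.

Lemma div_bound v : V v -> ip (div v) (div v) <= d%:R * vgip v v.
Proof.
move=> Vv; have Lp i j := V_pd_L2 i j Vv.
have [_ Id] := div_L2 Vv.
have Ip i : intg mu Omega (fun x => pd i (coordf v i) x ^+ 2) by case: (Lp i i).
rewrite ip2_sqr; apply: (@le_trans _ _ (\int[mu]_(x in Omega) (d%:R * \sum_i pd i (coordf v i) x ^+ 2))).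
  apply: le_Rint => //; first by apply: (intgZ mO); exact: intg_sum.
  move=> x _; rewrite divgE; have := sum_CS (fun=> 1) (fun i => pd i (coordf v i) x).
  rewrite (eq_bigr (fun i => pd i (coordf v i) x)) => [|i _]; last by rewrite mul1r.
  by rewrite expr1n sumr_const card_ord.
rewrite RintZ//; last exact: intg_sum.
rewrite ler_wpM2l// Rint_sum//; apply: ler_sum => i _; rewrite -ip2_sqr.
exact: (pd_ip_le_gip oO bO i (H10_W12 oO (Vv i))).
Qed.

Lemma ip_div_bound q v : L2 q -> V v -> ip q (div v) ^+ 2 <= (ip q q * d%:R) * vgip v v.
Proof.
move=> Lq Vv; apply: le_trans (ip_CS HL Lq (div_L2 Vv)) _.
by rewrite -mulrA ler_wpM2l ?div_bound// (sip_ge0 HL).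
Qed.

Lemma div_int v : V v -> \int[mu]_(x in Omega) div v x = 0.
Proof.
move=> Vv; have Ip i : intg mu Omega (pd i (coordf v i)) by exact: L2_intg (V_pd_L2 i i Vv).
rewrite (_ : div v = fun x => \sum_i pd i (coordf v i) x); last by apply/funext => x; exact: divgE.
by rewrite Rint_sum// big1// => i _; exact: (H10_pd_int oO bO i (Vv i)).
Qed.

Definition vec_of (F : 'I_d -> pt -> R) : pt -> pt := fun x => \row_j F j x.

Lemma coordf_vec_of F j : coordf (vec_of F) j = F j.
Proof. by apply/funext => x; rewrite /coordf mxE. Qed.

Lemma test_V F : (forall j, test (F j)) -> V (vec_of F).
Proof. by move=> tF j; rewrite coordf_vec_of; exact: test_H10. Qed.

Lemma div_vec_of F : (forall j, test (F j)) ->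
  ae_eq mu Omega (div (vec_of F)) (fun x => \sum_j D j (F j) x).
Proof.
move=> tF.
have h j : {ae mu, forall x, Omega x -> pd j (F j) x = D j (F j) x} by exact: pd_test.
have := ae_finall h; apply: filterS => x hx Ox; rewrite divgE.
by apply: eq_bigr => j _; rewrite coordf_vec_of hx.
Qed.

Lemma test_pd_ip i phi g : test phi -> L2 g -> ip g (pd i phi) = ip g (D i phi).
Proof.
move=> tp Lg; have tD := test_partial i tp.
apply: (ip2_ae mO) => //; [exact: ((test_W12 oO bO tp).2 i).2|exact: test_L2|exact: ae_eq_refl|exact: pd_test].
Qed.

Lemma vgip_vec_of F : (forall j, test (F j)) ->
  vgip (vec_of F) (vec_of F) = \sum_j \sum_i \int[mu]_x (D i (F j) x ^+ 2).
Proof.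
move=> tF; apply: eq_bigr => j _; apply: eq_bigr => i _.
have tD := test_partial i (tF j).
have e : (fun x => vec_of F x 0 j) = F j := coordf_vec_of F j.
rewrite e (test_pd_ip i (tF j)); last exact: ((test_W12 oO bO (tF j)).2 i).2.
rewrite (sip_sym HL); [|exact: ((test_W12 oO bO (tF j)).2 i).2|exact: test_L2].
rewrite (test_pd_ip i (tF j)) ?ip2_sqr; last exact: test_L2.
rewrite -(Rint_test_setT (Omega := Omega))//.
have -> : (fun x => D i (F j) x ^+ 2) = fun x => D i (F j) x * D i (F j) x by apply/funext => x; rewrite expr2.
exact: (testM tD.1 tD).
Qed.

Lemma ip_div_vec_of q F : L2 q -> (forall j, test (F j)) ->
  ip q (div (vec_of F)) = ip q (fun x => \sum_j D j (F j) x).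
Proof.
move=> Lq tF; apply: (ip2_ae mO) => //.
- exact: div_L2 (test_V tF).
- by apply: test_L2 => //; apply: test_sum => j; exact: test_partial.
- exact: ae_eq_refl.
- exact: div_vec_of.
Qed.

(** Harmonicity: the equation for [w] tested with the gradient of [phi] reads
    [(q, lap phi) = (div w, lap phi)] once derivatives are exchanged. Dual bound:
    [(q - div w, div F)] is [(grad w, grad F) - (div w, div F)], and two bounds
    [|div v|^2 <= d |grad v|^2] give the factor [d ^ 2]. *)
Lemma dirichlet_dual_bounded q w : L2 q -> V w ->
  (forall v, V v -> vgip w v = ip q (div v)) ->
  dual_bounded Omega (q - div w) ((2 + 2 * d%:R ^+ 2) * vgip w w).
Proof.
move=> Lq Vw hw; have Lw := div_L2 Vw; have w0 := sip_ge0 V_semi_ip Vw.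
have Lh : L2 (q - div w) by exact: (L2B mO).
split=> //.
- by rewrite mulr_ge0// addr_ge0// mulr_ge0// sqr_ge0.
- move=> phi tp; have tF j : test (D j phi) by exact: test_partial.
  have Ll : L2 (lap phi) by apply: test_L2 => //; apply: test_sum => j; exact: test_partial.
  rewrite (linB (sip_sub HL) (ip_linl HL Ll) Lq Lw).
  rewrite -[ip q _](ip_div_vec_of Lq tF) -hw; last exact: test_V.
  apply/eqP; rewrite subr_eq0; apply/eqP.
  have Ww j := H10_W12 oO (Vw j).
  transitivity (\sum_j \sum_i ip (pd i (coordf w i)) (D j (D j phi))).
    rewrite exchange_big/=; apply: eq_bigr => j _; apply: eq_bigr => i _.
    have e : (fun x => vec_of (fun j => D j phi) x 0 j) = D j phi := coordf_vec_of _ j.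
    (* The chain replaces [D i (D j phi)] by [D j (D i phi)] and then, by [H10_pdC] for [w] and
       [D i phi], exchanges the derivatives between the two factors, so that only the diagonal entry
       [pd j] of component [j] of [w] remains. *)
    have st1 := test_pd_ip i (tF j) (V_pd_L2 i j Vw).
    have sp : D i (D j phi) = D j (D i phi) := partialC i j tp.1.
    have st2 := test_pd_ip j (tF i) (V_pd_L2 i j Vw).
    have st3 := H10_pdC oO bO i j (Vw j) (test_H10 oO bO (tF i)).
    have st4 := test_pd_ip i (tF i) (V_pd_L2 j j Vw).
    by rewrite e; exact: (eq_trans st1 (eq_trans (congr1 (ip _) sp) (eq_trans (esym st2) (eq_trans st3 st4)))).
  have I2 i j : intg mu Omega (fun x => pd i (coordf w i) x * D j (D j phi) x).
    by apply: (L2_mul mO); [exact: V_pd_L2|apply: test_L2 => //; exact: test_partial].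
  transitivity (\int[mu]_(x in Omega) \sum_j \sum_i (pd i (coordf w i) x * D j (D j phi) x)).
    rewrite [RHS](Rint_sum mO); last by move=> j; exact: intg_sum.
    by apply: eq_bigr => j _; rewrite [RHS](Rint_sum mO).
  apply: eq_Rintegral => x _; rewrite divgE /lap mulr_sumr; apply: eq_bigr => j _.
  by rewrite mulr_suml.
- move=> F tF; have Ldiv : L2 (fun x => \sum_j D j (F j) x).
    by apply: test_L2 => //; apply: test_sum => j; exact: test_partial.
  have VF := test_V tF.
  rewrite -(ip_div_vec_of Lh tF) (linB (sip_sub HL) (ip_linl HL (div_L2 VF)) Lq Lw) -(hw _ VF).
  rewrite -(vgip_vec_of tF).
  have h1 := ip_CS V_semi_ip Vw VF; have h2 := ip_div_bound Lw VF.
  have h3 : ip (div w) (div (vec_of F)) ^+ 2 <= (d%:R ^+ 2 * vgip w w) * vgip (vec_of F) (vec_of F).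
    apply: (le_trans h2); apply: (ler_wpM2r (sip_ge0 V_semi_ip VF)).
    rewrite mulrC expr2 -mulrA; apply: (ler_wpM2l (ler0n _ d)); exact: div_bound.
  apply: (le_trans (sqrB_bound h1 h3)).
  by rewrite [(2 + _) * _]mulrDl -[2 * d%:R ^+ 2 * _]mulrA.
Qed.

Hypotheses (cO : connected Omega) (nO : Omega !=set0) (lO : lipschitz_boundary Omega).

(** Here [w] represents [v |-> (q, div v)], so [|grad w|] is the dual norm of the gradient of [q],
    and the bound is the inf-sup condition. It follows from the splitting [q = (q - div w) + div w],
    whose first part still has mean zero. *)
Lemma necas : exists2 K : R, 0 < K & forall q w, L2 q -> \int[mu]_(x in Omega) q x = 0 -> V w ->
  (forall v, V v -> vgip w v = ip q (div v)) -> ip q q <= K * vgip w w.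
Proof.
have [K K0 hK] := dual_bounded_mean_zero oO bO cO nO lO.
exists (2 * K * (2 + 2 * d%:R ^+ 2) + 2 * d%:R) => [|q w Lq q0 Vw hw].
  by rewrite ltr_wpDr ?mulr_ge0// !mulr_gt0// ltr_wpDr// mulr_ge0// sqr_ge0.
have hC := dirichlet_dual_bounded Lq Vw hw; have Lw := div_L2 Vw.
set C := _ * vgip w w in hC.
have h0 : \int[mu]_(x in Omega) (q - div w) x = 0.
  by rewrite (RintB mO (L2_intg mO fO Lq) (L2_intg mO fO Lw)) q0 div_int// subrr.
have Lh := db_L2 hC.
have hh : ip (q - div w) (q - div w) <= K * C.
  suff hh (e : R) : 0 < e -> ip (q - div w) (q - div w) <= K * C + e.
    by apply/ler_addgt0Pr => e; exact: hh.
  (* The constant [C] vanishes when [w] is null, whereas the estimate asks for a positive one; it is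
     enlarged by an arbitrarily small amount. *)
  move=> e0; have eK : 0 < e / K by rewrite divr_gt0.
  have C1 : C <= C + e / K by rewrite lerDl ltW.
  have C2 : 0 < C + e / K by rewrite ltr_wpDl// (db_ge0 hC).
  have := hK _ _ (dual_bounded_le C1 hC) C2 h0.
  by have -> : K * (C + e / K) = K * C + e by field; rewrite gt_eqF.
have -> : q = (q - div w) + div w by rewrite subrK.
apply: (le_trans (ip_le_sqrD HL Lh Lw)).
have := div_bound Vw; have -> : (2 * K * (2 + 2 * d%:R ^+ 2) + 2 * d%:R) * vgip w w =
  2 * (K * C) + 2 * (d%:R * vgip w w) by rewrite /C; ring.
by move=> h; apply: lerD; rewrite ler_pM2l.
Qed.

Definition mean_zero q := L2 q /\ \int[mu]_(x in Omega) q x = 0.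

Lemma mean_zero_semi_ip : semi_ip mean_zero ip.
Proof.
apply: (semi_ip_sub HL) => [|f []//]; split.
  by split; [exact: sub0 (sip_sub HL)|exact: Rint0].
move=> a f g [Lf f0] [Lg g0]; split; first exact: subDZ (sip_sub HL) _ _ _ _ _.
have If := L2_intg mO fO Lf; have Ig := L2_intg mO fO Lg.
by rewrite (RintD mO (intgZ mO a If) Ig) (RintZ mO _ If) f0 g0 mulr0 addr0.
Qed.

Lemma mean_zero_complete : complete_ip mean_zero ip.
Proof.
move=> u_ Su Cu; have [l Ll ul] := @L2_complete _ _ _ mu _ mO u_ (fun n => (Su n).1) Cu.
exists l => //; split=> //.
have L1 := L2_cst mO (1 : R) fO.
have e g : \int[mu]_(x in Omega) g x = ip g (fun=> 1).
  by apply: eq_Rintegral => x _; rewrite mulr1.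
have hM f : L2 f -> ip f (fun=> 1) ^+ 2 <= ip (fun=> 1) (fun=> 1) * ip f f.
  by move=> Lf; rewrite mulrC; exact: (ip_CS HL Lf L1).
apply/eqP; rewrite -normr_le0.
suff hh (ep : R) : 0 < ep -> `|\int[mu]_(x in Omega) l x| <= 0 + ep.
  by apply/ler_addgt0Pr => ep; exact: hh.
move=> ep0; have [N HN] := cvg_ip_lin HL (ip_linl HL L1) (sip_ge0 HL L1) hM (fun n => (Su n).1) Ll ul ep0.
by have := HN N (leqnn _); rewrite -!e (Su N).2 !add0r normrN => /ltW.
Qed.

(** Replaces the almost everywhere constraint by the vanishing of a seminorm, a form that suits
    orthogonality and limit arguments. *)
Lemma V0_div0 v : V v -> V0_space Omega v <-> ip (div v) (div v) = 0.
Proof.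
move=> Vv; have Lv := div_L2 Vv; split=> [[_ h]|h]; last first.
  by split=> //; exact: (ip2_eq0_ae mO Lv h).
have L0 := sub0 (sip_sub HL).
by rewrite (ip2_ae mO Lv Lv L0 Lv h (ae_eq_refl _ _ _)) (lin0 (sip_sub HL) (ip_linl HL Lv)).
Qed.

(** The map [T] sends [q] to the representative of [v |-> (q, div v)] and is bounded below by the
    inf-sup condition; [p] is the least squares solution of [T p = z], where [z] represents [l]. The
    residual [y] is orthogonal to the range of [T], that is, divergence-free; hence [l y = 0] and
    [|y|^2 = (p, div y) - l y = 0]. *)
Lemma pressure (l : (pt -> pt) -> R) (N : R) : lin_on V l ->
  (forall v, V v -> l v ^+ 2 <= N * vgip v v) -> (forall v, V0_space Omega v -> l v = 0) ->
  exists2 p, mean_zero p & forall v, V v -> ip p (div v) = l v.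
Proof.
move=> ll lN l0; have HV := V_semi_ip.
have [z Vz hz] := riesz HV V_complete ll lN.
have [T hT] : {T : (pt -> R) -> pt -> pt &
    forall q, L2 q -> V (T q) /\ forall v, V v -> vgip (T q) v = ip q (div v)}.
  apply: (@choice _ _ (fun q w => L2 q -> V w /\ forall v, V v -> vgip w v = ip q (div v))) => q.
  have [Lq|nL] := pselect (L2 q); last by exists 0.
  have [w Vw hw] := riesz HV V_complete (ip_div_lin Lq) (fun v Vv => ip_div_bound Lq Vv).
  by exists w.
have [K K0 hK] := necas.
have TS q : mean_zero q -> V (T q) by move=> [Lq _]; exact: (hT q Lq).1.
have Tlin (a : R) (u v : pt -> R) (w : pt -> pt) : mean_zero u -> mean_zero v -> V w ->
    vgip (T (a *: u + v)) w = a * vgip (T u) w + vgip (T v) w.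
  move=> [Lu _] [Lv _] Vw; rewrite (hT _ (subDZ (sip_sub HL) a Lu Lv)).2// (hT _ Lu).2// (hT _ Lv).2//.
  exact: (sip_lin HL a Lu Lv (div_L2 Vw)).
have [|||p [Lp p0] hp] := least_squares mean_zero_semi_ip HV TS Tlin (M := d%:R) (c := K^-1) mean_zero_complete _ Vz.
- by rewrite invr_gt0.
- move=> q [Lq _]; have [VT hq] := hT q Lq; set t := vgip _ _.
  have t0 : 0 <= t := sip_ge0 HV VT.
  have : t ^+ 2 <= ip q q * d%:R * t by rewrite {1}/t hq//; exact: ip_div_bound.
  have [->|tn] := eqVneq t 0; first by rewrite mulr_ge0 ?(sip_ge0 HL).
  have tp : 0 < t by rewrite lt_neqAle eq_sym tn.
  by rewrite expr2 ler_pM2r// mulrC.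
- move=> q [Lq q0]; have [VT hq] := hT q Lq.
  by rewrite mulrC ler_pdivrMr// mulrC; exact: hK.
have [VTp hTp] := hT p Lp; pose y := T p - z.
have Vy : V y by exact: (subB VS VTp Vz).
have Qy : mean_zero (div y) by split; [exact: div_L2|exact: div_int].
have [VTy hTy] := hT _ Qy.1.
have dy : ip (div y) (div y) = 0.
  rewrite -hTy// (sip_sym HV VTy Vy) (linB VS (ip_linl HV VTy) VTp Vz).
  by rewrite (hp _ Qy) subrr.
have ly : l y = 0 by apply: l0; exact/(V0_div0 Vy).
have py : vgip (T p) y = 0.
  rewrite hTp// (sip_sym HL Lp Qy.1).
  exact: (ip0_eq0 HL Qy.1 Lp dy).
have y0 : vgip y y = 0.
  by rewrite {1}/y (linB VS (ip_linl HV Vy) VTp Vz) py hz// ly subrr.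
exists p; first by split.
move=> v Vv.
have e3 := linB VS (ip_linl HV Vv) VTp Vz; have e4 := ip0_eq0 HV Vy Vv y0.
exact: (eq_trans (esym (hTp v Vv)) (eq_trans (subr0_eq (eq_trans (esym e3) e4)) (hz v Vv))).
Qed.

End divergence.

(** * The Ladyzhenskaya inequality *)

Section ladyzhenskaya.
Context {R : realType}.
Let leb : {measure set (measurableTypeR R) -> \bar R} := lebesgue_measure.
Local Notation mu n := (lebesgue_row R n).

Lemma row_snoc_max n (p : 'rV[R]_n) (t s : R) :
  row_snoc (p, t) + s *: unit_vec R ord_max = row_snoc (p, t + s).
Proof.
apply/rowP => k; rewrite !mxE; have [j ->|->] := unliftP ord_max k; rewrite /= ?eqxx.
  by rewrite eq_sym (negbTE (neq_lift _ _)) mulr0 addr0.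
by rewrite mulr1.
Qed.

Lemma row_snoc_lift n (p : 'rV[R]_n) (t s : R) (j : 'I_n) :
  row_snoc (p, t) + s *: unit_vec R (lift ord_max j) = row_snoc (p + s *: unit_vec R j, t).
Proof.
apply/rowP => k; rewrite !mxE; have [l ->|->] := unliftP ord_max k; rewrite /= ?eqxx.
  by rewrite !mxE/= (inj_eq (@lift_inj _ ord_max)).
by rewrite (negbTE (neq_lift _ _)) mulr0 addr0.
Qed.

(** The fundamental theorem of calculus for [phi ^+ 2] along a coordinate line, starting from a
    point outside the support; the integral is then extended to the whole line. *)
Lemma line_sqr_bound n (phi : 'rV[R]_n -> R) (i : 'I_n) (x : 'rV[R]_n) :
  test_function setT phi ->
  (((phi x) ^+ 2)%:E <= \int[leb]_s (2 * `|phi (x + s *: unit_vec R i)| *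
     `|'D_(unit_vec R i) phi (x + s *: unit_vec R i)|)%:E)%E.
Proof.
move=> tp; have sp := tp.1; have [_ [K [cK _ p0]]] := tp.
have [r r0 Kr] := compact_row_ball cK.
(* At parameter [a] the coordinate [i] is at most [- r], so the point has left the support of
   [phi]. *)
set e := unit_vec R i; pose a := - (`|x| + r).
have a0 : a < 0 by rewrite oppr_lt0 ltr_wpDl.
pose F (s : R) : R := phi (x + s *: e) ^+ 2.
pose g (s : R) : R := 2 * phi (x + s *: e) * 'D_e phi (x + s *: e).
have line_cont (h : 'rV[R]_n -> R) : continuous h -> continuous (fun s : R => h (x + s *: e)).
  move=> ch t; apply: continuous_comp; last exact: ch.
  by apply: continuousD; [exact: cst_continuous|exact: scalel_continuous].
have Fd t : is_derive t (1 : R) F (g t).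
  have h := is_derive_line x e t sp.
  have := is_deriveM h h; rewrite (_ : F = (fun s => phi (x + s *: e)) * (fun s => phi (x + s *: e))).
    move=> h2; apply: (is_derive_eq h2); rewrite /g /GRing.scale/=; ring.
  by apply/funext => s; rewrite /F expr2.
have cphi := smooth_continuous sp; have cD := smooth_continuous (smooth_partial i sp).
have cF : continuous F by apply: (line_cont (fun y => phi y ^+ 2)); apply: smooth_continuous; smooth_auto.
have cg : continuous g.
  by apply: (line_cont (fun y => 2 * phi y * 'D_e phi y)); apply: smooth_continuous; smooth_auto.
have Fa : F a = 0.
  rewrite /F p0 ?expr0n// => /Kr; rewrite -ball_normE /ball_/= sub0r normrN => h.
  have := le_lt_trans (row_norm_coord (x + a *: e) i) h.
  rewrite /e !mxE !eqxx/= mulr1; have := row_norm_coord x i.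
  by rewrite ler_norml ltr_norml /a => /andP[_ h1] /andP[h2 _]; lra.
have ftc : (\int[leb]_(s in `[a, 0%R]) (g s)%:E = (F 0 - F a)%:E)%E.
  rewrite (continuous_FTC2 (F := F) a0) ?EFinB//.
  - exact: continuous_subspaceT.
  - split; [by move=> t _; exact: ex_derive| |].
    + by apply: cvg_at_right_filter; exact: cF.
    + by apply: cvg_at_left_filter; exact: cF.
  - by move=> t _; rewrite derive1E; apply: derive_val.
have Fx : F 0 = phi x ^+ 2 by rewrite /F scale0r addr0.
rewrite Fa subr0 Fx in ftc; rewrite -ftc.
have mg : measurable_fun (setT : set (measurableTypeR R)) g by exact: continuous_measurable_fun.
have mgI : measurable_fun (`[a, 0%R] : set (measurableTypeR R)) (EFin \o g).
  by apply/measurable_EFinP; exact: measurable_funTS.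
apply: (@le_trans _ _ (\int[leb]_(s in `[a, 0%R]) `|(g s)%:E|)%E).
  apply: le_trans (lee_abs _) _; exact: le_abse_integral.
have -> : (\int[leb]_s (2 * `|phi (x + s *: e)| * `|'D_e phi (x + s *: e)|)%:E =
  \int[leb]_s `|(g s)%:E|)%E.
  by apply: eq_integral => s _; rewrite /= /g !normrM normr_nat.
apply: ge0_subset_integral => //.
by apply: measurableT_comp => //; exact/measurable_EFinP.
Qed.

Lemma row1_integral (g : 'rV[R]_1 -> \bar R) : measurable_fun setT g -> (forall x, (0 <= g x)%E) ->
  forall p : 'rV[R]_1, (\int[leb]_s g (p + s *: unit_vec R ord0)%R = \int[mu 1]_x g x)%E.
Proof.
move=> mg g0 p.
have [_ ->] := integral_row_step mg g0.
have -> : (\int[mu 0]_q (\int[leb]_t g (row_snoc (q, t))) = \int[leb]_t g (row_snoc (0%R, t)))%E.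
  rewrite (eq_integral (fun=> (\int[leb]_t g (row_snoc (0%R, t)))%E)); last by move=> q _; rewrite (thinmx0 q).
  by rewrite integral_cst// (_ : mu 0 setT = 1%E) ?mule1//; exact: diracT.
have e s : p + s *: unit_vec R ord0 = row_snoc (0 : 'rV[R]_0, s + p 0 0).
  apply/rowP => k; rewrite !mxE ord1; have [[]//|/= _] := unliftP ord_max 0.
  by rewrite mulr1 addrC.
under eq_integral do rewrite e.
rewrite -(ge0_integral_shift1 (p 0 0) (f := fun s => g (row_snoc (0 : 'rV[R]_0, s))))//.
exact: measurableT_comp mg (measurable_row_snocr _).
Qed.

(* In [F ^ 2], bound one factor by an integral over the first variable and the
   other by an integral over the second. *)
Lemma plane_product (F G0 G1 : 'rV[R]_2 -> R) :
  measurable_fun setT F -> measurable_fun setT G0 -> measurable_fun setT G1 ->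
  (forall x, 0 <= F x) -> (forall x, 0 <= G0 x) -> (forall x, 0 <= G1 x) ->
  (forall x, ((F x)%:E <= \int[leb]_s (G0 (x + s *: unit_vec R (lift ord_max ord0)))%:E)%E) ->
  (forall x, ((F x)%:E <= \int[leb]_s (G1 (x + s *: unit_vec R ord_max))%:E)%E) ->
  (\int[mu 2]_x ((F x) ^+ 2)%:E <= (\int[mu 2]_x (G0 x)%:E) * \int[mu 2]_x (G1 x)%:E)%E.
Proof.
move=> mF m0 m1 F0 G00 G10 h0 h1.
have mE (g : 'rV[R]_2 -> R) : measurable_fun setT g -> measurable_fun setT (fun x => (g x)%:E).
  by move=> mg; exact/measurable_EFinP.
pose A (p : 'rV[R]_1) := (\int[leb]_s (G1 (row_snoc (p, s)))%:E)%E.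
pose B (t : R) := (\int[mu 1]_p (G0 (row_snoc (p, t)))%:E)%E.
have A0 p : (0 <= A p)%E by apply: integral_ge0 => s _; rewrite lee_fin.
have B0 t : (0 <= B t)%E by apply: integral_ge0 => s _; rewrite lee_fin.
have FA p t : ((F (row_snoc (p, t)))%:E <= A p)%E.
  apply: le_trans (h1 _) _; rewrite /A.
  under eq_integral do rewrite row_snoc_max addrC.
  rewrite (ge0_integral_shift1 t (f := fun s => (G1 (row_snoc (p, s)))%:E))//.
    exact: measurableT_comp (mE _ m1) (measurable_row_snocr _).
  by move=> s; rewrite lee_fin.
have msl (c : R) : measurable_fun setT (fun p : 'rV[R]_1 => row_snoc (p, c)).
  by apply: (measurableT_comp (@measurable_row_snoc R 1)); exact: measurable_pair2.
have FB p t : ((F (row_snoc (p, t)))%:E <= B t)%E.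
  apply: le_trans (h0 _) _; under eq_integral do rewrite row_snoc_lift.
  rewrite (row1_integral (g := fun p => (G0 (row_snoc (p, t)))%:E))//; last by move=> q; rewrite lee_fin.
  exact: measurableT_comp (mE _ m0) (msl t).
have nE (T : Type) (g : T -> R) : (forall x, 0 <= g x) -> forall x, (0 <= (g x)%:E)%E.
  by move=> g0 x; rewrite lee_fin.
have [mA eA] := integral_row_step (mE _ m1) (nE _ _ G10).
have m0' : measurable_fun setT (fun p : 'rV[R]_1 * measurableTypeR R => (G0 (row_snoc p))%:E).
  exact: measurableT_comp (mE _ m0) (@measurable_row_snoc R 1).
have [_ mB e1 e2] := tonelli_sf (@lebesgue_row_sigma_finite R 1) m0' (nE _ _ (fun p => G00 (row_snoc p))).
have eB : (\int[mu 2]_x (G0 x)%:E = \int[leb]_t B t)%E.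
  have [_ ->] := integral_row_step (mE _ m0) (nE _ _ G00).
  by rewrite -e1 e2.
have [mF2 ->] := integral_row_step (mE _ (measurable_funX 2 mF)) (nE _ _ (fun x => sqr_ge0 (F x))).
apply: (@le_trans _ _ (\int[mu 1]_p (A p * \int[leb]_t B t))%E).
  apply: ge0_le_integral => //.
  - by move=> p _; apply: integral_ge0 => t _; rewrite lee_fin sqr_ge0.
  - exact: emeasurable_funM.
  move=> p _; rewrite -(ge0_integralZl leb measurableT mB (fun t _ => B0 t) (A0 p)).
  apply: ge0_le_integral => //.
  - by move=> t _; rewrite lee_fin sqr_ge0.
  - exact: measurableT_comp (mE _ (measurable_funX 2 mF)) (measurable_row_snocr _).
  - exact: emeasurable_funM.
  by move=> t _; rewrite expr2 EFinM; apply: lee_pmul; rewrite ?lee_fin.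
rewrite ge0_integralZr//; last by apply: integral_ge0.
by rewrite muleC eB -eA.
Qed.

End ladyzhenskaya.

Section bounded_support.
Context {R : realType}.
Let leb : {measure set (measurableTypeR R) -> \bar R} := lebesgue_measure.
Local Notation mu n := (lebesgue_row R n).

(** A class that makes all integrals below finite and, besides products and absolute values, is
    stable under fixing the last coordinate. *)
Definition bsupp n (f : 'rV[R]_n -> R) := measurable_fun setT f /\
  exists M r : R, (forall x, `|f x| <= M) /\ (forall x, ~ ball (0 : 'rV[R]_n) r x -> f x = 0).

Lemma bsupp_intg n (f : 'rV[R]_n -> R) : bsupp f -> intg (mu n) setT f.
Proof. by move=> [mf [M [r [h1 h2]]]]; exact: intg_bounded_supp mf h1 h2. Qed.

Lemma bsupp_EFin n (f : 'rV[R]_n -> R) : bsupp f ->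
  (\int[mu n]_x f x)%:E = (\int[mu n]_x (f x)%:E)%E.
Proof. by move=> bf; apply: EFin_Rint; [exact: measurableT|exact: bsupp_intg]. Qed.

Lemma bsuppM n (f g : 'rV[R]_n -> R) : bsupp f -> bsupp g -> bsupp (fun x => f x * g x).
Proof.
move=> [mf [M [r [h1 h2]]]] [mg [M' [r' [k1 k2]]]]; split; first exact: measurable_funM.
exists (M * M'), r; split=> [x|x /h2 ->]; last by rewrite mul0r.
by rewrite normrM; apply: ler_pM.
Qed.

Lemma bsuppX n (f : 'rV[R]_n -> R) k : bsupp f -> bsupp (fun x => f x ^+ k.+1).
Proof.
move=> bf; elim: k => [|k IH]; first by rewrite (_ : (fun _ => _) = f)//; apply/funext => x; rewrite expr1.
rewrite (_ : (fun _ => _) = (fun x => f x * f x ^+ k.+1)); last by apply/funext => x; rewrite exprS.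
exact: bsuppM.
Qed.

Lemma bsuppZ n (c : R) (f : 'rV[R]_n -> R) : bsupp f -> bsupp (fun x => c * f x).
Proof.
move=> [mf [M [r [h1 h2]]]]; split; first by apply: measurable_funM => //; exact: measurable_cst.
exists (`|c| * M), r; split=> [x|x /h2 ->]; last by rewrite mulr0.
by rewrite normrM ler_wpM2l.
Qed.

Lemma bsupp_norm n (f : 'rV[R]_n -> R) : bsupp f -> bsupp (fun x => `|f x|).
Proof.
move=> [mf [M [r [h1 h2]]]]; split; first exact: measurableT_comp.
by exists M, r; split=> [x|x /h2 ->]; rewrite ?normr_id ?normr0.
Qed.

Lemma bsupp_test n (phi : 'rV[R]_n -> R) : test_function setT phi -> bsupp phi.
Proof.
move=> tp; split; first exact: smooth_measurable tp.1.
have [M _ hM] := test_bounded tp; have [_ [K [cK _ p0]]] := tp.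
have [r r0 Kr] := compact_row_ball cK.
by exists M, r; split=> // x h; apply: p0 => /Kr.
Qed.

Lemma bsupp_slice n (f : 'rV[R]_n.+1 -> R) (t : R) : bsupp f -> bsupp (fun p => f (row_snoc (p, t))).
Proof.
move=> [mf [M [r [h1 h2]]]]; split.
  apply: measurableT_comp => //; apply: (measurableT_comp (@measurable_row_snoc R n)).
  exact: measurable_pair2.
exists M, r; split=> [p|p hp]; first exact: h1.
apply: h2 => hx; apply: hp; move: hx; rewrite -!ball_normE /ball_/= !sub0r !normrN => hx.
apply: le_lt_trans hx; apply: row_norm_le => // i.
have := row_norm_coord (row_snoc (p, t)) (lift ord_max i).
by rewrite mxE liftK.
Qed.

Lemma bsupp_L2 n (f : 'rV[R]_n -> R) : bsupp f -> L2 (mu n) setT f.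
Proof. by move=> bf; split; [exact: bf.1|exact: bsupp_intg (bsuppX 1 bf)]. Qed.

(** The trace of [g] being the partial derivative of [f] in direction [i]; in this form the relation
    restricts to slices. *)
Definition line_dominated n (f : 'rV[R]_n -> R) (i : 'I_n) (g : 'rV[R]_n -> R) := forall x,
  (((f x) ^+ 2)%:E <= \int[leb]_s (2 * `|f (x + s *: unit_vec R i)| *
     `|g (x + s *: unit_vec R i)|)%:E)%E.

Let G n (f g : 'rV[R]_n -> R) x := 2 * `|f x| * `|g x|.

Let bsuppG n (f g : 'rV[R]_n -> R) : bsupp f -> bsupp g -> bsupp (G f g).
Proof. by move=> bf bg; apply: bsuppM; [apply: bsuppZ|]; exact: bsupp_norm. Qed.

Let G0 n (f g : 'rV[R]_n -> R) x : 0 <= G f g x.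
Proof. by rewrite !mulr_ge0. Qed.

(** The product of the two line integrals is at most half the sum of their squares, and each square
    is bounded by Cauchy-Schwarz with a factor 4; this gives the constant 2. *)
Lemma plane_fourth_le (f g0 g1 : 'rV[R]_2 -> R) : bsupp f -> bsupp g0 -> bsupp g1 ->
  line_dominated f (lift ord_max ord0) g0 -> line_dominated f ord_max g1 ->
  \int[mu 2]_x (f x ^+ 4) <=
  2 * (\int[mu 2]_x (f x ^+ 2)) * (\int[mu 2]_x (g0 x ^+ 2) + \int[mu 2]_x (g1 x ^+ 2)).
Proof.
move=> bf b0 b1 h0 h1.
have b2 := bsuppX 1 bf.
have := plane_product b2.1 (bsuppG bf b0).1 (bsuppG bf b1).1
  (fun x => sqr_ge0 _) (G0 f g0) (G0 f g1) h0 h1.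
rewrite -(bsupp_EFin (bsuppX 1 b2)) -(bsupp_EFin (bsuppG bf b0)) -(bsupp_EFin (bsuppG bf b1)) -EFinM lee_fin.
have CS g : bsupp g -> (\int[mu 2]_x G f g x) ^+ 2 <= 4 * (\int[mu 2]_x (f x ^+ 2)) * \int[mu 2]_x (g x ^+ 2).
  move=> bg; have := ip_CS (L2_semi_ip (mu 2) measurableT) (bsupp_L2 (bsupp_norm bf)) (bsupp_L2 (bsupp_norm bg)).
  have -> : \int[mu 2]_x G f g x = 2 * ip2 (mu 2) setT (fun x => `|f x|) (fun x => `|g x|).
    rewrite -RintZ//; last by apply: (L2_mul measurableT); exact: bsupp_L2 (bsupp_norm _).
    by apply: eq_Rintegral => x _; rewrite /G mulrA.
  have e (k : 'rV[R]_2 -> R) : ip2 (mu 2) setT (fun x => `|k x|) (fun x => `|k x|) = \int[mu 2]_x (k x ^+ 2).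
    by apply: eq_Rintegral => x _; rewrite -expr2 real_normK// num_real.
  rewrite !e exprMn; lra.
have := CS _ b0; have := CS _ b1.
have -> : \int[mu 2]_x (f x ^+ 2) ^+ 2 = \int[mu 2]_x (f x ^+ 4).
  by apply: eq_Rintegral => x _; rewrite -exprM.
move: (\int[mu 2]_x (f x ^+ 4)) (\int[mu 2]_x (f x ^+ 2)) (\int[mu 2]_x (g0 x ^+ 2)) (\int[mu 2]_x (g1 x ^+ 2)).
rewrite -!/(G _ _ _).
move: (\int[mu 2]_x (G f g0 x)) (\int[mu 2]_x (G f g1 x)) => a b X N P Q.
have := sqr_ge0 (a - b); rewrite sqrrB; lra.
Qed.

(** The planar inequality on each slice of constant third coordinate contains the squared norm of
    the slice of [f]. The line bound in the third direction estimates it by [M3], uniformly in the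
    slice, so the remaining factors can be integrated. *)
Lemma space_fourth_le (f g0 g1 g2 : 'rV[R]_3 -> R) : bsupp f -> bsupp g0 -> bsupp g1 -> bsupp g2 ->
  line_dominated f (lift ord_max (lift ord_max ord0)) g0 -> line_dominated f (lift ord_max ord_max) g1 ->
  line_dominated f ord_max g2 ->
  \int[mu 3]_x (f x ^+ 4) <= 2 * (\int[mu 3]_x (f x ^+ 2) + \int[mu 3]_x (g2 x ^+ 2)) *
    (\int[mu 3]_x (g0 x ^+ 2) + \int[mu 3]_x (g1 x ^+ 2)).
Proof.
move=> bf b0 b1 b2 h0 h1 h2.
pose M3 := \int[mu 3]_x G f g2 x.
pose sl (k : 'rV[R]_3 -> R) t := fun p : 'rV[R]_2 => k (row_snoc (p, t)).
pose I2 k t := \int[mu 2]_p (sl k t p ^+ 2).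
have step (k : 'rV[R]_3 -> R) : bsupp k -> (forall x, 0 <= k x) ->
  measurable_fun [set: measurableTypeR R] (fun t : R => (\int[mu 2]_p sl k t p)%:E) /\
  (\int[mu 3]_x k x)%:E = (\int[leb]_t (\int[mu 2]_p sl k t p)%:E)%E.
  move=> bk k0; have mk : measurable_fun setT (EFin \o k) by apply/measurable_EFinP; exact: bk.1.
  have kE x : (0 <= (k x)%:E)%E by rewrite lee_fin.
  have m' : measurable_fun setT (fun p : 'rV[R]_2 * measurableTypeR R => (k (row_snoc p))%:E).
    exact: measurableT_comp mk (@measurable_row_snoc R 2).
  have [_ mB e1 e2] := tonelli_sf (@lebesgue_row_sigma_finite R 2) m' (fun p => kE _).
  have e t : (\int[mu 2]_p sl k t p)%:E = (\int[mu 2]_p (k (row_snoc (p, t)))%:E)%E.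
    by rewrite EFin_Rint//; exact: bsupp_intg (bsupp_slice t bk).
  split; first by under eq_fun do rewrite e.
  under eq_integral do rewrite e.
  by rewrite EFin_Rint ?(integral_row_step mk kE).2 -?e1 ?e2//; exact: bsupp_intg.
have N_le t : I2 f t <= M3.
  rewrite -lee_fin /I2 (bsupp_EFin (bsuppX 1 (bsupp_slice t bf))).
  have bG := bsuppG bf b2.
  have mk : measurable_fun setT (EFin \o G f g2) by apply/measurable_EFinP; exact: bG.1.
  have kE x : (0 <= (G f g2 x)%:E)%E by rewrite lee_fin.
  have [m3 e3] := integral_row_step mk kE.
  rewrite /M3 bsupp_EFin//.
  rewrite e3; apply: ge0_le_integral => //.
  - by move=> p _; rewrite lee_fin sqr_ge0.
  - by apply/measurable_EFinP; exact: (bsuppX 1 (bsupp_slice t bf)).1.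
  move=> p _; apply: le_trans (h2 _) _.
  under eq_integral do rewrite row_snoc_max addrC.
  rewrite (ge0_integral_shift1 t (f := fun s => (G f g2 (row_snoc (p, s)))%:E))//.
  exact: measurableT_comp mk (measurable_row_snocr _).
have slice t : \int[mu 2]_p (sl f t p ^+ 4) <= 2 * M3 * (I2 g0 t + I2 g1 t).
  apply: (@le_trans _ _ (2 * I2 f t * (I2 g0 t + I2 g1 t))).
    apply: plane_fourth_le; [exact: bsupp_slice..| |].
      move=> p; apply: le_trans (h0 _) _; rewrite le_eqVlt; apply/orP; left; apply/eqP.
      by apply: eq_integral => s _; rewrite row_snoc_lift.
    move=> p; apply: le_trans (h1 _) _; rewrite le_eqVlt; apply/orP; left; apply/eqP.
    by apply: eq_integral => s _; rewrite row_snoc_lift.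
  apply: ler_wpM2r; first by apply: addr_ge0; apply: Rint_ge0 => x _; exact: sqr_ge0.
  by rewrite ler_wpM2l.
have [m4 e4] := step _ (bsuppX 3 bf) (fun x => @exprn_even_ge0 R 4 (f x) isT).
have [m0 e0] := step _ (bsuppX 1 b0) (fun x => sqr_ge0 _).
have [m1 e1] := step _ (bsuppX 1 b1) (fun x => sqr_ge0 _).
have M3_le : M3 <= \int[mu 3]_x (f x ^+ 2) + \int[mu 3]_x (g2 x ^+ 2).
  have bf2 := bsuppX 1 bf; have bg2 := bsuppX 1 b2.
  rewrite -(RintD measurableT (bsupp_intg bf2) (bsupp_intg bg2)).
  apply: le_Rint; [exact: measurableT|exact: bsupp_intg (bsuppG bf b2)| |].
    by apply: intgD; [exact: measurableT|exact: bsupp_intg..].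
  move=> x _; rewrite /G; have := sqr_ge0 (`|f x| - `|g2 x|).
  rewrite sqrrB !real_normK ?num_real//; lra.
have S0 (k : 'rV[R]_3 -> R) : 0 <= \int[mu 3]_x (k x ^+ 2).
  by apply: Rint_ge0 => x _; exact: sqr_ge0.
have I20 k t : 0 <= I2 k t by apply: Rint_ge0 => x _; exact: sqr_ge0.
have M30 : 0 <= M3 by apply: Rint_ge0.
apply: (@le_trans _ _ (2 * M3 * (\int[mu 3]_x (g0 x ^+ 2) + \int[mu 3]_x (g1 x ^+ 2)))); last first.
  apply: ler_wpM2r; first exact: addr_ge0.
  by rewrite ler_wpM2l.
rewrite -lee_fin e4 EFinM EFinD e0 e1 -ge0_integralD//; [|by move=> t _; rewrite lee_fin; exact: I20..].
rewrite -ge0_integralZl//; last by rewrite lee_fin mulr_ge0.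
- apply: ge0_le_integral => //.
  + by move=> t _; rewrite lee_fin; apply: Rint_ge0 => x _; exact: exprn_even_ge0.
  + by apply: emeasurable_funM => //; exact: emeasurable_funD.
  + by move=> t _; rewrite -EFinD -EFinM lee_fin; exact: slice.
- exact: emeasurable_funD.
- by move=> t _; apply: adde_ge0; rewrite lee_fin; exact: I20.
Qed.

End bounded_support.

Section ladyzhenskaya.
Context {R : realType} {d : nat}.
Local Notation mu := (lebesgue_row R d).

Lemma ladyzhenskaya (phi : 'rV[R]_d -> R) : d = 2%N \/ d = 3%N -> test_function setT phi ->
  \int[mu]_x (phi x ^+ 4) <=
  2 * (\int[mu]_x (phi x ^+ 2) + \sum_i \int[mu]_x ('D_(unit_vec R i) phi x ^+ 2)) ^+ 2.
Proof.
move=> d23 tp.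
have bp := bsupp_test tp; have bD i := bsupp_test (test_partial i tp).
have ld i : line_dominated phi i ('D_(unit_vec R i) phi) := fun x => line_sqr_bound i x tp.
have S0 (k : 'rV[R]_d -> R) : 0 <= \int[mu]_x (k x ^+ 2).
  by apply: Rint_ge0 => x _; exact: sqr_ge0.
have key (x y : R) : 0 <= x -> 0 <= y -> 2 * x * y <= 2 * (x + y) ^+ 2.
  by move=> x0 y0; have := mulr_ge0 x0 y0; have := sqr_ge0 x; have := sqr_ge0 y; rewrite sqrrD; lra.
have key3 (p q r s : R) : 0 <= p -> 0 <= q -> 0 <= r -> 0 <= s ->
    2 * (p + q) * (r + s) <= 2 * (p + (r + s + q)) ^+ 2.
  move=> p0 q0 r0 s0; rewrite (_ : p + (r + s + q) = (p + q) + (r + s)); last by lra.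
  by apply: key; exact: addr_ge0.
case: d23 => e; subst d.
  apply: le_trans (plane_fourth_le bp (bD _) (bD _) (ld _) (ld _)) _.
  have e (J : 'I_2 -> R) : \sum_i J i = J (lift ord_max ord0) + J ord_max.
    by rewrite !big_ord_recl big_ord0 addr0; congr (J _ + J _); exact: val_inj.
  by rewrite e; apply: key; [exact: S0|apply: addr_ge0; exact: S0].
apply: le_trans (space_fourth_le bp (bD _) (bD _) (bD _) (ld _) (ld _) (ld _)) _.
have e (J : 'I_3 -> R) : \sum_i J i =
    J (lift ord_max (lift ord_max ord0)) + J (lift ord_max ord_max) + J ord_max.
  by rewrite !big_ord_recl big_ord0 addr0 addrA; congr (J _ + J _ + J _); exact: val_inj.
rewrite e; apply: key3; exact: S0.
Qed.

End ladyzhenskaya.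

(** * Bounded operators and forms on spaces of functions *)

Section essentially_bounded.
Context {dT : measure_display} {T : measurableType dT} {R : realType}
  (mu : {measure set T -> \bar R}) (D : set T).
Hypothesis mD : measurable D.
Implicit Types (f g : T -> R).
Local Notation L2 := (L2 mu D).
Local Notation ip := (ip2 mu D).

Definition ess_bounded g (M : R) := measurable_fun D g /\ {ae mu, forall x, D x -> `|g x| <= M}.

(** Turns an essentially bounded multiplier into a bounded one that agrees with it almost
    everywhere. *)
Let clamp (M t : R) := Num.max (- M) (Num.min t M).

Lemma ess_bounded_mul_L2 f g (M : R) : ess_bounded g M -> L2 f -> L2 (fun x => g x * f x).
Proof.
move=> [mg gM] Lf; have M0 : 0 <= `|M| by [].
have gM' : {ae mu, forall x, D x -> `|g x| <= `|M|}.
  by apply: filterS gM => x h Dx; apply: le_trans (h Dx) (ler_norm M).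
have mc : measurable_fun D (fun x => clamp `|M| (g x)).
  apply: measurable_maxr; first exact: measurable_cst.
  by apply: measurable_minr => //; exact: measurable_cst.
have Lc : L2 (fun x => clamp `|M| (g x) * f x).
  apply: (L2_mulb mD Lf mc (M := `|M|)) => x _; rewrite ler_norml /clamp le_max lexx/=.
  by rewrite ge_max ge_min lexx orbT andbT; lra.
apply: (L2_ae mD Lc); first by apply: measurable_funM => //; exact: Lf.1.
apply: filterS gM' => x h Dx; congr (_ * _); move: (h Dx); rewrite ler_norml => /andP[h1 h2].
by rewrite /clamp min_l// max_r.
Qed.

Lemma ess_bounded_mul_ip f g (M : R) : ess_bounded g M -> L2 f ->
  ip (fun x => g x * f x) (fun x => g x * f x) <= M ^+ 2 * ip f f.
Proof.
move=> bg Lf; rewrite !ip2_sqr// -RintZ; [|exact: mD|exact: Lf.2].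
apply: (le_Rint_ae mD); [exact: (ess_bounded_mul_L2 bg Lf).2|by apply: intgZ => //; exact: Lf.2|].
apply: filterS bg.2 => x h Dx; rewrite exprMn ler_wpM2r ?sqr_ge0//.
by rewrite -[g x ^+ 2]real_normK ?num_real// ler_pXn2r ?nnegrE ?(le_trans _ (h Dx))//; exact: h.
Qed.

Lemma ess_bounded_L2 g (M : R) : (mu D < +oo)%E -> ess_bounded g M -> L2 g.
Proof.
move=> fD bg; have := ess_bounded_mul_L2 bg (L2_cst mD (1 : R) fD).
by rewrite (_ : (fun _ => _) = g)//; apply/funext => x; rewrite mulr1.
Qed.

Context (V : lmodType R) (S : V -> Prop) (ipS : V -> V -> R).
Hypothesis HS : semi_ip S ipS.
Let SS := sip_sub HS.
Let H := L2_semi_ip mu mD.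

(* Weak derivatives are determined up to null sets, so operators built from
   them are linear only almost everywhere. *)
Definition bounded_op (s : V -> T -> R) :=
  [/\ forall u, S u -> L2 (s u),
      forall a u v, S u -> S v -> ae_eq mu D (s (a *: u + v)) (a *: s u + s v) &
      exists2 M : R, 0 <= M & forall u, S u -> ip (s u) (s u) <= M * ipS u u].

Lemma bounded_op_ext s s' : (forall u x, s u x = s' u x) -> bounded_op s -> bounded_op s'.
Proof. by move=> e; have -> : s = s' by apply/funext => u; apply/funext => x. Qed.

Lemma bounded_op_add s s' : bounded_op s -> bounded_op s' -> bounded_op (fun u x => s u x + s' u x).
Proof.
move=> [L l [M M0 hM]] [L' l' [M' M'0 hM']]; split=> [u Su|a u v Su Sv|].
- by apply: (L2D mD); [exact: L|exact: L'].
- apply: filterS2 (l a u v Su Sv) (l' a u v Su Sv) => x h h' Dx; rewrite h// h'//.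
  rewrite -[(a *: s u + s v) x]/(a * s u x + s v x) -[(a *: s' u + s' v) x]/(a * s' u x + s' v x).
  rewrite -[RHS]/(a * (s u x + s' u x) + (s v x + s' v x)); ring.
exists (2 * M + 2 * M'); first by lra.
move=> u Su; apply: le_trans (ip_le_sqrD H (L u Su) (L' u Su)) _.
by have := hM u Su; have := hM' u Su; rewrite mulrDl; lra.
Qed.

Lemma bounded_op_mul g M s : ess_bounded g M -> bounded_op s -> bounded_op (fun u x => g x * s u x).
Proof.
move=> bg [L l [K K0 hK]]; split=> [u Su|a u v Su Sv|].
- by apply: (ess_bounded_mul_L2 bg); exact: L.
- apply: filterS (l a u v Su Sv) => x h Dx; rewrite h//.
  rewrite -[(a *: s u + s v) x]/(a * s u x + s v x) -[RHS]/(a * (g x * s u x) + g x * s v x); ring.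
exists (M ^+ 2 * K); first by rewrite mulr_ge0 ?sqr_ge0.
move=> u Su; apply: le_trans (ess_bounded_mul_ip bg (L u Su)) _.
by rewrite -mulrA ler_wpM2l ?sqr_ge0//; exact: hK.
Qed.

Lemma bounded_op_scale (c : R) s : bounded_op s -> bounded_op (fun u x => c * s u x).
Proof.
move=> bs; apply: (@bounded_op_mul (fun=> c) `|c|) => //; split; first exact: measurable_cst.
by apply: aeW => x _.
Qed.

Lemma bounded_op_sub s s' : bounded_op s -> bounded_op s' -> bounded_op (fun u x => s u x - s' u x).
Proof.
move=> bs bs'; apply: (@bounded_op_ext (fun u x => s u x + -1 * s' u x)).
  by move=> u x; rewrite mulN1r.
by apply: bounded_op_add => //; exact: bounded_op_scale.
Qed.

Lemma bounded_op_sum (I : Type) (r : seq I) (s : I -> V -> T -> R) :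
  (forall i, bounded_op (s i)) -> bounded_op (fun u x => \sum_(i <- r) s i u x).
Proof.
move=> bs; elim: r => [|i r IH].
  apply: (@bounded_op_ext (fun _ _ => 0)); first by move=> u x; rewrite big_nil.
  split=> [u Su|a u v Su Sv|]; first exact: L2_0.
    by apply: aeW => x _; rewrite -[RHS]/(a * 0 + 0) mulr0 addr0.
  exists 0 => // u Su; rewrite mul0r -[leLHS]/(ip (0 : T -> R) 0).
  by rewrite (lin0 (sip_sub H) (ip_linl H (L2_0 mu D))).
apply: (@bounded_op_ext (fun u x => s i u x + \sum_(j <- r) s j u x)).
  by move=> u x; rewrite big_cons.
exact: bounded_op_add.
Qed.

Definition bounded_form (a : V -> V -> R) :=
  [/\ forall w, S w -> lin_on S (a^~ w), forall w, S w -> lin_on S (a w) &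
      exists2 M : R, 0 <= M & forall u v, S u -> S v -> a u v ^+ 2 <= M * ipS u u * ipS v v].

Lemma bounded_form_ext a b : (forall u v, S u -> S v -> a u v = b u v) -> bounded_form a -> bounded_form b.
Proof.
move=> e [l1 l2 [M M0 hM]]; split=> [w Sw c u v Su Sv|w Sw c u v Su Sv|].
- by rewrite -!e//; [exact: l1|exact: subDZ].
- by rewrite -!e//; [exact: l2|exact: subDZ].
by exists M => // u v Su Sv; rewrite -e//; exact: hM.
Qed.

Lemma bounded_form_op s s' : bounded_op s -> bounded_op s' -> bounded_form (fun u v => ip (s u) (s' v)).
Proof.
move=> [L l [M M0 hM]] [L' l' [M' M'0 hM']]; split=> [w Sw c u v Su Sv|w Sw c u v Su Sv|].
- have Lw := L' w Sw; have Lu := L u Su; have Lv := L v Sv.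
  rewrite -(sip_lin H c Lu Lv Lw); apply: (ip2_ae mD) => //.
  + by apply: L; exact: subDZ.
  + exact: subDZ (sip_sub H) _ _ _ _ _.
  + exact: l.
  + exact: ae_eq_refl.
- have Lw := L w Sw; have Lu := L' u Su; have Lv := L' v Sv.
  have Lc := subDZ (sip_sub H) c Lu Lv.
  rewrite -(ip_linr H Lw c Lu Lv); apply: (ip2_ae mD) => //.
  + by apply: L'; exact: subDZ.
  + exact: ae_eq_refl.
  + exact: l'.
exists (M * M'); first exact: mulr_ge0.
move=> u v Su Sv; apply: le_trans (ip_CS H (L u Su) (L' v Sv)) _.
rewrite (_ : _ * _ * _ = (M * ipS u u) * (M' * ipS v v)); last by ring.
apply: ler_pM; [exact: sip_ge0 H _ (L u Su)|exact: sip_ge0 H _ (L' v Sv)|exact: hM|exact: hM'].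
Qed.

Lemma bounded_form_add a b : bounded_form a -> bounded_form b -> bounded_form (fun u v => a u v + b u v).
Proof.
move=> [l1 l2 [M M0 hM]] [l1' l2' [M' M'0 hM']]; split=> [w Sw c u v Su Sv|w Sw c u v Su Sv|].
- by rewrite l1// l1'//; ring.
- by rewrite l2// l2'//; ring.
exists (2 * M + 2 * M'); first by lra.
move=> u v Su Sv; have := hM u v Su Sv; have := hM' u v Su Sv; have := sqr_ge0 (a u v - b u v).
rewrite sqrrB sqrrD !mulrDl -!mulrA; lra.
Qed.

Lemma bounded_form_scale (c : R) a : bounded_form a -> bounded_form (fun u v => c * a u v).
Proof.
move=> [l1 l2 [M M0 hM]]; split=> [w Sw b u v Su Sv|w Sw b u v Su Sv|].
- by rewrite l1//; ring.
- by rewrite l2//; ring.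
exists (c ^+ 2 * M); first by rewrite mulr_ge0 ?sqr_ge0.
move=> u v Su Sv; rewrite exprMn; have := hM u v Su Sv; have := sqr_ge0 c.
by move: (c ^+ 2) => k k0 h; rewrite -!(mulrA k) ler_wpM2l.
Qed.

Lemma bounded_form_opp a : bounded_form a -> bounded_form (fun u v => - a u v).
Proof.
move=> ba; apply: (@bounded_form_ext (fun u v => -1 * a u v)); last exact: bounded_form_scale.
by move=> u v _ _; rewrite mulN1r.
Qed.

Lemma bounded_form_sum (I : Type) (r : seq I) (a : I -> V -> V -> R) :
  (forall i, bounded_form (a i)) -> bounded_form (fun u v => \sum_(i <- r) a i u v).
Proof.
move=> ba; elim: r => [|i r IH].
  apply: (@bounded_form_ext (fun _ _ => 0)); first by move=> u v _ _; rewrite big_nil.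
  split=> [w Sw c u v Su Sv|w Sw c u v Su Sv|]; rewrite ?mulr0 ?addr0//.
  by exists 0 => // u v _ _; rewrite !mul0r expr0n.
apply: (@bounded_form_ext (fun u v => a i u v + \sum_(j <- r) a j u v)).
  by move=> u v _ _; rewrite big_cons.
exact: bounded_form_add.
Qed.

Lemma bounded_form_ip : bounded_form ipS.
Proof.
split; [exact: (ip_linl HS)|exact: (ip_linr HS)|].
by exists 1 => [|u v Su Sv]; [exact: ler01|have := ip_CS HS Su Sv; lra].
Qed.

(** Expand [a v v] at [v = u - w] with [w] small: all terms but [a u u] are small by boundedness of
    the form, which need not be symmetric. *)
Lemma bounded_form_dense_ge0 (P : V -> Prop) a u : bounded_form a -> S u ->
  (forall v, P v -> S v) -> (forall v, P v -> 0 <= a v v) ->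
  (forall e : R, 0 < e -> exists2 v, P v & ipS (u - v) (u - v) < e) -> 0 <= a u u.
Proof.
move=> [l1 l2 [M M0 hM]] Su PS P0 dense.
pose q := ipS u u; have q0 : 0 <= q by exact: sip_ge0 HS _ Su.
suff hh (e : R) : 0 < e -> 0 <= a u u + e by apply/ler_addgt0Pr => e; exact: hh.
move=> e0; have e4 : 0 < e / 4 by rewrite divr_gt0.
(* The threshold [d1] serves the two cross terms and [d2] the term in [w] alone; the further bound 1
   on the squared distance reduces its square to a first power there. *)
pose d1 := (e / 4) ^+ 2 / (M * q + 1); pose d2 := (e / 4) ^+ 2 / (M + 1).
have d10 : 0 < d1 by rewrite divr_gt0 ?exprn_gt0// ltr_wpDl// mulr_ge0.
have d20 : 0 < d2 by rewrite divr_gt0 ?exprn_gt0// ltr_wpDl.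
have [|v Pv] := dense (Num.min 1 (Num.min d1 d2)); first by rewrite !lt_min ltr01 d10.
rewrite !lt_min => /andP[p1 /andP[pd1 pd2]]; have Sv := PS v Pv.
have Sw := subB SS Su Sv; pose w := u - v; have ev : v = u - w by rewrite /w subKr.
set p := ipS (u - v) (u - v) in p1 pd1 pd2.
have p0 : 0 <= p by exact: sip_ge0 HS _ Sw.
have h1 : `|a u w| < e / 4.
  by apply: (@sqr_small R (M * q) _ p) => //; [exact: mulr_ge0|exact: hM].
have h2 : `|a w u| < e / 4.
  apply: (@sqr_small R (M * q) _ p) => //; first exact: mulr_ge0.
  by rewrite mulrAC; exact: hM.
have h3 : `|a w w| < e / 4.
  apply: (@sqr_small R M _ p) => //; apply: le_trans (hM _ _ Sw Sw) _.
  rewrite -/p -mulrA ler_wpM2l//; rewrite -[leRHS]mulr1 ler_wpM2l// ltW//.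
have key z : S z -> a (u - z) (u - z) = a u u - a u z - a z u + a z z.
  move=> Sz; have Suz := subB SS Su Sz; rewrite (linB SS (l1 _ Suz) Su Sz).
  rewrite (linB SS (l2 _ Su) Su Sz) (linB SS (l2 _ Sz) Su Sz); ring.
have := P0 v Pv; rewrite ev (key _ Sw); move: h1 h2 h3; rewrite !ltr_norml.
by rewrite /w; move=> /andP[? ?] /andP[? ?] /andP[? ?]; lra.
Qed.

End essentially_bounded.

(** * The convective term *)

Section convection.
Context {R : realType} {d : nat}.
Local Notation pt := 'rV[R]_d.
Local Notation mu := (lebesgue_row R d).
Local Notation D i f := ('D_(@unit_vec R d i) f).
Context (Omega : set pt).
Hypotheses (oO : open Omega) (bO : bounded_set Omega).
Implicit Types (f g phi : pt -> R) (i j : 'I_d).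
Let mO := open_measurable_row oO.
Let fO := bounded_row_lty mO bO.
Local Notation L2 := (L2 mu Omega).
Local Notation ip := (ip2 mu Omega).
Local Notation pd := (pd Omega).
Local Notation wp := (weak_partial Omega).
Local Notation test := (test_function Omega).
Local Notation W12 := (W12 Omega).
Local Notation ip_H1 := (ip_H1 Omega).
Local Notation gip := (gip Omega).
Local Notation ess_bounded := (ess_bounded mu Omega).
Let H := L2_semi_ip mu mO.
Let HH := H1_semi_ip oO bO.

Lemma in_Lpoo_ess_bounded f : in_Lp +oo Omega f -> ess_bounded f (Lp_norm +oo Omega f).
Proof. exact: in_Lpoo_bounded. Qed.

Lemma W1oo_pd f i : in_W1p +oo Omega f -> wp i f (pd i f) /\ exists M : R, ess_bounded (pd i f) M.
Proof.
move=> [_ /(_ i)[g Lg wg]]; have w : wp i f (pd i f) by apply: pdP; exists g.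
split=> //; exists (Lp_norm +oo Omega g); have [_ gM] := in_Lpoo_ess_bounded Lg.
split; first by case: w => _ [].
by apply: filterS2 (pd_uniq oO wg) gM => x e h Ox; rewrite e//; exact: h.
Qed.

Lemma pd_bounded_op i : bounded_op mu Omega W12 ip_H1 (fun f => pd i f).
Proof.
split=> [f Wf|a f g Wf Wg|]; first exact: (Wf.2 i).2.
  exact: pd_lin.
exists 1 => // f Wf; rewrite mul1r; apply: le_trans (pd_ip_le_gip oO bO i Wf) _.
by rewrite -[ip_H1 f f]/(ip f f + gip f f) lerDr; exact: sip_ge0 H _ Wf.1.
Qed.

Lemma id_bounded_op : bounded_op mu Omega W12 ip_H1 (fun f => f).
Proof.
split=> [f Wf|a f g Wf Wg|]; [exact: Wf.1|exact: ae_eq_refl|].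
exists 1 => // f Wf; rewrite mul1r -[ip_H1 f f]/(ip f f + gip f f) lerDl.
exact: sip_ge0 (gip_semi_ip oO bO) _ Wf.
Qed.

Context (beta : pt -> pt) (d23 : d = 2%N \/ d = 3%N).
Hypothesis bW : forall i, in_W1p +oo Omega (coordf beta i).

Let adv f x : R := \sum_i beta x 0 i * pd i f x.

Lemma divg_W1oo_L2 : L2 (divg Omega beta).
Proof.
have -> : divg Omega beta = fun x => \sum_i pd i (coordf beta i) x.
  by apply/funext => x; apply: eq_bigr => i _; rewrite mxE.
apply: (L2_sum mO) => i; have [_ [M bM]] := W1oo_pd i (bW i).
exact: ess_bounded_L2 mO _ _ fO bM.
Qed.

Lemma advection_bounded_op : bounded_op mu Omega W12 ip_H1 adv.
Proof.
apply: (bounded_op_sum mO) => i; have [/in_Lpoo_ess_bounded bb _] := bW i.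
exact: (bounded_op_mul mO bb (pd_bounded_op i)).
Qed.

(* Integration by parts: [2 phi D_i phi = D_i (phi^2)]. *)
Lemma advection_test phi : test phi ->
  2 * ip (adv phi) phi = - \int[mu]_(x in Omega) (divg Omega beta x * phi x ^+ 2).
Proof.
move=> tp; have tp2 : test (fun x => phi x * phi x) := testM tp.1 tp.
have [sp _] := tp; have Wp := test_W12 oO bO tp.
have Lp := test_L2 oO tp; have LD i := test_L2 oO (test_partial i tp).
have Lb i : exists M, ess_bounded (coordf beta i) M.
  by exists (Lp_norm +oo Omega (coordf beta i)); apply: in_Lpoo_ess_bounded; case: (bW i).
have LbD i : L2 (fun x => coordf beta i x * D i phi x).
  by have [M bM] := Lb i; exact: ess_bounded_mul_L2 mO _ _ _ bM (LD i).
have e1 : ip (adv phi) phi = \sum_i \int[mu]_(x in Omega) (coordf beta i x * D i phi x * phi x).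
  rewrite -(Rint_sum mO); last by move=> i; apply: (L2_mul mO).
  have Ladv := let: And3 h _ _ := advection_bounded_op in h phi Wp.
  have e : ae_eq mu Omega (adv phi) (fun x => \sum_i coordf beta i x * D i phi x).
    apply: filterS (ae_finall (fun i => pd_test oO bO i tp)) => x h Ox.
    by apply: eq_bigr => i _; congr (_ * _); exact: h.
  have LS : L2 (fun x => \sum_i coordf beta i x * D i phi x) by apply: (L2_sum mO).
  rewrite (ip2_ae mO Ladv Lp LS Lp e (ae_eq_refl _ _ _)).
  by apply: eq_Rintegral => x _; rewrite mulr_suml.
have e2 i : 2 * \int[mu]_(x in Omega) (coordf beta i x * D i phi x * phi x) =
    - \int[mu]_(x in Omega) (pd i (coordf beta i) x * (phi x * phi x)).
  have [[_ _ h] _] := W1oo_pd i (bW i); rewrite -(h _ tp2) -RintZ//; last exact: (L2_mul mO).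
  apply: eq_Rintegral => x _; rewrite derive_mulf//.
  by move: (coordf _ _ _) (phi x) ('D_ _ _ _) => a b c; ring.
have Lpp := test_L2 oO tp2.
have Ldp i : intg mu Omega (fun x => pd i (coordf beta i) x * (phi x * phi x)).
  have [_ [M bM]] := W1oo_pd i (bW i).
  exact: L2_mul mO _ _ (ess_bounded_L2 mO fO bM) Lpp.
rewrite e1 mulr_sumr (eq_bigr _ (fun i _ => e2 i)) sumrN -(Rint_sum mO)//; congr (- _).
apply: eq_Rintegral => x _; rewrite /divg /mxtrace mulr_suml; apply: eq_bigr => i _.
by rewrite mxE expr2.
Qed.

(** By Cauchy-Schwarz, twice the form is at most [N] times the norm of [phi ^+ 2], and the
    Ladyzhenskaya inequality bounds that norm by [sqrt 2] times [ip_H1 phi phi]. The resulting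
    factor [sqrt 2 / 2] is rounded up to 1. *)
Lemma advection_test_le phi : test phi ->
  `|ip (adv phi) phi| <= Lp_norm 2%:E Omega (divg Omega beta) * ip_H1 phi phi.
Proof.
move=> tp; have tp2 : test (fun x => phi x ^+ 2).
  by rewrite (_ : (fun _ => _) = (fun x => phi x * phi x)); [exact: testM tp.1 tp|apply/funext => x; rewrite expr2].
have tD i := test_partial i tp.
have Ld := divg_W1oo_L2; have Wp := test_W12 oO bO tp.
set N := Lp_norm _ _ _; have N0 : 0 <= N by exact: Lp_norm_ge0.
have h0 : 0 <= ip_H1 phi phi by exact: sip_ge0 HH _ Wp.
have eH : ip_H1 phi phi = \int[mu]_x (phi x ^+ 2) + \sum_i \int[mu]_x (D i phi x ^+ 2).
  rewrite -[ip_H1 phi phi]/(ip phi phi + gip phi phi) ip2_sqr (Rint_test_setT tp2); congr (_ + _); apply: eq_bigr => i _.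
  have LD := test_L2 oO (tD i).
  rewrite (ip2_ae mO (Wp.2 i).2 (Wp.2 i).2 LD LD (pd_test oO bO i tp) (pd_test oO bO i tp)) ip2_sqr.
  have tD2 : test (fun x => D i phi x ^+ 2).
    by rewrite (_ : (fun _ => _) = (fun x => D i phi x * D i phi x)); [exact: testM (tD i).1 (tD i)|apply/funext => x; rewrite expr2].
  exact: Rint_test_setT.
have := ladyzhenskaya d23 (test_sub (@subsetT _ _) tp); rewrite -eH => l4.
have := ip_CS H Ld (test_L2 oO tp2); rewrite -(Lp_norm_sqr Ld) -/N.
have -> : ip (fun x => phi x ^+ 2) (fun x => phi x ^+ 2) = \int[mu]_x (phi x ^+ 4).
  rewrite ip2_sqr (_ : (fun x => phi x ^+ 2 ^+ 2) = (fun x => phi x ^+ 4)).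
    apply: Rint_test_setT; rewrite (_ : (fun _ => _) = (fun x => phi x ^+ 2 * phi x ^+ 2)).
      exact: testM tp2.1 tp2.
    by apply/funext => x; rewrite -exprD.
  by apply/funext => x; rewrite -exprM.
rewrite -[ip (divg Omega beta) _]opprK -[- ip _ _](advection_test tp) sqrrN => h.
have : (2 * ip (adv phi) phi) ^+ 2 <= (2 * (N * ip_H1 phi phi)) ^+ 2.
  apply: le_trans h _; apply: (@le_trans _ _ (N ^+ 2 * (2 * ip_H1 phi phi ^+ 2))).
    by rewrite ler_wpM2l// sqr_ge0.
  have := mulr_ge0 (sqr_ge0 N) (sqr_ge0 (ip_H1 phi phi)); rewrite !exprMn; lra.
rewrite -[_ ^+ 2]real_normK ?num_real// ler_pXn2r ?nnegrE ?mulr_ge0//.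
by rewrite normrM normr_nat ler_pM2l.
Qed.

(** An absolute value is not a quadratic form, so the bound is split into the nonnegativity of
    [N * ip_H1 + s * ip (adv _) _] for [s = 1] and [s = -1], which extends by density. *)
Lemma advection_le f : in_H10 Omega f ->
  `|ip (adv f) f| <= Lp_norm 2%:E Omega (divg Omega beta) * ip_H1 f f.
Proof.
move=> /H10P-/(_ oO bO)[Wf dense]; set N := Lp_norm _ _ _.
have bA := bounded_form_op mO HH advection_bounded_op id_bounded_op.
have bN := bounded_form_scale N (bounded_form_ip HH).
have key (s : R) : `|s| <= 1 -> 0 <= N * ip_H1 f f + s * ip (adv f) f.
  move=> s1; pose a u v := N * ip_H1 u v + s * ip (adv u) v.
  rewrite -/(a f f); apply: (bounded_form_dense_ge0 HH (P := test)) dense => //.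
  - exact: bounded_form_add bN (bounded_form_scale s bA).
  - by move=> v tv; exact: test_W12.
  move=> v tv; rewrite /a; have := advection_test_le tv; rewrite -/N => h.
  have : `|s * ip (adv v) v| <= N * ip_H1 v v.
    by rewrite normrM; apply: le_trans h; rewrite ler_piMl.
  by rewrite ler_norml => /andP[h1 _]; lra.
rewrite ler_norml; have := key 1; have := key (-1); rewrite normrN normr1 mul1r mulN1r.
by move=> /(_ (lexx _)) h1 /(_ (lexx _)) h2; lra.
Qed.

End convection.

(** * The mixed form *)

Section axial_vectors.
Context {R : realType}.

(** The index maps [p] and [q] treat both dimensions at once wherever only the difference structure
    of the curl matters. *)
Lemma axialE d (d23 : d = 2%N \/ d = 3%N) : exists p q : 'I_(curl_dim d) -> 'I_d,
  forall (M : 'M[R]_d) k, axial M 0 k = M (p k) (q k) - M (q k) (p k).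
Proof.
case: d23 => ->; first by exists (fun=> 0), (fun=> 1) => M k; rewrite mxE.
by exists (fun k : 'I_3 => k + 1), (fun k : 'I_3 => k + 2) => M k; rewrite mxE.
Qed.

(** The subtracted double sum is the trace of [M ^ 2]; for a Jacobian it integrates to the squared
    norm of the divergence. *)
Lemma axial_sqr d (d23 : d = 2%N \/ d = 3%N) (M : 'M[R]_d) :
  dot (axial M) (axial M) = \sum_i \sum_j M i j ^+ 2 - \sum_i \sum_j M i j * M j i.
Proof.
case: d23 => e; subst d.
  have E (J : 'I_2 -> R) : \sum_i J i = J 0 + J 1.
    by rewrite !big_ord_recl big_ord0 addr0; congr (J _ + J _); exact: val_inj.
  rewrite !E /dot; have -> : \sum_(i < curl_dim 2) axial M 0 i * axial M 0 i = (M 0 1 - M 1 0) ^+ 2.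
    by rewrite /curl_dim big_ord_recl big_ord0 addr0 !mxE expr2.
  ring.
have E (J : 'I_3 -> R) : \sum_i J i = J 0 + J 1 + J 2.
  by rewrite !big_ord_recl big_ord0 addr0 addrA; congr (J _ + J _ + J _); exact: val_inj.
rewrite !E /dot; have -> : \sum_(i < curl_dim 3) axial M 0 i * axial M 0 i =
    (M 1 2 - M 2 1) ^+ 2 + (M 2 0 - M 0 2) ^+ 2 + (M 0 1 - M 1 0) ^+ 2.
  have e1 : (0 + 1 : 'I_3) = 1 by exact: val_inj.
  have e2 : (0 + 2 : 'I_3) = 2 by exact: val_inj.
  have e3 : (1 + 1 : 'I_3) = 2 by exact: val_inj.
  have e4 : (1 + 2 : 'I_3) = 0 by exact: val_inj.
  have e5 : (2 + 1 : 'I_3) = 0 by exact: val_inj.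
  have e6 : (2 + 2 : 'I_3) = 1 by exact: val_inj.
  rewrite (E (fun i => axial M 0 i * axial M 0 i)) !mxE e1 e2 e3 e4 e5 e6; ring.
ring.
Qed.

Lemma dot_sqr_ge0 n (v : 'rV[R]_n) : 0 <= dot v v.
Proof. by apply: sumr_ge0 => i _; rewrite -expr2 sqr_ge0. Qed.

Lemma dot_CS n (v w : 'rV[R]_n) : dot v w ^+ 2 <= dot v v * dot w w.
Proof. exact: (sum_CS (fun i => v 0 i) (fun i => w 0 i)). Qed.

Lemma enorm_sqr n (v : 'rV[R]_n) : enorm v ^+ 2 = dot v v.
Proof. by rewrite sqr_sqrtr// dot_sqr_ge0. Qed.

(* Lagrange's identity gives |v x w|^2 + (v . w)^2 = |v|^2 |w|^2. *)
Lemma cross_sqr_le d (d23 : d = 2%N \/ d = 3%N) (v w : 'rV[R]_d) :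
  dot (cross v w) (cross v w) <= dot v v * dot w w.
Proof.
rewrite /cross (axial_sqr d23).
have e i j : (v^T *m w) i j = v 0 i * w 0 j by rewrite mxE big_ord1 mxE.
have -> : \sum_i \sum_j (v^T *m w) i j ^+ 2 = dot v v * dot w w.
  rewrite mulr_suml; apply: eq_bigr => i _; rewrite mulr_sumr; apply: eq_bigr => j _.
  by rewrite e; ring.
rewrite lerBlDr lerDl; have -> : \sum_i \sum_j (v^T *m w) i j * (v^T *m w) j i = dot v w ^+ 2.
  rewrite expr2 [RHS]mulr_suml; apply: eq_bigr => i _; rewrite mulr_sumr; apply: eq_bigr => j _.
  by rewrite !e; ring.
exact: sqr_ge0.
Qed.

Lemma strain_row d (g : 'rV[R]_d) (M : 'M[R]_d) k :
  (2 *: (g *m (2^-1 *: (M + M^T)))) 0 k = \sum_i g 0 i * (M i k + M k i).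
Proof. by rewrite !mxE mulr_sumr; apply: eq_bigr => i _; rewrite !mxE; field. Qed.

Lemma strain_entries d (g : 'rV[R]_d) (M : 'M[R]_d) (y : 'rV[R]_d) :
  dot (2 *: (g *m (2^-1 *: (M + M^T)))) y ^+ 2 <=
  4 * (dot g g * dot y y) * \sum_i \sum_j M i j ^+ 2.
Proof.
pose a := \sum_i \sum_j (g 0 i * y 0 j) * M i j.
pose b := \sum_i \sum_j (g 0 j * y 0 i) * M i j.
have CS (h : 'I_d -> 'I_d -> R) : (\sum_i \sum_j h i j * M i j) ^+ 2 <=
    (\sum_i \sum_j h i j ^+ 2) * \sum_i \sum_j M i j ^+ 2.
  by rewrite !pair_big/=; exact: (sum_CS (fun p : 'I_d * 'I_d => h p.1 p.2) (fun p => M p.1 p.2)).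
have ha := CS (fun i j => g 0 i * y 0 j); have hb := CS (fun i j => g 0 j * y 0 i).
have eg : \sum_i \sum_j (g 0 i * y 0 j) ^+ 2 = dot g g * dot y y.
  rewrite mulr_suml; apply: eq_bigr => i _; rewrite mulr_sumr; apply: eq_bigr => j _; ring.
have eg' : \sum_i \sum_j (g 0 j * y 0 i) ^+ 2 = dot g g * dot y y.
  by rewrite exchange_big.
have -> : dot (2 *: (g *m (2^-1 *: (M + M^T)))) y = a + b.
  rewrite /a exchange_big /b -big_split /=; apply: eq_bigr => j _.
  rewrite strain_row mulr_suml -big_split/=; apply: eq_bigr => i _; ring.
rewrite eg in ha; rewrite eg' in hb; rewrite -/a in ha; rewrite -/b in hb.
have := sqr_ge0 (a - b); rewrite sqrrB sqrrD; lra.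
Qed.

Lemma young_le (t A B e : R) : 0 < e -> 0 <= A -> 0 <= B -> t ^+ 2 <= 4 * A * B -> t <= e * B + A / e.
Proof.
move=> e0 A0 B0 h; have r0 : 0 <= e * B + A / e by rewrite addr_ge0// ?mulr_ge0 ?invr_ge0// ltW.
have [/ltW t0|t0] := ltP t 0; first exact: le_trans t0 r0.
rewrite -ler_sqr ?nnegrE//; apply: le_trans h _.
have := sqr_ge0 (e * B - A / e); have -> : 4 * A * B = 4 * (e * B * (A / e)) by field; rewrite gt_eqF.
rewrite sqrrB sqrrD; lra.
Qed.

End axial_vectors.

(** * Bounded operators on the velocity-vorticity space *)

Section mixed_space.
Context {R : realType} {d : nat}.
Local Notation pt := 'rV[R]_d.
Local Notation mu := (lebesgue_row R d).
Context (Omega : set pt) (d23 : d = 2%N \/ d = 3%N).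
Hypotheses (oO : open Omega) (bO : bounded_set Omega).
Let mO := open_measurable_row oO.
Local Notation L2 := (L2 mu Omega).
Local Notation ip := (ip2 mu Omega).
Local Notation pd := (pd Omega).
Local Notation V := (V_space Omega).
Local Notation ess_bounded := (ess_bounded mu Omega).
Local Notation vgip := (@vec_ip R pt (gip Omega) d).
Local Notation cd := (curl_dim d).
Let HL := L2_semi_ip mu mO.

Definition VW := pair_sub V (@vec_sub R pt L2 cd).
Definition VW_ip := pair_ip vgip (@vec_ip R pt ip cd).

Lemma VW_semi_ip : semi_ip VW VW_ip.
Proof. exact: pair_semi_ip (V_semi_ip oO bO) (vec_semi_ip cd HL). Qed.

Local Notation bop := (bounded_op mu Omega VW VW_ip).
Local Notation bform := (bounded_form VW VW_ip).
Local Notation X := ((pt -> pt) * (pt -> 'rV[R]_cd))%type.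

Let d0 : (0 < d)%N.
Proof. by case: d23 => ->. Qed.

Let VW_ip_l (p : X) : VW p -> vgip p.1 p.1 <= VW_ip p p.
Proof. by move=> [_ W]; rewrite /VW_ip /pair_ip lerDl; exact: sip_ge0 (vec_semi_ip cd HL) _ W. Qed.

Let VW_ip_r (p : X) : VW p -> vec_ip ip p.2 p.2 <= VW_ip p p.
Proof. by move=> [Vp _]; rewrite /VW_ip /pair_ip lerDr; exact: sip_ge0 (V_semi_ip oO bO) _ Vp. Qed.

Lemma velocity_op i : bop (fun (p : X) x => p.1 x 0 i).
Proof.
have [C C0 hC] := poincare oO bO d0.
split=> [p [Vp _]|a p q _ _|].
- exact: (H10_W12 oO (Vp i)).1.
- by apply: aeW => x _; rewrite !mxE.
exists C => [|p Sp]; first exact: ltW.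
apply: le_trans (hC _ (Sp.1 i)) _; apply: ler_wpM2l; first exact: ltW.
by apply: le_trans (VW_ip_l Sp); exact: (vec_ip_coord_le (H10_gip oO bO) i Sp.1).
Qed.

Lemma vorticity_op k : bop (fun (p : X) x => p.2 x 0 k).
Proof.
split=> [p [_ W]|a p q _ _|]; [exact: W|by apply: aeW => x _; rewrite !mxE|].
exists 1 => [|p Sp]; first exact: ler01.
by rewrite mul1r; apply: le_trans (VW_ip_r Sp); exact: (vec_ip_coord_le HL k Sp.2).
Qed.

Lemma jac_op i j : bop (fun (p : X) x => jac Omega p.1 x i j).
Proof.
have jE (v : pt -> pt) : (fun x => jac Omega v x i j) = pd i (coordf v j).
  by apply/funext => x; rewrite mxE.
split=> [p [Vp _]|a p q [Vp _] [Vq _]|].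
- by rewrite jE; exact: V_pd_L2.
- apply: filterS (jac_lin oO a Vp Vq) => x h Ox.
  apply: (etrans (congr1 (fun M : 'M[R]_d => M i j) (h Ox))).
  by rewrite [LHS]mxE [X in X + _]mxE.
exists 1 => [|p Sp]; first exact: ler01.
rewrite mul1r jE; apply: le_trans (VW_ip_l Sp).
apply: le_trans (vec_ip_coord_le (H10_gip oO bO) j Sp.1).
exact: pd_ip_le_gip oO bO i _ (H10_W12 oO (Sp.1 j)).
Qed.

Lemma curl_op k : bop (fun (p : X) x => curl Omega p.1 x 0 k).
Proof.
have [r [s e]] := @axialE R d d23.
apply: (@bounded_op_ext _ _ _ _ _ _ _ _ (fun (p : X) x => jac Omega p.1 x (r k) (s k) - jac Omega p.1 x (s k) (r k))).
  by move=> p x; rewrite /curl e.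
by apply: (bounded_op_sub mO); exact: jac_op.
Qed.

Lemma div_op : bop (fun (p : X) => divg Omega p.1).
Proof. by apply: (bounded_op_sum mO) => i; exact: jac_op. Qed.

Definition vbop n (T : X -> pt -> 'rV[R]_n) := forall k, bop (fun p x => T p x 0 k).

Lemma vbop_scale n g (M : R) (T : X -> pt -> 'rV[R]_n) : ess_bounded g M -> vbop T ->
  vbop (fun p x => g x *: T p x).
Proof.
move=> bg bT k; apply: (@bounded_op_ext _ _ _ _ _ _ _ _ (fun p x => g x * T p x 0 k)).
  by move=> p x; rewrite mxE.
exact: (bounded_op_mul mO bg (bT k)).
Qed.

Lemma vbop_add n (T T' : X -> pt -> 'rV[R]_n) : vbop T -> vbop T' -> vbop (fun p x => T p x + T' p x).
Proof.
move=> bT bT' k; apply: (@bounded_op_ext _ _ _ _ _ _ _ _ (fun p x => T p x 0 k + T' p x 0 k)).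
  by move=> p x; rewrite mxE.
exact: (bounded_op_add mO (bT k) (bT' k)).
Qed.

Lemma vbop_sub n (T T' : X -> pt -> 'rV[R]_n) : vbop T -> vbop T' -> vbop (fun p x => T p x - T' p x).
Proof.
move=> bT bT' k; apply: (@bounded_op_ext _ _ _ _ _ _ _ _ (fun p x => T p x 0 k - T' p x 0 k)).
  by move=> p x; rewrite !mxE.
exact: (bounded_op_sub mO (bT k) (bT' k)).
Qed.

Lemma dot_intg n (u v : pt -> 'rV[R]_n) : vec_sub L2 u -> vec_sub L2 v ->
  intg mu Omega (fun x => dot (u x) (v x)).
Proof. by move=> Lu Lv; apply: (intg_sum mO) => i; exact: L2_mul. Qed.

Lemma Rint_dot n (u v : pt -> 'rV[R]_n) : vec_sub L2 u -> vec_sub L2 v ->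
  \int[mu]_(x in Omega) dot (u x) (v x) = vec_ip ip u v.
Proof. by move=> Lu Lv; apply: (Rint_sum mO) => i; exact: L2_mul. Qed.

Lemma vbop_L2 n (T : X -> pt -> 'rV[R]_n) p : vbop T -> VW p -> vec_sub L2 (T p).
Proof. by move=> bT Sp k; have [h _ _] := bT k; exact: h. Qed.

Lemma bform_dot n (T T' : X -> pt -> 'rV[R]_n) : vbop T -> vbop T' ->
  bform (fun p q => \int[mu]_(x in Omega) dot (T p x) (T' q x)).
Proof.
move=> bT bT'.
apply: (@bounded_form_ext _ _ _ _ VW_semi_ip (fun p q => \sum_k ip (fun x => T p x 0 k) (fun x => T' q x 0 k))).
  by move=> p q Sp Sq; rewrite Rint_dot//; exact: vbop_L2.
by apply: (bounded_form_sum VW_semi_ip) => k; exact: (bounded_form_op mO VW_semi_ip (bT k) (bT' k)).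
Qed.

End mixed_space.

(** * Boundedness and coercivity of the mixed form *)

Section mixed_form.
Context {R : realType} {d : nat}.
Local Notation pt := 'rV[R]_d.
Local Notation mu := (lebesgue_row R d).
Context (Omega : set pt) (d23 : d = 2%N \/ d = 3%N).
Hypotheses (oO : open Omega) (bO : bounded_set Omega).
Let mO := open_measurable_row oO.
Local Notation L2 := (L2 mu Omega).
Local Notation ip := (ip2 mu Omega).
Local Notation pd := (pd Omega).
Local Notation V := (V_space Omega).
Local Notation ess_bounded := (ess_bounded mu Omega).
Local Notation vgip := (@vec_ip R pt (gip Omega) d).
Local Notation cd := (curl_dim d).
Local Notation VW := (VW Omega).
Local Notation VW_ip := (VW_ip Omega).
Local Notation bform := (bounded_form VW VW_ip).
Local Notation vbop := (vbop Omega).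
Local Notation X := ((pt -> pt) * (pt -> 'rV[R]_cd))%type.
Let HL := L2_semi_ip mu mO.
Let HX := VW_semi_ip oO bO.

Context (nu sigma : pt -> R) (beta : pt -> pt) (rho1 rho2 : R).
Hypotheses (nuW : in_W1p +oo%E Omega nu) (sL : in_Lp +oo%E Omega sigma)
  (bW : forall i, in_W1p +oo%E Omega (coordf beta i)).

Local Notation gnu := (grad Omega nu).

Let velocity : vbop (fun p : X => p.1).
Proof. by move=> k; exact: velocity_op. Qed.

Let vorticity : vbop (fun p : X => p.2).
Proof. by move=> k; exact: vorticity_op. Qed.

Let curl_vop : vbop (fun p : X => curl Omega p.1).
Proof. by move=> k; exact: curl_op. Qed.

Let nu_b : ess_bounded nu (Lp_norm +oo%E Omega nu).
Proof. by case: nuW => /(in_Lpoo_ess_bounded oO). Qed.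

Let strain_vop : vbop (fun (p : X) x => 2 *: (gnu x *m strain Omega p.1 x)).
Proof.
move=> k; apply: (@bounded_op_ext _ _ _ _ _ _ _ _
  (fun (p : X) x => \sum_i pd i nu x * (jac Omega p.1 x i k + jac Omega p.1 x k i))).
  by move=> p x; rewrite strain_row; apply: eq_bigr => i _; congr (_ * _); rewrite mxE.
apply: (bounded_op_sum mO) => i; have [_ [M bM]] := W1oo_pd oO i nuW.
by apply: (bounded_op_mul mO bM); apply: (bounded_op_add mO); exact: jac_op.
Qed.

Let cross_vop : vbop (fun (p : X) x => cross (gnu x) (p.1 x)).
Proof.
move=> k; have [r [s e]] := @axialE R d d23.
apply: (@bounded_op_ext _ _ _ _ _ _ _ _
  (fun (p : X) x => pd (r k) nu x * p.1 x 0 (s k) - pd (s k) nu x * p.1 x 0 (r k))).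
  by move=> p x; rewrite /cross e !mxE !big_ord1 !mxE.
have [_ [M bM]] := W1oo_pd oO (r k) nuW; have [_ [M' bM']] := W1oo_pd oO (s k) nuW.
by apply: (bounded_op_sub mO); [apply: (bounded_op_mul mO bM)|apply: (bounded_op_mul mO bM')]; exact: velocity_op.
Qed.

Let convect_vop : vbop (fun (p : X) x => convect Omega beta p.1 x).
Proof.
move=> k; apply: (@bounded_op_ext _ _ _ _ _ _ _ _
  (fun (p : X) x => \sum_i beta x 0 i * jac Omega p.1 x i k)).
  by move=> p x; rewrite [RHS]mxE.
apply: (bounded_op_sum mO) => i; have [/(in_Lpoo_ess_bounded oO) bb _] := bW i.
by apply: (bounded_op_mul mO bb); exact: jac_op.
Qed.

Let reaction_vop : vbop (fun (p : X) x => sigma x *: p.1 x).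
Proof. exact: (vbop_scale oO (in_Lpoo_ess_bounded oO sL) velocity). Qed.

Let dotZl n (c : R) (v w : 'rV[R]_n) : dot (c *: v) w = c * dot v w.
Proof. by rewrite mulr_sumr; apply: eq_bigr => i _; rewrite mxE mulrA. Qed.

Let dotC n (v w : 'rV[R]_n) : dot v w = dot w v.
Proof. by apply: eq_bigr => i _; rewrite mulrC. Qed.

Definition A_pair (p q : X) := A_form Omega nu sigma beta rho1 rho2 p.1 p.2 q.1 q.2.

Let bdot := bform_dot oO bO.
Let nu_scale n (T : X -> pt -> 'rV[R]_n) : vbop T -> vbop (fun p x => nu x *: T p x) := vbop_scale oO nu_b.

Lemma A_pair_bounded : bform A_pair.
Proof.
have t1 := bdot strain_vop velocity.
have t2 : bform (fun p q : X => \int[mu]_(x in Omega) (nu x * dot (p.2 x) (curl Omega q.1 x))).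
  apply: (bounded_form_ext HX _ (bdot (nu_scale vorticity) curl_vop)) => p q _ _.
  by apply: eq_Rintegral => x _; rewrite dotZl.
have t3 := bdot vorticity cross_vop.
have t4 : bform (fun p q : X => \int[mu]_(x in Omega) (nu x * dot (p.2 x) (q.2 x))).
  apply: (bounded_form_ext HX _ (bdot (nu_scale vorticity) vorticity)) => p q _ _.
  by apply: eq_Rintegral => x _; rewrite dotZl.
have t5 : bform (fun p q : X => \int[mu]_(x in Omega) (nu x * dot (q.2 x) (curl Omega p.1 x))).
  apply: (bounded_form_ext HX _ (bdot (nu_scale curl_vop) vorticity)) => p q _ _.
  by apply: eq_Rintegral => x _; rewrite dotZl dotC.
have t6 := bdot (vbop_add oO reaction_vop convect_vop) velocity.
have t7 := bdot (vbop_sub oO curl_vop vorticity) curl_vop.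
have t8 : bform (fun p q : X => ip (divg Omega p.1) (divg Omega q.1)).
  by apply: (bounded_form_op mO HX); exact: div_op.
have s1 := bounded_form_add (bounded_form_opp HX t1) t2.
have s2 := bounded_form_add (bounded_form_add s1 t3) t4.
have s3 := bounded_form_add (bounded_form_add s2 (bounded_form_opp HX t5)) t6.
exact: (bounded_form_add (bounded_form_add s3 (bounded_form_scale rho1 t7)) (bounded_form_scale rho2 t8)).
Qed.

(** A crude essential bound [B], assembled from the components, first shows that the norm of the
    gradient is finite, so that [fine] loses nothing. *)
Lemma grad_sqr_le :
  {ae mu, forall x, Omega x -> dot (gnu x) (gnu x) <= Lp_norm +oo%E Omega (fun x => enorm (gnu x)) ^+ 2}.
Proof.
have [M hM] : {M : 'I_d -> R & forall i, ess_bounded (pd i nu) (M i)}.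
  by apply: (@choice _ _ (fun i m => ess_bounded (pd i nu) m)) => i; have [_] := W1oo_pd oO i nuW.
pose B := Num.sqrt (\sum_i M i ^+ 2).
have h : {ae mu, forall x, Omega x -> `|enorm (gnu x)| <= B}.
  apply: filterS (ae_finall (fun i => (hM i).2)) => x h Ox.
  rewrite ger0_norm ?sqrtr_ge0//; apply: ler_wsqrtr; apply: ler_sum => i _.
  have hi := h i Ox; rewrite mxE -expr2 -[X in X <= _]real_normK ?num_real//.
  by rewrite ler_pXn2r ?nnegrE ?(le_trans _ hi).
have B0 : 0 <= B by exact: sqrtr_ge0.
apply: filterS (Lp_norm_oo_ae h B0) => x hx Ox; rewrite -enorm_sqr -[X in X <= _]real_normK ?num_real//.
by have hi := hx Ox; rewrite ler_pXn2r ?nnegrE ?(le_trans _ hi).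
Qed.

Let jac_L2 v i j : V v -> L2 (fun x => jac Omega v x i j).
Proof.
move=> Vv; rewrite (_ : (fun _ => _) = pd i (coordf v j)); first exact: V_pd_L2.
by apply/funext => x; rewrite mxE.
Qed.

Let jac_sqr_intg v : V v -> intg mu Omega (fun x => \sum_i \sum_j jac Omega v x i j ^+ 2).
Proof. by move=> Vv; do 2! apply: (intg_sum mO) => ?; exact: (jac_L2 _ _ Vv).2. Qed.

Lemma Rint_jac_sqr v : V v ->
  \int[mu]_(x in Omega) (\sum_i \sum_j jac Omega v x i j ^+ 2) = vgip v v.
Proof.
move=> Vv; rewrite (Rint_sum mO); last by move=> i; apply: (intg_sum mO) => j; exact: (jac_L2 _ _ Vv).2.
rewrite [RHS]exchange_big/=; apply: eq_bigr => i _.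
rewrite (Rint_sum mO); last by move=> j; exact: (jac_L2 _ _ Vv).2.
by apply: eq_bigr => j _; rewrite ip2_sqr; apply: eq_Rintegral => x _; rewrite mxE.
Qed.

(** Integrate [axial_sqr] for the Jacobian: exchanging derivatives between components of [H^1_0]
    fields turns the trace term into the squared divergence. *)
Lemma curl_div_identity v : V v ->
  \int[mu]_(x in Omega) dot (curl Omega v x) (curl Omega v x) = vgip v v - ip (divg Omega v) (divg Omega v).
Proof.
move=> Vv; have Lp i j := V_pd_L2 oO i j Vv.
have Ijj i j : intg mu Omega (fun x => jac Omega v x i j * jac Omega v x j i).
  exact: (L2_mul mO (jac_L2 i j Vv) (jac_L2 j i Vv)).
rewrite (eq_Rintegral mu (g := fun x => \sum_i \sum_j jac Omega v x i j ^+ 2 - \sum_i \sum_j jac Omega v x i j * jac Omega v x j i)); last first.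
  by move=> x _; exact: axial_sqr.
rewrite (RintB mO (jac_sqr_intg Vv)); last by do 2! apply: (intg_sum mO) => ?.
rewrite Rint_jac_sqr//; congr (_ - _).
rewrite (Rint_sum mO); last by move=> i; apply: (intg_sum mO).
have -> : ip (divg Omega v) (divg Omega v) = \sum_i \sum_j ip (pd i (coordf v i)) (pd j (coordf v j)).
  rewrite /ip2 (eq_Rintegral mu (g := fun x => \sum_i \sum_j pd i (coordf v i) x * pd j (coordf v j) x)); last first.
    move=> x _; rewrite !divgE mulr_suml; apply: eq_bigr => i _; by rewrite mulr_sumr.
  rewrite (Rint_sum mO); last by move=> i; apply: (intg_sum mO) => j; exact: L2_mul.
  by apply: eq_bigr => i _; rewrite (Rint_sum mO)// => j; exact: L2_mul.
apply: eq_bigr => i _; rewrite (Rint_sum mO)//; apply: eq_bigr => j _.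
rewrite (eq_Rintegral mu (g := fun x => pd i (coordf v j) x * pd j (coordf v i) x)); last by move=> x _; rewrite !mxE.
rewrite -[LHS]/(ip (pd i (coordf v j)) (pd j (coordf v i))) (H10_pdC oO bO i j (Vv j) (Vv i)).
exact: sip_sym HL _ _ (Lp j j) (Lp i i).
Qed.

Lemma convect_le v : V v -> `|\int[mu]_(x in Omega) dot (convect Omega beta v x) (v x)| <=
  Lp_norm 2%:E Omega (divg Omega beta) * (vec_ip ip v v + vgip v v).
Proof.
move=> Vv.
have Sv : VW ((v, 0) : X) by split=> //; exact: sub0 (vec_subspace _ HL).
rewrite (Rint_dot oO (vbop_L2 convect_vop Sv) (vbop_L2 velocity Sv)).
rewrite /vec_ip -big_split mulr_sumr/=; apply: le_trans (ler_norm_sum _ _ _) _.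
apply: ler_sum => j _; have := advection_le oO bO d23 bW (Vv j).
rewrite /ip_H1; congr (`|ip _ _| <= _); apply/funext => x.
by rewrite [RHS]mxE; apply: eq_bigr => i _; rewrite mxE.
Qed.

Context (nu0 sigma_min : R).
Let N := Lp_norm +oo%E Omega (fun x => enorm (gnu x)).
Hypotheses (nu0_gt0 : 0 < nu0) (nu_ge : {ae mu, forall x, Omega x -> nu0 <= nu x})
  (sigma_ge : {ae mu, forall x, Omega x -> sigma_min <= sigma x})
  (small : Lp_norm 2%:E Omega (divg Omega beta) < Num.min (sigma_min - 9 * N ^+ 2 / nu0) (nu0 / 12))
  (rho1E : rho1 = 2 / 3 * nu0).

(* Since |curl y| = |grad y| when div y = 0, the [rho1] term yields nu0 / 3 of
   |grad y|^2; Young's inequality spends nu0 / 6 of it on the strain term and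
   nu0 / 12 of |kappa|^2 on the cross term, at the cost of (6 + 3) N^2 / nu0
   of |y|^2. *)
Lemma A_pair_coercive p : VW p -> V0_space Omega p.1 -> nu0 / 12 * VW_ip p p <= A_pair p p.
Proof.
move=> Sp V0p; case: p Sp V0p => y k Sp /= V0y.
have Vy := V0y.1; have Lk : vec_sub L2 k := Sp.2.
have Ly : vec_sub L2 y := vbop_L2 velocity Sp.
have Lc : vec_sub L2 (curl Omega y) := vbop_L2 curl_vop Sp.
pose Y := vec_ip ip y y; pose G := vgip y y; pose K := vec_ip ip k k.
pose CU := \int[mu]_(x in Omega) dot (curl Omega y x) (curl Omega y x).
pose Dv := Lp_norm 2%:E Omega (divg Omega beta).
have div0 : ip (divg Omega y) (divg Omega y) = 0 by apply/(V0_div0 oO Vy).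
have eCU : CU = G by rewrite /CU curl_div_identity// div0 subr0.
have IJ := jac_sqr_intg Vy; have eG : _ = G := Rint_jac_sqr Vy.
have Iyy := dot_intg oO Ly Ly; have Ikk := dot_intg oO Lk Lk; have Icc := dot_intg oO Lc Lc.
have eY : \int[mu]_(x in Omega) dot (y x) (y x) = Y by exact: Rint_dot.
have eK : \int[mu]_(x in Omega) dot (k x) (k x) = K by exact: Rint_dot.
have Y0 : 0 <= Y by rewrite -eY; apply: Rint_ge0 => x _; exact: dot_sqr_ge0.
have K0 : 0 <= K by rewrite -eK; apply: Rint_ge0 => x _; exact: dot_sqr_ge0.
have G0 : 0 <= G by exact: sip_ge0 (V_semi_ip oO bO) _ Vy.
pose q := N ^+ 2 / nu0.
have e1 : \int[mu]_(x in Omega) dot (2 *: (gnu x *m strain Omega y x)) (y x) <= nu0 / 6 * G + 6 * q * Y.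
  rewrite -eY -eG -!RintZ// -RintD//; [|exact: intgZ..].
  apply: (le_Rint_ae mO); first exact: (dot_intg oO (vbop_L2 strain_vop Sp) Ly).
    by apply: intgD => //; exact: intgZ.
  apply: filterS grad_sqr_le => x hx Ox.
  rewrite (_ : 6 * q * _ = (N ^+ 2 * dot (y x) (y x)) / (nu0 / 6)); last by rewrite /q; field; rewrite gt_eqF.
  apply: young_le; [by rewrite divr_gt0|by rewrite mulr_ge0 ?sqr_ge0 ?dot_sqr_ge0| |].
    by do 2! apply: sumr_ge0 => ? _; exact: sqr_ge0.
  apply: le_trans (strain_entries _ _ _) _; apply: ler_wpM2r.
    by do 2! apply: sumr_ge0 => ? _; exact: sqr_ge0.
  by rewrite ler_pM2l// ler_wpM2r ?dot_sqr_ge0//; exact: hx.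
have e2 : - (\int[mu]_(x in Omega) dot (k x) (cross (gnu x) (y x))) <= nu0 / 12 * K + 3 * q * Y.
  have Lx := vbop_L2 cross_vop Sp; have Ix := dot_intg oO Lk Lx.
  rewrite -eY -eK -!RintZ// -RintN// -RintD//; [|exact: intgZ..].
  apply: (le_Rint_ae mO); first exact: intgN.
    by apply: intgD => //; exact: intgZ.
  apply: filterS grad_sqr_le => x hx Ox.
  rewrite (_ : 3 * q * _ = (N ^+ 2 * dot (y x) (y x) / 4) / (nu0 / 12)); last by rewrite /q; field; rewrite gt_eqF.
  have yy := dot_sqr_ge0 (y x); have kk := dot_sqr_ge0 (k x).
  apply: young_le => //; [by rewrite divr_gt0|by rewrite divr_ge0// mulr_ge0 ?sqr_ge0|].
  rewrite sqrrN; apply: le_trans (dot_CS _ _) _.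
  rewrite (_ : 4 * _ * _ = dot (k x) (k x) * (N ^+ 2 * dot (y x) (y x))); last by field.
  apply: ler_wpM2l => //; apply: le_trans (cross_sqr_le d23 _ _) _.
  by apply: ler_wpM2r => //; exact: hx.
have e3 : nu0 * K <= \int[mu]_(x in Omega) (nu x * dot (k x) (k x)).
  have In : intg mu Omega (fun x => nu x * dot (k x) (k x)).
    apply: (intg_eq mO (f := fun x => dot (nu x *: k x) (k x))); first by move=> x _; rewrite dotZl.
    exact: (dot_intg oO (vbop_L2 (nu_scale vorticity) Sp) Lk).
  rewrite -eK -RintZ//; apply: (le_Rint_ae mO) => //; first exact: intgZ.
  by apply: filterS nu_ge => x hx Ox; rewrite ler_wpM2r ?dot_sqr_ge0//; exact: hx.
have e4 : sigma_min * Y - Dv * (Y + G) <=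
    \int[mu]_(x in Omega) dot (sigma x *: y x + convect Omega beta y x) (y x).
  have Is := dot_intg oO (vbop_L2 reaction_vop Sp) Ly.
  have Ic := dot_intg oO (vbop_L2 convect_vop Sp) Ly.
  rewrite (eq_Rintegral mu (g := fun x => dot (sigma x *: y x) (y x) + dot (convect Omega beta y x) (y x))); last first.
    by move=> x _; rewrite /dot -big_split; apply: eq_bigr => i _; rewrite mxE mulrDl.
  rewrite RintD//; have := convect_le Vy; rewrite -/Dv -/Y -/G ler_norml => /andP[h _].
  have : sigma_min * Y <= \int[mu]_(x in Omega) dot (sigma x *: y x) (y x).
    rewrite -eY -RintZ//; apply: (le_Rint_ae mO) => //; first exact: intgZ.
    by apply: filterS sigma_ge => x hx Ox; rewrite dotZl ler_wpM2r ?dot_sqr_ge0//; exact: hx.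
  lra.
(* The difference of the integrands is half of [|curl y - k|^2]. *)
have e5 : CU / 2 - K / 2 <= \int[mu]_(x in Omega) dot (curl Omega y x - k x) (curl Omega y x).
  have -> : CU / 2 - K / 2 = \int[mu]_(x in Omega) (2^-1 * dot (curl Omega y x) (curl Omega y x) - 2^-1 * dot (k x) (k x)).
    by rewrite RintB ?RintZ//; [rewrite -/CU eK; ring|exact: intgZ..].
  apply: (le_Rint mO); [by apply: intgB => //; exact: intgZ| |].
    exact: (dot_intg oO (vbop_L2 (vbop_sub oO curl_vop vorticity) Sp) Lc).
  move=> x _; have := dot_sqr_ge0 (curl Omega y x - k x).
  have eB n (a b c : 'rV[R]_n) : dot (a - b) c = dot a c - dot b c.
    by rewrite /dot -sumrB; apply: eq_bigr => i _; rewrite !mxE mulrBl.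
  rewrite !eB dotC eB (dotC (k x) (_ - _)) eB (dotC (k x)); lra.
have [s1 s2] : Dv < sigma_min - 9 * q /\ Dv < nu0 / 12.
  by move: small; rewrite lt_min -mulrA => /andP.
(* The final balance: [Y] keeps [sigma_min - 9 * q - Dv >= 0], [G] keeps
   [nu0 / 3 - nu0 / 6 - Dv >= nu0 / 12], and [K] keeps [nu0 - nu0 / 3 - nu0 / 12], which exceeds
   [nu0 / 12]. *)
have h1 : 0 <= (sigma_min - 9 * q - Dv) * Y by rewrite mulr_ge0// subr_ge0 ltW.
have h2 : 0 <= (nu0 / 12 - Dv) * G by rewrite mulr_ge0// subr_ge0 ltW.
have h3 : 0 <= nu0 * K by rewrite mulr_ge0// ltW.
have h4 : rho1 * (CU / 2 - K / 2) <= rho1 * \int[mu]_(x in Omega) dot (curl Omega y x - k x) (curl Omega y x).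
  by apply: ler_wpM2l => //; rewrite rho1E mulr_ge0// ltW.
have -> : VW_ip (y, k) (y, k) = G + K by [].
(* On the diagonal the two terms coupling [kappa] and the curl with weight [nu] cancel, and the
   [rho2] term vanishes with the divergence. *)
rewrite /A_pair /A_form /= -[\int[_]_(x in _) (divg _ _ _ * _)]/(ip (divg Omega y) (divg Omega y)) div0 mulr0.
rewrite eCU rho1E in h4; rewrite -!rho1E in h4 *.
move: h4 e1 e2 e3 e4; rewrite rho1E.
set a1 := \int[mu]_(x in Omega) _; set a2 := \int[mu]_(x in Omega) _; set a3 := \int[mu]_(x in Omega) _.
lra.
Qed.

End mixed_form.

(** * The optimal control problem *)

Section tracking.
Context {R : realType} (V : lmodType R) (S : V -> Prop) (ip : V -> V -> R)
  (Z : lmodType R) (SZ : Z -> Prop) (ipZ : Z -> Z -> R).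
Hypotheses (H : semi_ip S ip) (HZ : semi_ip SZ ipZ).
Context (T : V -> Z) (zd : Z) (g C : R).
Hypotheses (TS : forall u, S u -> SZ (T u)) (Szd : SZ zd) (g0 : 0 < g) (C0 : 0 <= C).
(** The solution operator is affine only up to null elements, because it selects a representative
    for each control independently. *)
Hypothesis T_mid : forall u v, S u -> S v ->
  let r := T (2^-1 *: (u + v)) - 2^-1 *: (T u + T v) in ipZ r r = 0.
Hypothesis T_lip : forall u v, S u -> S v ->
  ipZ (T u - T v) (T u - T v) <= C * ip (u - v) (u - v).
Let HS := sip_sub H.
Let HSZ := sip_sub HZ.

Definition tracking u : R := 2^-1 * ipZ (T u - zd) (T u - zd) + g / 2 * ip u u.

Let mid_le (W : lmodType R) (SW : W -> Prop) (ipW : W -> W -> R) (HW : semi_ip SW ipW) a b : SW a -> SW b ->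
  ipW (2^-1 *: (a + b)) (2^-1 *: (a + b)) = (ipW a a + ipW b b) / 2 - 4^-1 * ipW (a - b) (a - b).
Proof.
move=> Sa Sb; rewrite scalerDr (ip_quad HW) // (ip_sqrB HW)//.
by move: (ipW a a) (ipW b b) (ipW a b) => x y z; lra.
Qed.

Lemma tracking_mid u v : S u -> S v ->
  tracking (2^-1 *: (u + v)) <= (tracking u + tracking v) / 2 - g / 8 * ip (u - v) (u - v).
Proof.
move=> Su Sv; pose a := T u - zd; pose b := T v - zd; pose m := 2^-1 *: (a + b).
have Sa : SZ a by apply: subB => //; exact: TS.
have Sb : SZ b by apply: subB => //; exact: TS.
have Sm : SZ m by apply: subZ => //; exact: subD.
have Suv : S (2^-1 *: (u + v)) by apply: subZ => //; exact: subD.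
pose r := T (2^-1 *: (u + v)) - 2^-1 *: (T u + T v).
have Sr : SZ r.
  apply: subB => //; first exact: TS.
  by apply: subZ => //; apply: subD => //; exact: TS.
have r0 : ipZ r r = 0 by exact: T_mid.
have e : T (2^-1 *: (u + v)) - zd = r + m.
  rewrite /r /m /a /b addrACA -opprD scalerBr -mulr2n.
  have -> : 2^-1 *: (zd *+ 2) = zd by rewrite -(scaler_nat 2 zd) scalerA mulVf ?scale1r// pnatr_eq0.
  by rewrite addrA subrK.
have h : ipZ (r + m) (r + m) <= (ipZ a a + ipZ b b) / 2.
  rewrite (ip_sqrD HZ)// r0 (ip0_eq0 HZ Sr Sm r0) mulr0 !add0r /m (mid_le HZ)//.
  by have := sip_ge0 HZ (subB HSZ Sa Sb); lra.
rewrite /tracking e (mid_le H)// -/a -/b.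
move: h; move: (ipZ _ _) (ipZ _ _) (ipZ _ _) (ip _ _) (ip _ _) (ip _ _) => x y z p q s h.
lra.
Qed.

Context (K : V -> Prop).
Hypotheses (KS : forall u, K u -> S u) (K_mid : forall u v, K u -> K v -> K (2^-1 *: (u + v)))
  (K_closed : forall u_ l, (forall n, K (u_ n)) -> S l -> cvg_ip ip u_ l -> K l)
  (K0 : exists u, K u).

Lemma tracking_min : complete_ip S ip -> exists2 u, K u & forall w, K w -> tracking u <= tracking w.
Proof.
move=> cpl; apply: (@strongly_convex_min _ _ S ip K tracking (g / 8) 0) => //.
- by rewrite divr_gt0.
- move=> u /KS Su; have Sd : SZ (T u - zd) by apply: subB => //; exact: TS.
  have h1 := sip_ge0 HZ Sd; have h2 := mulr_ge0 (ltW g0) (sip_ge0 H Su).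
  by rewrite /tracking; lra.
- by move=> u v Ku Kv; split; [exact: K_mid|apply: tracking_mid; exact: KS].
move=> u_ l Ku Sl ul; have Su n := KS (Ku n); split; first exact: K_closed ul.
move=> e e0; have e2 : 0 < e / (1 + g) by rewrite divr_gt0// addr_gt0.
have [N1 HN1] := cvg_ip_sqr H Su Sl ul e2.
have SZn n : SZ (T (u_ n) - zd) by apply: subB => //; exact: TS.
have SZl : SZ (T l - zd) by apply: subB => //; exact: TS.
have Tul : cvg_ip ipZ (fun n => T (u_ n) - zd) (T l - zd).
  move=> t t0; have [|N HN] := ul (t / (C + 1)); first by rewrite divr_gt0// ltr_wpDl.
  exists N => n /HN; rewrite ltr_pdivlMr ?ltr_wpDl// opprB addrA subrK => h.
  apply: le_lt_trans (T_lip (Su n) Sl) _; apply: le_lt_trans h.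
  by rewrite mulrC ler_wpM2l ?lerDl//; exact: sip_ge0 H _ (subB HS (Su n) Sl).
have [N2 HN2] := cvg_ip_sqr HZ SZn SZl Tul e2.
exists (maxn N1 N2) => n; rewrite geq_max => /andP[/HN1 h1 /HN2 h2].
have eE : e = (1 + g) * (e / (1 + g)) by rewrite mulrC divfK// gt_eqF// addr_gt0.
rewrite /tracking [X in _ <= _ + X]eE.
move: h1 h2 e2; rewrite !ltr_norml.
move: (ipZ _ _) (ipZ _ _) (ip _ _) (ip _ _) (e / (1 + g)) => x y p q t /andP[h1 _] /andP[h2 _] t0.
have : g / 2 * (p - q) <= g / 2 * t by apply: ler_wpM2l; rewrite ?divr_ge0 ?ltW//; lra.
have : 0 <= g * t by rewrite mulr_ge0 ?ltW.
lra.
Qed.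

Lemma tracking_min_uniq u w : K u -> K w -> (forall v, K v -> tracking u <= tracking v) ->
  (forall v, K v -> tracking w <= tracking v) -> ip (u - w) (u - w) = 0.
Proof.
move=> Ku Kw hu hw; have := hu _ (K_mid Ku Kw); have := tracking_mid (KS Ku) (KS Kw).
have := hw _ Ku => h1 h2 h3.
have p0 := sip_ge0 H (subB HS (KS Ku) (KS Kw)).
apply/eqP; rewrite eq_le p0 andbT -(@ler_pM2l _ (g / 8)) ?divr_gt0// mulr0; lra.
Qed.

End tracking.

(** * Existence, stability and uniqueness of the state *)

Section state_equation.
Context {R : realType} {d : nat}.
Local Notation pt := 'rV[R]_d.
Local Notation mu := (lebesgue_row R d).
Context (Omega : set pt) (d23 : d = 2%N \/ d = 3%N).
Hypotheses (oO : open Omega) (bO : bounded_set Omega).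
Let mO := open_measurable_row oO.
Local Notation L2 := (L2 mu Omega).
Local Notation ip := (ip2 mu Omega).
Local Notation V := (V_space Omega).
Local Notation V0 := (V0_space Omega).
Local Notation vgip := (@vec_ip R pt (gip Omega) d).
Local Notation cd := (curl_dim d).
Local Notation VW := (VW Omega).
Local Notation VW_ip := (VW_ip Omega).
Local Notation X := ((pt -> pt) * (pt -> 'rV[R]_cd))%type.
Let HL := L2_semi_ip mu mO.
Let HV := V_semi_ip oO bO.

Let d0 : (0 < d)%N.
Proof. by case: d23 => ->. Qed.

Lemma in_L2P n (v : pt -> 'rV[R]_n) : in_L2 Omega v <-> vec_sub L2 v.
Proof. by split=> h i; apply/(in_Lp2P mO); exact: h. Qed.

Lemma L2_norm_sqr n (v : pt -> 'rV[R]_n) : vec_sub L2 v -> L2_norm Omega v ^+ 2 = vec_ip ip v v.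
Proof.
move=> Lv; have Id := dot_intg oO Lv Lv.
have Le : L2 (fun x => enorm (v x)).
  split.
    have ms : measurable_fun (setT : set (measurableTypeR R)) (@Num.sqrt R).
      by apply: continuous_measurable_fun; exact: sqrt_continuous.
    exact: (measurableT_comp ms (intg_mf Id)).
  by apply: (intg_eq mO _ Id) => x _; rewrite enorm_sqr.
rewrite /L2_norm (Lp_norm_sqr Le) ip2_sqr -(Rint_dot oO Lv Lv).
by apply: eq_Rintegral => x _; rewrite enorm_sqr.
Qed.

Lemma L2_innerE n (u v : pt -> 'rV[R]_n) : vec_sub L2 u -> vec_sub L2 v ->
  L2_inner Omega u v = vec_ip ip u v.
Proof. exact: Rint_dot. Qed.

Lemma vec_ip_eq0_ae n (u v : pt -> 'rV[R]_n) : vec_sub L2 u -> vec_sub L2 v ->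
  vec_ip ip (u - v) (u - v) = 0 -> ae_eq mu Omega u v.
Proof.
move=> Lu Lv h; have HW := vec_semi_ip n HL.
have Luv := subB (sip_sub HW) Lu Lv.
have hi i : {ae mu, forall x, Omega x -> (u - v) x 0 i = 0}.
  apply: (ip2_eq0_ae mO (Luv i)); apply/eqP; rewrite eq_le (sip_ge0 HL (Luv i)) andbT.
  by apply: le_trans (vec_ip_coord_le HL i Luv) _; rewrite h.
apply: filterS (ae_finall hi) => x hx Ox; apply/rowP => i.
by have := hx i Ox; rewrite !fctE !mxE => /eqP; rewrite subr_eq0 => /eqP.
Qed.

Lemma velocity_le : exists2 C : R, 0 <= C & forall v, V v -> vec_ip ip v v <= C * vgip v v.
Proof.
have [C C0 hC] := poincare oO bO d0; exists C; first exact: ltW.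
by move=> v Vv; rewrite mulr_sumr; apply: ler_sum => i _; exact: hC (Vv i).
Qed.

Lemma V_L2 v : V v -> vec_sub L2 v.
Proof. by move=> Vv i; exact: (H10_W12 oO (Vv i)).1. Qed.

Lemma V0_subspace : subspace V0.
Proof.
split.
  apply/(V0_div0 oO (sub0 (sip_sub HV))).
  have := ip_div_bound oO bO (div_L2 oO (sub0 (sip_sub HV))) (sub0 (sip_sub HV)).
  rewrite (lin0 (sip_sub HV) (ip_linl HV (sub0 (sip_sub HV)))) mulr0 => h.
  by apply/eqP; rewrite -sqrf_eq0 eq_le h sqr_ge0.
move=> a u v [Vu u0] [Vv v0]; split; first exact: subDZ (sip_sub HV) _ _ _ Vu Vv.
move: (div_lin oO a Vu Vv) u0 v0; apply: filterS3 => x h hu hv Ox.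
by rewrite h// -[LHS]/(a * divg Omega u x + divg Omega v x) hu// hv// mulr0 addr0.
Qed.

(** With [D] the divergence of the limit, [v |-> (D, div v)] is continuous and vanishes along the
    sequence, so [D] is orthogonal to itself. *)
Lemma V0_complete : complete_ip V0 vgip.
Proof.
move=> u_ Vu Cu; have [l Vl ul] := V_complete d0 oO bO (fun n => (Vu n).1) Cu.
exists l => //; apply/(V0_div0 oO Vl); have Ld := div_L2 oO Vl.
set D := divg Omega l in Ld *.
have hh (e : R) : 0 < e -> `|ip D D| <= 0 + e.
  move=> e0; have M0 : 0 <= ip D D * d%:R by rewrite mulr_ge0//; exact: sip_ge0 HL _ Ld.
  have [N /(_ N (leqnn N))] := cvg_ip_lin HV (ip_div_lin oO bO Ld) M0
    (fun v Vv => ip_div_bound oO bO Ld Vv) (fun n => (Vu n).1) Vl ul e0.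
  rewrite (_ : ip D (divg Omega (u_ N)) = 0) ?sub0r ?normrN ?add0r; first exact: ltW.
  have Lu := div_L2 oO (Vu N).1; have z := (V0_div0 oO (Vu N).1).1 (Vu N).
  by rewrite (sip_sym HL Ld Lu) (ip0_eq0 HL Lu Ld z).
by apply/eqP; rewrite -normr_le0; apply/ler_addgt0Pr => e; exact: hh.
Qed.

Definition V0W := pair_sub V0 (@vec_sub R pt L2 cd).

Lemma V0W_VW (p : X) : V0W p -> VW p.
Proof. by move=> [[]]. Qed.

Lemma V0_semi_ip : semi_ip V0 vgip.
Proof. by apply: (semi_ip_sub HV V0_subspace) => v []. Qed.

Lemma V0W_semi_ip : semi_ip V0W VW_ip.
Proof. exact: pair_semi_ip V0_semi_ip (vec_semi_ip cd HL). Qed.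

Lemma V0W_complete : complete_ip V0W VW_ip.
Proof.
apply: (pair_complete V0_semi_ip (vec_semi_ip cd HL) V0_complete).
exact: (vec_complete HL (L2_complete mO)).
Qed.

Context (nu sigma : pt -> R) (beta : pt -> pt) (rho1 rho2 nu0 sigma_min : R).
Hypotheses (nuW : in_W1p +oo%E Omega nu) (sL : in_Lp +oo%E Omega sigma)
  (bW : forall i, in_W1p +oo%E Omega (coordf beta i)) (nu0_gt0 : 0 < nu0)
  (nu_ge : {ae mu, forall x, Omega x -> nu0 <= nu x})
  (sigma_ge : {ae mu, forall x, Omega x -> sigma_min <= sigma x})
  (small : Lp_norm 2%:E Omega (divg Omega beta) < Num.min
    (sigma_min - 9 * Lp_norm +oo%E Omega (fun x => enorm (grad Omega nu x)) ^+ 2 / nu0) (nu0 / 12))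
  (rho1E : rho1 = 2 / 3 * nu0).

Local Notation A := (A_pair Omega nu sigma beta rho1 rho2).
Local Notation state := (is_state Omega nu sigma beta rho1 rho2).
Let A_b := A_pair_bounded d23 oO bO rho1 rho2 nuW sL bW.

Let A_coercive (p : X) : V0W p -> nu0 / 12 * VW_ip p p <= A p p.
Proof.
by move=> Sp; apply: (A_pair_coercive d23 oO bO rho2 nuW sL bW nu0_gt0 nu_ge sigma_ge small rho1E (V0W_VW Sp) Sp.1).
Qed.

Lemma stateP F (p : X) : vec_sub L2 F -> state F p.1 p.2 <->
  V0W p /\ forall q : X, V0W q -> A p q = vec_ip ip F q.1.
Proof.
move=> LF; split=> [[Vy Wk h]|[[Vy Wk] h]].
  have Sp : V0W p by split=> //; exact/in_L2P.
  split=> // q [Vq Lq]; rewrite -(L2_innerE LF (V_L2 Vq.1)); apply: h => //; exact/in_L2P.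
split=> // [|v t Vv Wt]; first exact/in_L2P.
have Lt : vec_sub L2 t by exact/in_L2P.
by rewrite (L2_innerE LF (V_L2 Vv.1)); exact: (h (v, t)).
Qed.

Let vip_lin F : vec_sub L2 F -> lin_on V (fun v => vec_ip ip F v).
Proof.
by move=> LF a u v Vu Vv; exact: (ip_linr (vec_semi_ip d HL) LF a (V_L2 Vu) (V_L2 Vv)).
Qed.

Let vip_bound F : vec_sub L2 F -> exists2 M : R, 0 <= M & forall v, V v -> vec_ip ip F v ^+ 2 <= M * vgip v v.
Proof.
move=> LF; have [C C0 hC] := velocity_le; have HW := vec_semi_ip d HL.
have f0 := sip_ge0 HW LF; exists (vec_ip ip F F * C); first exact: mulr_ge0.
move=> v Vv; apply: le_trans (ip_CS HW LF (V_L2 Vv)) _.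
by rewrite -mulrA ler_wpM2l// hC.
Qed.

Lemma state_exists F : vec_sub L2 F -> exists p : X, state F p.1 p.2.
Proof.
move=> LF; have [M M0 hM] := vip_bound LF; have [l1 l2 [K K0 hK]] := A_b.
have hb (u : X) : V0W u -> vec_ip ip F u.1 ^+ 2 <= M * VW_ip u u.
  move=> Su; apply: le_trans (hM _ (V0W_VW Su).1) _; apply: ler_wpM2l => //.
  by rewrite -[VW_ip u u]/(vgip u.1 u.1 + vec_ip ip u.2 u.2) lerDl; exact: sip_ge0 (vec_semi_ip cd HL) _ Su.2.
have [p Sp hp] := @lax_milgram _ _ V0W VW_ip A K (nu0 / 12) M (fun q : X => vec_ip ip F q.1)
  V0W_semi_ip V0W_complete K0 (divr_gt0 nu0_gt0 (ltr0n _ 12))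
  (fun w Sw a u v Su Sv => l1 w (V0W_VW Sw) a u v (V0W_VW Su) (V0W_VW Sv))
  (fun w Sw a u v Su Sv => l2 w (V0W_VW Sw) a u v (V0W_VW Su) (V0W_VW Sv))
  (fun u v Su Sv => hK u v (V0W_VW Su) (V0W_VW Sv)) A_coercive
  (fun a u v Su Sv => vip_lin LF a (V0W_VW Su).1 (V0W_VW Sv).1) hb.
by exists p; apply/(stateP _ LF).
Qed.

(** Test with the state itself: [c |p|^2 <= A p p = (F, y) <= |F| |y|], and the Poincare inequality
    bounds [|y|] by [|p|]. Applied to differences of states, this gives uniqueness as well as
    continuity in the source. *)
Lemma state_stable : exists2 C : R, 0 <= C & forall F (p : X), vec_sub L2 F -> state F p.1 p.2 ->
  vec_ip ip p.1 p.1 + vec_ip ip p.2 p.2 <= C * vec_ip ip F F.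
Proof.
have [C C0 hC] := velocity_le; have HW := vec_semi_ip d HL.
pose c := nu0 / 12; have c0 : 0 < c by rewrite divr_gt0.
exists ((C + 1) * (C / c ^+ 2)); first by rewrite mulr_ge0 ?addr_ge0// divr_ge0// sqr_ge0.
move=> F p LF /(stateP _ LF)[Sp hp].
have f0 := sip_ge0 HW LF; have Vp := (V0W_VW Sp).1; have t0 := sip_ge0 V0W_semi_ip Sp.
have k0 := sip_ge0 (vec_semi_ip cd HL) Sp.2; have g0 := sip_ge0 HV Vp.
have tE : VW_ip p p = vgip p.1 p.1 + vec_ip ip p.2 p.2 by [].
have h1 := A_coercive Sp; rewrite (hp _ Sp) -/c in h1.
have h2 := ip_CS HW LF (V_L2 Vp); have h3 := hC _ Vp.
have h4 : VW_ip p p <= C / c ^+ 2 * vec_ip ip F F.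
  have [t_eq0|tn0] := eqVneq (VW_ip p p) 0.
    by rewrite t_eq0 mulr_ge0// divr_ge0// sqr_ge0.
  have tp : 0 < VW_ip p p by rewrite lt_def tn0.
  rewrite mulrAC ler_pdivlMr ?exprn_gt0//.
  rewrite -(ler_pM2r tp); apply: (@le_trans _ _ (vec_ip ip F p.1 ^+ 2)).
    have -> : VW_ip p p * c ^+ 2 * VW_ip p p = (c * VW_ip p p) ^+ 2 by ring.
    by rewrite ler_pXn2r ?nnegrE ?(le_trans _ h1)// mulr_ge0// ltW.
  apply: le_trans h2 _; rewrite (mulrC C) -mulrA; apply: ler_wpM2l => //.
  by apply: le_trans h3 _; apply: ler_wpM2l => //; rewrite tE lerDl.
apply: (@le_trans _ _ ((C + 1) * VW_ip p p)).
  by rewrite tE mulrDl mul1r; apply: lerD; [apply: le_trans h3 _; rewrite ler_wpM2l// lerDl|rewrite lerDr].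
by rewrite -mulrA ler_wpM2l// addr_ge0.
Qed.

Lemma state_lin a F F' (p q : X) : vec_sub L2 F -> vec_sub L2 F' ->
  state F p.1 p.2 -> state F' q.1 q.2 -> state (a *: F + F') (a *: p + q).1 (a *: p + q).2.
Proof.
move=> LF LF' /(stateP _ LF)[Sp hp] /(stateP _ LF')[Sq hq]; have HW := vec_semi_ip d HL.
apply/(stateP _ (subDZ (sip_sub HW) a LF LF')); split; first exact: subDZ (sip_sub V0W_semi_ip) _ _ _ Sp Sq.
move=> r Sr; have [l1 _ _] := A_b.
rewrite (l1 _ (V0W_VW Sr) a p q (V0W_VW Sp) (V0W_VW Sq)) hp// hq//.
by rewrite -(sip_lin HW a LF LF' (V_L2 (V0W_VW Sr).1)).
Qed.

Lemma state_uniq F (p q : X) : vec_sub L2 F -> state F p.1 p.2 -> state F q.1 q.2 ->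
  ae_eq mu Omega p.1 q.1 /\ ae_eq mu Omega p.2 q.2.
Proof.
move=> LF sp sq; have HW := vec_semi_ip d HL; have HK := vec_semi_ip cd HL.
have [C C0 hC] := state_stable.
have := hC _ _ (subDZ (sip_sub HW) (-1) LF LF) (state_lin (-1) LF LF sq sp).
have -> : -1 *: F + F = 0 by rewrite scaleN1r addNr.
rewrite (lin0 (sip_sub HW) (ip_linl HW (sub0 (sip_sub HW)))) mulr0.
have [Sp _] := (stateP p LF).1 sp; have [Sq _] := (stateP q LF).1 sq.
have Lp1 := V_L2 (V0W_VW Sp).1; have Lq1 := V_L2 (V0W_VW Sq).1.
rewrite -[(-1 *: q + p).1]/(-1 *: q.1 + p.1) -[(-1 *: q + p).2]/(-1 *: q.2 + p.2) !scaleN1r ![- _ + _]addrC.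
have h1 := sip_ge0 HW (subB (sip_sub HW) Lp1 Lq1); have h2 := sip_ge0 HK (subB (sip_sub HK) Sp.2 Sq.2).
move=> h; split.
  by apply: vec_ip_eq0_ae => //; apply/eqP; rewrite eq_le h1 andbT; lra.
by apply: vec_ip_eq0_ae; [exact: Sp.2|exact: Sq.2|]; apply/eqP; rewrite eq_le h2 andbT; lra.
Qed.

End state_equation.

(** * Existence and uniqueness of the optimal control *)

Section optimal_control.
Context {R : realType} {d : nat}.
Local Notation pt := 'rV[R]_d.
Local Notation mu := (lebesgue_row R d).
Context (Omega : set pt) (d23 : d = 2%N \/ d = 3%N).
Hypotheses (oO : open Omega) (bO : bounded_set Omega).
Let mO := open_measurable_row oO.
Let fO := bounded_row_lty mO bO.
Local Notation L2 := (L2 mu Omega).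
Local Notation ip := (ip2 mu Omega).
Local Notation cd := (curl_dim d).
Local Notation X := ((pt -> pt) * (pt -> 'rV[R]_cd))%type.
Local Notation L2v n := (@vec_sub R pt L2 n).
Local Notation vip n := (@vec_ip R pt ip n).
Let HL := L2_semi_ip mu mO.

Lemma admissible_L2 a b (u : pt -> pt) : admissible Omega a b u -> L2v d u.
Proof. by move=> [/(in_L2P oO)]. Qed.

Lemma admissible_mid a b (u v : pt -> pt) : admissible Omega a b u -> admissible Omega a b v ->
  admissible Omega a b (2^-1 *: (u + v)).
Proof.
move=> Ku Kv; have Lu := admissible_L2 Ku; have Lv := admissible_L2 Kv.
have HW := sip_sub (vec_semi_ip d HL).
split; first by apply/(in_L2P oO); exact: subZ HW _ _ (subD HW Lu Lv).
move=> i; move: (Ku.2 i) (Kv.2 i); apply: filterS2 => x hu hv Ox.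
have -> : (2^-1 *: (u + v)) x 0 i = 2^-1 * (u x 0 i + v x 0 i) by rewrite !fctE !mxE.
by have /andP[? ?] := hu Ox; have /andP[? ?] := hv Ox; apply/andP; split; lra.
Qed.

(** Convergence in mean square does not preserve pointwise bounds directly; they pass to the limit
    along an almost everywhere convergent subsequence of each component. *)
Lemma admissible_closed a b (u_ : nat -> pt -> pt) l : (forall n, admissible Omega a b (u_ n)) ->
  L2v d l -> cvg_ip (vip d) u_ l -> admissible Omega a b l.
Proof.
move=> Ku Ll ul; split; first exact/(in_L2P oO).
have Lu n := admissible_L2 (Ku n); have HW := sip_sub (vec_semi_ip d HL).
move=> i; have uli : cvg_ip ip (fun n x => u_ n x 0 i) (fun x => l x 0 i).
  move=> e e0; have [N HN] := ul e e0; exists N => n /HN h.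
  apply: le_lt_trans h; have := vec_ip_coord_le HL i (subB HW (Lu n) Ll).
  by congr (ip _ _ <= _); apply/funext => x; rewrite !fctE !mxE.
have [s hs] := L2_cvg_subseq_ae mO (fun n => Lu n i) (Ll i) uli.
have hb := ae_foralln (fun n => (Ku (s n)).2 i).
apply: filterS2 hs hb => x hx hn Ox; have cx := hx Ox.
have cv : cvg ((fun n => u_ (s n) x 0 i) @ \oo) by apply/cvg_ex; exists (l x 0 i).
have e : lim ((fun n => u_ (s n) x 0 i) @ \oo) = l x 0 i by exact: cvg_lim.
rewrite -e; apply/andP; split.
  by apply: limr_ge => //; apply: nearW => n; case/andP: (hn n Ox).
by apply: limr_le => //; apply: nearW => n; case/andP: (hn n Ox).
Qed.

Lemma admissible_nonempty (a b : pt) : (forall i, a 0 i < b 0 i) -> exists u, admissible Omega a b u.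
Proof.
move=> ab; exists (fun=> a); split.
  by apply/(in_L2P oO) => i; exact: L2_cst mO _ fO.
by move=> i; apply: aeW => x _; rewrite lexx ltW.
Qed.

Context (nu sigma : pt -> R) (beta : pt -> pt) (rho1 rho2 nu0 sigma_min : R).
Hypotheses (nuW : in_W1p +oo%E Omega nu) (sL : in_Lp +oo%E Omega sigma)
  (bW : forall i, in_W1p +oo%E Omega (coordf beta i)) (nu0_gt0 : 0 < nu0)
  (nu_ge : {ae mu, forall x, Omega x -> nu0 <= nu x})
  (sigma_ge : {ae mu, forall x, Omega x -> sigma_min <= sigma x})
  (small : Lp_norm 2%:E Omega (divg Omega beta) < Num.min
    (sigma_min - 9 * Lp_norm +oo%E Omega (fun x => enorm (grad Omega nu x)) ^+ 2 / nu0) (nu0 / 12))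
  (rho1E : rho1 = 2 / 3 * nu0).

Local Notation state := (is_state Omega nu sigma beta rho1 rho2).

Context (f yd : pt -> pt) (kd : pt -> 'rV[R]_cd) (gamma : R) (Sy : (pt -> pt) -> pt -> pt)
  (Sk : (pt -> pt) -> pt -> 'rV[R]_cd).
Hypotheses (Lf : L2v d f) (Lyd : L2v d yd) (Lkd : L2v cd kd) (gamma_gt0 : 0 < gamma)
  (solve : forall u, L2v d u -> state (f + u) (Sy u) (Sk u)).

Let T u : X := (Sy u, Sk u).
Let HW := vec_semi_ip d HL.
Let HK := vec_semi_ip cd HL.
Let SZ := pair_sub (L2v d) (L2v cd).
Let ipZ := pair_ip (vip d) (vip cd).
Let HZ : semi_ip SZ ipZ := pair_semi_ip HW HK.

Let T_L2 u : L2v d u -> SZ (T u).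
Proof.
move=> Lu; have [V0y Wk _] := solve Lu.
by split; [exact: V_L2 oO _ V0y.1|exact/(in_L2P oO)].
Qed.

Let stable : exists2 C : R, 0 <= C & forall F (p : X), L2v d F -> state F p.1 p.2 ->
  ipZ p p <= C * vip d F F.
Proof. exact: (state_stable d23 oO bO rho2 nuW sL bW nu0_gt0 nu_ge sigma_ge small rho1E). Qed.

Let state_comb c F F' (p q : X) : L2v d F -> L2v d F' ->
  state F p.1 p.2 -> state F' q.1 q.2 -> state (c *: F + F') (c *: p + q).1 (c *: p + q).2.
Proof. exact: (state_lin d23 oO bO nuW sL bW). Qed.

Let Lfu u : L2v d u -> L2v d (f + u).
Proof. by move=> Lu; exact: subD (sip_sub HW) _ _ Lf Lu. Qed.

Let T_diff u v : L2v d u -> L2v d v -> state (u - v) (T u - T v).1 (T u - T v).2.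
Proof.
move=> Lu Lv; have := state_comb (-1) (p := T v) (q := T u) (Lfu Lv) (Lfu Lu) (solve Lv) (solve Lu).
rewrite (_ : -1 *: (f + v) + (f + u) = u - v); last first.
  by rewrite scaleN1r opprD [- f - v]addrC -addrA addKr addrC.
by rewrite (_ : -1 *: T v + T u = T u - T v)// scaleN1r addrC.
Qed.

Lemma cost_tracking u : L2v d u ->
  cost Omega Sy Sk yd kd gamma u = tracking (vip d) ipZ T (yd, kd) gamma u.
Proof.
move=> Lu; have [Ly Lk] := T_L2 Lu.
have h1 := subB (sip_sub HW) Ly Lyd; have h2 := subB (sip_sub HK) Lk Lkd.
rewrite /cost (L2_norm_sqr oO h1) (L2_norm_sqr oO h2) (L2_norm_sqr oO Lu) /tracking.
by rewrite /ipZ /pair_ip mulrDr.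
Qed.

Lemma optimal_control (a b : pt) : (forall i, a 0 i < b 0 i) -> exists ubar,
  minimizer (admissible Omega a b) (cost Omega Sy Sk yd kd gamma) ubar /\
  forall u, minimizer (admissible Omega a b) (cost Omega Sy Sk yd kd gamma) u -> ae_eq mu Omega u ubar.
Proof.
move=> ab; have [C C0 hC] := stable.
have Lz : SZ (yd, kd) by split.
have T_lip u v : L2v d u -> L2v d v -> ipZ (T u - T v) (T u - T v) <= C * vip d (u - v) (u - v).
  by move=> Lu Lv; apply: hC (T_diff Lu Lv); exact: subB (sip_sub HW) _ _ Lu Lv.
have T_mid u v : L2v d u -> L2v d v ->
    let r := T (2^-1 *: (u + v)) - 2^-1 *: (T u + T v) in ipZ r r = 0.
  move=> Lu Lv r; pose m : pt -> pt := 2^-1 *: (u + v).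
  have Lm : L2v d m by exact: subZ (sip_sub HW) _ _ (subD (sip_sub HW) Lu Lv).
  have s1 := T_diff Lm Lu; have s2 := T_diff Lm Lv.
  have L1 := subB (sip_sub HW) Lm Lu; have L2' := subB (sip_sub HW) Lm Lv.
  (* Twice the defect [r] is the sum of [T m - T u] and [T m - T v], a state for the source
     [(m - u) + (m - v) = 0]; stability makes it null. *)
  have s3 := state_comb 1 (p := T m - T u) (q := T m - T v) L1 L2' s1 s2.
  have L3 := subDZ (sip_sub HW) 1 L1 L2'.
  have := hC _ _ L3 s3.
  have -> : 1 *: (m - u) + (m - v) = 0.
    apply/funext => x; apply/rowP => i; rewrite /m !fctE !mxE; lra.
  rewrite (lin0 (sip_sub HW) (ip_linl HW (sub0 (sip_sub HW)))) mulr0.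
  rewrite scale1r (_ : T m - T u + (T m - T v) = 2 *: r); last first.
    rewrite /r -/m scalerBr scalerA divff ?pnatr_eq0// scale1r scaler_nat mulr2n opprD; exact: addrACA.
  have Sr : SZ r.
    apply: subB (sip_sub HZ) _ _ (T_L2 Lm) _.
    exact: subZ (sip_sub HZ) _ _ (subD (sip_sub HZ) (T_L2 Lu) (T_L2 Lv)).
  have := ip_quad HZ 2 0 Sr Sr; rewrite scale0r addr0 => -> h.
  apply/eqP; rewrite eq_le (sip_ge0 HZ Sr) andbT; move: h; rewrite expr0n !mulr0 !mul0r !addr0; lra.
have KL u : admissible Omega a b u -> L2v d u := @admissible_L2 a b u.
have [ubar Ku hu] := tracking_min HW HZ T_L2 Lz gamma_gt0 C0 T_mid T_lip KL
  (@admissible_mid a b) (@admissible_closed a b) (admissible_nonempty ab)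
  (vec_complete (k := d) HL (L2_complete mO)).
have mk w : (forall v, admissible Omega a b v -> tracking (vip d) ipZ T (yd, kd) gamma w <=
    tracking (vip d) ipZ T (yd, kd) gamma v) -> admissible Omega a b w ->
    minimizer (admissible Omega a b) (cost Omega Sy Sk yd kd gamma) w.
  by move=> h Kw; split=> // v Kv; rewrite !cost_tracking//; [exact: h|exact: KL..].
exists ubar; split; first exact: mk.
move=> u [Ku' hu']; apply: (vec_ip_eq0_ae oO (KL _ Ku') (KL _ Ku)).
apply: (tracking_min_uniq HW HZ T_L2 Lz gamma_gt0 T_mid KL (@admissible_mid a b) Ku' Ku) => // v Kv.
by have := hu' v Kv; rewrite !cost_tracking//; exact: KL.
Qed.

End optimal_control.

(** * Recovery of the pressure *)

Section state_pressure.
Context {R : realType} {d : nat}.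
Local Notation pt := 'rV[R]_d.
Local Notation mu := (lebesgue_row R d).
Context (Omega : set pt) (d23 : d = 2%N \/ d = 3%N).
Hypotheses (oO : open Omega) (bO : bounded_set Omega) (cO : connected Omega)
  (nO : Omega !=set0) (lO : lipschitz_boundary Omega).
Let mO := open_measurable_row oO.
Local Notation L2 := (L2 mu Omega).
Local Notation ip := (ip2 mu Omega).
Local Notation cd := (curl_dim d).
Local Notation X := ((pt -> pt) * (pt -> 'rV[R]_cd))%type.
Let HL := L2_semi_ip mu mO.

(** The residual is taken at pairs [(v, 0)], which makes it a form in the velocity alone. A general
    test pair is [(v, 0) + (0, theta)], and the second summand is already covered by the state
    equation since 0 is divergence-free. The sign in [B_form] matches a pressure that represents the
    residual itself. *)
Lemma state_pressure (nu sigma : pt -> R) (beta : pt -> pt) (rho1 rho2 : R) F y k :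
  in_W1p +oo%E Omega nu -> in_Lp +oo%E Omega sigma ->
  (forall i, in_W1p +oo%E Omega (coordf beta i)) -> vec_sub L2 F ->
  is_state Omega nu sigma beta rho1 rho2 F y k ->
  exists2 p, Q_space Omega p &
    (forall v theta, V_space Omega v -> W_space Omega theta ->
       A_form Omega nu sigma beta rho1 rho2 y k v theta + B_form Omega v theta p = L2_inner Omega F v) /\
    (forall phi, Q_space Omega phi -> B_form Omega y k phi = 0).
Proof.
move=> nuW sL bW LF sy; have d0 : (0 < d)%N by case: d23 => ->.
have HV := V_semi_ip oO bO; have HW := vec_semi_ip d HL; have HK := vec_semi_ip cd HL.
have [_ l2 [M M0 hM]] := A_pair_bounded d23 oO bO rho1 rho2 nuW sL bW.
have [Sp hp] := (stateP oO nu sigma beta rho1 rho2 (y, k) LF).1 sy.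
have Wp := V0W_VW Sp.
pose A := A_pair Omega nu sigma beta rho1 rho2.
have AE v t : A_form Omega nu sigma beta rho1 rho2 y k v t = A (y, k) (v, t) by [].
rewrite -/A in l2 hM hp; clearbody A.
have K0 := sub0 (sip_sub HK).
have V0VW v : V_space Omega v -> VW Omega ((v, 0) : X) by move=> Vv; split.
have [C C0 hC] := velocity_le d23 oO bO.
pose l (v : pt -> pt) := A (y, k) (v, 0) - vec_ip ip F v.
have l_lin : lin_on (V_space Omega) l.
  move=> c u v Vu Vv; rewrite /l (ip_linr HW LF c (V_L2 oO Vu) (V_L2 oO Vv)).
  rewrite (_ : (c *: u + v, 0) = c *: ((u, 0) : X) + ((v, 0) : X)); last first.
    by rewrite -[RHS]/(c *: u + v, c *: 0 + 0) scaler0 addr0.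
  by rewrite (l2 _ Wp c _ _ (V0VW _ Vu) (V0VW _ Vv)); ring.
have pe v : VW_ip Omega ((v, 0) : X) (v, 0) = vec_ip (gip Omega) v v.
  by rewrite /VW_ip /pair_ip/= (lin0 (sip_sub HK) (ip_linl HK K0)) addr0.
have l_bound v : V_space Omega v -> l v ^+ 2 <=
    (2 * (M * VW_ip Omega (y, k) (y, k)) + 2 * (vec_ip ip F F * C)) * vec_ip (gip Omega) v v.
  move=> Vv; have h1 := hM _ _ Wp (V0VW _ Vv); rewrite pe in h1.
  have h2 := ip_CS HW LF (V_L2 oO Vv).
  have h3 : vec_ip ip F F * vec_ip ip v v <= vec_ip ip F F * (C * vec_ip (gip Omega) v v).
    by apply: ler_wpM2l; [exact: sip_ge0 HW _ LF|exact: hC].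
  rewrite /l; move: h1 h2 h3; move: (A _ _) (vec_ip ip F v) => s t h1 h2 h3.
  by have := sqr_ge0 (s + t); rewrite sqrrB sqrrD; lra.
have l_zero v : V0_space Omega v -> l v = 0.
  by move=> Vv; rewrite /l hp ?subrr//; split.
have [p [Lp p0] hpr] := pressure d0 oO bO cO nO lO l_lin l_bound l_zero.
exists p; first by split=> //; exact/(in_Lp2P mO).
split=> [v theta Vv /(in_L2P oO) Lt|phi [/(in_Lp2P mO) Lphi _]].
  rewrite (L2_innerE oO LF (V_L2 oO Vv)) /B_form -[\int[mu]_(x in Omega) _]/(ip p (divg Omega v)) (hpr v Vv).
  rewrite AE.
  have V0t : V0W Omega ((0, theta) : X).
    by split; [exact: (sub0 (V0_subspace oO bO))|exact: Lt].
  have e : ((v, theta) : X) = 1 *: ((v, 0) : X) + (0, theta).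
    by rewrite -[RHS]/(1 *: v + 0, 1 *: 0 + theta) scale1r scaler0 addr0 add0r.
  rewrite e (l2 _ Wp 1 _ _ (V0VW _ Vv) (V0W_VW V0t)) (hp _ V0t) mul1r.
  rewrite (lin0 (sip_sub HW) (ip_linr HW LF)) /l; ring.
have z := (V0_div0 oO Sp.1.1).1 Sp.1; have Ld := div_L2 oO Sp.1.1.
rewrite /B_form -[\int[mu]_(x in Omega) _]/(ip phi (divg Omega y)) (sip_sym HL Lphi Ld).
by rewrite (ip0_eq0 HL Ld Lphi z) oppr0.
Qed.

End state_pressure.

Theorem mainTheorem2 (R : realType) (d : nat) (d23 : d = 2%N \/ d = 3%N)
    (Omega : set 'rV[R]_d) (hOmega : polyhedral_lipschitz_domain Omega) :
  exists2 C : R, 0 < C &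
  forall (nu sigma : 'rV[R]_d -> R) (beta f yd : 'rV[R]_d -> 'rV[R]_d)
    (kd : 'rV[R]_d -> 'rV[R]_(curl_dim d)) (a b : 'rV[R]_d)
    (nu0 nu1 sigma_min sigma_max gamma rho1 rho2 : R),
  let mu := lebesgue_row R d in
  let N := Lp_norm +oo%E Omega (fun x => enorm (grad Omega nu x)) in
  0 < nu0 -> 0 < nu1 -> 0 < sigma_min -> 0 < sigma_max -> 0 < gamma ->
  0 < rho1 -> 0 < rho2 ->
  in_W1p +oo%E Omega nu ->
  {ae mu, forall x, Omega x -> nu0 < nu x < nu1} ->
  in_Lp +oo%E Omega sigma ->
  {ae mu, forall x, Omega x -> sigma_min < sigma x < sigma_max} ->
  (forall i, in_W1p +oo%E Omega (coordf beta i)) ->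
  in_L2 Omega f -> in_L2 Omega yd -> in_L2 Omega kd ->
  (forall i, a 0 i < b 0 i) ->
  9 * N ^+ 2 / nu0 <= sigma_min ->
  C * Lp_norm 2%:E Omega (divg Omega beta) <
    Num.min (sigma_min - 9 * N ^+ 2 / nu0) (nu0 / 12) ->
  rho1 = 2 / 3 * nu0 ->
  nu0 / 3 < rho2 ->
  let state (u y : 'rV[R]_d -> 'rV[R]_d) kappa :=
    is_state Omega nu sigma beta rho1 rho2 (fun x => f x + u x) y kappa in
  (* the reduced state equation is uniquely solvable *)
  (forall u, in_L2 Omega u ->
    exists y kappa, state u y kappa /\
      forall y' kappa', state u y' kappa' ->
        ae_eq mu Omega y' y /\ ae_eq mu Omega kappa' kappa)
  /\
  (* (Sy, Sk) is the solution operator *)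
  forall Sy Sk, (forall u, in_L2 Omega u -> state u (Sy u) (Sk u)) ->
  let is_sol :=
    minimizer (admissible Omega a b) (cost Omega Sy Sk yd kd gamma) in
  exists ubar,
    [/\ is_sol ubar,
        forall u, is_sol u -> ae_eq mu Omega u ubar &
        exists2 pbar, Q_space Omega pbar &
          (forall v theta, V_space Omega v -> W_space Omega theta ->
             A_form Omega nu sigma beta rho1 rho2 (Sy ubar) (Sk ubar) v theta
             + B_form Omega v theta pbar
             = L2_inner Omega (fun x => f x + ubar x) v)
          /\
          (forall phi, Q_space Omega phi ->
             B_form Omega (Sy ubar) (Sk ubar) phi = 0)].
Proof.
have [oO [cO nO] bO _ lO] := hOmega.
exists 1 => [|nu sigma beta f yd kd a b nu0 nu1 sigma_min sigma_max gamma rho1 rho2 mu N]; first exact: ltr01.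
move=> nu0_gt0 _ _ _ gamma_gt0 _ _ nuW nu_bd sL sigma_bd bW Lf Lyd Lkd ab _; rewrite mul1r => small rho1E _ state.
have nu_ge : {ae mu, forall x, Omega x -> nu0 <= nu x}.
  by apply: filterS nu_bd => x h Ox; case/andP: (h Ox) => /ltW.
have sigma_ge : {ae mu, forall x, Omega x -> sigma_min <= sigma x}.
  by apply: filterS sigma_bd => x h Ox; case/andP: (h Ox) => /ltW.
have Lf' := (in_L2P oO f).1 Lf; have Lyd' := (in_L2P oO yd).1 Lyd; have Lkd' := (in_L2P oO kd).1 Lkd.
have HW := sip_sub (vec_semi_ip d (L2_semi_ip mu (open_measurable_row oO))).
have Lfu u : in_L2 Omega u -> vec_sub (L2 mu Omega) (f + u).
  by move=> /(in_L2P oO) Lu; exact: subD HW _ _ Lf' Lu.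
split=> [u Lu|Sy Sk solve is_sol].
  have [p sp] := state_exists d23 oO bO rho2 nuW sL bW nu0_gt0 nu_ge sigma_ge small rho1E (Lfu u Lu).
  exists p.1, p.2; split=> // y' k' s'.
  exact: (state_uniq d23 oO bO nuW sL bW nu0_gt0 nu_ge sigma_ge small rho1E (p := (y', k')) (Lfu u Lu) s' sp).
have solve' u : vec_sub (L2 mu Omega) u -> state u (Sy u) (Sk u) by move=> /(in_L2P oO); exact: solve.
have [ubar [hu uniq]] := optimal_control d23 oO bO nuW sL bW nu0_gt0 nu_ge sigma_ge small rho1E
  Lf' Lyd' Lkd' gamma_gt0 solve' ab.
exists ubar; split=> //.
exact: (state_pressure d23 oO bO cO nO lO nuW sL bW (Lfu _ hu.1.1) (solve _ hu.1.1)).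
Qed.
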